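(* Let $G$ be a connected Lie group whose Lie algebra $\mathfrak{g}$ carries an $\mathrm{Ad}$-invariant inner product, let $s>\frac12$, and let $\Omega^s(X,Y)$ denote the curvature operator of the Levi-Civita connection $\nabla^s$ of the Sobolev-$s$ metric on either the free loop group $LG$ or the based loop group $\Omega G$, where $X,Y$ are smooth left invariant vector fields on that loop group. Then: (1) If $s>1$, then, for both free and based loop groups, $\Omega^s(X,Y)$ is a pseudodifferential operator of order at most $-2$ for all $X,Y$. (2) If $\frac12<s<1$, then, for both free and based loop groups, $\Omega^s(X,Y)$ is a pseudodifferential operator of order at most $-2s$ for all $X,Y$. (3) The bounds in (1) and (2) are optimal: in the free case and in the based case, for each $s>1$ there exist a connected Lie group $G$ whose Lie algebra carries an $\mathrm{Ad}$-invariant inner product and smooth left invariant vector fields $X,Y$ on the corresponding loop group ($LG$ in the free case, $\Omega G$ in the based case) for which the order of $\Omega^s(X,Y)$ is exactly $-2$, and for each $s$ with $\frac12<s<1$ there exist a connected Lie group $G$ whose Lie algebra carries an $\mathrm{Ad}$-invariant inner product and smooth left invariant vector fields $X,Y$ on the corresponding loop group ($LG$ in the free case, $\Omega G$ in the based case) for which the order of $\Omega^s(X,Y)$ is exactly $-2s$. (4) If $s=1$, then for based loop groups the order of $\Omega^1(X,Y)$ is $-\infty$ for all $X,Y$. (5) If $s>1$, then, for both free and based loop groups, $\Omega^s(X,Y)$ is a trace class operator for all $X,Y$.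
   Context: Loop groups. $G$ is a connected Lie group with a left invariant, $\mathrm{Ad}$-invariant Riemannian metric $\langle\cdot,\cdot\rangle$, and $s>\frac12$ is a real parameter. $LG=L_sG$ is the group of Sobolev class $H^s$ free loops $S^1\to G$ (with $S^1=[0,2\pi]/(0\sim 2\pi)$), and $\Omega G=\Omega_sG$ is the group of $H^s$ loops based at the identity; the group operation is pointwise multiplication. By left translation, left invariant vector fields on $LG$ are identified with elements of $H^s(S^1,\mathfrak{g})$, and left invariant vector fields on $\Omega G$ with those elements of $H^s(S^1,\mathfrak{g})$ vanishing at $0$ and $2\pi$. Smooth left invariant vector fields are those corresponding to $C^\infty$ maps $S^1\to\mathfrak{g}$ (vanishing at $0$ and $2\pi$ in the based case). The bracket $[X,Y]$ is the pointwise bracket $[X,Y](\theta)=[X(\theta),Y(\theta)]$. Metrics. $\Delta=-\partial_\theta^2\otimes \mathrm{id}_{\mathfrak{g}}$ acts on left invariant vector fields. On $LG$ the metric is the left invariant metric $$\langle X,Y\rangle_s=\frac1{2\pi}\int_0^{2\pi}\langle (1+\Delta)^sX(\theta),Y(\theta)\rangle\,d\theta ,$$ and on $\Omega G$ it is the left invariant metric $$\langle X,Y\rangle_s=\frac1{2\pi}\int_0^{2\pi}\langle \Delta^sX(\theta),Y(\theta)\rangle\,d\theta .$$ The powers $(1+\Delta)^{\pm s}$ and $\Delta^{\pm s}$ are Seeley's complex powers; in the based case $\Delta$ has trivial kernel because loops vanish at the base point, so its complex powers are well defined. They are regarded as pseudodifferential operators of order $\pm 2s$ with total symbols $(1+\xi^2)^{\pm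 s}\,\mathrm{id}$ and $|\xi|^{\pm 2s}\,\mathrm{id}$, respectively. Connection and curvature. Put $A=1+\Delta$ for $LG$ and $A=\Delta$ for $\Omega G$. For left invariant vector fields $X,Y$ the Levi-Civita connection of $\langle\cdot,\cdot\rangle_s$ is given by $$2\nabla^s_XY=[X,Y]-A^{-s}[A^sX,Y]+A^{-s}[X,A^sY].$$ For fixed $X$, $\nabla^s_X$ is viewed as an operator in $Y$, a pseudodifferential operator of order $0$. The curvature operator is $$\Omega^s(X,Y)=\nabla^s_X\nabla^s_Y-\nabla^s_Y\nabla^s_X-\nabla^s_{[X,Y]},$$ a pseudodifferential operator acting on ($\mathfrak{g}$-valued functions representing) left invariant vector fields. Order. The total symbol $\sigma(P)(\theta,\xi)$ of such an operator $P$ is an $\mathrm{End}(\mathfrak{g})$-valued asymptotic sum of terms homogeneous in $\xi$ of decreasing real degrees, and symbols compose by $\sigma(P\circ Q)\sim\sum_{\alpha\ge0}\frac{1}{i^{\alpha}\alpha!}\partial_\xi^\alpha\sigma(P)\,\partial_\theta^\alpha\sigma(Q)$. $P$ has order at most $m$ if all homogeneous terms of degree greater than $m$ vanish; it has order exactly $m$ if in addition the term of degree $m$ is not identically zero; it has order $-\infty$ (is smoothing) if all homogeneous terms vanish. Trace class is meant on the Hilbert space of $H^s$ left invariant vector fields. *)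

(* Defs.v *)
From HB Require Import structures.
From mathcomp Require Import all_boot all_order all_algebra.
From mathcomp Require Import all_classical all_reals all_analysis.
From mathcomp Require Import complex.

Set Implicit Arguments.
Unset Strict Implicit.
Unset Printing Implicit Defensive.
Import Order.TTheory GRing.Theory Num.Theory.
Import numFieldNormedType.Exports.
Local Open Scope classical_set_scope.
Local Open Scope ring_scope.
Local Open Scope complex_scope.

Local Notation cre := (@complex.Re _).
Local Notation cim := (@complex.Im _).
Local Notation normc := (@ComplexField.Normc.normc _).

Section Smooth.
Context {R : realType}.

Fixpoint Ck (k : nat) (V W : normedModType R) (O : set V) (f : V -> W) : Prop :=
  match k with
  | 0 => forall x, O x -> {for x, continuous f}
  | k'.+1 => (forall x, O x -> differentiable f x) /\
             forall v : V, Ck k' O ('D_v f)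
  end.

Definition smooth_on (V W : normedModType R) (O : set V) (f : V -> W) : Prop :=
  forall k, Ck k O f.

End Smooth.

(** [par] is the inverse of the coordinate map [coord] of a chart; only its
    values on [coord @` dom] matter. *)
Record chart (R : realType) (d : nat) (G : topologicalType) := Chart {
  dom : set G;
  coord : G -> 'cV[R]_d;
  par : 'cV[R]_d -> G }.

Definition is_chart (R : realType) (d : nat) (G : topologicalType)
    (c : chart R d G) : Prop :=
  [/\ open (dom c),
      open (coord c @` dom c),
      forall x, dom c x -> par c (coord c x) = x,
      forall x, dom c x -> {for x, continuous (coord c)} &
      forall u, (coord c @` dom c) u -> {for u, continuous (par c)}].

(** Second countability is not listed: it follows from the other axioms when
    the group is connected.  The chart [lg_chart1] identifies the tangent space
    at the identity with R^d. *)
Record lieGroup (R : realType) := LieGroup {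
  lg_sort :> topologicalType;
  lg_dim : nat;
  lg_mul : lg_sort -> lg_sort -> lg_sort;
  lg_inv : lg_sort -> lg_sort;
  lg_one : lg_sort;
  lg_mulA : forall x y z, lg_mul x (lg_mul y z) = lg_mul (lg_mul x y) z;
  lg_mul1 : forall x, lg_mul lg_one x = x;
  lg_mulV : forall x, lg_mul (lg_inv x) x = lg_one;
  lg_hausdorff : hausdorff_space lg_sort;
  lg_atlas : set (chart R lg_dim lg_sort);
  lg_charts : forall c, lg_atlas c -> is_chart c;
  lg_cover : forall x, exists2 c, lg_atlas c & dom c x;
  lg_compat : forall c c', lg_atlas c -> lg_atlas c' ->
    smooth_on (coord c @` (dom c `&` dom c')) (coord c' \o par c);
  lg_mul_cont : continuous (fun z : lg_sort * lg_sort => lg_mul z.1 z.2);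
  lg_inv_cont : continuous lg_inv;
  lg_mul_smooth : forall c1 c2 c3, lg_atlas c1 -> lg_atlas c2 -> lg_atlas c3 ->
    smooth_on
      [set z : 'cV[R]_lg_dim * 'cV[R]_lg_dim |
        [/\ (coord c1 @` dom c1) z.1, (coord c2 @` dom c2) z.2 &
            dom c3 (lg_mul (par c1 z.1) (par c2 z.2))]]
      (fun z => coord c3 (lg_mul (par c1 z.1) (par c2 z.2)));
  lg_inv_smooth : forall c c', lg_atlas c -> lg_atlas c' ->
    smooth_on
      [set u | (coord c @` dom c) u /\ dom c' (lg_inv (par c u))]
      (fun u => coord c' (lg_inv (par c u)));
  lg_chart1 : chart R lg_dim lg_sort;
  lg_chart1_atlas : lg_atlas lg_chart1;
  lg_chart1_one : dom lg_chart1 lg_one }.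

Section LieAlgebra.
Context {R : realType} (G : lieGroup R).

Local Notation phi := (coord (lg_chart1 G)).
Local Notation phiV := (par (lg_chart1 G)).

(** The differential at the identity of x |-> g x g^-1. *)
Definition Ad (g : G) (v : 'cV[R]_(lg_dim G)) : 'cV[R]_(lg_dim G) :=
  'D_v (fun u => phi (lg_mul (lg_mul g (phiV u)) (lg_inv g))) (phi (lg_one G)).

(** [v, w] = (d_e Ad)(v) w. *)
Definition lie_bracket (v w : 'cV[R]_(lg_dim G)) : 'cV[R]_(lg_dim G) :=
  'D_v (fun u => Ad (phiV u) w) (phi (lg_one G)).

Definition inner_product (ip : 'cV[R]_(lg_dim G) -> 'cV[R]_(lg_dim G) -> R) :=
  [/\ forall v w, ip v w = ip w v,
      forall a u v w, ip (a *: u + v) w = a * ip u w + ip v w &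
      forall v, v != 0 -> 0 < ip v v].

Definition Ad_invariant (ip : 'cV[R]_(lg_dim G) -> 'cV[R]_(lg_dim G) -> R) :=
  forall g v w, ip (Ad g v) (Ad g w) = ip v w.

End LieAlgebra.

(** A g-valued (or complexified g-valued) distribution on the circle is
    represented by its sequence of Fourier coefficients. *)
Definition coeffs (R : realType) (d : nat) : Type := int -> 'cV[R[i]]_d.

Section Circle.
Context {R : realType}.

Definition periodic (T : Type) (f : R -> T) : Prop :=
  forall x, f (x + pi *+ 2) = f x.

Definition smooth1 (V : normedModType R) (U : set R) (f : R -> V) : Prop :=
  forall n x, U x -> derivable (derive1n n f) x 1.

Definition csmooth1 (U : set R) (f : R -> R[i]) : Prop :=
  smooth1 U (cre \o f : R -> R^o) /\ smooth1 U (cim \o f : R -> R^o).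

Definition cderive (n : nat) (f : R -> R[i]) (x : R) : R[i] :=
  derive1n n (cre \o f : R -> R^o) x +i*
  derive1n n (cim \o f : R -> R^o) x.

(** Sums over Z are limits of symmetric partial sums. *)
Definition zpartial (f : int -> R) (N : nat) : R :=
  \sum_(k < N.*2.+1) f (k%:Z - N%:Z).

Definition zsum (f : int -> R) : R := limn (zpartial f).

Definition csum (f : int -> R[i]) : R[i] :=
  zsum (fun n => cre (f n)) +i* zsum (fun n => cim (f n)).

Definition vsum (d : nat) (f : int -> 'cV[R[i]]_d) : 'cV[R[i]]_d :=
  \col_i csum (fun n => f n i 0).

Definition expi (x : R) : R[i] := cos x +i* sin x.

Definition fourier (d : nat) (f : R -> 'cV[R]_d) : coeffs R d := fun n =>
  \col_i ((pi *+ 2)^-1 *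
     Rintegral lebesgue_measure `[0, pi *+ 2]
       (fun x => f x i 0 * cos (n%:~R * x)) -i*
   ((pi *+ 2)^-1 *
     Rintegral lebesgue_measure `[0, pi *+ 2]
       (fun x => f x i 0 * sin (n%:~R * x)))).

Definition fseries (d : nat) (Z : coeffs R d) (x : R) : 'cV[R[i]]_d :=
  vsum (fun n => expi (n%:~R * x) *: Z n).

End Circle.

(** [a m] is the term of degree m in xi: its value at (x, xi), xi != 0, is
    |xi|^m a m (0 < xi) x. *)
Definition symbol (R : realType) (d : nat) : Type :=
  R -> bool -> R -> 'M[R[i]]_d.

Variant loops := Free | Based.

Section Sobolev.
Context {R : realType} (k : loops).

(** X is a smooth map on the circle R / (2 pi Z). *)
Definition smooth_field (d : nat) (X : R -> 'cV[R]_d) : Prop :=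
  [/\ periodic X, smooth1 setT X & k = Based -> X 0 = 0].

(** The eigenvalue of A on exp(i n x), raised to the power s.  For based loops
    and s != 0 this vanishes at n = 0, because [0 `^ s = 0]. *)
Definition weight (s : R) (n : int) : R :=
  match k with
  | Free => (1 + (n%:~R) ^+ 2) `^ s
  | Based => ((n%:~R) ^+ 2) `^ s
  end.

Definition Apow (d : nat) (s : R) (Z : coeffs R d) : coeffs R d :=
  fun n => (weight s n)%:C *: Z n.

(** A^-s.  For free loops it is the Fourier multiplier (1 + n^2)^-s.  For based
    loops, A^s maps fields vanishing at 0 injectively to functionals on such
    fields, that is, to distributions modulo multiples of the Dirac mass at 0,
    all of whose Fourier coefficients are equal.  Its inverse sends F to the
    unique W with W(0) = 0 and |n|^2s W_n = F_n - F_0 for all n; equivalently,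
    <W, Z>_s = (1 / 2 pi) \int <F, Z> for all based Z. *)
Definition Ainv (d : nat) (s : R) (F : coeffs R d) : coeffs R d :=
  match k with
  | Free => Apow (- s) F
  | Based => fun n =>
      if n == 0 then - vsum (fun j => (weight (- s) j)%:C *: (F j - F 0))
      else (weight (- s) n)%:C *: (F n - F 0)
  end.

(** The first condition says that Z is the Fourier series of a real field. *)
Definition Hs (d : nat) (s : R) : set (coeffs R d) :=
  [set Z : coeffs R d | [/\ forall n i, Z (- n) i 0 = (Z n i 0)^*,
      forall i, cvgn (zpartial (fun n =>
        (1 + (n%:~R) ^+ 2) `^ s * (normc (Z n i 0)) ^+ 2)) &
      k = Based -> fseries Z 0 = 0]].

Definition remx (d : nat) (v : 'cV[R[i]]_d) : 'cV[R]_d := map_mx cre v.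
Definition immx (d : nat) (v : 'cV[R[i]]_d) : 'cV[R]_d := map_mx cim v.

(** The metric <Z, W>_s = (1 / 2 pi) \int <A^s Z, W> on real fields, by
    Parseval; the n and -n terms are conjugate, so real parts suffice. *)
Definition sip (d : nat) (ip : 'cV[R]_d -> 'cV[R]_d -> R) (s : R)
    (Z W : coeffs R d) : R :=
  zsum (fun n => weight s n *
    (ip (remx (Z n)) (remx (W n)) + ip (immx (Z n)) (immx (W n)))).

Definition snorm (d : nat) (ip : 'cV[R]_d -> 'cV[R]_d -> R) (s : R)
    (Z : coeffs R d) : R := Num.sqrt (sip ip s Z Z).

Definition cbracket (d : nat) (br : 'cV[R]_d -> 'cV[R]_d -> 'cV[R]_d)
    (v w : 'cV[R[i]]_d) : 'cV[R[i]]_d :=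
  \col_i ((br (remx v) (remx w) - br (immx v) (immx w)) i 0 +i*
          (br (remx v) (immx w) + br (immx v) (remx w)) i 0).

(** The pointwise bracket of a smooth field and a distribution, in terms of
    Fourier coefficients. *)
Definition conv_bracket (d : nat) (br : 'cV[R]_d -> 'cV[R]_d -> 'cV[R]_d)
    (Z W : coeffs R d) : coeffs R d :=
  fun n => vsum (fun j => cbracket br (Z (n - j)) (W j)).

Definition nabla (d : nat) (br : 'cV[R]_d -> 'cV[R]_d -> 'cV[R]_d) (s : R)
    (X : R -> 'cV[R]_d) (Z : coeffs R d) : coeffs R d :=
  let x := fourier X in
  fun n => 2^-1 *:
    (conv_bracket br x Z n
     - Ainv s (conv_bracket br (Apow s x) Z) n
     + Ainv s (conv_bracket br x (Apow s Z)) n).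

Definition curvature (d : nat) (br : 'cV[R]_d -> 'cV[R]_d -> 'cV[R]_d) (s : R)
    (X Y : R -> 'cV[R]_d) (Z : coeffs R d) : coeffs R d :=
  fun n => nabla br s X (nabla br s Y Z) n - nabla br s Y (nabla br s X Z) n
           - nabla br s (fun x => br (X x) (Y x)) Z n.

(** Trace class (that is, nuclear) operators on the real Hilbert space of H^s
    fields with the metric <.,.>_s. *)
Definition trace_class (d : nat) (ip : 'cV[R]_d -> 'cV[R]_d -> R) (s : R)
    (P : coeffs R d -> coeffs R d) : Prop :=
  (forall Z, Hs s Z -> Hs s (P Z)) /\
  exists u v : nat -> coeffs R d,
    [/\ forall j, Hs s (u j) /\ Hs s (v j),
        cvgn (series (fun j => snorm ip s (u j) * snorm ip s (v j))) &
        forall Z, Hs s Z ->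
          (fun N => snorm ip s (fun n => P Z n -
             \sum_(j < N) (sip ip s Z (u j))%:C *: v j n)) @ \oo --> (0 : R)].

(** The open set on which symbols live: the circle for free loops, and the
    circle minus the base point, i.e. the open interval (0, 2 pi), for based
    loops. *)
Definition angles : set R :=
  match k with
  | Free => setT
  | Based => [set x | forall n : int, x != n%:~R * (pi *+ 2)]
  end.

Definition symbol_term (d : nat) (a : symbol R d) (m : R) (x : R) (n : int) :
    'M[R[i]]_d :=
  ((`|n|%N%:R `^ m)%:C) *: a m (0 < n) x.

Definition vanishes (d : nat) (t : bool -> R -> 'M[R[i]]_d) : Prop :=
  forall e x, angles x -> t e x = 0.

(** The last condition makes a a formal sum of homogeneous terms whose degrees
    decrease to -oo. *)
Definition is_symbol (d : nat) (a : symbol R d) : Prop :=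
  [/\ forall m e, periodic (a m e),
      forall m e i j, csmooth1 angles (fun x => a m e x i j) &
      forall M, finite_set [set m | M < m /\ ~ vanishes (a m)]].

Definition cutoff (chi : R -> R) : Prop :=
  [/\ periodic chi, smooth1 setT (chi : R -> R^o) &
      forall x : R, ~ angles x -> \forall y \near x, chi y = 0].

(** P is a classical pseudodifferential operator on [angles] with total symbol
    a.  On the circle a pseudodifferential operator is
    f |-> \sum_n exp(i n x) p(x, n) f_n, where p(x, n) is asymptotic, as
    |n| -> oo, to the value at xi = n of its total symbol in the coordinate x.
    This is required of the localizations chi P psi, where psi = 1 near the
    support of chi, whose total symbol is chi a.  No difference estimates in n
    are needed: they follow from the asymptotic expansion. *)
Definition total_symbol (d : nat) (P : coeffs R d -> coeffs R d)
    (a : symbol R d) : Prop :=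
  is_symbol a /\
  forall chi psi : R -> R, cutoff chi -> cutoff psi ->
  (forall x : R, (\forall y \near x, chi y = 0) \/ (\forall y \near x, psi y = 1)) ->
  exists p : int -> R -> 'M[R[i]]_d,
    [/\ forall n, periodic (p n),
        forall n i j, csmooth1 setT (fun x => p n x i j),
        forall f : R -> 'cV[R]_d, periodic f -> smooth1 setT f -> forall x,
          (chi x)%:C *: fseries (P (fourier (fun y => psi y *: f y))) x =
          fseries (fun n => p n x *m fourier f n) x &
        forall (M : R) (alpha : nat) i j, exists C : R, forall (n : int) (x : R),
          n != 0 ->
          normc (cderive alpha (fun y => (p n y - (chi y)%:C *:
            \sum_(m \in [set m | M < m]) symbol_term a m y n) i j) x)
          <= C * `|n|%N%:R `^ M].

Definition order_at_most (d : nat) (P : coeffs R d -> coeffs R d) (m : R) :=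
  exists2 a, total_symbol P a & forall m', m < m' -> vanishes (a m').

Definition order_exactly (d : nat) (P : coeffs R d -> coeffs R d) (m : R) :=
  exists a, [/\ total_symbol P a, forall m', m < m' -> vanishes (a m') &
                ~ vanishes (a m)].

Definition order_minus_infinity (d : nat) (P : coeffs R d -> coeffs R d) :=
  exists2 a, total_symbol P a & forall m, vanishes (a m).

End Sobolev.

Definition loop_curvature (R : realType) (G : lieGroup R) (k : loops) (s : R)
    (X Y : R -> 'cV[R]_(lg_dim G)) :=
  curvature k (@lie_bracket R G) s X Y.
Arguments loop_curvature {R} G k s X Y.

(* Main.v *)
(** In Fourier coefficients [nabla_X] has the kernel [ad (x_(p - q)) * gker p q / 2],
    where [gker p q = 1 + (w q - w (p - q)) / w p] and [w] is the eigenvalue of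
    [A^s].  Since [[X, Y]] acts as a commutator of ad's (only the Leibniz form of
    the Jacobi identity is used), the curvature has the kernel
    [\sum_(a, b) (ad x_a ad y_b - ad y_b ad x_a) h(n; a, b)] from frequency [n] to
    [n + a + b], with a scalar [h] that is independent of the Lie algebra.
    Expanding [w] in powers of [1 / n] gives
    [h = h_0 + |n|^(-2s) h_1 + |n|^(-4s) h_2], where each [h_i] is a power series in
    [1 / n] with coefficients of polynomial growth in [a] and [b].  In [h_0] the
    coefficients of [1] and [1 / n] cancel and that of [1 / n^2] is [- s^2 a b], while
    [h_1] starts with [- (w a + w b - w (a + b)) / 2]; this gives the orders [-2] and
    [-2s].  For based loops and [s = 1] the scalar [h] vanishes for large [n].  The
    bounds are attained for [sin x] times two imaginary units of the quaternions, at
    [x = pi].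

    For based loops the row [n = 0] of the kernel is minus the sum of the other rows.
    Locally, this contributes [exp(- i n x) sigma(n, 0)] to the operator with symbol
    [sigma], which is negligible: the cutoff [psi] on the right vanishes near the base
    point.

    For [s > 1] the same expansion shows that the curvature gains two powers of the
    frequency, so that it is nuclear: it suffices to sum the norms of its values on a
    real orthogonal basis of cosines and sines. *)
Require Import Defs.
From HB Require Import structures.
From mathcomp Require Import all_boot all_order all_algebra.
From mathcomp Require Import all_classical all_reals all_analysis.
From mathcomp Require Import complex.
From mathcomp Require Import ring lra zify.
Set Implicit Arguments.
Unset Strict Implicit.
Unset Printing Implicit Defensive.
Import Order.TTheory GRing.Theory Num.Theory.
Import numFieldNormedType.Exports.
Import ComplexField.Normc.
Local Open Scope classical_set_scope.
Local Open Scope ring_scope.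
Local Open Scope complex_scope.

(** The definitions sum symmetrically over Z, but composing kernels means rearranging sums; all sums
    are therefore turned into absolutely convergent unordered ones. The obstacle is uniformity: the
    shifts [a], [b] are unbounded, so no expansion for large [n] is uniform in them. The estimates
    allow a polynomial loss in [(1 + |a|) (1 + |b|)], which the rapidly decaying Fourier
    coefficients of the fields absorb, and they distinguish two cases: either the shift is small
    against [n] and Taylor's formula applies, or [|n|] is bounded by the shift and a crude
    polynomial bound suffices. Localization brings in a third frequency [c], that of [psi], and
    [h(n + c; a, b)] is expanded in powers of [c / n]. Summed against the Fourier series of [psi] at
    [x], the power [c^al] gives a derivative of [psi] of order [al] at [x]; where [psi] is constant
    near [x], only [al = 0] survives. The condition [1/2 < s] makes the sum of [|n|^(-2s)] converge,
    on which the row [n = 0] of based loops rests. *)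

Local Notation cre := (@complex.Re _).
Local Notation cim := (@complex.Im _).
Local Notation periodic := Defs.periodic.
Local Notation Ic := ('i%C).

(** * Unordered sums *)

Section RealSums.
Context {R : realType}.
Implicit Types I J : choiceType.

Definition esumT I (p : I -> R) : \bar R := (\esum_(i in [set: I]) (p i)%:E)%E.

Definition rsumm I (f : I -> R) : Prop := (esumT (fun i => `|f i|%R) < +oo)%E.

(** The positive part minus the negative part; the value is meaningful under [rsumm], since [fine]
    sends an infinite sum to 0. *)
Definition rsum I (f : I -> R) : R :=
  fine (esumT (fun i => Num.max (f i) 0)) - fine (esumT (fun i => Num.max (- f i) 0)).

Lemma eq_esumT I (p q : I -> R) : p =1 q -> esumT p = esumT q.
Proof. by move=> /funext ->. Qed.

Lemma le_esumT I (p q : I -> R) : (forall i, p i <= q i) -> (esumT p <= esumT q)%E.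
Proof. by move=> h; apply: le_esum => i _; rewrite lee_fin. Qed.

Lemma esumT_ge0 I (p : I -> R) : (forall i, 0 <= p i) -> (0 <= esumT p)%E.
Proof. by move=> h; apply: esum_ge0 => i _; rewrite lee_fin. Qed.

Lemma esumTD I (p q : I -> R) : (forall i, 0 <= p i) -> (forall i, 0 <= q i) ->
  esumT (fun i => p i + q i) = (esumT p + esumT q)%E.
Proof.
move=> hp hq; rewrite /esumT -esumD.
- by apply: eq_esum => i _; rewrite EFinD.
- by move=> i _; rewrite lee_fin.
- by move=> i _; rewrite lee_fin.
Qed.

Lemma rsummE I (p : I -> R) : (forall i, 0 <= p i) -> rsumm p -> (esumT p \is a fin_num).
Proof.
move=> h; rewrite /rsumm ge0_fin_numE ?esumT_ge0 //.
by congr (_ < _)%E; apply: eq_esumT => i; rewrite ger0_norm.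
Qed.

Lemma rsumm_le I (f g : I -> R) : rsumm g -> (forall i, `|f i| <= `|g i|) -> rsumm f.
Proof. by move=> hg h; apply: le_lt_trans hg; apply: le_esumT. Qed.

Lemma rsumm_lew I (f g : I -> R) : rsumm g -> (forall i, `|f i| <= g i) -> rsumm f.
Proof. by move=> hg h; apply: (rsumm_le hg) => i; rewrite (le_trans (h i)) ?ler_norm. Qed.

Lemma rsummD I (f g : I -> R) : rsumm f -> rsumm g -> rsumm (fun i => f i + g i).
Proof.
move=> hf hg; have := lte_add_pinfty hf hg; rewrite -esumTD //.
by apply: le_lt_trans; apply: le_esumT => i; rewrite ler_normD.
Qed.

Lemma rsummN I (f : I -> R) : rsumm f -> rsumm (fun i => - f i).
Proof. by move=> hf; apply: (rsumm_le hf) => i; rewrite normrN. Qed.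

(** The inequality [H], applied to [c] and then to its inverse, gives both directions. *)
Lemma esumTZ I (c : R) (p : I -> R) : 0 <= c -> (forall i, 0 <= p i) ->
  (esumT (fun i => (c * p i)%R) = c%:E * esumT p)%E.
Proof.
rewrite le_eqVlt => /predU1P[<-|c0] hp.
  rewrite mul0e /esumT esum1 // => i _; by rewrite mul0r.
have H d (q : I -> R) : 0 < d -> (forall i, 0 <= q i) ->
    (esumT (fun i => (d * q i)%R) <= d%:E * esumT q)%E.
  move=> d0 hq; apply: ge_ereal_sup => _ [A [fA _] <-].
  have -> : (\sum_(i \in A) (d * q i)%R%:E = d%:E * \sum_(i \in A) (q i)%:E)%E.
    rewrite !fsbig_finite //= !sumEFin -EFinM; congr (_%:E).
    by rewrite mulr_sumr.
  rewrite lee_pmul2l // ?lte_fin //; apply: esum_ge; by exists A.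
apply/eqP; rewrite eq_le H //=.
have := @H c^-1 (fun i => c * p i).
rewrite invr_gt0 => /(_ c0) /(_ (fun i => mulr_ge0 (ltW c0) (hp i))) h.
rewrite -[leRHS]mul1e -(divff (lt0r_neq0 c0)) EFinM -muleA lee_pmul2l // ?lte_fin //.
apply: le_trans h; apply: le_esumT => i; by rewrite mulKf ?lt0r_neq0.
Qed.

Lemma rsummZ I (c : R) (f : I -> R) : rsumm f -> rsumm (fun i => c * f i).
Proof.
move=> hf; rewrite /rsumm.
have -> : esumT (fun i => `|c * f i|) = (`|c|%R%:E * esumT (fun i => `|f i|%R))%E.
  by rewrite -esumTZ //; apply: eq_esumT => i; rewrite normrM.
have h : esumT (fun i => `|f i|) \is a fin_num by rewrite ge0_fin_numE ?esumT_ge0.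
by rewrite -(fineK h) -EFinM ltry.
Qed.

(** Any splitting of [f] into a difference of summable nonnegative families gives the same value;
    linearity of [rsum] is read off from suitable splittings. *)
Lemma rsumE I (f p q : I -> R) : (forall i, 0 <= p i) -> (forall i, 0 <= q i) ->
  rsumm p -> rsumm q -> (forall i, f i = p i - q i) ->
  rsum f = fine (esumT p) - fine (esumT q).
Proof.
move=> p0 q0 sp sq fE.
have sf : rsumm f.
  have -> : f = (fun i => p i + - q i) by apply/funext => i; rewrite fE.
  by apply: rsummD => //; apply: rsummN.
set u := fun i => Num.max (f i) 0; set v := fun i => Num.max (- f i) 0.
have u0 i : 0 <= u i by rewrite /u le_max lexx orbT.
have v0 i : 0 <= v i by rewrite /v le_max lexx orbT.
have su : rsumm u.
  apply: (rsumm_le sf) => i; rewrite ger0_norm ?u0 //.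
  by rewrite /u ge_max ler_norm normr_ge0.
have sv : rsumm v.
  apply: (rsumm_le sf) => i; rewrite ger0_norm ?v0 //.
  by rewrite /v ge_max normr_ge0 -normrN ler_norm.
have e i : u i + q i = v i + p i.
  have : f i = u i - v i by rewrite /u /v /Num.max; do 2 case: ifP; lra.
  rewrite fE => h; lra.
have : (esumT u + esumT q = esumT v + esumT p)%E.
  by rewrite -!esumTD //; apply: eq_esumT => i; rewrite e.
rewrite /rsum -/u -/v.
move: (rsummE u0 su) (rsummE v0 sv) (rsummE p0 sp) (rsummE q0 sq).
case: (esumT u) => // a _; case: (esumT v) => // b _; case: (esumT p) => // c _.
case: (esumT q) => // d _ [] /=; lra.
Qed.

Lemma rsum_ge0E I (p : I -> R) : (forall i, 0 <= p i) -> rsumm p ->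
  (rsum p)%:E = esumT p.
Proof.
move=> p0 sp; rewrite (@rsumE _ p p (fun=> 0)) //.
- rewrite {2}/esumT esum1 // subr0 fineK //; exact: rsummE.
- by rewrite /rsumm /esumT esum1 // => i _; rewrite normr0.
- by move=> i; rewrite subr0.
Qed.

Definition rpos I (f : I -> R) := (fun i => Num.max (f i) 0).
Lemma rpos_ge0 I (f : I -> R) i : 0 <= rpos f i.
Proof. by rewrite /rpos le_max lexx orbT. Qed.
Lemma rposB I (f : I -> R) i : f i = rpos f i - rpos (fun j => - f j) i.
Proof. by rewrite /rpos /Num.max; do 2 case: ifP; lra. Qed.
Lemma rpos_le I (f : I -> R) i : rpos f i <= `|f i|.
Proof. by rewrite /rpos ge_max ler_norm normr_ge0. Qed.
Lemma rposm I (f : I -> R) : rsumm f -> rsumm (rpos f).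
Proof. by move=> sf; apply: (rsumm_le sf) => i; rewrite ger0_norm ?rpos_ge0 ?rpos_le. Qed.

Lemma rsum_ge0 I (p : I -> R) : (forall i, 0 <= p i) -> 0 <= rsum p.
Proof.
move=> p0; rewrite /rsum.
have -> : esumT (fun i => Num.max (- p i) 0) = 0%E.
  by apply: esum1 => i _; congr (_%:E); apply/max_idPr; rewrite oppr_le0.
rewrite subr0; apply: fine_ge0; apply: esumT_ge0 => i; by rewrite le_max lexx orbT.
Qed.

Lemma rsumD I (f g : I -> R) : rsumm f -> rsumm g ->
  rsum (fun i => f i + g i) = rsum f + rsum g.
Proof.
move=> sf sg.
rewrite (@rsumE _ _ (fun i => rpos f i + rpos g i)
  (fun i => rpos (fun j => - f j) i + rpos (fun j => - g j) i)).
- rewrite !esumTD; do ?exact: rpos_ge0.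
  have F1 := rsummE (@rpos_ge0 _ f) (rposm sf).
  have F2 := rsummE (@rpos_ge0 _ _) (rposm (rsummN sf)).
  have F3 := rsummE (@rpos_ge0 _ g) (rposm sg).
  have F4 := rsummE (@rpos_ge0 _ _) (rposm (rsummN sg)).
  rewrite !fineD // /rsum -/(rpos f) -/(rpos g) -/(rpos (fun i => - f i)) -/(rpos (fun i => - g i)); lra.
- by move=> i; rewrite addr_ge0 ?rpos_ge0.
- by move=> i; rewrite addr_ge0 ?rpos_ge0.
- by apply: rsummD; exact: rposm.
- by apply: rsummD; apply: rposm; exact: rsummN.
- by move=> i; rewrite {1}(rposB f) {1}(rposB g); lra.
Qed.

Lemma rsumN I (f : I -> R) : rsum (fun i => - f i) = - rsum f.
Proof.
rewrite /rsum opprB; congr (_ - fine _).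
by apply: eq_esumT => i; rewrite opprK.
Qed.

Lemma eq_rsum I (f g : I -> R) : f =1 g -> rsum f = rsum g.
Proof. by move=> /funext ->. Qed.

Lemma rsumZ I (c : R) (f : I -> R) : rsumm f -> rsum (fun i => c * f i) = c * rsum f.
Proof.
have H d : 0 <= d -> rsumm f -> rsum (fun i => d * f i) = d * rsum f.
  move=> d0 sf.
  rewrite (@rsumE _ _ (fun i => d * rpos f i) (fun i => d * rpos (fun j => - f j) i)).
  - rewrite !esumTZ //; do ?exact: rpos_ge0.
    have F1 := rsummE (@rpos_ge0 _ f) (rposm sf).
    have F2 := rsummE (@rpos_ge0 _ _) (rposm (rsummN sf)).
    by rewrite !fineM //= -mulrBr.
  - by move=> i; rewrite mulr_ge0 ?rpos_ge0.
  - by move=> i; rewrite mulr_ge0 ?rpos_ge0.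
  - by apply: rsummZ; exact: rposm.
  - by apply: rsummZ; apply: rposm; exact: rsummN.
  - by move=> i; rewrite {1}(rposB f) mulrBr.
have [c0|c0] := leP 0 c; first exact: H.
move=> sf; rewrite -[c]opprK mulNr -H ?oppr_ge0 1?ltW //.
by rewrite -rsumN; apply: eq_rsum => i; rewrite mulNr.
Qed.

Lemma le_rsum I (f g : I -> R) : rsumm f -> rsumm g -> (forall i, f i <= g i) ->
  rsum f <= rsum g.
Proof.
move=> sf sg h; rewrite -subr_ge0 -rsumN -rsumD //; last exact: rsummN.
by apply: rsum_ge0 => i; rewrite subr_ge0.
Qed.

Lemma rsumm_norm I (f : I -> R) : rsumm (fun i => `|f i|) <-> rsumm f.
Proof.
by rewrite /rsumm /esumT; split; apply: le_lt_trans; apply: le_esumT => i; rewrite normr_id.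
Qed.

Lemma norm_rsum_le I (f g : I -> R) : rsumm g -> (forall i, `|f i| <= g i) ->
  `|rsum f| <= rsum g.
Proof.
move=> sg h; have sf := rsumm_lew sg h.
rewrite ler_norml -rsumN !le_rsum //; do ?exact: rsummN.
  by move=> i; have := h i; rewrite ler_norml => /andP[].
by move=> i; have := h i; rewrite ler_norml => /andP[].
Qed.

Lemma rsum_set1 I (f : I -> R) (i0 : I) : (forall i, i != i0 -> f i = 0) ->
  rsumm f /\ rsum f = f i0.
Proof.
move=> h.
have H (p : I -> R) : (forall i, 0 <= p i) -> (forall i, i != i0 -> p i = 0) -> esumT p = (p i0)%:E.
  move=> p0 hp; rewrite -(@esum_set1 _ _ i0 (fun i => (p i)%:E)) ?lee_fin //.
  rewrite [RHS]esum_mkcond; apply: eq_esum => i _.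
  have [e|e] := boolP (i \in [set i0]) => //.
  by rewrite hp //; apply: contraNneq e => ->; rewrite inE.
split; first by rewrite /rsumm H ?ltry // => i /h ->; rewrite normr0.
rewrite /rsum -/(rpos f) -/(rpos (fun i => - f i)) !H /=; first by rewrite -rposB.
- exact: rpos_ge0.
- by move=> i /h; rewrite /rpos => ->; rewrite oppr0 maxxx.
- exact: rpos_ge0.
- by move=> i /h; rewrite /rpos => ->; rewrite maxxx.
Qed.

Lemma esumT_prod I J (p : I * J -> R) : (forall z, 0 <= p z) ->
  (\esum_(i in [set: I]) esumT (fun j => p (i, j)) = esumT p)%E.
Proof.
move=> p0; rewrite /esumT (@esum_esum _ _ _ _ _ (fun i j => (p (i, j))%:E)).
  have -> : [set: I] `*`` (fun=> [set: J]) = [set: I * J] by apply/seteqP; split.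
  by apply: eq_esum => -[].
by move=> i j _ _; rewrite lee_fin.
Qed.

Lemma rsumm_section I J (f : I * J -> R) : rsumm f -> forall i, rsumm (fun j => f (i, j)).
Proof.
move=> sf i; apply: le_lt_trans sf; rewrite -esumT_prod //.
rewrite -[leLHS](@esum_set1 _ _ i (fun i => esumT (fun j => `|f (i, j)|))); last exact: esumT_ge0.
rewrite esum_mkcond; apply: le_esum => k _; case: ifP => // _; exact: esumT_ge0.
Qed.

Lemma rsum_prod_ge0 I J (p : I * J -> R) : (forall z, 0 <= p z) -> rsumm p ->
  rsumm (fun i => rsum (fun j => p (i, j))) /\
  rsum (fun i => rsum (fun j => p (i, j))) = rsum p.
Proof.
move=> p0 sp.
have e : esumT (fun i => rsum (fun j => p (i, j))) = esumT p.
  rewrite -esumT_prod //; apply: eq_esum => i _; rewrite rsum_ge0E //.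
  exact: rsumm_section.
have q0 i : 0 <= rsum (fun j => p (i, j)) by apply: rsum_ge0.
have h : rsumm (fun i => rsum (fun j => p (i, j))).
  rewrite /rsumm; under [X in esumT X]eq_fun do rewrite ger0_norm //.
  by rewrite e -rsum_ge0E // ltry.
by split => //; apply: EFin_inj; rewrite !rsum_ge0E.
Qed.

(** Fubini, from Tonelli's theorem for the positive and the negative part. *)
Lemma rsum_prod I J (f : I * J -> R) : rsumm f ->
  rsumm (fun i => rsum (fun j => f (i, j))) /\
  rsum (fun i => rsum (fun j => f (i, j))) = rsum f.
Proof.
move=> sf.
have s1 := rposm sf; have s2 := rposm (rsummN sf).
have [a1 b1] := rsum_prod_ge0 (@rpos_ge0 _ f) s1.
have [a2 b2] := rsum_prod_ge0 (@rpos_ge0 _ _) s2.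
have e (i : I) : rsum (fun j => f (i, j)) =
   rsum (fun j => rpos f (i, j)) + - rsum (fun j => rpos (fun z => - f z) (i, j)).
  rewrite -rsumN -rsumD; last 2 first.
  - exact: rsumm_section.
  - by apply: rsummN; exact: (rsumm_section s2).
  by apply: eq_rsum => j; rewrite [LHS]rposB.
under eq_fun do rewrite e.
split; first by apply: rsummD => //; exact: rsummN.
rewrite rsumD //; last exact: rsummN.
rewrite rsumN b1 b2 -rsumN -rsumD //; last exact: rsummN.
by apply: eq_rsum => z; rewrite [RHS]rposB.
Qed.

Lemma rsum_reindex I J (e : I -> J) (f : J -> R) : bijective e ->
  (rsumm (fun i => f (e i)) <-> rsumm f) /\ rsum (fun i => f (e i)) = rsum f.
Proof.
move=> be; have H (p : J -> R) : esumT (fun i => p (e i)) = esumT p.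
  rewrite /esumT [RHS](@reindex_esum _ _ _ [set: I] _ e) //.
  split => //; first by move=> x y _ _; apply: bij_inj.
  by move=> y _; case: be => g _ eg; exists (g y).
by rewrite /rsumm /rsum !(H (fun j => `|f j|)) (H (fun j => Num.max (f j) 0)) (H (fun j => Num.max (- f j) 0)).
Qed.

Lemma rsumm0 I : rsumm (fun _ : I => 0).
Proof. by rewrite /rsumm /esumT esum1 ?ltry // => i _; rewrite normr0. Qed.

Lemma rsum0 I : rsum (fun _ : I => 0) = 0.
Proof. by rewrite /rsum /esumT !esum1 ?subrr // => i _; rewrite ?oppr0 maxxx. Qed.

Lemma rsumm_prodM I J (p : I -> R) (q : J -> R) : rsumm p -> rsumm q ->
  rsumm (fun z : I * J => p z.1 * q z.2).
Proof.
move=> sp sq; rewrite /rsumm -esumT_prod //=.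
have -> : (\esum_(i in [set: I]) esumT (fun j => `|p i * q j|%R))%E =
   esumT (fun i => rsum (fun j => `|q j|) * `|p i|).
  apply: eq_esum => i _; rewrite mulrC EFinM rsum_ge0E //; last exact/rsumm_norm.
  by rewrite -esumTZ //; apply: eq_esumT => j; rewrite normrM.
have /(rsummZ (rsum (fun j => `|q j|))) := (rsumm_norm p).2 sp.
rewrite /rsumm; congr (_ < _)%E; apply: eq_esumT => i.
by rewrite ger0_norm // mulr_ge0 // rsum_ge0.
Qed.

Lemma sum_seq_le I (p : I -> R) (s : seq I) : (forall i, 0 <= p i) -> uniq s ->
  ((\sum_(i <- s) p i)%:E <= esumT p)%E.
Proof.
move=> p0 us; apply: esum_ge; exists [set` s]; first by split => //; exact: finite_seq.
by rewrite -fsbig_seq // sumEFin.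
Qed.

Lemma esumT_le I (p : I -> R) (M : R) :
  (forall s : seq I, uniq s -> \sum_(i <- s) p i <= M) -> (esumT p <= M%:E)%E.
Proof.
move=> h; apply: ge_ereal_sup => _ [A [fA _] <-].
by rewrite fsbig_finite //= sumEFin lee_fin; apply: h.
Qed.

Lemma rsum_bounded I (p : I -> R) (M : R) : (forall i, 0 <= p i) ->
  (forall s : seq I, uniq s -> \sum_(i <- s) p i <= M) -> rsumm p /\ rsum p <= M.
Proof.
move=> p0 h; have H := esumT_le h.
have sp : rsumm p.
  rewrite /rsumm; apply: le_lt_trans (ltry M); apply: le_trans H.
  by apply: le_esumT => i; rewrite ger0_norm.
by split => //; rewrite -lee_fin rsum_ge0E.
Qed.

Lemma sum_seq_rsum_le I (p : I -> R) (s : seq I) : (forall i, 0 <= p i) -> rsumm p -> uniq s ->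
  \sum_(i <- s) p i <= rsum p.
Proof. by move=> p0 sp us; rewrite -lee_fin rsum_ge0E // sum_seq_le. Qed.

End RealSums.
Global Opaque esumT rsumm rsum.

(** * Absolutely convergent sums of complex numbers *)

Section ComplexNorm.
Context {R : realType}.
Implicit Types x y : R[i].

Lemma normcE x : `|x| = (normc x)%:C. Proof. by case: x. Qed.

Lemma normc_ge0 x : 0 <= normc x.
Proof. by case: x => a b; rewrite sqrtr_ge0. Qed.

Lemma normcD x y : normc (x + y) <= normc x + normc y.
Proof. by rewrite -lecR rmorphD /= -!normcE ler_normD. Qed.

Lemma normcN x : normc (- x) = normc x.
Proof. by apply: complexI; rewrite -!normcE normrN. Qed.

Lemma normcB x y : normc (x - y) <= normc x + normc y.
Proof. by rewrite -(normcN y) normcD. Qed.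

Lemma normc_real (a : R) : normc a%:C = `|a|.
Proof. by rewrite /= expr0n addr0 sqrtr_sqr. Qed.

Lemma normc_re x : `|cre x| <= normc x.
Proof.
case: x => a b /=; rewrite -[leLHS]sqrtr_sqr ler_sqrt ?addr_ge0 ?sqr_ge0 //.
by rewrite lerDl sqr_ge0.
Qed.

Lemma normc_im x : `|cim x| <= normc x.
Proof.
case: x => a b /=; rewrite -[leLHS]sqrtr_sqr ler_sqrt ?addr_ge0 ?sqr_ge0 //.
by rewrite lerDr sqr_ge0.
Qed.

Lemma normc_le x : normc x <= `|cre x| + `|cim x|.
Proof.
have -> : x = (cre x)%:C + 'i * (cim x)%:C by case: x => a b; rewrite -complexE.
apply: le_trans (normcD _ _) _; rewrite normcM !normc_real /=.
rewrite !(mul0r, mul1r, mulr0, addr0, add0r, subr0, expr0n, expr1n) /=.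
by rewrite sqrtr1 mul1r.
Qed.

Lemma normcX x n : normc (x ^+ n) = normc x ^+ n.
Proof. by elim: n => [|n IH]; rewrite ?expr0 ?normc1 // !exprS normcM IH. Qed.

Lemma normc_sum (I : Type) (r : seq I) (P : pred I) (f : I -> R[i]) :
  normc (\sum_(i <- r | P i) f i) <= \sum_(i <- r | P i) normc (f i).
Proof.
elim/big_rec2: _ => [|i a b _ h]; first by rewrite normc0.
by apply: le_trans (normcD _ _) _; rewrite lerD2l.
Qed.

Lemma creD x y : cre (x + y) = cre x + cre y. Proof. by case: x; case: y. Qed.
Lemma cimD x y : cim (x + y) = cim x + cim y. Proof. by case: x; case: y. Qed.
Lemma creN x : cre (- x) = - cre x. Proof. by case: x. Qed.
Lemma cimN x : cim (- x) = - cim x. Proof. by case: x. Qed.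
Lemma creM x y : cre (x * y) = cre x * cre y - cim x * cim y.
Proof. by case: x; case: y. Qed.
Lemma cimM x y : cim (x * y) = cre x * cim y + cim x * cre y.
Proof. by case: x; case: y. Qed.
Lemma complex_ext x y : cre x = cre y -> cim x = cim y -> x = y.
Proof. by case: x; case: y => a b c d /= -> ->. Qed.

End ComplexNorm.

Section ComplexSums.
Context {R : realType}.
Implicit Types I J : choiceType.

Definition summ I (f : I -> R[i]) : Prop := rsumm (fun i => normc (f i)).

Definition tsum I (f : I -> R[i]) : R[i] :=
  rsum (fun i => cre (f i)) +i* rsum (fun i => cim (f i)).

Lemma summ_le I (f : I -> R[i]) (g : I -> R) :
  rsumm g -> (forall i, normc (f i) <= g i) -> summ f.
Proof. by move=> sg h; apply: (rsumm_lew sg) => i; rewrite ger0_norm ?normc_ge0. Qed.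

Lemma summ_re I (f : I -> R[i]) : summ f -> rsumm (fun i => cre (f i)).
Proof. by move=> sf; apply: (rsumm_lew sf) => i; exact: normc_re. Qed.

Lemma summ_im I (f : I -> R[i]) : summ f -> rsumm (fun i => cim (f i)).
Proof. by move=> sf; apply: (rsumm_lew sf) => i; exact: normc_im. Qed.

Lemma summ_reim I (f : I -> R[i]) :
  rsumm (fun i => cre (f i)) -> rsumm (fun i => cim (f i)) -> summ f.
Proof.
move=> /(rsumm_norm _).2 h1 /(rsumm_norm _).2 h2.
apply: (@summ_le _ f _ (rsummD h1 h2)) => i; exact: normc_le.
Qed.

Lemma eq_tsum I (f g : I -> R[i]) : f =1 g -> tsum f = tsum g.
Proof. by move=> /funext ->. Qed.

Lemma eq_summ I (f g : I -> R[i]) : f =1 g -> summ f -> summ g.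
Proof. by move=> /funext ->. Qed.

Lemma summD I (f g : I -> R[i]) : summ f -> summ g -> summ (fun i => f i + g i).
Proof. by move=> sf sg; apply: (summ_le (rsummD sf sg)) => i; exact: normcD. Qed.

Lemma summN I (f : I -> R[i]) : summ f -> summ (fun i => - f i).
Proof. by move=> sf; apply: (summ_le sf) => i; rewrite normcN. Qed.

Lemma summB I (f g : I -> R[i]) : summ f -> summ g -> summ (fun i => f i - g i).
Proof. by move=> sf sg; apply: summD => //; exact: summN. Qed.

Lemma summZ I (c : R[i]) (f : I -> R[i]) : summ f -> summ (fun i => c * f i).
Proof.
by move=> sf; apply: (summ_le (rsummZ (normc c) sf)) => i; rewrite normcM.
Qed.

Lemma tsumD I (f g : I -> R[i]) : summ f -> summ g ->
  tsum (fun i => f i + g i) = tsum f + tsum g.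
Proof.
move=> sf sg.
have a1 := summ_re sf; have a2 := summ_im sf; have b1 := summ_re sg; have b2 := summ_im sg.
apply: complex_ext; rewrite ?creD ?cimD /= -rsumD //; apply: eq_rsum => i;
  by rewrite ?creD ?cimD.
Qed.

Lemma tsumN I (f : I -> R[i]) : tsum (fun i => - f i) = - tsum f.
Proof.
apply: complex_ext; rewrite ?creN ?cimN /= -rsumN; apply: eq_rsum => i;
  by rewrite ?creN ?cimN.
Qed.

Lemma tsumB I (f g : I -> R[i]) : summ f -> summ g ->
  tsum (fun i => f i - g i) = tsum f - tsum g.
Proof. by move=> sf sg; rewrite -tsumN -tsumD //; exact: summN. Qed.

Lemma tsumZ I (c : R[i]) (f : I -> R[i]) : summ f ->
  tsum (fun i => c * f i) = c * tsum f.
Proof.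
move=> sf; have a := summ_re sf; have b := summ_im sf.
apply: complex_ext; rewrite ?creM ?cimM /=.
  rewrite -(rsumZ (cre c) a) -(rsumZ (cim c) b) -rsumN.
  rewrite -(rsumD (rsummZ (cre c) a) (rsummN (rsummZ (cim c) b))).
  by apply: eq_rsum => i; rewrite creM.
rewrite -(rsumZ (cre c) b) -(rsumZ (cim c) a).
rewrite -(rsumD (rsummZ (cre c) b) (rsummZ (cim c) a)).
by apply: eq_rsum => i; rewrite cimM.
Qed.

Lemma tsumZr I (c : R[i]) (f : I -> R[i]) : summ f ->
  tsum (fun i => f i * c) = tsum f * c.
Proof. by move=> sf; rewrite mulrC -tsumZ //; apply: eq_tsum => i; rewrite mulrC. Qed.

Lemma summZr I (c : R[i]) (f : I -> R[i]) : summ f -> summ (fun i => f i * c).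
Proof. by move=> sf; apply: eq_summ (summZ c sf) => i; rewrite mulrC. Qed.

Lemma summ0 I : summ (fun _ : I => 0).
Proof.
rewrite /summ; under [X in rsumm X]eq_fun do rewrite normc0; exact: rsumm0.
Qed.

Lemma tsum0 I : tsum (fun _ : I => 0) = 0.
Proof. by apply: complex_ext; rewrite /= rsum0. Qed.

Lemma summ_sum I (T : Type) (r : seq T) (P : pred T) (f : T -> I -> R[i]) :
  (forall t, summ (f t)) -> summ (fun i => \sum_(t <- r | P t) f t i).
Proof.
move=> sf; elim: r => [|t r IH].
  by apply: eq_summ (@summ0 I) => i; rewrite big_nil.
have [Pt|nPt] := boolP (P t).
  by apply: eq_summ (summD (sf t) IH) => i; rewrite big_cons Pt.
by apply: eq_summ IH => i; rewrite big_cons (negPf nPt).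
Qed.

Lemma tsum_sum I (T : Type) (r : seq T) (P : pred T) (f : T -> I -> R[i]) :
  (forall t, summ (f t)) ->
  tsum (fun i => \sum_(t <- r | P t) f t i) = \sum_(t <- r | P t) tsum (f t).
Proof.
move=> sf; elim: r => [|t r IH].
  by rewrite big_nil -[RHS](tsum0 I); apply: eq_tsum => i; rewrite big_nil.
rewrite big_cons -IH; case: ifPn => Pt.
  rewrite -tsumD //; last exact: summ_sum.
  by apply: eq_tsum => i; rewrite big_cons Pt.
by apply: eq_tsum => i; rewrite big_cons (negPf Pt).
Qed.

(** The factor 2 comes from bounding the real and the imaginary part separately; only the order of
    magnitude matters later. *)
Lemma normc_tsum_le I (f : I -> R[i]) (g : I -> R) :
  rsumm g -> (forall i, normc (f i) <= g i) -> normc (tsum f) <= 2 * rsum g.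
Proof.
move=> sg h; apply: le_trans (normc_le _) _; rewrite mulr2n mulrDl mul1r /=.
by apply: lerD; apply: norm_rsum_le => // i; apply: le_trans (h i);
  [exact: normc_re|exact: normc_im].
Qed.

Lemma summ_section I J (f : I * J -> R[i]) : summ f -> forall i, summ (fun j => f (i, j)).
Proof. by move=> sf i; exact: (rsumm_section sf). Qed.

Lemma tsum_prod I J (f : I * J -> R[i]) : summ f ->
  summ (fun i => tsum (fun j => f (i, j))) /\
  tsum (fun i => tsum (fun j => f (i, j))) = tsum f.
Proof.
move=> sf; have [a b] := rsum_prod (summ_re sf); have [c d] := rsum_prod (summ_im sf).
split; first exact: summ_reim.
by apply: complex_ext.
Qed.

Lemma tsum_reindex I J (e : I -> J) (f : J -> R[i]) : bijective e ->
  (summ (fun i => f (e i)) <-> summ f) /\ tsum (fun i => f (e i)) = tsum f.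
Proof.
move=> be; split; first exact: (rsum_reindex (fun j => normc (f j)) be).1.
apply: complex_ext; first exact: (rsum_reindex (fun j => cre (f j)) be).2.
exact: (rsum_reindex (fun j => cim (f j)) be).2.
Qed.

Lemma summ_reindex I J (e : I -> J) (f : J -> R[i]) : bijective e ->
  summ f -> summ (fun i => f (e i)).
Proof. by move=> be; have [[]] := tsum_reindex f be. Qed.

Lemma tsum_swap I J (f : I -> J -> R[i]) : summ (fun z : I * J => f z.1 z.2) ->
  tsum (fun i => tsum (f i)) = tsum (fun j => tsum (fun i => f i j)).
Proof.
move=> sf; rewrite (tsum_prod sf).2.
have be : bijective (fun z : J * I => (z.2, z.1)) by exists (fun z => (z.2, z.1)) => -[].
have [[_ h1] h2] := tsum_reindex (fun z : I * J => f z.1 z.2) be.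
by rewrite -h2 -(tsum_prod (h1 sf)).2.
Qed.

Lemma tsum_set1 I (f : I -> R[i]) (i0 : I) : (forall i, i != i0 -> f i = 0) ->
  summ f /\ tsum f = f i0.
Proof.
move=> h.
have [a1 b1] := @rsum_set1 _ _ (fun i => cre (f i)) i0 (fun i hi => congr1 cre (h i hi)).
have [a2 b2] := @rsum_set1 _ _ (fun i => cim (f i)) i0 (fun i hi => congr1 cim (h i hi)).
split; first exact: summ_reim.
by apply: complex_ext.
Qed.

Lemma cre_tsum I (f : I -> R[i]) : cre (tsum f) = rsum (fun i => cre (f i)).
Proof. by []. Qed.

Lemma cim_tsum I (f : I -> R[i]) : cim (tsum f) = rsum (fun i => cim (f i)).
Proof. by []. Qed.

End ComplexSums.
Global Opaque summ tsum.

(** * Sums over the integers *)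

Section IntSums.
Context {R : realType}.

Definition zseq (N : nat) : seq int := [seq (k%:Z - N%:Z) | k <- iota 0 N.*2.+1].

Lemma zpartialE (f : int -> R) N : zpartial f N = \sum_(i <- zseq N) f i.
Proof. by rewrite /zpartial /zseq big_map -(big_mkord xpredT (fun k => f (k%:Z - N%:Z))) /index_iota subn0. Qed.

Lemma zseq_uniq N : uniq (zseq N).
Proof. by rewrite map_inj_uniq ?iota_uniq // => i j; lia. Qed.

Lemma mem_zseq N i : (i \in zseq N) = (`|i|%N <= N)%N.
Proof.
apply/mapP/idP => [[k]|h]; first by rewrite mem_iota => ? ->; lia.
exists (absz (i + N%:Z)); [rewrite mem_iota; lia|lia].
Qed.

Lemma zpartial_le (p : int -> R) N : (forall i, 0 <= p i) -> rsumm p ->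
  zpartial p N <= rsum p.
Proof.
move=> p0 sp; rewrite zpartialE.
by apply: sum_seq_rsum_le => //; exact: zseq_uniq.
Qed.

Lemma sum_seq_zpartial (p : int -> R) (s : seq int) : (forall i, 0 <= p i) -> uniq s ->
  exists N, \sum_(i <- s) p i <= zpartial p N.
Proof.
move=> p0 us; exists (\max_(i <- s) `|i|%N); rewrite zpartialE.
rewrite [leRHS](bigID (mem s)) /= -[leLHS]addr0 lerD ?sumr_ge0 //.
rewrite -[leRHS]big_filter.
suff /(perm_big _) -> : perm_eq s [seq i <- zseq (\max_(i <- s) `|i|%N) | i \in s] by [].
apply: uniq_perm => //; first by rewrite filter_uniq ?zseq_uniq.
move=> i; rewrite mem_filter mem_zseq; have [h|//] := boolP (i \in s).
by rewrite /= (big_rem i) //= leq_maxl.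
Qed.

Lemma zpartialS (f : int -> R) N :
  zpartial f N.+1 = zpartial f N + (f (- (N.+1)%:Z) + f (N.+1)%:Z).
Proof.
rewrite /zpartial doubleS big_ord_recl big_ord_recr /= addrCA.
congr (_ + (_ + _)).
- by apply: eq_bigr => i _; congr f; rewrite /bump /=; lia.
- by congr f; lia.
- by congr f; rewrite /bump /=; lia.
Qed.

Lemma zpartial_bounded (p : int -> R) M : (forall i, 0 <= p i) ->
  (forall N, zpartial p N <= M) -> rsumm p /\ rsum p <= M.
Proof.
move=> p0 h; apply: rsum_bounded => // s us.
by have [N hN] := sum_seq_zpartial p0 us; exact: le_trans hN (h N).
Qed.

(** For a nonnegative family the partial sums increase to the unordered sum; the general case is a
    difference of two such. This turns the [zsum] and [csum] of the definitions into unordered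
    sums. *)
Lemma cvg_zpartial (f : int -> R) : rsumm f -> zpartial f @ \oo --> rsum f.
Proof.
have H (p : int -> R) : (forall i, 0 <= p i) -> rsumm p -> zpartial p @ \oo --> rsum p.
  move=> p0 sp.
  have nd : nondecreasing_seq (zpartial p).
    by apply/nondecreasing_seqP => n; rewrite zpartialS lerDl addr_ge0.
  have ub : has_ubound (range (zpartial p)).
    by exists (rsum p) => _ [n _ <-]; exact: zpartial_le.
  have c := nondecreasing_cvgn nd ub.
  suff <- : sup (range (zpartial p)) = rsum p by [].
  apply/eqP; rewrite eq_le; apply/andP; split.
    by apply: ge_sup => [|_ [n _ <-]]; [exists (zpartial p 0), 0%N|exact: zpartial_le].
  have [] := @zpartial_bounded p (sup (range (zpartial p))) p0 => //.
  by move=> N; apply: ub_le_sup => //; exists N.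
move=> sf.
have e : zpartial f = (fun N => zpartial (rpos f) N - zpartial (rpos (fun i => - f i)) N).
  apply/funext => N; rewrite /zpartial -sumrB; apply: eq_bigr => i _; exact: rposB.
rewrite e; have -> : rsum f = rsum (rpos f) - rsum (rpos (fun i => - f i)).
  rewrite -rsumN -rsumD; last 2 first.
  - exact: rposm.
  - by apply: rsummN; apply: rposm; exact: rsummN.
  by apply: eq_rsum => i; exact: rposB.
apply: cvgB; apply: H; do ?[exact: rpos_ge0]; apply: rposm => //; exact: rsummN.
Qed.

Lemma zsumE (f : int -> R) : rsumm f -> zsum f = rsum f.
Proof. by move=> sf; apply/cvg_lim => //; exact: cvg_zpartial. Qed.

Lemma csumE (f : int -> R[i]) : summ f -> csum f = tsum f.
Proof. by move=> sf; rewrite /csum !zsumE //; [exact: summ_im|exact: summ_re]. Qed.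

(** Comparable to [sqrt (1 + n^2)], at least 1, and submultiplicative ([japD]): an estimate at a
    shifted frequency becomes one at the frequency times a power of the shift. *)
Definition jap (n : int) : R := 1 + `|n|%N%:R.

Lemma jap_ge1 n : 1 <= jap n. Proof. by rewrite lerDl ler0n. Qed.
Lemma jap_gt0 n : 0 < jap n. Proof. exact: lt_le_trans ltr01 (jap_ge1 n). Qed.
Lemma jap_ge0 n : 0 <= jap n. Proof. exact: ltW (jap_gt0 n). Qed.

Lemma jap_summ : rsumm (fun n => (jap n) ^- 2).
Proof.
(* The two new terms add up to [2 / (N + 2)^2], at most [2 / (N + 1) - 2 / (N + 2)], so this
   majorant telescopes. *)
have h N : zpartial (fun n => (jap n) ^- 2) N <= 4 - 2 / N.+1%:R.
  elim: N => [|N IH].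
    have -> : zpartial (fun n => (jap n) ^- 2) 0 = 1.
      rewrite /zpartial big_ord_recl big_ord0 addr0 /jap.
      by rewrite (_ : `|_|%N = 0%N) // addr0 expr1n invr1.
    lra.
  rewrite zpartialS; apply: le_trans (lerD IH (lexx _)) _.
  rewrite -[leRHS]addr0 -addrA.
  have -> : jap (- (N.+1)%:Z) = N.+2%:R by rewrite /jap abszN absz_nat -[RHS]natr1 addrC.
  have -> : jap (N.+1)%:Z = N.+2%:R by rewrite /jap absz_nat -[RHS]natr1 addrC.
  have a0 : 0 < N.+1%:R :> R by rewrite ltr0n.
  have -> : N.+2%:R = N.+1%:R + 1 :> R by rewrite natr1.
  move: (N.+1%:R : R) a0 => a a0.
  have a1 : 0 < a + 1 by lra.
  have -> : 2 / (a + 1) = 2 / a - 2 / (a * (a + 1)) by field; rewrite !lt0r_neq0.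
  have : (a + 1) ^- 2 <= (a * (a + 1))^-1.
    rewrite lef_pV2 ?posrE ?exprn_gt0 ?mulr_gt0 // expr2 ler_pM2r //; lra.
  rewrite -[2 / (a * _)]/(2 * (a * (a + 1))^-1); move: ((a + 1) ^- 2) ((a * (a + 1))^-1) => u v; lra.
have [] // := @zpartial_bounded (fun n => (jap n) ^- 2) 4.
- by move=> i; rewrite invr_ge0 exprn_ge0 // jap_ge0.
- by move=> N; apply: le_trans (h N) _; rewrite gerBl divr_ge0 // ler0n.
Qed.

Lemma japD m n : jap (m + n) <= jap m * jap n.
Proof.
have h : (`|(m + n)%R|%N%:R : R) <= `|m|%N%:R + `|n|%N%:R.
  by rewrite -natrD ler_nat; lia.
have a : 0 <= `|m|%N%:R :> R by rewrite ler0n.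
have b : 0 <= `|n|%N%:R :> R by rewrite ler0n.
rewrite /jap; nra.
Qed.

Lemma japN n : jap (- n) = jap n. Proof. by rewrite /jap abszN. Qed.

End IntSums.
Arguments jap {R}.

(** * Fourier series of smooth periodic functions *)

Section PeriodIntegral.
Context {R : realType}.
Implicit Types (u v f h : R -> R).

Definition per_int u : R := Rintegral lebesgue_measure `[0, pi *+ 2] u.

Local Notation mu := (@lebesgue_measure R).

Lemma twopi_gt0 : 0 < pi *+ 2 :> R.
Proof. by rewrite mulr2n addr_gt0 ?pi_gt0. Qed.

Lemma per_integrable u : continuous u -> mu.-integrable `[0, pi *+ 2] (EFin \o u).
Proof.
move=> cu; apply: continuous_compact_integrable; first exact: segment_compact.
by apply: continuous_subspaceT => x; exact: cu.
Qed.

Lemma per_intD u v : continuous u -> continuous v ->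
  per_int (fun x => u x + v x) = per_int u + per_int v.
Proof. by move=> cu cv; rewrite /per_int RintegralD //; exact: per_integrable. Qed.

Lemma per_intZ (c : R) u : continuous u -> per_int (fun x => c * u x) = c * per_int u.
Proof. by move=> cu; rewrite /per_int RintegralZl //; exact: per_integrable. Qed.

Lemma per_intN u : continuous u -> per_int (fun x => - u x) = - per_int u.
Proof.
move=> cu; rewrite -mulN1r -per_intZ //; congr per_int; apply/funext => x.
by rewrite mulN1r.
Qed.

Lemma is_derive_continuous f (df : R -> R) : (forall x : R, is_derive x 1 f (df x)) -> continuous f.
Proof.
by move=> h x; apply: differentiable_continuous; apply/derivable1_diffP; have [] := h x.
Qed.

Lemma per_int_FTC f (df : R -> R) : (forall x : R, is_derive x 1 f (df x)) -> continuous df ->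
  per_int df = f (pi *+ 2) - f 0.
Proof.
move=> hd cd; have cf := is_derive_continuous hd.
rewrite /per_int /Rintegral (@continuous_FTC2 _ df f) //=.
- exact: twopi_gt0.
- by apply: continuous_subspaceT => x; exact: cd.
- split.
  + by move=> x _; have [] := hd x.
  + by apply: cvg_at_right_filter; exact: cf.
  + by apply: cvg_at_left_filter; exact: cf.
- by move=> x _; rewrite derive1E; have [_ ->] := hd x.
Qed.

Lemma per_int_cst (c : R) : per_int (fun=> c) = pi *+ 2 * c.
Proof.
have hd (x : R) : is_derive x 1 (fun y => c * y) c.
  by have := is_deriveZ c (is_derive_id x (1 : R)); rewrite /GRing.scale /= mulr1.
have := per_int_FTC hd (fun x => cvg_cst c).
by rewrite mulr0 subr0 mulrC => ->.
Qed.

Lemma per_int_le u (M : R) : continuous u -> (forall x, `|u x| <= M) ->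
  `|per_int u| <= pi *+ 2 * M.
Proof.
move=> cu h; apply: le_trans (le_normr_Rintegral _ _) _ => //; first exact: per_integrable.
rewrite -per_int_cst /per_int.
apply: le_Rintegral => //.
- by apply: per_integrable => x; apply: cvg_norm; exact: cu.
- by apply: per_integrable => x; exact: cvg_cst.
Qed.

Lemma cos_int (n : int) (x : R) : cos (n%:~R * (pi *+ 2) + x) = cos x.
Proof.
case: n => n.
  by rewrite -pmulrn addrC mulr_natl (periodicn (@cosD2pi R)).
rewrite NegzE mulrNz mulNr -pmulrn mulr_natl addrC.
by rewrite -(periodicn (@cosD2pi R) n.+1) subrK.
Qed.

Lemma sin_int (n : int) (x : R) : sin (n%:~R * (pi *+ 2) + x) = sin x.
Proof.
by rewrite -!cosBpihalf -addrA cos_int.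
Qed.

Lemma is_derive_cosl (n p x : R) : is_derive x 1 (fun y => cos (n * y + p)) (- (n * sin (n * x + p))).
Proof.
apply: trigger_derive; rewrite /=.
  by rewrite /GRing.scale /= mulr1 addr0 mulrC mulrN.
Qed.

Lemma is_derive_sinl (n p x : R) : is_derive x 1 (fun y => sin (n * y + p)) (n * cos (n * x + p)).
Proof.
apply: trigger_derive; rewrite /=.
by rewrite /GRing.scale /= mulr1 addr0 mulrC.
Qed.

Lemma continuous_cosl (n p : R) : continuous (fun y : R => cos (n * y + p)).
Proof. exact: is_derive_continuous (is_derive_cosl n p). Qed.

Lemma continuous_sinl (n p : R) : continuous (fun y : R => sin (n * y + p)).
Proof. exact: is_derive_continuous (is_derive_sinl n p). Qed.

Lemma per_int_cos (n : int) (p : R) :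
  per_int (fun x => cos (n%:~R * x + p)) = if n == 0 then pi *+ 2 * cos p else 0.
Proof.
case: eqP => [->|/eqP n0].
  by rewrite -per_int_cst; congr per_int; apply/funext => x; rewrite mul0r add0r.
have n0' : n%:~R != 0 :> R by rewrite intr_eq0.
have hd (x : R) : is_derive x 1 (fun x => n%:~R^-1 * sin (n%:~R * x + p)) (cos (n%:~R * x + p)).
  have := is_deriveZ (n%:~R^-1) (is_derive_sinl n%:~R p x).
  by rewrite /GRing.scale /= mulKf.
have := per_int_FTC hd (@continuous_cosl _ _).
by rewrite mulr0 add0r sin_int subrr.
Qed.

End PeriodIntegral.

(** * Rapid decay of the Fourier coefficients of smooth functions *)

Section FourierCoefficients.
Context {R : realType}.
Implicit Types (f h : R -> R).

Definition fc f (n : int) : R[i] :=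
  ((pi *+ 2)^-1 * per_int (fun x => f x * cos (n%:~R * x))) -i*
  ((pi *+ 2)^-1 * per_int (fun x => f x * sin (n%:~R * x))).

Lemma normc_fc_le f (M : R) n : continuous f -> (forall x, `|f x| <= M) -> normc (fc f n) <= 2 * M.
Proof.
move=> cf hM; apply: le_trans (normc_le _) _; rewrite /fc /= normrN mulr2n mulrDl mul1r.
have H (g : R -> R) : continuous g -> (forall x, `|g x| <= 1) ->
    `|(pi *+ 2)^-1 * per_int (fun x => f x * g x)| <= M.
  move=> cg hg; rewrite normrM ger0_norm ?invr_ge0 ?(ltW (@twopi_gt0 R)) //.
  rewrite ler_pdivrMl ?twopi_gt0 //; apply: per_int_le => [x|x].
    by apply: cvgM; [exact: cf|exact: cg].
  rewrite normrM; apply: le_trans (hM x); exact: ler_piMr.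
have c := @continuous_cosl R n%:~R 0; have s := @continuous_sinl R n%:~R 0.
rewrite -mulr2n; apply: lerD; apply: H.
- by move: c; under eq_fun do rewrite addr0.
- by move=> x; rewrite cos_max.
- by move: s; under eq_fun do rewrite addr0.
- by move=> x; rewrite sin_max.
Qed.

Lemma is_derive_mulcos f (df : R -> R) (n x : R) : is_derive x 1 f (df x) ->
  is_derive x 1 (fun y => f y * cos (n * y)) (df x * cos (n * x) - n * (f x * sin (n * x))).
Proof.
move=> hf; have := is_deriveM hf (is_derive_cosl n 0 x).
rewrite /GRing.scale /= !addr0 => h.
have -> : (fun y => f y * cos (n * y)) = (f * (fun y => cos (n * y + 0))).
  by apply/funext => y; rewrite -[RHS]/(f y * cos (n * y + 0)) addr0.
apply: is_derive_eq h _; ring.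
Qed.

Lemma is_derive_mulsin f (df : R -> R) (n x : R) : is_derive x 1 f (df x) ->
  is_derive x 1 (fun y => f y * sin (n * y)) (df x * sin (n * x) + n * (f x * cos (n * x))).
Proof.
move=> hf; have := is_deriveM hf (is_derive_sinl n 0 x).
rewrite /GRing.scale /= !addr0 => h.
have -> : (fun y => f y * sin (n * y)) = (f * (fun y => sin (n * y + 0))).
  by apply/funext => y; rewrite -[RHS]/(f y * sin (n * y + 0)) addr0.
apply: is_derive_eq h _; ring.
Qed.

Lemma cos_int0 (n : int) : cos (n%:~R * (pi *+ 2)) = 1 :> R.
Proof. by rewrite -[X in cos X]addr0 cos_int cos0. Qed.
Lemma sin_int0 (n : int) : sin (n%:~R * (pi *+ 2)) = 0 :> R.
Proof. by rewrite -[X in sin X]addr0 sin_int sin0. Qed.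

Lemma cont_mul f h : continuous f -> continuous h -> continuous (fun x => f x * h x).
Proof. by move=> cf ch x; apply: cvgM; [exact: cf|exact: ch]. Qed.
Lemma cont_add f h : continuous f -> continuous h -> continuous (fun x => f x + h x).
Proof. by move=> cf ch x; apply: cvgD; [exact: cf|exact: ch]. Qed.
Lemma cont_opp f : continuous f -> continuous (fun x => - f x).
Proof. by move=> cf x; apply: cvgN; exact: cf. Qed.
Lemma cont_cst (c : R) : continuous (fun _ : R => c). Proof. by move=> x; exact: cvg_cst. Qed.
Lemma cont_cosn (n : R) : continuous (fun x : R => cos (n * x)).
Proof. by have := @continuous_cosl R n 0; under eq_fun do rewrite addr0. Qed.
Lemma cont_sinn (n : R) : continuous (fun x : R => sin (n * x)).
Proof. by have := @continuous_sinl R n 0; under eq_fun do rewrite addr0. Qed.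

(** Integration by parts: the fundamental theorem is applied to [f] times cosine and [f] times sine,
    and the boundary terms cancel by periodicity. *)
Lemma fc_derive f (df : R -> R) n : f (pi *+ 2) = f 0 -> (forall x : R, is_derive x 1 f (df x)) ->
  continuous df -> fc df n = Ic * n%:~R%:C * fc f n.
Proof.
move=> pf hd cd; have cf := is_derive_continuous hd.
have e1 : per_int (fun x => df x * cos (n%:~R * x)) = n%:~R * per_int (fun x => f x * sin (n%:~R * x)).
  have cs := cont_mul cf (@cont_sinn n%:~R); have cc := cont_mul cd (@cont_cosn n%:~R).
  have := per_int_FTC (fun x => is_derive_mulcos n%:~R (hd x)) (cont_add cc (cont_opp (cont_mul (@cont_cst n%:~R) cs))).
  rewrite per_intD //; last exact: cont_opp (cont_mul (@cont_cst _) cs).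
  rewrite per_intN ?per_intZ //; last exact: (cont_mul (@cont_cst _) cs).
  rewrite cos_int0 mulr0 cos0 pf subrr; lra.
have e2 : per_int (fun x => df x * sin (n%:~R * x)) = - (n%:~R * per_int (fun x => f x * cos (n%:~R * x))).
  have cs := cont_mul cf (@cont_cosn n%:~R); have cc := cont_mul cd (@cont_sinn n%:~R).
  have := per_int_FTC (fun x => is_derive_mulsin n%:~R (hd x)) (cont_add cc (cont_mul (@cont_cst n%:~R) cs)).
  rewrite per_intD //; last exact: (cont_mul (@cont_cst _) cs).
  rewrite per_intZ //.
  rewrite sin_int0 !mulr0 sin0 mulr0 subrr; lra.
rewrite /fc e1 e2; apply: complex_ext; rewrite /=; ring.
Qed.

Lemma smooth1_is_derive f k (x : R) : smooth1 setT (f : R -> R^o) ->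
  is_derive x 1 (derive1n k (f : R -> R^o)) (derive1n k.+1 (f : R -> R^o) x).
Proof. by move=> sf; rewrite derive1nS derive1E; apply: derivableP; exact: sf. Qed.

Lemma derive1n_periodic f k : periodic f -> periodic (derive1n k (f : R -> R^o)).
Proof.
move=> pf; elim: k => [|k IH]; first exact: pf.
by move=> x; rewrite derive1nS /derive1; under eq_fun do rewrite addrA !IH.
Qed.

Lemma derive1n_continuous f k : smooth1 setT (f : R -> R^o) -> continuous (derive1n k (f : R -> R^o)).
Proof. move=> sf; exact: (is_derive_continuous (fun x => smooth1_is_derive k x sf)). Qed.

Lemma periodic_int f (k : int) (x : R) : periodic f -> f (k%:~R * (pi *+ 2) + x) = f x.
Proof.
move=> pf; have H (n : nat) y : f (n%:R * (pi *+ 2) + y) = f y.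
  elim: n => [|n IH]; first by rewrite mul0r add0r.
  by rewrite -natr1 mulrDl mul1r -addrA [_ + y]addrC addrA pf.
case: k => n; first by rewrite -pmulrn H.
by rewrite NegzE mulrNz mulNr -pmulrn -[LHS](H n.+1) addrA subrr add0r.
Qed.

Lemma int_reduce (x0 x : R) : exists k : int, `|k%:~R * (pi *+ 2) + x - x0| <= pi.
Proof.
(* The floor of [t] is the integer nearest to [(x0 - x) / 2 pi]. *)
pose t := (x0 - x) / (pi *+ 2) + 2^-1.
exists (Num.floor t); have := Num.Theory.floor_itv t; rewrite intrD.
move=> /andP[h1 h2]; have p0 := @pi_gt0 R.
have e : t * (pi *+ 2) = x0 - x + pi.
  by rewrite /t mulrDl divfK ?lt0r_neq0 ?twopi_gt0 //; congr (_ + _); lra.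
have : (Num.floor t)%:~R * (pi *+ 2) <= t * (pi *+ 2) by rewrite ler_pM2r ?twopi_gt0.
have : t * (pi *+ 2) < ((Num.floor t)%:~R + 1) * (pi *+ 2) by rewrite ltr_pM2r ?twopi_gt0.
rewrite e mulrDl mul1r; move: (_ * (pi *+ 2)) => z; rewrite ler_norml; lra.
Qed.

Lemma periodic_bounded f : continuous f -> periodic f -> exists M, forall x, `|f x| <= M.
Proof.
move=> cf pf.
have p0 : - pi <= pi :> R by have := @pi_gt0 R; lra.
have cn : {within `[- pi, pi], continuous (fun x => `|f x|)}.
  by apply: continuous_subspaceT => x; apply: cvg_norm; exact: cf.
have [c _ hc] := EVT_max p0 cn.
exists `|f c| => x; have [k hk] := int_reduce 0 x.
rewrite -(periodic_int k x pf); apply: hc; rewrite in_itv /= -ler_norml.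
by move: hk; rewrite subr0.
Qed.

Lemma fc_deriven f k n : periodic f -> smooth1 setT (f : R -> R^o) ->
  fc (derive1n k (f : R -> R^o)) n = (Ic * n%:~R%:C) ^+ k * fc f n.
Proof.
move=> pf sf; elim: k => [|k IH]; first by rewrite expr0 mul1r.
rewrite exprS -mulrA -IH; apply: fc_derive.
- by rewrite -[in LHS](add0r (pi *+ 2)) derive1n_periodic.
- by move=> x; exact: smooth1_is_derive.
- exact: derive1n_continuous.
Qed.

Definition rapid (z : int -> R[i]) : Prop :=
  forall L : nat, exists2 C : R, 0 <= C & forall n, normc (z n) <= C * jap n ^- L.

(** Bounds on the derivatives of orders 0 and [L] together control [jap n ^+ L], which is at most
    [2^L (1 + |n|^L)]. *)
Lemma rapid_fc f : periodic f -> smooth1 setT (f : R -> R^o) -> rapid (fc f).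
Proof.
move=> pf sf L.
have H k : exists2 C, 0 <= C & forall n, `|n|%N%:R ^+ k * normc (fc f n) <= C.
  have [M hM] := periodic_bounded (derive1n_continuous (k:=k) sf) (derive1n_periodic k pf).
  exists (2 * M); first by rewrite mulr_ge0 //; apply: le_trans (hM 0).
  move=> n; apply: le_trans (normc_fc_le n (derive1n_continuous (k:=k) sf) hM).
  rewrite fc_deriven // normcM normcX normcM normc_real natr_absz intr_norm.
  by rewrite /normc /= expr0n add0r expr1n sqrtr1 mul1r.
have [C0 C00 h0] := H 0%N; have [CL CL0 hL] := H L.
exists (2 ^+ L * (C0 + CL)); first by rewrite mulr_ge0 ?addr_ge0 ?exprn_ge0.
move=> n; rewrite ler_pdivlMr ?exprn_gt0 ?jap_gt0 // mulrC.
have : jap n ^+ L <= 2 ^+ L * (1 + `|n|%N%:R ^+ L) :> R.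
  rewrite /jap; move: (`|n|%N) => m; case: m => [|m].
    rewrite addr0 expr1n; apply: le_trans (_ : 2 ^+ L * 1 <= _).
      by rewrite mulr1 exprn_ege1 // ler1n.
    by rewrite ler_wpM2l ?exprn_ge0 // lerDl exprn_ge0.
  apply: le_trans (_ : 2 ^+ L * m.+1%:R ^+ L <= _); last first.
    by rewrite ler_wpM2l ?exprn_ge0 // lerDr.
  rewrite -exprMn lerXn2r ?nnegrE ?mulr_ge0 ?addr_ge0 //.
  by rewrite mulr2n mulrDl mul1r lerD2r ler1n.
move=> h; apply: le_trans (ler_wpM2r (normc_ge0 _) h) _.
rewrite -mulrA ler_wpM2l ?exprn_ge0 // mulrDl mul1r lerD //.
by have := h0 n; rewrite expr0 mul1r.
Qed.

End FourierCoefficients.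

(** * Differentiation of trigonometric series *)

Section TrigSeries.
Context {R : realType}.

Lemma expiD (x y : R) : expi (x + y) = expi x * expi y.
Proof. by rewrite /expi sinD cosD; apply: complex_ext; rewrite /=; ring. Qed.
Lemma expi0 : expi (0 : R) = 1. Proof. by rewrite /expi cos0 sin0. Qed.
Lemma normc_expi (x : R) : normc (expi x) = 1.
Proof. by rewrite /expi /= cos2Dsin2 sqrtr1. Qed.
Lemma expi_int (n : int) (x : R) : expi (n%:~R * (pi *+ 2) + x) = expi x.
Proof. by rewrite /expi cos_int sin_int. Qed.

(** Series are differentiated through this criterion: a quadratic Taylor bound can be summed term by
    term. *)
Lemma is_derive_bound (f : R -> R) (x l K : R) :
  (forall e, `|f (x + e) - f x - e * l| <= K * e ^+ 2) -> is_derive x 1 f l.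
Proof.
move=> h.
have c : (fun e => e^-1 *: (f (e *: (1 : R) + x) - f x)) @ 0^' --> l.
  apply/cvgrPdist_le => /= e e0.
  have K1 : 0 < `|K| + 1 by rewrite ltr_wpDl.
  near=> t.
  have t0 : t != 0 by near: t; exact: nbhs_dnbhs_neq.
  rewrite /GRing.scale /= mulr1 [t + x]addrC.
  have -> : l - t^-1 * (f (x + t) - f x) = - (t^-1 * (f (x + t) - f x - t * l)) by field.
  rewrite normrN normrM normfV ler_pdivrMl ?normr_gt0 //.
  apply: le_trans (h t) _; rewrite -real_normK ?num_real // expr2 mulrA mulrC.
  rewrite ler_wpM2l //.
  apply: le_trans (_ : (`|K| + 1) * `|t| <= _).
    by rewrite ler_wpM2r // (le_trans (ler_norm K)) // lerDl.
  rewrite mulrC -ler_pdivlMr //.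
  by near: t; apply: dnbhs0_le; rewrite divr_gt0.
split; first by apply/cvg_ex; exists l.
exact: cvg_lim.
Unshelve. all: by end_near. Qed.

Lemma sin_lip (x : R) : `|sin x| <= `|x|.
Proof.
wlog x0 : x / 0 <= x => [H|].
  case: (leP 0 x) => [/H //|xn]; have := H (- x); rewrite sinN !normrN; apply; lra.
have [|c _] := @MVT_segment R sin cos 0 x x0 (fun y _ => is_derive_sin y).
  by apply: continuous_subspaceT => y; exact: continuous_sin.
rewrite sin0 !subr0 => ->; rewrite normrM; exact: ler_piMl (cos_max _).
Qed.

Lemma cos_lip2 (x : R) : `|cos x - 1| <= x ^+ 2.
Proof.
wlog x0 : x / 0 <= x => [H|].
  case: (leP 0 x) => [/H //|xn]; have := H (- x); rewrite cosN sqrrN; apply; lra.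
have [|c] := @MVT_segment R cos (fun y => - sin y) 0 x x0 (fun y _ => is_derive_cos y).
  by apply: continuous_subspaceT => y; exact: continuous_cos.
rewrite in_itv /= => /andP[c0 cx].
rewrite cos0 subr0 => ->; rewrite mulNr normrN normrM (ger0_norm x0) expr2 ler_wpM2r //.
by apply: le_trans (sin_lip c) _; rewrite ger0_norm.
Qed.

Lemma cos_lip (x : R) : `|cos x - 1| <= `|x|.
Proof.
wlog x0 : x / 0 <= x => [H|].
  case: (leP 0 x) => [/H //|xn]; have := H (- x); rewrite cosN normrN; apply; lra.
have [|c _] := @MVT_segment R cos (fun y => - sin y) 0 x x0 (fun y _ => is_derive_cos y).
  by apply: continuous_subspaceT => y; exact: continuous_cos.
rewrite cos0 subr0 => ->; rewrite mulNr normrN normrM; apply: ler_piMl => //; exact: sin_max.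
Qed.

Lemma sin_lip2 (x : R) : `|sin x - x| <= x ^+ 2.
Proof.
wlog x0 : x / 0 <= x => [H|].
  case: (leP 0 x) => [/H //|xn]; have := H (- x).
  rewrite sinN sqrrN -opprD normrN; apply; lra.
have hd (y : R) : y \in `]0, x[ -> is_derive y 1 (fun y => sin y - y) (cos y - 1).
  by move=> _; exact: is_deriveB (is_derive_sin y) (is_derive_id y (1 : R)).
have [|c] := MVT_segment x0 hd.
  by apply: continuous_subspaceT => y; apply: cvgB; [exact: continuous_sin|exact: cvg_id].
rewrite in_itv /= => /andP[c0 cx].
rewrite sin0 !subr0 => ->; rewrite normrM (ger0_norm x0) expr2 ler_wpM2r //.
by apply: le_trans (cos_lip c) _; rewrite ger0_norm.
Qed.

Lemma expi_taylor (y : R) : normc (expi y - 1 - Ic * y%:C) <= 2 * y ^+ 2.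
Proof.
apply: le_trans (normc_le _) _; rewrite /expi /= !(mul0r, mulr0, mul1r, subr0, oppr0, addr0, add0r).
by rewrite mulr2n mulrDl mul1r lerD // ?cos_lip2 ?sin_lip2.
Qed.

Context {I : choiceType}.
Implicit Types (c : I -> R[i]) (k : I -> int).

(** The index type is arbitrary and the frequency is a function of the index, so that products of
    series, and series over pairs or triples of frequencies, are again of this form. *)
Definition tser c k (x : R) : R[i] := tsum (fun i => c i * expi ((k i)%:~R * x)).

Definition decays c k := forall L : nat, rsumm (fun i => normc (c i) * jap (k i) ^+ L).

Definition dcoef (n : int) : R[i] := Ic * n%:~R%:C.

Lemma normc_dcoef n : normc (dcoef n) <= jap n.
Proof.
rewrite /dcoef normcM normc_real -intr_norm -natr_absz [normc _]/normc expr0n add0r expr1n sqrtr1.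
by rewrite mul1r /jap lerDr.
Qed.

Lemma decays_mul c k a : decays c k -> decays (fun i => c i * dcoef (k i) ^+ a) k.
Proof.
move=> h L; apply: rsumm_lew (h (L + a)%N) _ => i.
rewrite ger0_norm ?mulr_ge0 ?normc_ge0 ?exprn_ge0 ?jap_ge0 //.
rewrite normcM normcX -mulrA ler_wpM2l ?normc_ge0 // exprD mulrC.
rewrite ler_wpM2l ?exprn_ge0 ?jap_ge0 //.
by rewrite lerXn2r ?nnegrE ?normc_ge0 ?jap_ge0 // normc_dcoef.
Qed.

Lemma decays0 c k : decays c k -> summ c.
Proof. by move=> h; apply: summ_le (h 0%N) _ => i; rewrite expr0 mulr1. Qed.

Lemma summ_expi c k x : summ c -> summ (fun i => c i * expi ((k i)%:~R * x)).
Proof. by move=> h; apply: summ_le h _ => i; rewrite normcM normc_expi mulr1. Qed.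

(** Of the factor 4, one 2 comes from [expi_taylor] and the other from [normc_tsum_le]. *)
Lemma tser_taylor c k x e : decays c k ->
  normc (tser c k (x + e) - tser c k x - e%:C * tser (fun i => c i * dcoef (k i)) k x)
   <= 4 * rsum (fun i => normc (c i) * jap (k i) ^+ 2) * e ^+ 2.
Proof.
move=> h; have s0 := decays0 h.
have s1 : summ (fun i => c i * dcoef (k i)).
  by apply: decays0 (decays_mul 1 h).
have ha := summ_expi k (x + e) s0; have hb := summ_expi k x s0.
have hc := summ_expi k x s1; have hd := summZ e%:C hc.
rewrite /tser -(tsumZ e%:C hc) -(tsumB ha hb) -(tsumB (summB ha hb) hd).
have -> : 4 * rsum (fun i => normc (c i) * jap (k i) ^+ 2) * e ^+ 2 =
    2 * rsum (fun i => 2 * e ^+ 2 * (normc (c i) * jap (k i) ^+ 2)).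
  by rewrite rsumZ; [ring|exact: h].
apply: normc_tsum_le; first exact: rsummZ (h 2%N).
move=> i; rewrite mulrDr expiD.
have -> : c i * (expi ((k i)%:~R * x) * expi ((k i)%:~R * e)) - c i * expi ((k i)%:~R * x) -
   e%:C * (c i * dcoef (k i) * expi ((k i)%:~R * x)) =
   c i * (expi ((k i)%:~R * x) * (expi ((k i)%:~R * e) - 1 - Ic * ((k i)%:~R * e)%:C)).
  by rewrite /dcoef rmorphM; ring.
rewrite !normcM normc_expi mul1r [leRHS]mulrCA ler_wpM2l ?normc_ge0 //.
have e20 : 0 <= 2 * e ^+ 2 by rewrite pmulr_rge0 // sqr_ge0.
apply: le_trans (expi_taylor _) _; rewrite exprMn [_ ^+ 2 * e ^+ 2]mulrC mulrA ler_wpM2l //.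
rewrite -real_normK ?num_real // -intr_norm -natr_absz lerXn2r ?nnegrE ?jap_ge0 //.
by rewrite /jap lerDr.
Qed.

Lemma is_derive_tser_re c k (x : R) : decays c k ->
  is_derive x 1 (fun y => cre (tser c k y)) (cre (tser (fun i => c i * dcoef (k i)) k x)).
Proof.
move=> h; apply: is_derive_bound => e; apply: le_trans (tser_taylor x e h).
apply: le_trans (normc_re _); rewrite !creD !creN creM /=.
by rewrite mul0r subr0.
Qed.

Lemma is_derive_tser_im c k (x : R) : decays c k ->
  is_derive x 1 (fun y => cim (tser c k y)) (cim (tser (fun i => c i * dcoef (k i)) k x)).
Proof.
move=> h; apply: is_derive_bound => e; apply: le_trans (tser_taylor x e h).
apply: le_trans (normc_im _); rewrite !cimD !cimN cimM /=.
by rewrite mul0r addr0.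
Qed.

Lemma derive1n_tser c k n : decays c k ->
  derive1n n (fun y => cre (tser c k y) : R^o) = (fun x => cre (tser (fun i => c i * dcoef (k i) ^+ n) k x)) /\
  derive1n n (fun y => cim (tser c k y) : R^o) = (fun x => cim (tser (fun i => c i * dcoef (k i) ^+ n) k x)).
Proof.
move=> h.
elim: n => [|n [IH1 IH2]].
  by split; apply/funext => x; rewrite derive1n0; congr (_ (tser _ k x)); apply/funext => i; rewrite expr0 mulr1.
rewrite !derive1nS IH1 IH2.
have hn := decays_mul n h.
have e : (fun i => c i * dcoef (k i) ^+ n * dcoef (k i)) = (fun i => c i * dcoef (k i) ^+ n.+1).
  by apply/funext => i; rewrite exprSr mulrA.
split; apply/funext => x; rewrite derive1E.
  by have [_ ->] := is_derive_tser_re x hn; rewrite e.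
by have [_ ->] := is_derive_tser_im x hn; rewrite e.
Qed.

Lemma csmooth1_tser c k U : decays c k -> csmooth1 U (tser c k).
Proof.
move=> h; split => n x _.
  have [+ _] := derive1n_tser n h; rewrite /comp => ->.
  by have [] := is_derive_tser_re x (decays_mul n h).
have [_ +] := derive1n_tser n h; rewrite /comp => ->.
by have [] := is_derive_tser_im x (decays_mul n h).
Qed.

Lemma cderive_tser c k n x : decays c k ->
  cderive n (tser c k) x = tser (fun i => c i * dcoef (k i) ^+ n) k x.
Proof.
move=> h; rewrite /cderive /comp; have [-> ->] := derive1n_tser n h.
by case: (tser _ k x).
Qed.

Lemma periodic_tser c k : periodic (tser c k).
Proof.
move=> x; apply: eq_tsum => i; congr (_ * _).
by rewrite mulrDr addrC expi_int.
Qed.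

End TrigSeries.

(** * Fourier inversion *)

Section Inversion.
Context {R : realType}.
Implicit Types (f h : R -> R).

(** For [0 <= t <= 2], [1 - cos t = 2 sin(t/2)^2] and [sin(t/2) >= (t/2) cos 1] by the mean value
    theorem. For [t > 2] the cosine is negative, so [pi^2] suffices. *)
Lemma one_sub_cos_ge : exists2 K : R, 0 <= K & forall t : R, `|t| <= pi -> t ^+ 2 <= K * (1 - cos t).
Proof.
have c0 := @cos1_gt0 R.
exists (2 / cos 1 ^+ 2 + pi ^+ 2); first by rewrite addr_ge0 ?divr_ge0 ?sqr_ge0.
move=> t ht.
have cc : 0 <= 1 - cos t by rewrite subr_ge0 cos_le1.
have c2 : 0 < cos 1 ^+ 2 :> R by rewrite exprn_gt0.
wlog t0 : t ht cc / 0 <= t => [H|].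
  case: (leP 0 t) => [/H|tn]; first exact.
  by have := H (- t); rewrite sqrrN cosN normrN; apply => //; lra.
rewrite mulrDl; have [t2|t2] := leP t 2.
  rewrite -[leLHS]addr0 lerD ?(mulr_ge0 (sqr_ge0 _) cc) //.
  rewrite mulrAC ler_pdivlMr //.
  have -> : 1 - cos t = 2 * sin (t / 2) ^+ 2.
    have -> : cos t = cos (t / 2 + t / 2) by congr cos; lra.
    rewrite cosD -!expr2 cos2sin2; lra.
  have t20 : 0 <= t / 2 by lra.
  have [|c] := @MVT_segment R sin cos 0 (t / 2) t20 (fun y _ => is_derive_sin y).
    by apply: continuous_subspaceT => y; exact: continuous_sin.
  rewrite in_itv /= sin0 !subr0 => /andP[cg ct] ->.
  have hc : cos 1 <= cos c.
    have p2 := @pi_ge2 R; have p1 := @pihalf_ge1 R.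
    have [->|ne] := eqVneq c 1; first by [].
    apply: ltW; rewrite ltr_cos ?in_itv /=; [|apply/andP; split; lra|apply/andP; split; lra].
    rewrite lt_neqAle ne /=; lra.
  have h2 : cos 1 ^+ 2 <= cos c ^+ 2 by rewrite lerXn2r ?nnegrE // ltW //; apply: lt_le_trans hc.
  rewrite exprMn; have := ler_wpM2l (sqr_ge0 t) h2.
  move: (cos c ^+ 2) (cos 1 ^+ 2) => u v; nra.
rewrite -[leLHS]add0r lerD //; first by rewrite !mulr_ge0 // invr_ge0 sqr_ge0.
have : cos t < 0.
  apply: lt_trans (@cos2_lt0 R); rewrite ltr_cos ?in_itv //=.
    by rewrite ler0n /= pi_ge2.
  by rewrite t0 /=; move: ht; rewrite ger0_norm.
move=> ct; apply: le_trans (_ : pi ^+ 2 * 1 <= _).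
  by rewrite mulr1 lerXn2r ?nnegrE ?pi_ge0 //; move: ht; rewrite ger0_norm.
rewrite ler_wpM2l ?sqr_ge0 //; lra.
Qed.

Lemma MVT_norm f (df : R -> R) (a b M r : R) : (forall x : R, is_derive x 1 f (df x)) ->
  `|b - a| <= r -> (forall x, `|x - a| <= r -> `|df x| <= M) -> `|f b - f a| <= M * `|b - a|.
Proof.
move=> hd hab hM; have cf := is_derive_continuous hd.
have [ab|ba] := leP a b.
  have [|c] := MVT_segment ab (fun x _ => hd x).
    by apply: continuous_subspaceT => y; exact: cf.
  rewrite in_itv /= => /andP[ac cb] ->; rewrite normrM ler_wpM2r // hM //.
  apply: le_trans hab; rewrite !ger0_norm; lra.
have [|c] := MVT_segment (ltW ba) (fun x _ => hd x).
  by apply: continuous_subspaceT => y; exact: cf.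
rewrite in_itv /= => /andP[ac cb].
rewrite -normrN opprB => ->; rewrite normrM (distrC b a) ler_wpM2r // hM //.
apply: le_trans hab; rewrite !ler0_norm; lra.
Qed.

(** The mean value theorem, used twice from [x0], gives a multiple of [(x - x0)^2] within distance
    [pi] of [x0]; [one_sub_cos_ge] compares it with [1 - cos], and periodicity extends the bound to
    all [x]. *)
Lemma vanishing2_bound h (h1 h2 : R -> R) (x0 : R) : periodic h ->
  (forall x : R, is_derive x 1 h (h1 x)) -> (forall x : R, is_derive x 1 h1 (h2 x)) -> continuous h2 ->
  h x0 = 0 -> h1 x0 = 0 -> exists2 B, 0 <= B & forall x, `|h x| <= B * (1 - cos (x - x0)).
Proof.
move=> ph d1 d2 c2 e0 e1.
have p0 : x0 - pi <= x0 + pi by have := @pi_gt0 R; lra.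
have cn : {within `[x0 - pi, x0 + pi], continuous (fun x => `|h2 x|)}.
  by apply: continuous_subspaceT => x; apply: cvg_norm; exact: c2.
have [c _ hc] := EVT_max p0 cn.
have [K K0 hK] := one_sub_cos_ge.
have M2 x : `|x - x0| <= pi -> `|h2 x| <= `|h2 c|.
  by move=> hx; apply: hc; rewrite in_itv /=; move: hx; rewrite ler_norml; lra.
have M1 x : `|x - x0| <= pi -> `|h1 x| <= `|h2 c| * `|x - x0|.
  by move=> hx; have := MVT_norm d2 hx M2; rewrite e1 subr0.
have M0 x : `|x - x0| <= pi -> `|h x| <= `|h2 c| * (x - x0) ^+ 2.
  move=> hx; have := @MVT_norm h h1 x0 x (`|h2 c| * `|x - x0|) `|x - x0| d1 (lexx _).
  rewrite e0 subr0 -mulrA -expr2 real_normK ?num_real //; apply.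
  move=> y hy; apply: le_trans (M1 y (le_trans hy hx)) _; exact: ler_wpM2l.
exists (`|h2 c| * K); first by rewrite mulr_ge0.
move=> x; have [k hk] := int_reduce x0 x.
rewrite -(periodic_int k x ph) -(cos_int k (x - x0)) addrA.
apply: le_trans (M0 _ hk) _; rewrite -mulrA ler_wpM2l //.
exact: hK.
Qed.

(** Up to the factor [2 pi], the real part of the term of index [n] of the Fourier series at [x0]
    ([re_fc_expi]). *)
Definition shiftcos (u : R -> R) (x0 : R) (n : int) : R :=
  per_int (fun x => u x * cos (n%:~R * (x - x0))).

Lemma cont_shiftcos (n x0 : R) : continuous (fun x : R => cos (n * (x - x0))).
Proof.
by have := @continuous_cosl R n (- (n * x0)); under eq_fun do rewrite -mulrBr.
Qed.

Lemma shiftcosN u x0 n : shiftcos u x0 (- n) = shiftcos u x0 n.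
Proof.
by congr per_int; apply/funext => x; rewrite mulrNz mulNr cosN.
Qed.

Lemma shiftcos_le u x0 n M : continuous u -> (forall x, `|u x| <= M) ->
  `|shiftcos u x0 n| <= pi *+ 2 * M.
Proof.
move=> cu hM; apply: per_int_le.
  exact: cont_mul cu (@cont_shiftcos _ _).
move=> x; rewrite normrM; apply: le_trans (hM x); apply: ler_piMr => //; exact: cos_max.
Qed.

(** [a] is even and [al] is minus half its second difference, so the symmetric partial sums
    telescope to [a N - a (N + 1)], up to one error for each summand. *)
Lemma zpartial_second_difference (al a e : int -> R) N (E : R) :
  (forall n, al (- n) = al n) -> (forall n, a (- n) = a n) ->
  (forall n, al n = a n - 2^-1 * (a (n + 1) + a (n - 1)) + e n) ->
  (forall n, `|e n| <= E) ->
  `|zpartial al N - (a N%:Z - a N.+1%:Z)| <= N.*2.+1%:R * E.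
Proof.
move=> aln an ale eE; elim: N => [|N IH].
  have -> : zpartial al 0 = al 0 by rewrite /zpartial big_ord_recl big_ord0 addr0.
  rewrite ale sub0r add0r an mul1r.
  have -> : a 0 - 2^-1 * (a 1 + a 1) + e 0 - (a 0 - a 1) = e 0 by lra.
  exact: eE.
rewrite zpartialS aln ale.
have -> : (N.+1%:Z - 1) = N%:Z by lia.
have -> : (N.+1%:Z + 1) = N.+2%:Z by lia.
have -> : zpartial al N + (a N.+1%:Z - 2^-1 * (a N.+2%:Z + a N%:Z) + e N.+1%:Z
  + (a N.+1%:Z - 2^-1 * (a N.+2%:Z + a N%:Z) + e N.+1%:Z)) - (a N.+1%:Z - a N.+2%:Z) =
  (zpartial al N - (a N%:Z - a N.+1%:Z)) + (e N.+1%:Z + e N.+1%:Z) by lra.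
apply: le_trans (ler_normD _ _) _.
have -> : N.+1.*2.+1%:R * E = N.*2.+1%:R * E + (E + E) by rewrite doubleS -[N.*2.+3%:R]natr1 -(natr1 N.*2.+1) !mulrDl mul1r addrA.
apply: lerD => //; apply: le_trans (ler_normD _ _) _; exact: lerD.
Qed.

(** [a] consists of the coefficients of [q = h / (1 - cos + eps)]: multiplication by
    [1 - cos (x - x0)] acts on coefficients as minus half the second difference. The positive [eps]
    keeps the denominator away from 0, while [|q| <= B] holds whatever [eps] is. *)
Lemma shiftcos_second_difference h x0 (B eps : R) : continuous h -> 0 < eps -> 0 <= B ->
  (forall x, `|h x| <= B * (1 - cos (x - x0))) ->
  exists a e : int -> R, [/\ forall n, a (- n) = a n,
    forall n, shiftcos h x0 n = a n - 2^-1 * (a (n + 1) + a (n - 1)) + e n,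
    forall n, `|e n| <= pi *+ 2 * (B * eps) & forall n, `|a n| <= pi *+ 2 * B].
Proof.
move=> ch e0 B0 hB.
have cc : continuous (fun x => cos (x - x0)).
  by have := @cont_shiftcos 1 x0; under eq_fun do rewrite mul1r.
pose d x := 1 - cos (x - x0) + eps.
have d0 x : 0 < d x by rewrite ltr_wpDl // subr_ge0 cos_le1.
pose q x := h x / d x.
have cq : continuous q.
  move=> x; apply: cvgM; first exact: ch.
  apply: cvgV; first by rewrite lt0r_neq0.
  by apply: cvgD; [apply: cvgB; [exact: cvg_cst|exact: cc]|exact: cvg_cst].
have qB x : `|q x| <= B.
  rewrite /q normrM normfV (gtr0_norm (d0 x)) ler_pdivrMr //.
  by apply: le_trans (hB x) _; rewrite ler_wpM2l // /d lerDl ltW.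
exists (shiftcos q x0), (shiftcos (fun x => eps * q x) x0); split.
- exact: shiftcosN.
- move=> n; rewrite /shiftcos.
  have c1 m := cont_mul cq (@cont_shiftcos m x0).
  have ceq : continuous (fun x => eps * q x) by exact: cont_mul (@cont_cst _ eps) cq.
  have c2 m := cont_mul ceq (@cont_shiftcos m x0).
  rewrite -(per_intD (c1 _) (c1 _)) -per_intZ; last exact: cont_add (c1 _) (c1 _).
  rewrite -per_intN; last by apply: cont_mul; [exact: cont_cst|exact: cont_add (c1 _) (c1 _)].
  rewrite -per_intD; [|exact: c1|by apply: cont_opp; apply: cont_mul; [exact: cont_cst|exact: cont_add (c1 _) (c1 _)]].
  rewrite -per_intD; [|by apply: cont_add; [exact: c1|apply: cont_opp; apply: cont_mul; [exact: cont_cst|exact: cont_add (c1 _) (c1 _)]]|exact: c2].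
  congr per_int; apply/funext => x.
  have -> : h x = d x * q x by rewrite /q mulrC divfK // lt0r_neq0.
  have -> : (n + 1)%:~R = n%:~R + 1 :> R by rewrite intrD.
  have -> : (n - 1)%:~R = n%:~R - 1 :> R by rewrite rmorphB.
  rewrite /d; set th := x - x0.
  rewrite [(n%:~R + 1) * _]mulrDl [(n%:~R - 1) * _]mulrDl mulN1r mul1r (cosD (n%:~R * th) th) (cosB (n%:~R * th) th).
  by field.
- move=> n; apply: shiftcos_le; first exact: cont_mul (@cont_cst _ eps) cq.
  by move=> x; rewrite normrM (gtr0_norm e0) mulrC ler_wpM2r // ltW.
- by move=> n; exact: shiftcos_le.
Qed.

(** The partial sums are themselves differences, up to an error, so that summing them telescopes
    once more, to [a 0 - a N]. *)
Lemma shiftcos_cesaro h x0 B : continuous h -> 0 <= B ->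
  (forall x, `|h x| <= B * (1 - cos (x - x0))) -> forall N,
  `|\sum_(0 <= M < N) zpartial (shiftcos h x0) M| <= pi *+ 2 * B *+ 2.
Proof.
move=> ch B0 hB N; apply/ler_addgt0Pr => eps e0.
(* The total error for this [N] is [K] times the parameter of the second-difference lemma, which is
   therefore taken to be [eps / (K + 1)]; the bound on [a] does not depend on it. *)
pose K := \sum_(0 <= M < N) M.*2.+1%:R * (pi *+ 2 * B) : R.
have K0 : 0 <= K.
  by apply: sumr_ge0 => i _; rewrite !mulr_ge0 // ltW // twopi_gt0.
have ep : 0 < eps / (K + 1) by rewrite divr_gt0 // ltr_wpDl.
have [a [e [an ae eE aB]]] := shiftcos_second_difference ch ep B0 hB.
have -> : \sum_(0 <= M < N) zpartial (shiftcos h x0) M =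
  (a 0 - a N%:Z) + \sum_(0 <= M < N) (zpartial (shiftcos h x0) M - (a M%:Z - a M.+1%:Z)).
  rewrite sumrB; have -> : \sum_(0 <= M < N) (a M%:Z - a M.+1%:Z) = a 0 - a N%:Z.
    elim: N {K K0 ep eE} => [|N IH]; first by rewrite big_geq // subrr.
    by rewrite big_nat_recr //= IH addrA subrK.
  by rewrite addrC subrK.
apply: le_trans (ler_normD _ _) _; apply: lerD.
  by apply: le_trans (ler_normB _ _) _; rewrite [leRHS]mulr2n lerD.
apply: le_trans (ler_norm_sum _ _ _) _.
apply: le_trans (_ : \sum_(0 <= M < N) M.*2.+1%:R * (pi *+ 2 * (B * (eps / (K + 1)))) <= _).
  apply: ler_sum => M _; apply: zpartial_second_difference an ae eE => n; exact: shiftcosN.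
have -> : \sum_(0 <= M < N) M.*2.+1%:R * (pi *+ 2 * (B * (eps / (K + 1)))) = K * (eps / (K + 1)).
  by rewrite /K mulr_suml; apply: eq_bigr => i _; rewrite !mulrA.
rewrite mulrA ler_pdivrMr ?ltr_wpDl // mulrC ler_wpM2l ?ltW //; lra.
Qed.

(** Bounded sums have Cesaro means tending to 0, and the means have the limit of the sequence. *)
Lemma cesaro_bounded0 (u : nat -> R) (l C : R) : u @ \oo --> l ->
  (forall N, `|\sum_(0 <= M < N) u M| <= C) -> l = 0.
Proof.
move=> ul hC.
have h := cesaro ul.
have : arithmetic_mean u @ \oo --> 0.
  apply: (@squeeze_cvgr _ _ _ _ (fun n => - (C * harmonic n)) (fun n => C * harmonic n)).
  - apply: nearW => n; rewrite -ler_norml /arithmetic_mean /harmonic /= normrM.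
    rewrite ger0_norm ?invr_ge0 // mulrC ler_wpM2r ?invr_ge0 //.
    exact: hC.
  - rewrite -oppr0 -(mulr0 C); apply: cvgN; apply: cvgM; [exact: cvg_cst|exact: cvg_harmonic].
  - rewrite -(mulr0 C); apply: cvgM; [exact: cvg_cst|exact: cvg_harmonic].
exact: cvg_unique h.
Qed.

Lemma rapid_summ (z : int -> R[i]) : rapid z -> summ z.
Proof.
move=> /(_ 2%N) [C C0 hC]; apply: summ_le (rsummZ C jap_summ) _; exact: hC.
Qed.

Lemma rapid_decays (z : int -> R[i]) : rapid z -> decays z id.
Proof.
move=> hz L; have [C C0 hC] := hz (L + 2)%N; apply: rsumm_lew (rsummZ C jap_summ) _ => n.
rewrite ger0_norm ?mulr_ge0 ?normc_ge0 ?exprn_ge0 ?jap_ge0 //.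
apply: le_trans (ler_wpM2r _ (hC n)) _; first by rewrite exprn_ge0 // jap_ge0.
rewrite -mulrA ler_wpM2l // exprD invfM mulrAC mulVf ?mul1r //.
by rewrite lt0r_neq0 // exprn_gt0 // jap_gt0.
Qed.

Lemma is_derive_smooth0 f (x : R) : smooth1 setT (f : R -> R^o) ->
  is_derive x 1 f (derive1n 1 (f : R -> R^o) x).
Proof. exact: (@smooth1_is_derive R f 0 x). Qed.

Lemma re_fc_expi f n x0 : continuous f ->
  cre (fc f n * expi (n%:~R * x0)) = (pi *+ 2)^-1 * shiftcos f x0 n.
Proof.
move=> cf; rewrite creM /fc /expi /=.
have cc := cont_mul cf (@cont_cosn _ n%:~R); have cs := cont_mul cf (@cont_sinn _ n%:~R).
have -> : shiftcos f x0 n = cos (n%:~R * x0) * per_int (fun x => f x * cos (n%:~R * x)) +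
   sin (n%:~R * x0) * per_int (fun x => f x * sin (n%:~R * x)).
  rewrite -!per_intZ // -per_intD; [|exact: cont_mul (@cont_cst _ _) cc|exact: cont_mul (@cont_cst _ _) cs].
  by congr per_int; apply/funext => x; rewrite mulrBr cosB; ring.
ring.
Qed.

Lemma im_fc_expi f n x0 : continuous f ->
  cim (fc f (- n) * expi ((- n)%:~R * x0)) = - cim (fc f n * expi (n%:~R * x0)).
Proof.
move=> cf; rewrite !cimM /fc /expi /= mulrNz !mulNr sinN cosN.
have -> : (fun x => f x * cos (- n%:~R * x)) = (fun x => f x * cos (n%:~R * x)).
  by apply/funext => x; rewrite mulNr cosN.
have -> : per_int (fun x => f x * sin (- n%:~R * x)) = - per_int (fun x => f x * sin (n%:~R * x)).
  rewrite -per_intN; last exact: cont_mul cf (@cont_sinn _ _).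
  by congr per_int; apply/funext => x; rewrite mulNr sinN mulrN.
ring.
Qed.

(** Subtracting [f x0] and a multiple of [sin (x - x0)] leaves a function [h] vanishing to second
    order at [x0]. Its centred cosine coefficients are summable and their partial sums have bounded
    sums, so they add up to 0; the subtracted terms account for [2 pi f(x0)]. *)
Theorem fourier_inversion f (x0 : R) : periodic f -> smooth1 setT (f : R -> R^o) ->
  tser (fc f) id x0 = (f x0)%:C.
Proof.
move=> pf sf.
have cf : continuous f by exact: (@derive1n_continuous R f 0).
have sm := rapid_summ (rapid_fc pf sf).
have s1 := summ_expi id x0 sm.
have p2 := @twopi_gt0 R; have p20 : (pi *+ 2 : R) != 0 by rewrite lt0r_neq0.
apply: complex_ext; rewrite /tser ?cre_tsum ?cim_tsum [RHS]/=; last first.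
  (* The imaginary parts are odd in [n], so their sum equals its own negative. *)
  set g := fun n : int => cim _; have sg : rsumm g := summ_im s1.
  have bn : bijective (fun n : int => - n) by exists (fun n : int => - n); exact: opprK.
  have := (rsum_reindex g bn).2.
  have -> : (fun i => g (- i)) = (fun i => - g i) by apply/funext => n; exact: im_fc_expi.
  rewrite rsumN; lra.
set a := derive1n 1 (f : R -> R^o) x0.
pose h x := f x - f x0 - a * sin (x - x0).
have hsin (x : R) : is_derive x 1 (fun x => sin (x - x0)) (cos (x - x0)).
  by have := is_derive_sinl 1 (- x0) x; rewrite !mul1r; under eq_fun do rewrite mul1r.
have hcos (x : R) : is_derive x 1 (fun x => cos (x - x0)) (- sin (x - x0)).
  by have := is_derive_cosl 1 (- x0) x; rewrite !mul1r; under eq_fun do rewrite mul1r.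
pose h1 x := derive1n 1 (f : R -> R^o) x - a * cos (x - x0).
pose h2 x := derive1n 2 (f : R -> R^o) x + a * sin (x - x0).
have d1 (x : R) : is_derive x 1 h (h1 x).
  have := is_deriveB (is_deriveB (is_derive_smooth0 x sf) (is_derive_cst (f x0) x (1 : R))) (is_deriveZ a (hsin x)).
  by rewrite subr0.
have d2 (x : R) : is_derive x 1 h1 (h2 x).
  have := is_deriveB (smooth1_is_derive 1 x sf) (is_deriveZ a (hcos x)).
  by rewrite scalerN opprK.
have csin := is_derive_continuous hsin.
have c2 : continuous h2.
  exact: cont_add (derive1n_continuous (k:=2) sf) (cont_mul (@cont_cst _ a) csin).
have ph : periodic h.
  move=> x; rewrite /h pf; congr (_ - _ * _).
  by rewrite addrAC sinD2pi.
have e0 : h x0 = 0 by rewrite /h !subrr sin0 mulr0 subr0.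
have e1 : h1 x0 = 0 by rewrite /h1 subrr cos0 mulr1 subrr.
have [B B0 hB] := vanishing2_bound ph d1 d2 c2 e0 e1.
have ch := is_derive_continuous d1.
have al n : shiftcos h x0 n = shiftcos f x0 n - (if n == 0 then pi *+ 2 * f x0 else 0).
  have c1 : continuous (fun x => cos (n%:~R * (x - x0))) by exact: cont_shiftcos.
  have e n' : per_int (fun x => f x0 * cos (n'%:~R * (x - x0))) = if n' == 0 then pi *+ 2 * f x0 else 0.
    rewrite per_intZ; last exact: cont_shiftcos.
    under [X in per_int X]eq_fun do rewrite mulrBr.
    rewrite per_int_cos; case: eqP => [->|_]; last by rewrite mulr0.
    by rewrite mul0r oppr0 cos0 mulr1 mulrC.
  rewrite -e /shiftcos -per_intN; last exact: cont_mul (@cont_cst _ _) c1.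
  have cfc := cont_mul cf c1; have ccc := cont_opp (cont_mul (@cont_cst _ (f x0)) c1).
  have css := cont_mul csin c1.
  rewrite -(per_intD cfc ccc) -[RHS]subr0 -[X in _ - X](mulr0 a).
  (* By symmetry about [x0], the sine term of [h] contributes to no centred cosine coefficient. *)
  have <- : per_int (fun x => sin (x - x0) * cos (n%:~R * (x - x0))) = 0.
    have cK (m : R) : continuous (fun x : R => sin (m * x + (- (m * x0)))) by exact: continuous_sinl.
    have Z (m : int) : per_int (fun x => sin (m%:~R * x + (- (m%:~R * x0)))) = 0 :> R.
      under [X in per_int X]eq_fun do rewrite -cosBpihalf -addrA.
      rewrite per_int_cos; case: eqP => [->|//].
      by rewrite mul0r oppr0 add0r cosN cos_pihalf mulr0.
    have := congr1 (fun z => 2^-1 * z) (per_intD (cK (n + 1)%:~R) (cont_opp (cK (n - 1)%:~R))).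
    rewrite per_intN // !Z oppr0 addr0 mulr0 -per_intZ => [<-|].
      congr per_int; apply/funext => x; rewrite -!mulrBr.
      have -> : (n + 1)%:~R = n%:~R + 1 :> R by rewrite intrD.
      have -> : (n - 1)%:~R = n%:~R - 1 :> R by rewrite rmorphB.
      set th := x - x0.
      rewrite [(n%:~R + 1) * _]mulrDl [(n%:~R - 1) * _]mulrDl mulN1r mul1r (sinD (n%:~R * th) th) (sinB (n%:~R * th) th).
      by field.
    exact: cont_add (cK _) (cont_opp (cK _)).
  rewrite -per_intZ // -per_intN; last exact: cont_mul (@cont_cst _ a) css.
  rewrite -per_intD; [|exact: cont_add cfc ccc|exact: cont_opp (cont_mul (@cont_cst _ a) css)].
  by congr per_int; apply/funext => x; rewrite /h; ring.
have [d0s d0e] := @rsum_set1 R _ (fun n : int => if n == 0 then pi *+ 2 * f x0 else 0) 0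
  (fun n hn => ifN _ _ hn).
have sre : rsumm (fun n => shiftcos f x0 n).
  have := rsummZ (pi *+ 2) (summ_re s1); congr rsumm; apply/funext => n.
  by rewrite re_fc_expi // mulVKf.
have sal : rsumm (shiftcos h x0).
  have := rsummD sre (rsummN d0s); congr rsumm; apply/funext => n; by rewrite al.
have L0 := cesaro_bounded0 (cvg_zpartial sal) (shiftcos_cesaro ch B0 hB).
have E : rsum (shiftcos f x0) = pi *+ 2 * f x0.
  have := rsumD sre (rsummN d0s); rewrite rsumN d0e eqxx.
  rewrite (_ : rsum _ = 0) => [|]; first lra.
  by rewrite -[RHS]L0; apply: eq_rsum => n; rewrite al.
have -> : rsum (fun n : int => cre (fc f n * expi ((id n)%:~R * x0))) = (pi *+ 2)^-1 * rsum (shiftcos f x0).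
  rewrite -rsumZ //; apply: eq_rsum => n; exact: re_fc_expi.
by rewrite E mulKf.
Qed.

End Inversion.

(** * Products of functions and convolution of Fourier coefficients *)

Section Convolution.
Context {R : realType}.
Implicit Types (z w : int -> R[i]).

Lemma rapidZ (c : R[i]) z : rapid z -> rapid (fun n => c * z n).
Proof.
move=> hz L; have [C C0 hC] := hz L; exists (normc c * C); first by rewrite mulr_ge0 ?normc_ge0.
by move=> n; rewrite normcM -mulrA ler_wpM2l ?normc_ge0.
Qed.

Lemma rapidD z w : rapid z -> rapid w -> rapid (fun n => z n + w n).
Proof.
move=> hz hw L; have [C C0 hC] := hz L; have [D D0 hD] := hw L.
exists (C + D); first by rewrite addr_ge0.
by move=> n; rewrite mulrDl; apply: le_trans (normcD _ _) _; rewrite lerD.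
Qed.

Lemma rapid0 : rapid (fun _ => 0 : R[i]).
Proof. by move=> L; exists 0 => // n; rewrite normc0 mul0r. Qed.

Lemma rapid_sum (T : Type) (r : seq T) (P : pred T) (f : T -> int -> R[i]) :
  (forall t, rapid (f t)) -> rapid (fun n => \sum_(t <- r | P t) f t n).
Proof.
move=> hf; elim: r => [|t r IH]; first by under eq_fun do rewrite big_nil; exact: rapid0.
under eq_fun do rewrite big_cons.
by case: (P t) => //; exact: rapidD.
Qed.

Lemma rapid_le z w : rapid w -> (forall n, normc (z n) <= normc (w n)) -> rapid z.
Proof.
move=> hw h L; have [C C0 hC] := hw L; exists C => // n; exact: le_trans (h n) (hC n).
Qed.

Definition conv z w (n : int) : R[i] := tsum (fun j => z (n - j) * w j).

Lemma jap_sub_inv n j (L : nat) : jap (n - j) ^- L * jap j ^- L <= jap n ^- L :> R.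
Proof.
have h m : 0 < jap m ^+ L :> R by rewrite exprn_gt0 // jap_gt0.
rewrite -invfM lef_pV2 ?posrE ?mulr_gt0 // -exprMn lerXn2r ?nnegrE ?mulr_ge0 ?jap_ge0 //.
by rewrite -{1}(subrK j n) japD.
Qed.

Lemma bij_subl (n : int) : bijective (fun j : int => n - j).
Proof. by exists (fun j => n - j) => j; rewrite opprB addrC subrK. Qed.

Lemma bij_addr (n : int) : bijective (fun j : int => j + n).
Proof. by exists (fun j => j - n) => j; rewrite ?addrK ?subrK. Qed.

Lemma summ_conv z w n : rapid z -> rapid w -> summ (fun j => z (n - j) * w j).
Proof.
move=> hz hw; have [C C0 hC] := hz 0%N; have [D D0 hD] := hw 2%N.
apply: summ_le (rsummZ (C * D) jap_summ) _ => j.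
rewrite normcM -mulrA; apply: ler_pM; rewrite ?normc_ge0 //.
by have := hC (n - j); rewrite expr0 invr1 mulr1.
Qed.

Lemma rapid_conv z w : rapid z -> rapid w -> rapid (conv z w).
Proof.
move=> hz hw L; have [C C0 hC] := hz L; have [D D0 hD] := hw (L + 2)%N.
have s0 : 0 <= rsum (fun j : int => jap j ^- 2 : R).
  by apply: rsum_ge0 => j; rewrite invr_ge0 exprn_ge0 // jap_ge0.
exists (2 * (C * D * rsum (fun j : int => jap j ^- 2 : R))); first by rewrite !mulr_ge0.
move=> n; have -> : 2 * (C * D * rsum (fun j : int => jap j ^- 2 : R)) * jap n ^- L =
    2 * rsum (fun j : int => C * D * jap n ^- L * jap j ^- 2 : R).
  by rewrite rsumZ; [ring|exact: jap_summ].
apply: normc_tsum_le; first exact: rsummZ jap_summ.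
move=> j; rewrite normcM.
apply: le_trans (_ : (C * jap (n - j) ^- L) * (D * jap j ^- (L + 2)) <= _).
  by apply: ler_pM; rewrite ?normc_ge0.
rewrite exprD invfM.
have -> : C * jap (n - j) ^- L * (D * (jap j ^- L * jap j ^- 2)) =
   C * D * ((jap (n - j) ^- L * jap j ^- L) * jap j ^- 2) by ring.
rewrite -[leRHS]mulrA ler_wpM2l ?mulr_ge0 // ler_wpM2r ?invr_ge0 ?exprn_ge0 ?jap_ge0 //.
exact: jap_sub_inv.
Qed.

Lemma bij_shear : bijective (fun p : int * int => (p.1 - p.2, p.2)).
Proof. by exists (fun p => (p.1 + p.2, p.2)) => -[a b] /=; rewrite ?subrK ?addrK. Qed.

(** Fubini; for each fixed [j] the shift of [n] by [j] then separates the two series. *)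
Lemma tser_conv z w x : rapid z -> rapid w ->
  tser (conv z w) id x = tser z id x * tser w id x.
Proof.
move=> hz hw; have sz := rapid_summ hz; have sw := rapid_summ hw.
have sp : summ (fun p : int * int => z p.1 * w p.2).
  apply: summ_le (rsumm_prodM sz sw) _ => p; by rewrite normcM.
have sq : summ (fun p : int * int => z (p.1 - p.2) * w p.2 * expi (p.1%:~R * x)).
  by apply: summ_le (summ_reindex bij_shear sp) _ => p; rewrite !normcM normc_expi mulr1.
rewrite /tser.
transitivity (tsum (fun n => tsum (fun j => z (n - j) * w j * expi (n%:~R * x)))).
  by apply: eq_tsum => n; rewrite tsumZr //; exact: summ_conv.
rewrite (tsum_swap (f := fun n j => z (n - j) * w j * expi (n%:~R * x))) //.
rewrite -tsumZ; last exact: summ_expi.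
apply: eq_tsum => j.
rewrite -(tsum_reindex (fun n => z (n - j) * w j * expi (n%:~R * x)) (bij_addr j)).2.
rewrite mulrC -tsumZ; last exact: summ_expi.
apply: eq_tsum => n; rewrite addrK intrD mulrDl expiD; ring.
Qed.

Lemma rapid_shift z n : rapid z -> rapid (fun j => z (j + n)).
Proof.
move=> hz L; have [C C0 hC] := hz L.
have jn : 0 < jap n ^+ L :> R by rewrite exprn_gt0 // jap_gt0.
exists (C * jap n ^+ L); first by rewrite mulr_ge0 // ltW.
move=> j; apply: le_trans (hC _) _; rewrite -mulrA ler_wpM2l //.
have h m : 0 < jap m ^+ L :> R by rewrite exprn_gt0 // jap_gt0.
rewrite -ler_pdivrMl // -invfM lef_pV2 ?posrE ?mulr_gt0 //.
rewrite -exprMn lerXn2r ?nnegrE ?mulr_ge0 ?jap_ge0 // mulrC.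
by rewrite -{1}(addrK n j) -[X in _ <= _ * X]japN japD.
Qed.

Lemma tser_mulexpi z x n : summ z ->
  tser z id x * expi (- (n%:~R * x)) = tser (fun j => z (j + n)) id x.
Proof.
move=> sz; rewrite /tser -tsumZr; last exact: summ_expi.
rewrite -[LHS](tsum_reindex _ (bij_addr n)).2; apply: eq_tsum => j.
by rewrite -mulrA -expiD /= intrD mulrDl addrK.
Qed.

(** The nonconstant part is the derivative of the periodic series with coefficients [z i / dcoef i],
    so its integral over a period is 0. *)
Lemma per_int_tser_re z : rapid z ->
  per_int (fun x => cre (tser z id x)) = pi *+ 2 * cre (z 0).
Proof.
move=> hz; pose c (i : int) := if i == 0 then 0 else z i / (dcoef i : R[i]).
have dn i : i != 0 -> 1 <= normc ((dcoef i : R[i])).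
  move=> i0; rewrite /dcoef normcM normc_real -intr_norm -natr_absz [normc _]/normc expr0n add0r expr1n sqrtr1.
  by rewrite mul1r ler1n absz_gt0.
have hc : rapid c.
  apply: rapid_le hz _ => i; rewrite /c; case: eqVneq => [_|i0]; first by rewrite normc0 normc_ge0.
  rewrite normcM normcV ler_pdivrMr; last exact: lt_le_trans (dn _ i0).
  by apply: ler_peMr; [exact: normc_ge0|exact: dn].
have dc := rapid_decays hc.
have dz := rapid_decays hz.
have cz : continuous (fun x => cre (tser z id x)).
  by apply: is_derive_continuous => x; exact: is_derive_tser_re.
have E x : cre (tser z id x) = cre (tser (fun i => c i * (dcoef i : R[i])) id x) + cre (z 0).
  rewrite -creD; congr cre.
  have [s1 e1] := @tsum_set1 R _ (fun i : int => if i == 0 then z 0 else 0) 0 (fun n hn => ifN _ _ hn).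
  have {e1}-> : z 0 = tsum (fun i : int => if i == 0 then z 0 else 0) by rewrite e1 eqxx.
  rewrite /tser -tsumD //; last first.
    by apply: summ_expi; have := decays0 (decays_mul 1 dc).
  apply: eq_tsum => i; rewrite /c; case: eqVneq => [->|i0].
    by rewrite !mul0r add0r expi0 mulr1.
  rewrite divfK ?addr0 //; apply: contraTneq (dn i i0) => ->.
  by rewrite normc0 -ltNge ltr01.
under [X in per_int X]eq_fun do rewrite E.
rewrite per_intD; [|by apply: is_derive_continuous => x; exact: is_derive_tser_re (decays_mul 1 dc)|exact: cont_cst].
rewrite (per_int_FTC (fun x => is_derive_tser_re x dc)); last first.
  by apply: is_derive_continuous => x; exact: is_derive_tser_re (decays_mul 1 dc).
by rewrite -[X in tser c id X]add0r periodic_tser subrr add0r per_int_cst.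
Qed.

(** Uniqueness of Fourier coefficients: multiplication by [exp(- i n x)] shifts the coefficients,
    which reduces the claim to the mean value of a rapidly converging series. *)
Lemma fc_tser z (f : R -> R) n : rapid z -> (forall x, tser z id x = (f x)%:C) -> fc f n = z n.
Proof.
move=> hz hf; have hs := rapid_shift n hz.
have p20 : (pi *+ 2 : R) != 0 by rewrite lt0r_neq0 ?twopi_gt0.
have e x : (f x)%:C * expi (- (n%:~R * x)) = tser (fun j => z (j + n)) id x.
  by rewrite -hf tser_mulexpi //; exact: rapid_summ.
apply: complex_ext; rewrite /fc /=.
  have -> : (fun x => f x * cos (n%:~R * x)) = (fun x => cre (tser (fun j => z (j + n)) id x)).
    by apply/funext => x; rewrite -e creM /expi /= cosN; ring.
  by rewrite per_int_tser_re // add0r mulKf.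
have -> : (fun x => f x * sin (n%:~R * x)) = (fun x => cre (tser (fun j => Ic * z (j + n)) id x)).
  apply/funext => x; have -> : tser (fun j => Ic * z (j + n)) id x = Ic * tser (fun j => z (j + n)) id x.
    rewrite /tser -tsumZ; first by apply: eq_tsum => j; rewrite mulrA.
    by apply: summ_expi; exact: rapid_summ.
  by rewrite -e !creM !cimM /expi /= sinN cosN; ring.
rewrite per_int_tser_re ?add0r ?mulKf //; last exact: rapidZ.
by rewrite creM /=; ring.
Qed.

(** Inversion turns both functions into series, [tser_conv] multiplies these, and uniqueness reads
    off the coefficients. *)
Lemma fc_mul (f g : R -> R) n : periodic f -> smooth1 setT (f : R -> R^o) ->
  periodic g -> smooth1 setT (g : R -> R^o) ->
  fc (fun x => f x * g x) n = conv (fc f) (fc g) n.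
Proof.
move=> pf sf pg sg; apply: fc_tser; first by apply: rapid_conv; exact: rapid_fc.
move=> x; rewrite tser_conv ?fourier_inversion ?rmorphM //; exact: rapid_fc.
Qed.

Lemma derive1n_fourier (f : R -> R) k x : periodic f -> smooth1 setT (f : R -> R^o) ->
  tser (fun n => fc f n * dcoef n ^+ k) id x = (derive1n k (f : R -> R^o) x)%:C.
Proof.
move=> pf sf; have d := rapid_decays (rapid_fc pf sf).
rewrite -cderive_tser // /cderive.
have -> : cre \o tser (fc f) id = f.
  by apply/funext => y; rewrite /= fourier_inversion.
have -> : cim \o tser (fc f) id = cst 0.
  by apply/funext => y; rewrite /= fourier_inversion.
suff -> : derive1n k (cst 0 : R -> R^o) = cst 0 by [].
elim: k => [//|k IH]; rewrite derive1nS IH; apply/funext => y.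
by rewrite derive1_cst.
Qed.

Lemma derive1n_near_cst (f : R -> R) (a x : R) k : (\forall y \near x, f y = a) ->
  \forall y \near x, derive1n k (f : R -> R^o) y = if k == 0%N then a else 0.
Proof.
move=> h; elim: k => [//|k IH].
have {}IH : \forall y \near x, derive1n k (f : R -> R^o) y = (if k == 0%N then a else 0) by [].
move/near_join : IH; apply: filterS => y hy.
rewrite derive1nS derive1E (@near_eq_derive _ _ _ _ (cst (if k == 0%N then a else 0) : R -> R^o)) //.
by rewrite derive_cst.
Qed.

End Convolution.

(** * Asymptotic expansions in powers of 1 / n *)

Section BinomialSeries.
Context {R : realType}.

(** Generalized binomial coefficients, by the recursion that matches differentiation of [(1 + z)^t],
    which lowers the exponent to [t - 1]. *)
Fixpoint binr (t : R) (i : nat) : R :=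
  if i is i'.+1 then t / i%:R * binr (t - 1) i' else 1.

Lemma powR_abs_le (X t : R) : 2^-1 <= X -> X <= 2 -> X `^ t <= 2 `^ `|t|.
Proof.
move=> h1 h2; have X0 : 0 < X by lra.
rewrite /powR !gt_eqF // ler_expR.
have h : `|ln X| <= ln 2.
  rewrite ler_norml; apply/andP; split; last by rewrite ler_ln ?posrE.
  by rewrite -lnV ?posrE // ler_ln ?posrE // invr_gt0.
apply: le_trans (ler_norm _) _; rewrite normrM.
by rewrite ler_wpM2l.
Qed.

Definition binrem (t : R) (N : nat) (z : R) : R :=
  (1 + z) `^ t - \sum_(i < N) binr t i * z ^+ i.

Lemma is_derive_powR1 (t z : R) : `|z| <= 2^-1 -> is_derive z 1 (fun z => (1 + z) `^ t) (t * (1 + z) `^ (t - 1)).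
Proof.
rewrite ler_norml => /andP[z1 z2]; have z0 : 0 < 1 + z by lra.
have h1 : is_derive z 1 (fun z : R => 1 + z) 1.
  by have := is_deriveD (is_derive_cst (1 : R) z 1) (is_derive_id z (1 : R)); rewrite add0r.
have h2 : is_derive (1 + z) (1 : R) (fun y => y `^ t) (t * (1 + z) `^ (t - 1)).
  exact: is_derive1_powR.
have := @is_derive1_comp R (fun y => y `^ t) (fun z => 1 + z) z _ _ h2 h1.
by rewrite mulr1.
Qed.

Lemma is_derive_binsum (t z : R) N :
  is_derive z 1 (fun z => \sum_(i < N.+1) binr t i * z ^+ i) (t * \sum_(i < N) binr (t - 1) i * z ^+ i).
Proof.
have h (i : 'I_N.+1) : is_derive z 1 (fun z => binr t i * z ^+ i) (binr t i * (z ^+ i.-1 *+ i)).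
  have := is_deriveZ (binr t i) (is_deriveX i (is_derive_id z (1 : R))).
  have -> : (binr t i \*: id ^+ i) = (fun y : R => binr t i * y ^+ i).
    by apply/funext => y; rewrite /= exprfctE.
  move=> H; apply: is_derive_eq (H) _; rewrite /GRing.scale /= mulr1; congr (_ * _).
  by rewrite mulr_natl.
have H := @is_derive_sum _ _ _ _ _ z 1 _ h.
have e : \sum_(i < N.+1) (fun y : R => binr t i * y ^+ i) = (fun y => \sum_(i < N.+1) binr t i * y ^+ i).
  by apply/funext => y; rewrite fct_sumE.
move: H; rewrite e => H.
apply: is_derive_eq (H) _.
rewrite big_ord_recl mulr0n mulr0 add0r mulr_sumr; apply: eq_bigr => i _.
rewrite lift0 /= -[z ^+ _ *+ _]mulr_natr; have : (i.+1%:R : R) != 0 by rewrite pnatr_eq0.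
by move: (i.+1%:R : R) => x h0; field.
Qed.

(** The remainder for [t] vanishes at 0 and its derivative is [t] times the remainder for [t - 1]
    with one term fewer; the mean value theorem supplies the missing power of [z]. *)
Lemma binrem_le (N : nat) : forall t : R, exists2 C, 0 <= C & forall z, `|z| <= 2^-1 -> `|binrem t N z| <= C * `|z| ^+ N.
Proof.
elim: N => [|N IH] t.
  exists (2 `^ `|t|); first exact: powR_ge0.
  move=> z; rewrite ler_norml => hz; rewrite /binrem big_ord0 subr0 expr0 mulr1 ger0_norm ?powR_ge0 //.
  by apply: powR_abs_le; lra.
have [C C0 hC] := IH (t - 1); exists (`|t| * C); first by rewrite mulr_ge0.
move=> z hz.
have hd (y : R) : `|y| <= 2^-1 -> is_derive y 1 (binrem t N.+1) (t * binrem (t - 1) N y).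
  move=> hy; have := is_deriveB (is_derive_powR1 t hy) (is_derive_binsum t y N).
  by rewrite /binrem mulrBr.
have e0 : binrem t N.+1 0 = 0.
  rewrite /binrem addr0 powR1 big_ord_recl expr0 mulr1 big1 ?addr0 ?subrr // => i _.
  by rewrite expr0n mulr0.
have bd y : `|y| <= `|z| -> `|t * binrem (t - 1) N y| <= `|t| * C * `|z| ^+ N.
  move=> hy; rewrite normrM -mulrA ler_wpM2l //.
  apply: le_trans (hC y (le_trans hy hz)) _; rewrite ler_wpM2l //.
  by rewrite lerXn2r ?nnegrE.
have cont (a b : R) : `|a| <= `|z| -> `|b| <= `|z| -> {within `[a, b], continuous (binrem t N.+1)}.
  move=> ha hb; apply: derivable_within_continuous => y; rewrite in_itv /= => yab.
  have hy : `|y| <= 2^-1.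
    apply: le_trans hz; move: ha hb; rewrite !ler_norml; lra.
  by have [] := hd y hy.
rewrite exprSr mulrA.
have [z0|z0] := leP 0 z.
  have [||c] := @MVT_segment R (binrem t N.+1) (fun y => t * binrem (t - 1) N y) 0 z z0.
  - move=> y; rewrite in_itv /= => yz; apply: hd; apply: le_trans hz; rewrite !ger0_norm; lra.
  - by apply: cont => //; rewrite normr0.
  rewrite in_itv /= e0 !subr0 => cz ->; rewrite normrM ler_wpM2r //; apply: bd.
  rewrite !ger0_norm; lra.
have [||c] := @MVT_segment R (binrem t N.+1) (fun y => t * binrem (t - 1) N y) z 0 (ltW z0).
- move=> y; rewrite in_itv /= => yz; apply: hd; apply: le_trans hz; rewrite !ler0_norm; lra.
- by apply: cont => //; rewrite normr0.
rewrite in_itv /= e0 !sub0r => cz /(congr1 -%R); rewrite opprK mulrN opprK => ->.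
rewrite normrM ler_wpM2r //; apply: bd; rewrite !ler0_norm; lra.
Qed.

End BinomialSeries.

(** * Expansions with polynomially bounded coefficients *)

Section Expansions.
Context {R : realType} {T : Type} (rho : T -> R).
Hypothesis rho_ge1 : forall th, 1 <= rho th.

(** [rho] measures the size of the parameters, later [(1 + |a|) (1 + |b|)]. A polynomial loss in
    [rho] is harmless against rapidly decaying coefficients. *)
Definition polyb (a : T -> R) : Prop :=
  exists C, exists2 L : nat, 0 <= C & forall th, `|a th| <= C * rho th ^+ L.

Definition bounded_expn (f : int -> T -> R) : Prop :=
  exists C, exists2 L : nat, 0 <= C & forall n th, n != 0 -> `|f n th| <= C * rho th ^+ L.

(* [expn N f c]: f n = c 0 + c 1 / n + ... + c (N - 1) / n ^ (N - 1) + O (1 / n ^ N), polynomially in rho. *)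
Fixpoint expn (N : nat) (f : int -> T -> R) (c : nat -> T -> R) : Prop :=
  if N is N'.+1 then
    polyb (c 0%N) /\ expn N' (fun n th => n%:~R * (f n th - c 0%N th)) (fun i => c i.+1)
  else bounded_expn f.

Lemma rhoX_ge1 th L : 1 <= rho th ^+ L. Proof. exact: exprn_ege1. Qed.
Lemma rho_ge0 th : 0 <= rho th. Proof. exact: le_trans ler01 (rho_ge1 th). Qed.

Lemma rhoX_le th (L M : nat) : (L <= M)%N -> rho th ^+ L <= rho th ^+ M.
Proof. by move=> h; apply: ler_weXn2l. Qed.

Lemma polybD a b : polyb a -> polyb b -> polyb (fun th => a th + b th).
Proof.
move=> [C [L C0 hC]] [D [M D0 hD]]; exists (C + D), (L + M)%N; first exact: addr_ge0.
move=> th; apply: le_trans (ler_normD _ _) _; rewrite mulrDl; apply: lerD.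
  by apply: le_trans (hC th) _; rewrite ler_wpM2l // rhoX_le // leq_addr.
by apply: le_trans (hD th) _; rewrite ler_wpM2l // rhoX_le // leq_addl.
Qed.

Lemma polybM a b : polyb a -> polyb b -> polyb (fun th => a th * b th).
Proof.
move=> [C [L C0 hC]] [D [M D0 hD]]; exists (C * D), (L + M)%N; first exact: mulr_ge0.
by move=> th; rewrite normrM exprD mulrACA ler_pM.
Qed.

Lemma polyb_cst (k : R) : polyb (fun=> k).
Proof. by exists `|k|, 0%N => // th; rewrite mulr1. Qed.

Lemma polyb_le (a b : T -> R) : polyb b -> (forall th, `|a th| <= `|b th|) -> polyb a.
Proof. by move=> [C [L C0 hC]] h; exists C, L => // th; exact: le_trans (h th) (hC th). Qed.

Lemma eq_expn N f g c : (forall n th, n != 0 -> f n th = g n th) -> expn N f c -> expn N g c.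
Proof.
elim: N f g c => [|N IH] f g c e /=.
  by move=> [C [L C0 hC]]; exists C, L => // n th n0; rewrite -e // hC.
move=> [p h]; split => //; apply: IH h => n th n0; by rewrite e.
Qed.

Lemma eq_expnc N f c d : (forall i, (i < N)%N -> c i =1 d i) -> expn N f c -> expn N f d.
Proof.
elim: N f c d => [|N IH] f c d e //= [p h].
have e0 := e 0%N isT; split.
  by move: p => [C [L C0 hC]]; exists C, L => // th; rewrite -e0.
apply: IH (fun i hi => e i.+1 hi) _.
by apply: eq_expn h => n th _; rewrite e0.
Qed.

Lemma bounded_expn_le f g : bounded_expn g -> (forall n th, n != 0 -> `|f n th| <= `|g n th|) -> bounded_expn f.
Proof. by move=> [C [L C0 hC]] h; exists C, L => // n th n0; exact: le_trans (h n th n0) (hC n th n0). Qed.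

Lemma bounded_expnD f g : bounded_expn f -> bounded_expn g -> bounded_expn (fun n th => f n th + g n th).
Proof.
move=> [C [L C0 hC]] [D [M D0 hD]]; exists (C + D), (L + M)%N; first exact: addr_ge0.
move=> n th n0; apply: le_trans (ler_normD _ _) _; rewrite mulrDl; apply: lerD.
  by apply: le_trans (hC n th n0) _; rewrite ler_wpM2l // rhoX_le // leq_addr.
by apply: le_trans (hD n th n0) _; rewrite ler_wpM2l // rhoX_le // leq_addl.
Qed.

Lemma bounded_expnM f g : bounded_expn f -> bounded_expn g -> bounded_expn (fun n th => f n th * g n th).
Proof.
move=> [C [L C0 hC]] [D [M D0 hD]]; exists (C * D), (L + M)%N; first exact: mulr_ge0.
by move=> n th n0; rewrite normrM exprD mulrACA ler_pM ?hC ?hD.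
Qed.

Lemma polyb_bounded a : polyb a -> bounded_expn (fun _ => a).
Proof. by move=> [C [L C0 hC]]; exists C, L. Qed.

Lemma norm_int_ge1 (n : int) : n != 0 -> 1 <= `|n%:~R| :> R.
Proof. by move=> n0; rewrite -intr_norm -natr_absz ler1n absz_gt0. Qed.

Lemma expn_bounded N f c : expn N f c -> bounded_expn f.
Proof.
elim: N f c => [//|N IH] f c /= [p /IH h].
apply: bounded_expn_le (bounded_expnD (polyb_bounded p)
   (bounded_expn_le (f := fun n th => f n th - c 0%N th) h _)) _.
  move=> n th n0; rewrite normrM; apply: ler_peMl => //; exact: norm_int_ge1.
by move=> n th _; rewrite addrC subrK.
Qed.

Lemma expn_le N f c : expn N.+1 f c -> expn N f c.
Proof.
elim: N f c => [|N IH] f c.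
  exact: expn_bounded.
by move=> [p h]; split => //; exact: IH.
Qed.

Lemma expnD N f g c d : expn N f c -> expn N g d ->
  expn N (fun n th => f n th + g n th) (fun i th => c i th + d i th).
Proof.
elim: N f g c d => [|N IH] f g c d /=; first exact: bounded_expnD.
move=> [pc hf] [pd hg]; split; first exact: polybD.
by apply: eq_expn (IH _ _ _ _ hf hg) => n th _; ring.
Qed.

Lemma expnZ N f c a : polyb a -> expn N f c ->
  expn N (fun n th => a th * f n th) (fun i th => a th * c i th).
Proof.
move=> pa; elim: N f c => [|N IH] f c /=.
  by move=> h; apply: bounded_expnM => //; exact: polyb_bounded.
move=> [pc hf]; split; first exact: polybM.
by apply: eq_expn (IH _ _ hf) => n th _; ring.
Qed.

Definition cst_coef (a : T -> R) (i : nat) : T -> R := if i is 0%N then a else fun=> 0.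

Lemma expn_zero N f : (forall n th, n != 0 -> f n th = 0) -> expn N f (fun _ _ => 0).
Proof.
elim: N f => [|N IH] f h /=.
  by exists 0, 0%N => // n th n0; rewrite h // normr0 mul0r.
split; first exact: polyb_cst.
by apply: IH => n th n0; rewrite h // subr0 mulr0.
Qed.

Lemma expn_cst N a : polyb a -> expn N (fun _ => a) (cst_coef a).
Proof.
case: N => [|N] pa /=; first exact: polyb_bounded.
by split => //; apply: expn_zero => n th _; rewrite subrr mulr0.
Qed.

Fixpoint cauchy (c d : nat -> T -> R) (k : nat) (th : T) : R :=
  if k is k'.+1 then c 0%N th * d k th + cauchy (fun i => c i.+1) d k' th
  else c 0%N th * d 0%N th.

(** Induction on the identity [n (f g - c0 d0) = c0 n (g - d0) + n (f - c0) g]. *)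
Lemma expnM N f g c d : expn N f c -> expn N g d ->
  expn N (fun n th => f n th * g n th) (cauchy c d).
Proof.
elim: N f g c d => [|N IH] f g c d; first exact: bounded_expnM.
move=> [pc hf] /[dup] /expn_le hg' [pd hg]; split; first exact: polybM.
have := expnD (expnZ pc hg) (IH _ _ _ _ hf hg').
by apply: eq_expn => n th _ /=; ring.
Qed.

Lemma expn_remainder N f c : expn N f c -> exists C, exists2 L : nat, 0 <= C & forall n th, n != 0 ->
  `|f n th - \sum_(i < N) n%:~R ^- i * c i th| <= C * rho th ^+ L * `|n%:~R| ^- N.
Proof.
elim: N f c => [|N IH] f c /=.
  move=> [C [L C0 hC]]; exists C, L => // n th n0.
  by rewrite big_ord0 subr0 expr0 invr1 mulr1 hC.
move=> [p /IH [C [L C0 hC]]]; exists C, L => // n th n0.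
have n0' : n%:~R != 0 :> R by rewrite intr_eq0.
have := hC n th n0; rewrite big_ord_recl expr0 invr1 mul1r.
have -> : \sum_(i < N) n%:~R ^- (lift ord0 i) * c (lift ord0 i) th =
    n%:~R^-1 * \sum_(i < N) n%:~R ^- i * c i.+1 th.
  rewrite mulr_sumr; apply: eq_bigr => i _; rewrite /= /bump /= add1n exprS invfM; ring.
move: (\sum_(i < N) _) => S h.
have -> : f n th - (c 0%N th + n%:~R^-1 * S) = n%:~R^-1 * (n%:~R * (f n th - c 0%N th) - S).
  by field.
rewrite normrM normfV exprS invfM mulrCA ler_wpM2l ?invr_ge0 //.
Qed.

Lemma expnP N f c : (forall i, (i < N)%N -> polyb (c i)) ->
  (exists C, exists2 L : nat, 0 <= C & forall n th, n != 0 ->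
  `|f n th - \sum_(i < N) n%:~R ^- i * c i th| <= C * rho th ^+ L * `|n%:~R| ^- N) -> expn N f c.
Proof.
elim: N f c => [|N IH] f c pc [C [L C0 hC]] /=.
  exists C, L => // n th n0; have := hC n th n0.
  by rewrite big_ord0 subr0 expr0 invr1 mulr1.
split; first exact: pc.
apply: IH => [i hi|]; first exact: pc.
exists C, L => // n th n0.
have n0' : n%:~R != 0 :> R by rewrite intr_eq0.
have := hC n th n0; rewrite big_ord_recl expr0 invr1 mul1r.
have -> : \sum_(i < N) n%:~R ^- (lift ord0 i) * c (lift ord0 i) th =
    n%:~R^-1 * \sum_(i < N) n%:~R ^- i * c i.+1 th.
  rewrite mulr_sumr; apply: eq_bigr => i _; rewrite /= /bump /= add1n exprS invfM; ring.
move: (\sum_(i < N) _) => S h.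
have -> : n%:~R * (f n th - c 0%N th) - S = n%:~R * (f n th - (c 0%N th + n%:~R^-1 * S)).
  by field.
have n1 : 0 < `|n%:~R : R| by rewrite normr_gt0.
rewrite normrM -ler_pdivlMl // mulrCA -invfM -exprS //.
Qed.

End Expansions.

(** * Expansion of real powers *)

Section PowerExpansion.
Context {R : realType} {T : Type} (rho : T -> R).
Hypothesis rho_ge1 : forall th, 1 <= rho th.
Variables (t : R) (v1 : int -> T -> R) (V : nat -> T -> R).
Hypothesis expn_v1 : forall N, expn rho N v1 V.

Let v (n : int) (th : T) : R := n%:~R^-1 * v1 n th.

Hypothesis v_bound : exists C, exists2 L : nat, 0 <= C &
  forall n th, n != 0 -> `|(1 + v n th) `^ t| <= C * (rho th * `|n%:~R|) ^+ L.

(** The Taylor quotient of [(1 + z)^t] after [m] terms, continued by its value at 0. At [z = v],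
    which carries a factor [1 / n], [binquotS] derives an expansion of the quotient for [m] from one
    of the quotient for [m + 1] that is one order shorter. *)
Definition binquot (m : nat) (z : R) : R :=
  if z == 0 then binr t m else binrem t m z / z ^+ m.

Lemma binquotS m z : binquot m z = binr t m + z * binquot m.+1 z.
Proof.
rewrite /binquot; have [->|z0] := eqVneq z 0; first by rewrite mul0r addr0.
rewrite /binrem big_ord_recr /= exprS; field.
by rewrite z0 expf_neq0.
Qed.

Lemma binquot0 z : binquot 0 z = (1 + z) `^ t.
Proof.
rewrite /binquot; have [->|z0] := eqVneq z 0; first by rewrite addr0 powR1.
by rewrite /binrem big_ord0 subr0 expr0 divr1.
Qed.

Lemma v_le : exists C, exists2 L : nat, 0 <= C & forall n th, n != 0 ->
  `|v n th| <= C * rho th ^+ L /\ (2^-1 < `|v n th| -> `|n%:~R| <= C * rho th ^+ L).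
Proof.
have [C [L C0 hC]] := expn_v1 0%N; exists (2 * C), L; first by rewrite mulr_ge0.
move=> n th n0; have n1 := @norm_int_ge1 R n n0; have h := hC n th n0.
have E : `|v n th| = `|v1 n th| / `|n%:~R| by rewrite /v normrM normfV mulrC.
have h0 : 0 <= C * rho th ^+ L by apply: le_trans h.
rewrite E; split.
  rewrite ler_pdivrMr; last exact: lt_le_trans n1.
  move: h h0 n1; rewrite -mulrA; move: (C * _) (`|v1 n th|) (`|n%:~R|) => x y z; nra.
rewrite ltr_pdivlMr; last exact: lt_le_trans n1.
rewrite -mulrA; move: h h0; move: (C * _) (`|v1 n th|) (`|n%:~R|) => x y z; lra.
Qed.

(** For [|v| <= 1/2] this is Taylor's formula. Otherwise [v_le] bounds [|n|] by a power of [rho],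
    and the crude bound [v_bound] becomes polynomial in [rho]. *)
Lemma binquot_bounded m : bounded_expn rho (fun n th => binquot m (v n th)).
Proof.
have [C [L C0 hC]] := v_bound; have [D [M D0 hD]] := v_le.
have [E E0 hE] := binrem_le m t.
pose S := \sum_(i < m) `|binr t i|.
have S0 : 0 <= S by apply: sumr_ge0.
pose K := (M * (L + m) + L)%N.
exists (`|binr t m| + E + 2 ^+ m * (C * D ^+ L + S * (1 + D) ^+ m)), K.
  by rewrite !addr_ge0 ?mulr_ge0 ?addr_ge0 ?exprn_ge0 ?mulr_ge0 ?exprn_ge0 ?addr_ge0.
move=> n th n0; rewrite /binquot.
have r1 : 1 <= rho th ^+ K by exact: rhoX_ge1.
have q0 : 0 <= 2 ^+ m * (C * D ^+ L + S * (1 + D) ^+ m).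
  by rewrite !mulr_ge0 ?addr_ge0 ?exprn_ge0 ?mulr_ge0 ?exprn_ge0 ?addr_ge0.
case: eqP => [_|/eqP vn0].
  apply: le_trans (_ : `|binr t m| * 1 <= _); first by rewrite mulr1.
  by apply: ler_pM => //; rewrite -addrA lerDl addr_ge0.
have vm : 0 < `|v n th| ^+ m by rewrite exprn_gt0 // normr_gt0.
rewrite normrM normfV normrX.
have [h|h] := leP `|v n th| 2^-1.
  rewrite ler_pdivrMr //; apply: le_trans (hE _ h) _; rewrite ler_wpM2r ?(ltW vm) //.
  apply: le_trans (_ : E * 1 <= _); first by rewrite mulr1.
  by apply: ler_pM => //; rewrite addrAC lerDr addr_ge0.
have [d1 d2] := hD n th n0; have {}d2 := d2 h.
have i0 : (`|v n th| ^+ m)^-1 <= 2 ^+ m.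
  rewrite -exprVn lerXn2r ?nnegrE ?invr_ge0 // invf_ple ?posrE ?normr_gt0 //; exact: ltW.
have rK (i : nat) : (i <= K)%N -> rho th ^+ i <= rho th ^+ K by exact: rhoX_le.
have rX i : 0 <= rho th ^+ i by apply: le_trans (rhoX_ge1 rho_ge1 th i).
apply: le_trans (_ : (C * D ^+ L + S * (1 + D) ^+ m) * rho th ^+ K * 2 ^+ m <= _); last first.
  rewrite [_ * 2 ^+ m]mulrC mulrA ler_wpM2r //.
  by rewrite lerDr addr_ge0.
apply: ler_pM; rewrite ?invr_ge0 ?exprn_ge0 //.
rewrite /binrem; apply: le_trans (ler_normB _ _) _; rewrite mulrDl; apply: lerD.
  apply: le_trans (hC n th n0) _; rewrite -mulrA ler_wpM2l //.
  apply: le_trans (_ : (rho th * (D * rho th ^+ M)) ^+ L <= _).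
    rewrite lerXn2r ?nnegrE ?mulr_ge0 ?(rho_ge0 rho_ge1) //.
    by rewrite ler_wpM2l // (rho_ge0 rho_ge1).
  rewrite mulrCA -exprS exprMn -exprM; apply: ler_wpM2l; first exact: exprn_ge0.
  by apply: rK; rewrite mulSn /K mulnDr addnC leq_add2r leq_addr.
apply: le_trans (ler_norm_sum _ _ _) _.
rewrite /S !mulr_suml; apply: ler_sum => i _; rewrite normrM -mulrA ler_wpM2l // normrX.
apply: le_trans (_ : (1 + D) ^+ i * rho th ^+ (M * i) <= _).
  rewrite exprM -exprMn lerXn2r ?nnegrE ?mulr_ge0 ?addr_ge0 //.
  by apply: le_trans d1 _; rewrite ler_wpM2r // lerDr.
apply: ler_pM => //; first by rewrite exprn_ge0 // addr_ge0.
  by rewrite ler_weXn2l ?lerDl // ltnW.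
apply: rK; rewrite /K mulnDr -addnA addnCA.
apply: leq_trans (leq_addr _ _); by rewrite leq_mul2l ltnW ?orbT.
Qed.

(** The coefficients of [binquot m]. In the recursion [m] grows while the index decreases, hence the
    fuel; its amount is immaterial once it exceeds the index ([powc_fuel]). *)
Fixpoint powc (fuel m : nat) : nat -> T -> R :=
  if fuel is f.+1 then
    fun k => if k is k'.+1 then cauchy V (powc f m.+1) k' else fun=> binr t m
  else fun _ _ => 0.

Lemma expn_binquot N m : expn rho N (fun n th => binquot m (v n th)) (powc N m).
Proof.
elim: N m => [|N IH] m; first exact: binquot_bounded.
split; first exact: polyb_cst.
have := expnM rho_ge1 (expn_v1 N) (IH m.+1).
apply: eq_expn => n th n0; rewrite (binquotS m) -[powc N.+1 m 0 th]/(binr t m) addrAC subrr add0r /v.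
by rewrite !mulrA mulfV ?mul1r // intr_eq0.
Qed.

Lemma cauchy_ext (c d d' : nat -> T -> R) k : (forall j, (j <= k)%N -> d j =1 d' j) ->
  cauchy c d k =1 cauchy c d' k.
Proof.
elim: k c => [|k IH] c h th /=; first by rewrite h.
rewrite h // (IH _ (fun j hj => h j (leqW hj))) //.
Qed.

Lemma powc_fuel k : forall f f' m, (k < f)%N -> (k < f')%N -> powc f m k =1 powc f' m k.
Proof.
have [n hn] := ubnP k; elim: n k hn => // n IH k hk [|f] [|f'] m //= kf kf'.
case: k hk kf kf' => [//|k] hk kf kf'; apply: cauchy_ext => j hj.
by apply: IH; lia.
Qed.

Definition powcoef (k : nat) : T -> R := powc k.+1 0 k.

Lemma expn_pow N : expn rho N (fun n th => (1 + v n th) `^ t) powcoef.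
Proof.
apply: eq_expn (eq_expnc _ (expn_binquot N 0)).
  by move=> n th _; rewrite binquot0.
by move=> i hi; apply: powc_fuel.
Qed.

End PowerExpansion.

(** * Powers of ratios of eigenvalues *)

Section WeightRatio.
Context {R : realType} {T : Type} (rho : T -> R).
Hypothesis rho_ge1 : forall th, 1 <= rho th.
Variables (eps : bool) (a : T -> int) (t : R).
Hypothesis a_le : forall th, `|(a th)%:~R| <= rho th.

Local Notation e := (eps%:R : R).

Definition wratio (n : int) (th : T) : R := ((e + (n + a th)%:~R ^+ 2) / n%:~R ^+ 2) `^ t.

Definition wlin (i : nat) (th : T) : R :=
  match i with 0%N => 2 * (a th)%:~R | 1%N => (a th)%:~R ^+ 2 + e | _ => 0 end.

Lemma polyb_a : polyb rho (fun th => (a th)%:~R).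
Proof. by exists 1, 1%N => // th; rewrite mul1r expr1. Qed.

Lemma expn_wlin N : expn rho N (fun n th => 2 * (a th)%:~R + n%:~R^-1 * ((a th)%:~R ^+ 2 + e)) wlin.
Proof.
have p0 : polyb rho (fun th => 2 * (a th)%:~R).
  by apply: polybM => //; [exact: polyb_cst|exact: polyb_a].
have p1 : polyb rho (fun th => (a th)%:~R ^+ 2 + e).
  apply: polybD => //; last exact: polyb_cst.
  apply: (polyb_le (b := fun th => (a th)%:~R * (a th)%:~R)); last by move=> th; rewrite expr2.
  by apply: polybM => //; exact: polyb_a.
apply: expnP => [i _|].
  by case: i => [|[|i]] //=; exact: polyb_cst.
case: N => [|[|N]].
- have [C [L C0 hC]] := polybD rho_ge1 p0 (polyb_cst rho 0).
  have [D [M D0 hD]] := p1; exists (C + D), (L + M)%N; first exact: addr_ge0.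
  move=> n th n0; rewrite big_ord0 subr0 expr0 invr1 mulr1.
  apply: le_trans (ler_normD _ _) _; rewrite [leRHS]mulrDl; apply: lerD.
    have := hC th; rewrite addr0 => h; apply: le_trans h _.
    by rewrite ler_wpM2l // rhoX_le // leq_addr.
  rewrite normrM normfV; apply: le_trans (_ : 1 * (D * rho th ^+ M) <= _).
    rewrite ler_pM ?invr_ge0 // ?hD // invf_le1 ?norm_int_ge1 //.
    by rewrite normr_gt0 intr_eq0.
  by rewrite mul1r ler_wpM2l // rhoX_le // leq_addl.
- have [D [M D0 hD]] := p1; exists D, M => // n th n0.
  rewrite big_ord_recl big_ord0 expr0 invr1 mul1r addr0 /= addrAC subrr add0r.
  by rewrite normrM normfV mulrC expr1 ler_wpM2r ?invr_ge0 // hD.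
- exists 0, 0%N => // n th n0; rewrite !big_ord_recl big1 => [|i _]; last by rewrite mulr0.
  rewrite /= expr0 invr1 mul1r addr0 expr1 subrr normr0 !mul0r //.
Qed.

Lemma wratioE n th : n != 0 ->
  (e + (n + a th)%:~R ^+ 2) / n%:~R ^+ 2 = 1 + n%:~R^-1 * (2 * (a th)%:~R + n%:~R^-1 * ((a th)%:~R ^+ 2 + e)).
Proof.
move=> n0; have n0' : n%:~R != 0 :> R by rewrite intr_eq0.
by rewrite intrD; field.
Qed.

Lemma powR_two_sided (X B : R) (K : nat) : `|t| <= K%:R -> 1 <= B -> 0 < X -> X <= B -> B^-1 <= X ->
  X `^ t <= B ^+ K.
Proof.
move=> tK B1 X0 XB BX; have B0 : 0 < B by exact: lt_le_trans B1.
rewrite -powR_mulrn ?(ltW B0) // /powR !gt_eqF // ler_expR.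
have lB : 0 <= ln B by rewrite ln_ge0.
have h : `|ln X| <= ln B.
  rewrite ler_norml; apply/andP; split; last by rewrite ler_ln ?posrE.
  by rewrite -lnV ?posrE // ler_ln ?posrE // invr_gt0.
apply: le_trans (ler_norm _) _; rewrite normrM.
by apply: ler_pM.
Qed.

(** A nonzero ratio lies between [1 / B] and [B] for [B = 5 (rho |n|)^2], which bounds its powers of
    either sign. For the lower bound, the numerator is an integer, hence at least 1 when it is
    positive. *)
Lemma wratio_bound : exists C, exists2 L : nat, 0 <= C & forall n th, n != 0 ->
  `|wratio n th| <= C * (rho th * `|n%:~R|) ^+ L.
Proof.
pose K := (Num.truncn `|t|).+1.
have tK : `|t| <= K%:R.
  by apply: ltW; have /andP[] := Num.Theory.truncn_itv (normr_ge0 t).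
exists (5 ^+ K), (2 * K)%N; first by rewrite exprn_ge0.
move=> n th n0; rewrite exprM -exprMn ger0_norm ?powR_ge0 //.
have n1 := @norm_int_ge1 R n n0; have r1 := rho_ge1 th; have al := a_le th.
set B := 5 * _; rewrite /wratio.
have n2 : 0 < n%:~R ^+ 2 :> R by rewrite exprn_even_gt0 //= intr_eq0.
have n21 : 1 <= n%:~R ^+ 2 :> R by rewrite -real_normK ?num_real // exprn_ege1.
have r2 : 1 <= rho th ^+ 2 by rewrite exprn_ege1.
have BE : B = 5 * (rho th ^+ 2 * n%:~R ^+ 2) by rewrite /B exprMn real_normK ?num_real.
have B1 : 1 <= B by rewrite BE; move: (rho th ^+ 2) (n%:~R ^+ 2) r2 n21 => x y; nra.
set X := _ / _.
have X0 : 0 <= X by rewrite divr_ge0 ?addr_ge0 ?sqr_ge0 // ler0n.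
have XB : X <= B.
  rewrite /X ler_pdivrMr // BE intrD.
  have e1 : e <= 1 by case: (eps).
  have a2 : (a th)%:~R ^+ 2 <= rho th ^+ 2 :> R by rewrite -real_normK ?num_real // lerXn2r ?nnegrE // (le_trans ler01).
  apply: le_trans (_ : 5 * (rho th ^+ 2 * n%:~R ^+ 2) * 1 <= _); last first.
    by rewrite ler_wpM2l // mulr_ge0 // mulr_ge0 // ltW // (lt_le_trans ltr01).
  move: (n%:~R : R) ((a th)%:~R : R) (rho th ^+ 2) (e : R) n21 r2 e1 a2 => x y z w h1 h2 h3 h4.
  have : x ^+ 2 <= z * x ^+ 2 by rewrite ler_peMl // (le_trans ler01).
  have : z <= z * x ^+ 2 by rewrite ler_peMr // (le_trans ler01).
  have : 0 <= (x - y) ^+ 2 by rewrite sqr_ge0.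
  rewrite sqrrB sqrrD; move: (z * x ^+ 2) => zx; move: (x ^+ 2) (y ^+ 2) (x * y) h1 h4 => x2 y2 xy; lra.
move: X0; rewrite le_eqVlt => /predU1P[X0|X0].
  (* Without the summand [eps] the numerator vanishes at [n = - a th]; the power is then 0 or 1 by
     convention. *)
  rewrite -X0 /powR eqxx; apply: le_trans (exprn_ege1 K B1); by case: eqP => //= _; rewrite ler01.
apply: powR_two_sided => //.
apply: le_trans (_ : (n%:~R ^+ 2)^-1 <= _).
  rewrite lef_pV2 ?posrE //; last exact: lt_le_trans B1.
  by rewrite BE; move: (rho th ^+ 2) (n%:~R ^+ 2) r2 n21 => x y; nra.
rewrite /X -[leLHS]mul1r ler_wpM2r ?invr_ge0 ?(ltW n2) //.
have : 0 < e + (n + a th)%:~R ^+ 2.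
  by move: X0; rewrite /X pmulr_lgt0 // invr_gt0.
have -> : e + (n + a th)%:~R ^+ 2 = ((eps : nat)%:Z + (n + a th) ^+ 2)%:~R.
  by rewrite intrD -rmorphXn.
by rewrite -[1]/(1%:~R) ltr0z ler_int gtz0_ge1.
Qed.

Definition wcoef : nat -> T -> R := powcoef t wlin.

Lemma expn_wratio N : expn rho N wratio wcoef.
Proof.
have h n th : n != 0 -> (1 + n%:~R^-1 * (2 * (a th)%:~R + n%:~R^-1 * ((a th)%:~R ^+ 2 + e))) `^ t = wratio n th.
  by move=> n0; rewrite /wratio wratioE.
apply: (eq_expn h); apply: expn_pow => //; first exact: expn_wlin.
have [C [L C0 hC]] := wratio_bound; exists C, L => // n th n0.
by rewrite h // hC.
Qed.

Lemma wcoef0 th : wcoef 0 th = 1. Proof. by []. Qed.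
Lemma wcoef1 th : wcoef 1 th = 2 * t * (a th)%:~R.
Proof. by rewrite /wcoef /powcoef /=; field. Qed.
Lemma wcoef2 th : wcoef 2 th = t * e + t * (2 * t - 1) * (a th)%:~R ^+ 2.
Proof. by rewrite /wcoef /powcoef /=; field. Qed.

End WeightRatio.

(** * Changing a kernel where the parameters dominate the frequency *)

Section ExpansionComplements.
Context {R : realType} {T : Type} (rho : T -> R).
Hypothesis rho_ge1 : forall th, 1 <= rho th.

(** Where [f] is nonzero, [(rho / |n|)^N] is at least 1, so a bound on [f] is already a remainder of
    order [N]. *)
Lemma expn_supp N f : bounded_expn rho f ->
  (forall n th, n != 0 -> f n th != 0 -> `|n%:~R| <= rho th) -> expn rho N f (fun _ _ => 0).
Proof.
move=> [C [L C0 hC]] hs; apply: expnP => [i _|]; first exact: polyb_cst.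
exists C, (L + N)%N => // n th n0.
rewrite big1 ?subr0 => [|i _]; last by rewrite mulr0.
have [->|f0] := eqVneq (f n th) 0.
  by rewrite normr0 mulr_ge0 ?invr_ge0 ?exprn_ge0 // mulr_ge0 ?exprn_ge0 // (rho_ge0 rho_ge1).
rewrite ler_pdivlMr ?exprn_gt0 ?normr_gt0 ?intr_eq0 // exprD mulrA.
apply: ler_pM; [by []|by []|exact: hC|].
by rewrite lerXn2r ?nnegrE ?(rho_ge0 rho_ge1) // hs.
Qed.

(** The change is supported in [|n| <= rho], so by [expn_supp] its expansion is zero. This allows a
    row to be removed from a kernel. *)
Lemma expn_discard N f c (bad : int -> T -> bool) : expn rho N f c ->
  (forall n th, bad n th -> `|n%:~R| <= rho th) ->
  expn rho N (fun n th => if bad n th then 0 else f n th) c.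
Proof.
move=> hf hb.
have hg : expn rho N (fun n th => if bad n th then - f n th else 0) (fun _ _ => 0).
  apply: expn_supp => [|n th _].
    apply: bounded_expn_le (expn_bounded rho_ge1 hf) _ => n th _.
    by case: ifP; rewrite ?normrN ?normr0.
  by case: ifP => [/hb //|]; rewrite eqxx.
have := expnD rho_ge1 hf hg => h.
have {}h := eq_expnc (d := c) (fun i _ th => addr0 (c i th)) h.
by apply: eq_expn h => n th _; case: ifP; rewrite ?subrr ?addr0.
Qed.

End ExpansionComplements.

(** * The scalar kernel of the curvature *)

Section CurvatureKernel.
Context {R : realType}.
Variables (k : loops) (s : R).
Hypothesis s_gt0 : 0 < s.

Local Notation T := (int * int)%type.

Definition rho2 (th : T) : R := jap th.1 * jap th.2.

Lemma rho2_ge1 th : 1 <= rho2 th.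
Proof. by rewrite /rho2 mulr_ege1 ?jap_ge1. Qed.

Lemma jap_norm (n : int) : `|n%:~R| <= jap n :> R.
Proof. by rewrite -intr_norm -natr_absz /jap lerDr. Qed.

Lemma rho2_snd th : `|th.2%:~R| <= rho2 th.
Proof. apply: le_trans (jap_norm _) _; rewrite /rho2; apply: ler_peMl; [exact: jap_ge0|exact: jap_ge1]. Qed.
Lemma rho2_add th : `|(th.1 + th.2)%:~R| <= rho2 th.
Proof. exact: le_trans (jap_norm _) (japD _ _). Qed.
Lemma rho2_zero (th : T) : `|0%:~R| <= rho2 th.
Proof. by rewrite normr0; apply: le_trans (rho2_ge1 th). Qed.

Definition eps : bool := if k is Free then true else false.

Lemma weightE (t : R) n : weight k t n = (eps%:R + n%:~R ^+ 2) `^ t.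
Proof. by rewrite /weight /eps; case: k; rewrite ?add0r. Qed.

Lemma weight_ge0 (t : R) n : 0 <= weight k t n.
Proof. by rewrite weightE powR_ge0. Qed.

Lemma weightN (t : R) n : weight k (- t) n = (weight k t n)^-1.
Proof. by rewrite !weightE powRN. Qed.

(* The kernel of 2 nabla_X is ad (x_(p - q)) gker p q, except in the row p = 0 for based loops. *)
Definition gker (p q : int) : R := 1 + (weight k s q - weight k s (p - q)) * weight k (- s) p.

(* The kernel of the curvature from frequency n to n + th.1 + th.2. *)
Definition hker (n : int) (th : T) : R :=
  4^-1 * (gker (n + (th.1 + th.2)) (n + th.2) * gker (n + th.2) n
          - 2 * gker (n + (th.1 + th.2)) n).

Definition hpow (n : int) : R := (n%:~R ^+ 2) `^ (- s).

Let ab (th : T) := th.1 + th.2.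
Let bb (th : T) := th.2.
Let zz (th : T) : int := 0.

(** In [gker (n + al) (n + be)] the powers of [n] cancel from the ratio of the eigenvalues at the
    two frequencies, which gives [g0]. The eigenvalue at the difference [al - be] does not involve
    [n]; divided by the one at [n + al], it leaves [|n|^(-2s)] times [g1] ([gkerE]). *)
Definition g0 (al be : T -> int) n th : R := 1 + wratio eps be s n th * wratio eps al (- s) n th.
Definition g1 (al : T -> int) n th : R := wratio eps al (- s) n th.

Lemma wratio_weight (al : T -> int) (t : R) n th : n != 0 ->
  weight k t (n + al th) = wratio eps al t n th * (n%:~R ^+ 2) `^ t.
Proof.
move=> n0; have n2 : 0 < n%:~R ^+ 2 :> R by rewrite exprn_even_gt0 //= intr_eq0.
rewrite weightE /wratio -powRM ?divr_ge0 ?addr_ge0 ?sqr_ge0 ?ler0n //.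
by rewrite divfK // lt0r_neq0.
Qed.

Lemma gkerE al be n th : n != 0 ->
  gker (n + al th) (n + be th) = g0 al be n th - weight k s (al th - be th) * (hpow n * g1 al n th).
Proof.
move=> n0; rewrite /gker mulrBl !wratio_weight // /g0 /g1 /hpow.
have n2 : n%:~R ^+ 2 != 0 :> R by rewrite expf_neq0 // intr_eq0.
have e : (n%:~R ^+ 2) `^ s * (n%:~R ^+ 2) `^ (- s) = 1 :> R.
  by rewrite powRN divff // powR_eq0 negb_and n2.
have -> : n + al th - (n + be th) = al th - be th by lia.
rewrite mulrACA e mulr1; ring.
Qed.

(** The products in [hker] expanded by [gkerE] and sorted by the number of factors [|n|^(-2s)]. *)
Definition hk (i : nat) (n : int) (th : T) : R :=
  match i with
  | 0%N => 4^-1 * (g0 ab bb n th * g0 bb zz n th + (- 2) * g0 ab zz n th)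
  | 1%N => 4^-1 * ((- weight k s th.1) * (g1 ab n th * g0 bb zz n th)
        + ((- weight k s th.2) * (g0 ab bb n th * g1 bb n th)
        + (2 * weight k s (th.1 + th.2)) * g1 ab n th))
  | _ => 4^-1 * ((weight k s th.1 * weight k s th.2) * (g1 ab n th * g1 bb n th))
  end.

Lemma hkerE n th : n != 0 -> hker n th = hk 0 n th + hpow n * hk 1 n th + hpow n ^+ 2 * hk 2 n th.
Proof.
move=> n0; rewrite /hker.
have := @gkerE ab bb n th n0; have := @gkerE bb zz n th n0; have := @gkerE ab zz n th n0.
rewrite /ab /bb /zz !addr0 ?subr0 addrK => e1 e2 e3; rewrite e1 e2 e3 /hk; ring.
Qed.

Definition g0c (al be : T -> int) (i : nat) th : R :=
  cst_coef (fun=> 1) i th + cauchy (wcoef eps be s) (wcoef eps al (- s)) i th.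

Definition hc (j : nat) : nat -> T -> R :=
  match j with
  | 0%N => fun i th => 4^-1 * (cauchy (g0c ab bb) (g0c bb zz) i th + (- 2) * g0c ab zz i th)
  | 1%N => fun i th => 4^-1 * ((- weight k s th.1) * cauchy (wcoef eps ab (- s)) (g0c bb zz) i th
        + ((- weight k s th.2) * cauchy (g0c ab bb) (wcoef eps bb (- s)) i th
        + (2 * weight k s (th.1 + th.2)) * wcoef eps ab (- s) i th))
  | _ => fun i th => 4^-1 * ((weight k s th.1 * weight k s th.2) *
                        cauchy (wcoef eps ab (- s)) (wcoef eps bb (- s)) i th)
  end.

Lemma weight_le_jap : exists K : nat, forall n, weight k s n <= jap n ^+ K.
Proof.
pose K := (Num.truncn s).+1.
have sK : s <= K%:R by apply: ltW; have /andP[] := Num.Theory.truncn_itv (ltW s_gt0).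
exists (2 * K)%N => n; rewrite weightE exprM -powR_mulrn ?exprn_ge0 ?jap_ge0 //.
have j1 : 1 <= jap n ^+ 2 :> R by rewrite exprn_ege1 // jap_ge1.
apply: le_trans (_ : (jap n ^+ 2) `^ s <= _); last exact: ler_powR.
apply: ge0_ler_powR; rewrite ?nnegrE ?addr_ge0 ?sqr_ge0 ?ler0n ?exprn_ge0 ?jap_ge0 ?(ltW s_gt0) //.
rewrite /jap -(@real_normK _ n%:~R) ?num_real // -intr_norm -natr_absz.
have : (eps%:R : R) <= 1 by case: eps.
have : 0 <= `|n|%N%:R :> R by []; move: (`|n|%N%:R : R) (eps%:R : R) => x y; nra.
Qed.

Lemma polyb_weight (a : T -> int) : (forall th, jap (a th) <= rho2 th) ->
  polyb rho2 (fun th => weight k s (a th)).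
Proof.
move=> ha; have [K hK] := weight_le_jap; exists 1, K => // th.
rewrite mul1r ger0_norm ?weight_ge0 //; apply: le_trans (hK _) _.
by rewrite lerXn2r ?nnegrE ?jap_ge0 // (rho_ge0 rho2_ge1).
Qed.

Lemma polyb_w1 : polyb rho2 (fun th => weight k s th.1).
Proof. by apply: polyb_weight => th; apply: ler_peMr; [exact: jap_ge0|exact: jap_ge1]. Qed.
Lemma polyb_w2 : polyb rho2 (fun th => weight k s th.2).
Proof. by apply: polyb_weight => th; apply: ler_peMl; [exact: jap_ge0|exact: jap_ge1]. Qed.
Lemma polyb_w12 : polyb rho2 (fun th => weight k s (th.1 + th.2)).
Proof. by apply: polyb_weight => th; exact: japD. Qed.
Lemma polybN (a : T -> R) : polyb rho2 a -> polyb rho2 (fun th => - a th).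
Proof. by move=> h; apply: polyb_le h _ => th; rewrite normrN. Qed.

Lemma expn_g0 al be N : (forall th, `|(al th)%:~R| <= rho2 th) -> (forall th, `|(be th)%:~R| <= rho2 th) ->
  expn rho2 N (g0 al be) (g0c al be).
Proof.
move=> ha hb; apply: (expnD rho2_ge1); first exact: expn_cst (polyb_cst rho2 1).
by apply: (expnM rho2_ge1); apply: expn_wratio => //; exact: rho2_ge1.
Qed.

Lemma expn_g1 al N : (forall th, `|(al th)%:~R| <= rho2 th) ->
  expn rho2 N (g1 al) (wcoef eps al (- s)).
Proof. by move=> ha; apply: expn_wratio => //; exact: rho2_ge1. Qed.

Lemma expn_hk j N : expn rho2 N (hk j) (hc j).
Proof.
have r1 := rho2_ge1.
have p4 : polyb rho2 (fun=> 4^-1) by exact: polyb_cst.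
have Gab := expn_g0 (al := ab) (be := bb) N rho2_add rho2_snd.
have Gbz := expn_g0 (al := bb) (be := zz) N rho2_snd rho2_zero.
have Gaz := expn_g0 (al := ab) (be := zz) N rho2_add rho2_zero.
have Wab := expn_g1 (al := ab) N rho2_add.
have Wb := expn_g1 (al := bb) N rho2_snd.
case: j => [|[|j]].
- exact: (expnZ p4 (expnD r1 (expnM r1 Gab Gbz) (expnZ (polyb_cst rho2 (- 2)) Gaz))).
- have A1 := expnZ (polybN polyb_w1) (expnM r1 Wab Gbz).
  have A2 := expnZ (polybN polyb_w2) (expnM r1 Gab Wb).
  have A3 := expnZ (polybM (polyb_cst rho2 2) polyb_w12) Wab.
  exact: (expnZ p4 (expnD r1 A1 (expnD r1 A2 A3))).
- exact: (expnZ p4 (expnZ (polybM polyb_w1 polyb_w2) (expnM r1 Wab Wb))).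
Qed.

Lemma hc00 th : hc 0 0 th = 0.
Proof. by rewrite /hc /g0c /= !wcoef0; field. Qed.

(** The coefficient of [1 / n] in [g0 al be] is [2 s (be - al)]. It is additive along the path from
    [n] through [n + b] to [n + a + b], so the product of the two steps and twice the direct step
    agree to this order. *)
Lemma hc01 th : hc 0 1 th = 0.
Proof.
rewrite /hc /g0c /= !wcoef0 !wcoef1 /ab /bb /zz intrD; by field.
Qed.

Lemma hc02 th : hc 0 2 th = - (s ^+ 2 * th.1%:~R * th.2%:~R).
Proof.
rewrite /hc /g0c /= !wcoef0 !wcoef1 !wcoef2 /ab /bb /zz intrD; by field.
Qed.

Lemma hc10 th : hc 1 0 th = - 2^-1 * (weight k s th.1 + weight k s th.2 - weight k s (th.1 + th.2)).
Proof. by rewrite /hc /g0c /= !wcoef0; field. Qed.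

Lemma hpow_le1 n : n != 0 -> 0 <= hpow n <= 1.
Proof.
move=> n0; rewrite /hpow powR_ge0 /= powRN invf_le1; last first.
  by rewrite powR_gt0 // exprn_even_gt0 //= intr_eq0.
have n21 : 1 <= n%:~R ^+ 2 :> R by rewrite -real_normK ?num_real // exprn_ege1 // norm_int_ge1.
by have := ler_powR n21 (ltW s_gt0); rewrite powRr0.
Qed.

Lemma bounded_hker : bounded_expn rho2 hker.
Proof.
have b j := expn_bounded rho2_ge1 (expn_hk j 0).
have p1 : bounded_expn rho2 (fun n _ => hpow n).
  by exists 1, 0%N => // n th n0; have /andP[h0 h1] := hpow_le1 n0; rewrite ger0_norm // mulr1.
have b1 := bounded_expnM p1 (b 1%N); have b2 := bounded_expnM (bounded_expnM p1 p1) (b 2%N).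
apply: bounded_expn_le (bounded_expnD rho2_ge1 (bounded_expnD rho2_ge1 (b 0%N) b1) b2) _ => n th n0.
by rewrite hkerE // expr2.
Qed.

(** The base [eps + n^2] is a natural number, hence 0 or at least 1; at 0 the power is 0 by
    convention. *)
Lemma weightNs_le1 n : weight k (- s) n <= 1.
Proof.
rewrite weightN weightE; set X := _ + _.
have [X0|X0] := eqVneq X 0; first by rewrite X0 powR0 ?invr0 ?ler01 // lt0r_neq0.
have X1 : 1 <= X.
  move: X0; rewrite /X; have -> : eps%:R + n%:~R ^+ 2 = ((eps : nat)%:Z + n ^+ 2)%:~R :> R.
    by rewrite intrD -rmorphXn.
  by rewrite intr_eq0 -[1]/(1%:~R) ler_int; have := sqr_ge0 n; case: eps => /=; lia.
rewrite invf_le1 ?powR_gt0 ?(lt_le_trans ltr01) //.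
by have := ler_powR X1 (ltW s_gt0); rewrite powRr0.
Qed.

(** Expansions in [1 / n] say nothing at [n = 0], a value that the frequency [n + c] takes after
    localization. *)
Lemma polyb_hker0 : polyb rho2 (hker 0).
Proof.
have G (p q : T -> int) : (forall th, jap (q th) <= rho2 th) -> (forall th, jap (p th - q th) <= rho2 th) ->
    polyb rho2 (fun th => gker (p th) (q th)).
  move=> hq hpq.
  have A := polybD rho2_ge1 (polyb_weight hq) (polybN (polyb_weight hpq)).
  have B : polyb rho2 (fun th => weight k (- s) (p th)).
    apply: (polyb_le (b := fun=> 1)); first exact: polyb_cst.
    by move=> th; rewrite normr1 ger0_norm ?weight_ge0 ?weightNs_le1.
  exact: (polybD rho2_ge1 (polyb_cst rho2 1) (polybM A B)).
have j1 th : jap th.1 <= rho2 th by apply: ler_peMr; [exact: jap_ge0|exact: jap_ge1].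
have j2 th : jap th.2 <= rho2 th by apply: ler_peMl; [exact: jap_ge0|exact: jap_ge1].
have j0 th : jap 0 <= rho2 th by rewrite /jap addr0 rho2_ge1.
have j12 th : jap (th.1 + th.2) <= rho2 th by exact: japD.
have G1 : polyb rho2 (fun th => gker (0 + (th.1 + th.2)) (0 + th.2)).
  by apply: (G (fun th => 0 + (th.1 + th.2)) (fun th => 0 + th.2)) => th; rewrite ?add0r ?addrK.
have G2 : polyb rho2 (fun th => gker (0 + th.2) 0).
  by apply: (G (fun th => 0 + th.2) (fun=> 0)) => th; rewrite ?add0r ?subr0.
have G3 : polyb rho2 (fun th => gker (0 + (th.1 + th.2)) 0).
  by apply: (G (fun th => 0 + (th.1 + th.2)) (fun=> 0)) => th; rewrite ?add0r ?subr0.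
have r1 := rho2_ge1.
exact: (polybM (polyb_cst rho2 4^-1) (polybD r1 (polybM G1 G2) (polybN (polybM (polyb_cst rho2 2) G3)))).
Qed.

End CurvatureKernel.

(** * The scalar kernel for based loops and s = 1 *)

Section BasedOne.
Context {R : realType}.

Lemma gker_based1 (p q : int) : p != 0 -> gker Based (1 : R) p q = 2 * q%:~R / p%:~R.
Proof.
move=> p0; have p0' : p%:~R != 0 :> R by rewrite intr_eq0.
rewrite /gker weightN /weight !powRr1 ?sqr_ge0 // intrB; field.
by [].
Qed.

(** By [gker_based1] the kernel is [2 q / p]; along the path from [n] through [n + b] to [n + a + b]
    the intermediate frequency cancels, and the product of the steps is twice the direct step. *)
Lemma hker_based1 n (th : int * int) : n + th.2 != 0 -> n + (th.1 + th.2) != 0 -> hker Based (1 : R) n th = 0.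
Proof.
move=> h1 h2; rewrite /hker !gker_based1 //.
have h1' : (n + th.2)%:~R != 0 :> R by rewrite intr_eq0.
have h2' : (n + (th.1 + th.2))%:~R != 0 :> R by rewrite intr_eq0.
move: ((n + th.2)%:~R : R) ((n + (th.1 + th.2))%:~R : R) h1' h2' => x y x0 y0.
by field; rewrite x0 y0.
Qed.

End BasedOne.

(** * Expansion of the kernel at a shifted frequency *)

Section Shift.
Context {R : realType}.
Variable s : R.
Hypothesis s_gt0 : 0 < s.

Definition dterm (j i : nat) (n : int) : R := `|n|%N%:R `^ (- (2 * s * j%:R)) * n%:~R ^- i.

Definition dexp (j i : nat) : R := - (2 * s * j%:R) - i%:R.

Lemma hpowE n j : hpow s n ^+ j = `|n|%N%:R `^ (- (2 * s * j%:R)).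
Proof.
rewrite /hpow -powR_mulrn ?powR_ge0 // -powRrM natr_absz intr_norm.
rewrite -(@real_normK _ n%:~R) ?num_real // -powR_mulrn // -powRrM.
by congr (_ `^ _); ring.
Qed.

(** This includes [n = 0], where real powers are 0 or 1 and the inverse of 0 is 0; the value occurs
    as [n + c]. *)
Lemma norm_dterm_le1 j i n : `|dterm j i n| <= 1.
Proof.
rewrite /dterm normrM; have [->|n0] := eqVneq n 0.
  rewrite absz0 (_ : 0%:~R = 0 :> R) // ger0_norm ?powR_ge0 //.
  have h1 (t : R) : 0 `^ t <= 1 by rewrite /powR eqxx; case: eqP => //= _; rewrite ler01.
  have h2 : `|0 ^- i : R| <= 1.
    by case: (i) => [|l]; rewrite ?expr0 ?invr1 ?normr1 // exprS mul0r invr0 normr0 ler01.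
  exact: (mulr_ile1 (powR_ge0 _ _) (normr_ge0 _) (h1 _) h2).
have n1 := @norm_int_ge1 R n n0.
apply: mulr_ile1 => //.
  rewrite ger0_norm ?powR_ge0 //.
  have hn : 1 <= (`|n|%N%:R : R) by rewrite natr_absz intr_norm.
  have hs : - (2 * s * j%:R) <= 0 by rewrite oppr_le0 mulr_ge0 // mulr_ge0 // ltW.
  by have := ler_powR hn hs; rewrite powRr0.
by rewrite normfV normrX invf_le1 ?exprn_ege1 // exprn_gt0 // (lt_le_trans ltr01).
Qed.

Lemma dterm_exp j i n : n != 0 -> `|dterm j i n| = `|n|%N%:R `^ (dexp j i).
Proof.
move=> n0; have n1 := @norm_int_ge1 R n n0.
have np : 0 < (`|n|%N%:R : R) by rewrite natr_absz intr_norm (lt_le_trans ltr01).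
rewrite /dterm normrM ger0_norm ?powR_ge0 // /dexp powRD; last first.
  by rewrite (gt_eqF np) implybT.
by congr (_ * _); rewrite powR_invn ?(ltW np) // normfV normrX natr_absz intr_norm.
Qed.

Lemma dterm_shift j i n c : n != 0 -> `|c%:~R / n%:~R| <= 2^-1 :> R ->
  dterm j i (n + c) = dterm j i n * (1 + c%:~R / n%:~R) `^ (dexp j i).
Proof.
move=> n0; set z := _ / _ => hz.
have n0' : n%:~R != 0 :> R by rewrite intr_eq0.
have z0 : 0 < 1 + z by move: hz; rewrite ler_norml; lra.
have e : (n + c)%:~R = n%:~R * (1 + z) :> R by rewrite intrD /z; field.
rewrite /dterm !natr_absz !intr_norm e normrM (gtr0_norm z0) powRM ?(ltW z0) //.
rewrite exprMn invfM /dexp powRD; last by rewrite (gt_eqF z0) implybT.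
by rewrite powR_invn ?(ltW z0) //; ring.
Qed.

Lemma norm_int_shift (n c : int) : n + c != 0 -> `|n%:~R| <= `|(n + c)%:~R| * jap c :> R.
Proof.
move=> h; have h1 := @norm_int_ge1 R _ h.
have : `|n%:~R| <= `|(n + c)%:~R| + `|c%:~R| :> R.
  by apply: le_trans (ler_normB _ _); rewrite intrD addrK.
rewrite /jap natr_absz intr_norm; have : 0 <= `|c%:~R : R| by [].
move: (`|n%:~R : R|) (`|(n + c)%:~R : R|) (`|c%:~R : R|) h1 => x y z; nra.
Qed.

(** For [|c / n| <= 1/2] this is the binomial expansion of [(1 + c / n)^dexp]. Otherwise
    [|n| < 2 |c|], and the factor [(2 jap c / |n|)^N >= 1] absorbs every term. *)
Lemma dterm_expansion j i N : exists2 C : R, 0 <= C & forall n c, n != 0 ->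
  `|dterm j i (n + c) - \sum_(al < N) dterm j i n * n%:~R ^- al * (binr (dexp j i) al * c%:~R ^+ al)|
   <= C * jap c ^+ (N + N) * `|n%:~R| ^- N.
Proof.
have [C C0 hC] := binrem_le N (dexp j i).
pose S := \sum_(al < N) `|binr (dexp j i) al|.
have S0 : 0 <= S by apply: sumr_ge0.
exists (C + (1 + S) * 2 ^+ N); first by rewrite addr_ge0 // mulr_ge0 ?addr_ge0 ?exprn_ge0.
move=> n c n0; have n1 := @norm_int_ge1 R n n0.
have np : 0 < `|n%:~R : R| by apply: lt_le_trans n1.
have nN : 0 <= `|n%:~R : R| ^- N by rewrite invr_ge0 exprn_ge0.
have jc := @jap_ge1 R c; have cj := @jap_norm R c.
have jN : jap c ^+ N <= jap c ^+ (N + N) :> R by rewrite ler_weXn2l // leq_addl.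
have jN0 : 0 <= jap c ^+ (N + N) :> R by rewrite exprn_ge0 // jap_ge0.
have [h|h] := leP `|c%:~R / n%:~R : R| 2^-1.
  rewrite dterm_shift //.
  have -> : \sum_(al < N) dterm j i n * n%:~R ^- al * (binr (dexp j i) al * c%:~R ^+ al) =
     dterm j i n * \sum_(al < N) binr (dexp j i) al * (c%:~R / n%:~R) ^+ al.
    rewrite mulr_sumr; apply: eq_bigr => al _; rewrite expr_div_n; ring.
  rewrite -mulrBr normrM; apply: le_trans (_ : 1 * (C * `|c%:~R / n%:~R| ^+ N) <= _).
    by apply: ler_pM => //; [exact: norm_dterm_le1|exact: hC].
  rewrite mul1r normrM normfV expr_div_n mulrA ler_wpM2r //.
  apply: ler_pM; rewrite ?exprn_ge0 //; first by rewrite lerDl mulr_ge0 ?addr_ge0 ?exprn_ge0.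
  by apply: le_trans jN; rewrite lerXn2r ?nnegrE ?jap_ge0.
have h2 : 1 <= 2 ^+ N * jap c ^+ N * `|n%:~R : R| ^- N.
  rewrite -exprMn -exprVn -exprMn exprn_ege1 // ler_pdivlMr // mul1r.
  move: h; rewrite normrM normfV ltr_pdivlMr // => h.
  apply: le_trans (_ : 2 * `|c%:~R| <= _); last by rewrite ler_wpM2l.
  by rewrite -ler_pdivrMl //; exact: ltW.
apply: le_trans (ler_normB _ _) _.
apply: le_trans (_ : 1 + S * jap c ^+ N <= _).
  apply: lerD; first exact: norm_dterm_le1.
  apply: le_trans (ler_norm_sum _ _ _) _; rewrite /S mulr_suml; apply: ler_sum => al _.
  rewrite normrM [X in _ * X]normrM normrX (normrM (dterm j i n)) normfV normrX.
  apply: le_trans (_ : 1 * (`|binr (dexp j i) al| * `|c%:~R| ^+ al) <= _).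
    rewrite ler_wpM2r ?mulr_ge0 ?exprn_ge0 //; apply: mulr_ile1; rewrite ?invr_ge0 ?exprn_ge0 //.
      exact: norm_dterm_le1.
    by rewrite invf_le1 ?exprn_gt0 // exprn_ege1.
  rewrite mul1r ler_wpM2l //; apply: le_trans (_ : jap c ^+ al <= _).
    by rewrite lerXn2r ?nnegrE ?jap_ge0.
  by rewrite ler_weXn2l // ltnW.
have j1 : 1 <= jap c ^+ N :> R by rewrite exprn_ege1.
apply: le_trans (_ : (1 + S) * jap c ^+ N <= _).
  by rewrite mulrDl mul1r lerD2r.
apply: le_trans (_ : (1 + S) * jap c ^+ N * (2 ^+ N * jap c ^+ N * `|n%:~R : R| ^- N) <= _).
  by apply: ler_peMr => //; rewrite mulr_ge0 ?addr_ge0 // (le_trans ler01).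
have -> : (1 + S) * jap c ^+ N * (2 ^+ N * jap c ^+ N * `|n%:~R| ^- N) =
   (1 + S) * 2 ^+ N * jap c ^+ (N + N) * `|n%:~R| ^- N.
  by rewrite exprD; ring.
by rewrite ler_wpM2r // ler_wpM2r // lerDr.
Qed.

Context {T : Type} (rho : T -> R).
Hypothesis rho_ge1 : forall th, 1 <= rho th.
Variables (H : int -> T -> R) (hk : nat -> int -> T -> R) (hc : nat -> nat -> T -> R).
Hypothesis HE : forall n th, n != 0 -> H n th = \sum_(j < 3) `|n|%N%:R `^ (- (2 * s * j%:R)) * hk j n th.
Hypothesis hkE : forall j N, expn rho N (hk j) (hc j).
Hypothesis H0 : polyb rho (H 0).

Lemma polyb_coef j i : polyb rho (hc j i).
Proof.
suff h N f c : expn rho N f c -> forall i, (i < N)%N -> polyb rho (c i).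
  exact: (h _ _ _ (hkE j i.+1) i (ltnSn i)).
elim: N f c => [|N IH] f c //= [p h] [|l] hl //; exact: (IH _ (fun i => c i.+1) h l hl).
Qed.

Lemma polyb_sum n (f : 'I_n -> T -> R) : (forall i, polyb rho (f i)) -> polyb rho (fun th => \sum_(i < n) f i th).
Proof.
elim: n f => [|n IH] f h.
  by apply: polyb_le (polyb_cst rho 0) _ => th; rewrite big_ord0.
apply: polyb_le (polybD rho_ge1 (h ord0) (IH (fun i => f (lift ord0 i)) (fun i => h _))) _ => th.
by rewrite big_ord_recl.
Qed.

Lemma bounded_sum n (f : 'I_n -> int -> T -> R) : (forall i, bounded_expn rho (f i)) ->
  bounded_expn rho (fun m th => \sum_(i < n) f i m th).
Proof.
elim: n f => [|n IH] f h.
  by exists 0, 0%N => // m th _; rewrite big_ord0 normr0 mul0r.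
apply: bounded_expn_le (bounded_expnD rho_ge1 (h ord0) (IH (fun i => f (lift ord0 i)) (fun i => h _))) _ => m th _.
by rewrite big_ord_recl.
Qed.

Lemma H_bounded : exists C, exists2 L : nat, 0 <= C & forall n th, `|H n th| <= C * rho th ^+ L.
Proof.
have p j : bounded_expn rho (fun n _ => `|n|%N%:R `^ (- (2 * s * j%:R))).
  exists 1, 0%N => // n th n0; have := norm_dterm_le1 j 0 n.
  by rewrite /dterm expr0 invr1 !mulr1.
have [C [L C0 hC]] := bounded_sum (fun j : 'I_3 => bounded_expnM (p j) (expn_bounded rho_ge1 (hkE j 0))).
have [D [M D0 hD]] := H0.
exists (C + D), (L + M)%N; first exact: addr_ge0.
move=> n th; rewrite mulrDl; have q i : 0 <= rho th ^+ i by apply: le_trans (rhoX_ge1 rho_ge1 th i).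
have [->|n0] := eqVneq n 0.
  apply: le_trans (hD th) _; rewrite -[leLHS]add0r lerD ?mulr_ge0 // ler_wpM2l // rhoX_le // leq_addl.
  by [].
rewrite HE //; apply: le_trans (hC n th n0) _; rewrite -[leLHS]addr0 lerD ?mulr_ge0 // ler_wpM2l // rhoX_le // leq_addr.
by [].
Qed.

(** Since [|n| <= |n + c| jap c], a remainder of order [|n + c|^(-N)] is one of order [|n|^(-N)] at
    the price of [jap c ^+ N]. *)
Lemma H_expansion_at N : exists C, exists2 L : nat, 0 <= C & forall n c th, n != 0 ->
  `|H (n + c) th - \sum_(j < 3) \sum_(i < N) dterm j i (n + c) * hc j i th|
   <= C * (rho th * jap c) ^+ L * `|n%:~R| ^- N.
Proof.
have q th i : 0 <= rho th ^+ i by apply: le_trans (rhoX_ge1 rho_ge1 th i).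
(* The expansion of H says nothing at n + c = 0, where |n| = |c|. *)
have [D [M D0 hD]] : polyb rho (fun th => H 0 th - \sum_(j < 3) \sum_(i < N) dterm j i 0 * hc j i th).
  apply: polybD => //; apply: (polyb_le (b := fun th => \sum_(j < 3) \sum_(i < N) dterm j i 0 * hc j i th)); last first.
    by move=> th; rewrite normrN.
  apply: polyb_sum => j; apply: polyb_sum => i; apply: polybM; [exact: polyb_cst|exact: polyb_coef].
have [C [L C0 hC]] : bounded_expn rho (fun n th => `|n%:~R| ^+ N *
    (H n th - \sum_(j < 3) \sum_(i < N) dterm j i n * hc j i th)).
  have h j : bounded_expn rho (fun n th => `|n%:~R| ^+ N * (`|n|%N%:R `^ (- (2 * s * j%:R)) *
      (hk j n th - \sum_(i < N) n%:~R ^- i * hc j i th))).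
    have [C [L C0 hC]] := expn_remainder (hkE j N); exists C, L => // n th n0.
    have np : 0 < `|n%:~R : R| ^+ N by rewrite exprn_gt0 // normr_gt0 intr_eq0.
    rewrite !normrM normrX normr_id mulrC -ler_pdivlMr //.
    have := norm_dterm_le1 j 0 n; rewrite /dterm expr0 invr1 !mulr1 => h1.
    by apply: le_trans (hC n th n0); apply: ler_piMl.
  apply: bounded_expn_le (bounded_sum (fun j : 'I_3 => h j)) _ => n th n0.
  rewrite HE // -sumrB mulr_sumr le_eqVlt; apply/orP; left; apply/eqP; congr `|_|.
  apply: eq_bigr => j _; rewrite [_ * (hk j n th - _)]mulrBr; congr (_ * (_ - _)).
  by rewrite mulr_sumr; apply: eq_bigr => i _; rewrite /dterm mulrA.
exists (C + D), (L + M + N)%N; first exact: addr_ge0.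
move=> n c th n0.
have jc1 := @jap_ge1 R c; have r1 := rho_ge1 th.
have jX i : 1 <= jap c ^+ i :> R by rewrite exprn_ege1.
have rX := rhoX_ge1 rho_ge1 th.
have np : 0 < `|n%:~R : R| ^+ N by rewrite exprn_gt0 // normr_gt0 intr_eq0.
rewrite ler_pdivlMr // mulrDl exprMn.
have key (E : R) (l : nat) : 0 <= E -> (l <= L + M + N)%N ->
    E * rho th ^+ l * jap c ^+ N <= E * (rho th ^+ (L + M + N) * jap c ^+ (L + M + N)).
  move=> E0 hl; rewrite -mulrA ler_wpM2l //; apply: ler_pM => //.
  - by apply: le_trans (jX N).
  - exact: rhoX_le.
  - by rewrite ler_weXn2l // leq_addl.
have key0 (E : R) : 0 <= E -> 0 <= E * (rho th ^+ (L + M + N) * jap c ^+ (L + M + N)).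
  by move=> E0; rewrite !mulr_ge0 // (le_trans ler01).
have [nc|nc] := eqVneq (n + c) 0.
  rewrite nc -[leLHS]add0r; apply: lerD; first exact: key0.
  apply: le_trans (key D M D0 _); last by lia.
  apply: ler_pM; [by []|exact: ltW|exact: hD|].
  rewrite lerXn2r ?nnegrE ?jap_ge0 //.
  have -> : n = - c by lia.
  by rewrite mulrNz normrN jap_norm.
rewrite -[leLHS]addr0; apply: lerD; last exact: key0.
apply: le_trans (key C L C0 _); last by lia.
have := hC (n + c) th nc; rewrite normrM ger0_norm ?exprn_ge0 // => h.
apply: le_trans (_ : `|H (n + c) th - \sum_(j < 3) \sum_(i < N) dterm j i (n + c) * hc j i th| *
    (`|(n + c)%:~R| ^+ N * jap c ^+ N) <= _).
  rewrite ler_wpM2l // -exprMn lerXn2r ?nnegrE ?mulr_ge0 ?jap_ge0 //.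
  exact: norm_int_shift.
rewrite mulrA ler_wpM2r //; first by apply: le_trans (jX N).
by rewrite mulrC.
Qed.

Definition hmain (N : nat) (n c : int) (th : T) : R :=
  \sum_(j < 3) \sum_(i < N) \sum_(al < N)
    dterm j i n * n%:~R ^- al * (binr (dexp j i) al * c%:~R ^+ al) * hc j i th.

(** The expansion of [H] at [n + c], followed by the expansion of each [dterm] at [n]. The
    coefficients in [c] are monomials, which later become derivatives of the cutoff. *)
Lemma H_expansion N : exists C, exists2 L : nat, 0 <= C & forall n c th, n != 0 ->
  `|H (n + c) th - hmain N n c th| <= C * (rho th * jap c) ^+ L * `|n%:~R| ^- N.
Proof.
have [C [L C0 hC]] := H_expansion_at N.
have [D [M D0 hD]] : exists D, exists2 M : nat, 0 <= D & forall n c th, n != 0 ->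
  `|\sum_(j < 3) \sum_(i < N) dterm j i (n + c) * hc j i th - hmain N n c th|
    <= D * (rho th * jap c) ^+ M * `|n%:~R| ^- N.
  have h (j : 'I_3) (i : 'I_N) : exists D, exists2 M : nat, 0 <= D & forall n c th, n != 0 ->
    `|(dterm j i (n + c) - \sum_(al < N) dterm j i n * n%:~R ^- al * (binr (dexp j i) al * c%:~R ^+ al)) * hc j i th|
    <= D * (rho th * jap c) ^+ M * `|n%:~R| ^- N.
    have [D D0 hD] := dterm_expansion j i N; have [E [K E0 hE]] := polyb_coef j i.
    exists (D * E), ((N + N) + K)%N; first exact: mulr_ge0.
    move=> n c th n0; rewrite normrM.
    have r1 := rho_ge1 th; have j1 := @jap_ge1 R c.
    have n2 : 0 <= `|n%:~R : R| ^- N by rewrite invr_ge0 exprn_ge0.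
    apply: le_trans (_ : (D * jap c ^+ (N + N) * `|n%:~R| ^- N) * (E * rho th ^+ K) <= _).
      by apply: ler_pM => //; exact: hD.
    have -> : D * jap c ^+ (N + N) * `|n%:~R| ^- N * (E * rho th ^+ K) =
       D * E * (rho th ^+ K * jap c ^+ (N + N)) * `|n%:~R| ^- N by ring.
    rewrite ler_wpM2r // ler_wpM2l ?mulr_ge0 // exprMn.
    apply: ler_pM; rewrite ?exprn_ge0 ?jap_ge0 ?(rho_ge0 rho_ge1) //.
      by rewrite rhoX_le // leq_addl.
    by rewrite ler_weXn2l // leq_addr.
  have sumb (m : nat) (F : 'I_m -> int -> int -> T -> R) :
    (forall i, exists D, exists2 M : nat, 0 <= D & forall n c th, n != 0 ->
      `|F i n c th| <= D * (rho th * jap c) ^+ M * `|n%:~R| ^- N) ->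
    exists D, exists2 M : nat, 0 <= D & forall n c th, n != 0 ->
      `|\sum_(i < m) F i n c th| <= D * (rho th * jap c) ^+ M * `|n%:~R| ^- N.
    elim: m F => [|m IH] F hF.
      by exists 0, 0%N => // n c th _; rewrite big_ord0 normr0 !mul0r.
    have [D [M D0 hD]] := hF ord0.
    have [E [K E0 hE]] := IH (fun i => F (lift ord0 i)) (fun i => hF _).
    exists (D + E), (M + K)%N; first exact: addr_ge0.
    move=> n c th n0; rewrite big_ord_recl; apply: le_trans (ler_normD _ _) _.
    have r1 : 1 <= rho th * jap c by rewrite mulr_ege1 // jap_ge1.
    have n2 : 0 <= `|n%:~R : R| ^- N by rewrite invr_ge0 exprn_ge0.
    rewrite !mulrDl; apply: lerD.
      apply: le_trans (hD _ _ _ n0) _; rewrite ler_wpM2r // ler_wpM2l //.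
      by rewrite ler_weXn2l // leq_addr.
    apply: le_trans (hE _ _ _ n0) _; rewrite ler_wpM2r // ler_wpM2l //.
    by rewrite ler_weXn2l // leq_addl.
  have [D [M D0 hD]] := sumb _ _ (fun j => sumb _ _ (fun i => h j i)).
  exists D, M => // n c th n0; apply: le_trans (hD n c th n0).
  rewrite le_eqVlt; apply/orP; left; apply/eqP; congr `|_|.
  rewrite /hmain -sumrB; apply: eq_bigr => j _; rewrite -sumrB; apply: eq_bigr => i _.
  by rewrite mulrBl mulr_suml.
exists (C + D), (L + M)%N; first exact: addr_ge0.
move=> n c th n0.
have r1 : 1 <= rho th * jap c by rewrite mulr_ege1 // jap_ge1.
have n2 : 0 <= `|n%:~R : R| ^- N by rewrite invr_ge0 exprn_ge0.
rewrite -(subrKA (\sum_(j < 3) \sum_(i < N) dterm j i (n + c) * hc j i th)).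
apply: le_trans (ler_normD _ _) _; rewrite !mulrDl; apply: lerD.
  apply: le_trans (hC _ _ _ n0) _; rewrite ler_wpM2r // ler_wpM2l //.
  by rewrite ler_weXn2l // leq_addr.
apply: le_trans (hD _ _ _ n0) _; rewrite ler_wpM2r // ler_wpM2l //.
by rewrite ler_weXn2l // leq_addl.
Qed.

End Shift.

(** * Products of trigonometric series *)

Section TserAlgebra.
Context {R : realType}.
Implicit Types I J : choiceType.

Lemma tsum_mul I J (u : I -> R[i]) (w : J -> R[i]) : summ u -> summ w ->
  summ (fun p : I * J => u p.1 * w p.2) /\ tsum (fun p : I * J => u p.1 * w p.2) = tsum u * tsum w.
Proof.
move=> su sw.
have sp : summ (fun p : I * J => u p.1 * w p.2).
  by apply: summ_le (rsumm_prodM su sw) _ => p; rewrite normcM.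
split => //; rewrite -(tsum_prod sp).2 -tsumZr //; apply: eq_tsum => i.
by rewrite /= (tsumZ (u i) sw).
Qed.

Lemma rsum_mul I J (u : I -> R) (w : J -> R) : rsumm u -> rsumm w ->
  rsum (fun p : I * J => u p.1 * w p.2) = rsum u * rsum w.
Proof.
move=> su sw; have sp := rsumm_prodM su sw.
rewrite -(rsum_prod sp).2 mulrC -rsumZ //; apply: eq_rsum => i.
by rewrite /= rsumZ // mulrC.
Qed.

Lemma tser_mul I J (c : I -> R[i]) (k : I -> int) (c' : J -> R[i]) (k' : J -> int) (x : R) :
  summ c -> summ c' ->
  tser c k x * tser c' k' x = tser (fun p : I * J => c p.1 * c' p.2) (fun p => k p.1 + k' p.2) x.
Proof.
move=> sc sc'; rewrite /tser -(tsum_mul (summ_expi k x sc) (summ_expi k' x sc')).2.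
by apply: eq_tsum => p; rewrite intrD mulrDl expiD; ring.
Qed.

Lemma japX_add (m n : int) L : jap (m + n) ^+ L <= jap m ^+ L * jap n ^+ L :> R.
Proof. by rewrite -exprMn lerXn2r ?nnegrE ?mulr_ge0 ?jap_ge0 // japD. Qed.

Lemma decays_prod I J (c : I -> R[i]) (k : I -> int) (c' : J -> R[i]) (k' : J -> int) :
  decays c k -> decays c' k' ->
  decays (fun p : I * J => c p.1 * c' p.2) (fun p => k p.1 + k' p.2).
Proof.
move=> dc dc' L; apply: rsumm_lew (rsumm_prodM (dc L) (dc' L)) _ => p.
rewrite ger0_norm ?mulr_ge0 ?normc_ge0 ?exprn_ge0 ?jap_ge0 // normcM mulrACA.
by rewrite ler_wpM2l ?mulr_ge0 ?normc_ge0 // japX_add.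
Qed.

Lemma normc_tser_le I (c : I -> R[i]) (k : I -> int) x (g : I -> R) : rsumm g ->
  (forall i, normc (c i) <= g i) -> normc (tser c k x) <= 2 * rsum g.
Proof. by move=> sg h; apply: normc_tsum_le sg _ => i; rewrite normcM normc_expi mulr1. Qed.

Lemma normc_cderive_le I (c : I -> R[i]) (k : I -> int) al x : decays c k ->
  normc (cderive al (tser c k) x) <= 2 * rsum (fun i => normc (c i) * jap (k i) ^+ al).
Proof.
move=> dc; rewrite cderive_tser //; apply: normc_tser_le (dc al) _ => i.
rewrite normcM normcX ler_wpM2l ?normc_ge0 // lerXn2r ?nnegrE ?normc_ge0 ?jap_ge0 //.
exact: normc_dcoef.
Qed.

(** [chi] is itself a trigonometric series, so the product is a series indexed by [int * I] with
    decaying coefficients. [K] depends on [chi] and [al] alone, which makes the bound uniform in [n]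
    when it is applied to symbols. *)
Lemma localized_bound (chi : R -> R) al : periodic chi -> smooth1 setT (chi : R -> R^o) ->
  exists2 K : R, 0 <= K & forall I (c : I -> R[i]) (k : I -> int), decays c k ->
    csmooth1 setT (fun x => (chi x)%:C * tser c k x) /\
    forall x, normc (cderive al (fun x => (chi x)%:C * tser c k x) x) <=
      K * rsum (fun i => normc (c i) * jap (k i) ^+ al).
Proof.
move=> pc sc; have rc := rapid_decays (rapid_fc pc sc).
exists (2 * rsum (fun n => normc (fc chi n) * jap n ^+ al)).
  by rewrite mulr_ge0 //; apply: rsum_ge0 => n; rewrite mulr_ge0 ?normc_ge0 ?exprn_ge0 ?jap_ge0.
move=> I c k dc.
have e : (fun x => (chi x)%:C * tser c k x) = tser (fun p : int * I => fc chi p.1 * c p.2) (fun p => p.1 + k p.2).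
  apply/funext => x; rewrite -fourier_inversion // tser_mul //; [exact: decays0 rc|exact: decays0 dc].
rewrite e; have dp := decays_prod rc dc.
split; first exact: csmooth1_tser.
move=> x; apply: le_trans (normc_cderive_le al x dp) _.
have sq := rsumm_prodM (rc al) (dc al).
rewrite -mulrA ler_wpM2l // -(rsum_mul (rc al) (dc al)).
apply: le_rsum (dp al) sq _ => p; rewrite normcM mulrACA ler_wpM2l ?mulr_ge0 ?normc_ge0 //.
exact: japX_add.
Qed.

Lemma derive1nD n (f g : R -> R^o) : smooth1 setT f -> smooth1 setT g ->
  derive1n n (fun x => f x + g x : R^o) = (fun x => derive1n n f x + derive1n n g x).
Proof.
move=> sf sg; elim: n => [//|n IH]; rewrite derive1nS IH; apply/funext => x.
by rewrite derive1E (deriveD (sf n x I) (sg n x I)) !derive1nS !derive1E.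
Qed.

Lemma csmooth1D (f g : R -> R[i]) : csmooth1 setT f -> csmooth1 setT g ->
  csmooth1 setT (fun x => f x + g x) /\
  forall n x, cderive n (fun x => f x + g x) x = cderive n f x + cderive n g x.
Proof.
move=> [f1 f2] [g1 g2].
have e1 : cre \o (fun x => f x + g x) = (fun x => (cre \o f) x + (cre \o g) x).
  by apply/funext => x; rewrite /= creD.
have e2 : cim \o (fun x => f x + g x) = (fun x => (cim \o f) x + (cim \o g) x).
  by apply/funext => x; rewrite /= cimD.
have D1 n := derive1nD n f1 g1; have D2 n := derive1nD n f2 g2.
split; first split.
- rewrite e1 => n x _; rewrite D1; exact: derivableD (f1 n x I) (g1 n x I).
- rewrite e2 => n x _; rewrite D2; exact: derivableD (f2 n x I) (g2 n x I).
- by move=> n x; rewrite /cderive e1 e2 D1 D2.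
Qed.

End TserAlgebra.

(** * Symbols of localized operators *)

Section LocalSymbol.
Context {R : realType}.
Variable s : R.
Hypothesis s_gt0 : 0 < s.
Local Notation T := (int * int)%type.
Variables (H : int -> T -> R) (hk : nat -> int -> T -> R) (hc : nat -> nat -> T -> R).
Hypothesis HE : forall n th, n != 0 -> H n th = \sum_(j < 3) `|n|%N%:R `^ (- (2 * s * j%:R)) * hk j n th.
Hypothesis hkE : forall j N, expn (@rho2 R) N (hk j) (hc j).
Hypothesis H0 : polyb (@rho2 R) (H 0).

Definition rapid2 (m : T -> R[i]) : Prop :=
  forall L : nat, exists2 C : R, 0 <= C & forall th, normc (m th) <= C * rho2 th ^- L.

Variable m : T -> R[i].
Hypothesis m_rapid : rapid2 m.

Lemma rho2_summ : rsumm (fun th : T => rho2 th ^- 2 : R).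
Proof.
have := rsumm_prodM (@jap_summ R) (@jap_summ R); congr rsumm; apply/funext => th.
by rewrite /rho2 exprMn [RHS]invfM.
Qed.

Lemma rapid2_polyb (f : T -> R) L : polyb (@rho2 R) f -> rsumm (fun th => normc (m th) * `|f th| * rho2 th ^+ L).
Proof.
move=> [C [M C0 hC]]; have [D D0 hD] := m_rapid (M + L + 2)%N.
have r1 := @rho2_ge1 R; have r0 th i : 0 < rho2 th ^+ i :> R by rewrite exprn_gt0 // (lt_le_trans ltr01).
apply: rsumm_lew (rsummZ (D * C) rho2_summ) _ => th.
rewrite ger0_norm ?mulr_ge0 ?normc_ge0 ?(ltW (r0 _ _)) //.
apply: le_trans (_ : (D * rho2 th ^- (M + L + 2)) * (C * rho2 th ^+ M) * rho2 th ^+ L <= _).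
  rewrite ler_wpM2r ?(ltW (r0 _ _)) //; apply: ler_pM => //; exact: normc_ge0.
rewrite le_eqVlt; apply/orP; left; apply/eqP.
by rewrite !exprD; field; rewrite ?lt0r_neq0 // -1?(@expr1 R (rho2 th)).
Qed.

(** The coefficient of [|n|^(-2 s j) n^(-i)] in the symbol, as a function of [x]. *)
Definition bterm (j i : nat) (x : R) : R[i] :=
  tser (fun th => m th * (hc j i th)%:C) (fun th : T => th.1 + th.2) x.

Lemma jap_add_rho2 (th : T) L : jap (th.1 + th.2) ^+ L <= rho2 th ^+ L :> R.
Proof.
rewrite lerXn2r ?nnegrE ?jap_ge0 //; first exact: rho_ge0 (@rho2_ge1 R) th.
exact: japD.
Qed.

Lemma decays_bterm j i : decays (fun th => m th * (hc j i th)%:C) (fun th : T => th.1 + th.2).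
Proof.
move=> L; apply: rsumm_lew (rapid2_polyb L (polyb_coef hkE j i)) _ => th.
rewrite ger0_norm ?mulr_ge0 ?normc_ge0 ?exprn_ge0 ?jap_ge0 // normcM normc_real.
by rewrite ler_wpM2l ?mulr_ge0 ?normc_ge0 // jap_add_rho2.
Qed.

Variable psi : int -> R[i].
Hypothesis psi_rapid : rapid psi.

Local Notation T3 := ((int * int) * int)%type.
Definition tot (q : T3) : int := q.1.1 + q.1.2 + q.2.

(* The symbol of the operator with kernel m H composed with multiplication by psi. *)
Definition sigma (n : int) (x : R) : R[i] :=
  tser (fun q : T3 => m q.1 * psi q.2 * (H (n + q.2) q.1)%:C) tot x.

Definition srem (N : nat) (n : int) (x : R) : R[i] :=
  tser (fun q : T3 => m q.1 * psi q.2 * (H (n + q.2) q.1 - hmain s hc N n q.2 q.1)%:C) tot x.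

Lemma weighted_summ (L : nat) : rsumm (fun q : T3 => normc (m q.1 * psi q.2) * (rho2 q.1 * jap q.2) ^+ L).
Proof.
have h1 : rsumm (fun th : T => normc (m th) * rho2 th ^+ L).
  have := rapid2_polyb L (polyb_cst (@rho2 R) 1); congr rsumm; apply/funext => th.
  by rewrite normr1 mulr1.
have := rsumm_prodM h1 (rapid_decays psi_rapid L); congr rsumm; apply/funext => q.
by rewrite [normc (m q.1 * psi q.2)]normcM [(rho2 _ * _) ^+ L]exprMn; ring.
Qed.

Lemma tot_jap (q : T3) L : jap (tot q) ^+ L <= (rho2 q.1 * jap q.2) ^+ L :> R.
Proof.
have r0 := rho_ge0 (@rho2_ge1 R) q.1.
rewrite lerXn2r ?nnegrE ?mulr_ge0 ?jap_ge0 //; apply: le_trans (japD _ _) _.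
by rewrite ler_wpM2r ?jap_ge0 // japD.
Qed.

(** Polynomial growth of [f] in the three frequencies is absorbed by the rapid decay of [m] and
    [psi]. The constant [C] stays in front, so that a factor depending on [n] passes through. *)
Lemma decays_poly (f : T3 -> R) (C : R) (L : nat) : 0 <= C ->
  (forall q, `|f q| <= C * (rho2 q.1 * jap q.2) ^+ L) ->
  decays (fun q => m q.1 * psi q.2 * (f q)%:C) tot /\
  forall al, rsum (fun q : T3 => normc (m q.1 * psi q.2 * (f q)%:C) * jap (tot q) ^+ al) <=
    C * rsum (fun q : T3 => normc (m q.1 * psi q.2) * (rho2 q.1 * jap q.2) ^+ (L + al)).
Proof.
move=> C0 hf.
have key al q : normc (m q.1 * psi q.2 * (f q)%:C) * jap (tot q) ^+ al <=
    C * (normc (m q.1 * psi q.2) * (rho2 q.1 * jap q.2) ^+ (L + al)).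
  rewrite normcM normc_real exprD.
  have -> : C * (normc (m q.1 * psi q.2) * ((rho2 q.1 * jap q.2) ^+ L * (rho2 q.1 * jap q.2) ^+ al)) =
    normc (m q.1 * psi q.2) * (C * (rho2 q.1 * jap q.2) ^+ L) * (rho2 q.1 * jap q.2) ^+ al by ring.
  apply: ler_pM; rewrite ?mulr_ge0 ?normc_ge0 ?exprn_ge0 ?jap_ge0 //; last exact: tot_jap.
  by rewrite ler_wpM2l ?normc_ge0.
have d : decays (fun q => m q.1 * psi q.2 * (f q)%:C) tot.
  move=> al; apply: rsumm_lew (rsummZ C (weighted_summ (L + al))) _ => q.
  by rewrite ger0_norm ?mulr_ge0 ?normc_ge0 ?exprn_ge0 ?jap_ge0 // key.
split => // al; rewrite -rsumZ; last exact: weighted_summ.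
by apply: le_rsum; [exact: d|exact: rsummZ (weighted_summ _)|exact: key].
Qed.

Lemma decays_sigma n : decays (fun q : T3 => m q.1 * psi q.2 * (H (n + q.2) q.1)%:C) tot.
Proof.
have [C [L C0 hC]] := H_bounded s_gt0 (@rho2_ge1 R) HE hkE H0.
apply: (decays_poly (f := fun q => H (n + q.2) q.1) (L := L) C0 _).1 => q.
apply: le_trans (hC _ _) _; rewrite ler_wpM2l // lerXn2r ?nnegrE ?mulr_ge0 ?jap_ge0 //.
- by apply: ler_peMr; [exact: rho_ge0 (@rho2_ge1 R) _|exact: jap_ge1].
Qed.

Lemma srem_bound N : (forall n, n != 0 -> decays (fun q : T3 => m q.1 * psi q.2 * (H (n + q.2) q.1 - hmain s hc N n q.2 q.1)%:C) tot)
  /\ forall al, exists2 C : R, 0 <= C & forall n, n != 0 ->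
  rsum (fun q : T3 => normc (m q.1 * psi q.2 * (H (n + q.2) q.1 - hmain s hc N n q.2 q.1)%:C) * jap (tot q) ^+ al)
   <= C * `|n%:~R| ^- N.
Proof.
have [C [L C0 hC]] := H_expansion s_gt0 (@rho2_ge1 R) HE hkE H0 N.
have n2 (n : int) : 0 <= `|n%:~R : R| ^- N by rewrite invr_ge0 exprn_ge0.
have hb n : n != 0 -> forall q : T3, `|H (n + q.2) q.1 - hmain s hc N n q.2 q.1| <= C * `|n%:~R| ^- N * (rho2 q.1 * jap q.2) ^+ L.
  by move=> n0 q; apply: le_trans (hC n q.2 q.1 n0) _; rewrite mulrAC.
have hn n (n0 : n != 0) := decays_poly (mulr_ge0 C0 (n2 n)) (hb n n0).
split=> [n n0|al]; first exact: (hn n n0).1.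
exists (C * rsum (fun q : T3 => normc (m q.1 * psi q.2) * (rho2 q.1 * jap q.2) ^+ (L + al))).
  by rewrite mulr_ge0 //; apply: rsum_ge0 => q; rewrite mulr_ge0 ?normc_ge0 ?exprn_ge0 ?mulr_ge0 ?jap_ge0 // (rho_ge0 (@rho2_ge1 R)).
by move=> n n0; apply: le_trans ((hn n n0).2 al) _; rewrite mulrAC.
Qed.

(** [hv] holds when [psi] is the Fourier series of a function equal to [v] near [x]: the moment of
    order [al] is, up to a power of [i], the derivative of order [al] at [x]. Hence the terms with
    [al > 0] of the expansion in [c / n] drop out. It serves with [v = 1] where [psi] is 1, and with
    [v = 0] at the base point. *)
Lemma sigma_split N n x (v : R[i]) : n != 0 ->
  (forall al, tser (fun c => psi c * (c%:~R ^+ al)%:C) id x = if al == 0%N then v else 0) ->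
  sigma n x = v * \sum_(j < 3) \sum_(i < N) (dterm s j i n)%:C * bterm j i x + srem N n x.
Proof.
move=> n0 hv; have [sr _] := srem_bound N.
have scp al : summ (fun c => psi c * (c%:~R ^+ al)%:C).
  apply: summ_le (rapid_decays psi_rapid al) _ => c.
  rewrite normcM normc_real normrX ler_wpM2l ?normc_ge0 //.
  by rewrite lerXn2r ?nnegrE ?jap_ge0 // jap_norm.
have sb j i := decays0 (decays_bterm j i).
pose tm j i al := fun q : T3 => (dterm s j i n * n%:~R ^- al * binr (dexp s j i) al)%:C *
   ((m q.1 * (hc j i q.1)%:C * (psi q.2 * (q.2%:~R ^+ al)%:C)) * expi ((tot q)%:~R * x)).
have stm0 j i al : summ (fun q : T3 => (m q.1 * (hc j i q.1)%:C * (psi q.2 * (q.2%:~R ^+ al)%:C)) * expi ((tot q)%:~R * x)).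
  apply: summ_le (tsum_mul (sb j i) (scp al)).1 _ => q.
  by rewrite normcM normc_expi mulr1.
have stm j i al : summ (tm j i al) by exact: summZ (stm0 j i al).
have etm j i al : tsum (tm j i al) = if al == 0%N then (dterm s j i n)%:C * (v * bterm j i x) else 0.
  rewrite /tm tsumZ //.
  have -> : tsum (fun q : T3 => (m q.1 * (hc j i q.1)%:C * (psi q.2 * (q.2%:~R ^+ al)%:C)) * expi ((tot q)%:~R * x)) =
     bterm j i x * tser (fun c => psi c * (c%:~R ^+ al)%:C) id x.
    rewrite /bterm (tser_mul _ _ _ (sb j i) (scp al)).
    by apply: eq_tsum => q.
  rewrite hv; case: eqP => [->|_]; last by rewrite !mulr0.
  by rewrite expr0 invr1 !mulr1 [v * _]mulrC.
pose main := fun q : T3 => \sum_(j < 3) \sum_(i < N) \sum_(al < N) tm j i al q.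
have smain : summ main.
  by do 3!apply: summ_sum => ?.
have emain : tsum main = v * \sum_(j < 3) \sum_(i < N) (dterm s j i n)%:C * bterm j i x.
  rewrite /main tsum_sum; last by move=> j; apply: summ_sum => i; apply: summ_sum => al.
  rewrite mulr_sumr; apply: eq_bigr => j _.
  rewrite tsum_sum; last by move=> i; apply: summ_sum => al.
  rewrite mulr_sumr; apply: eq_bigr => i _.
  rewrite tsum_sum // (bigD1 (Ordinal (leq_ltn_trans (leq0n i) (ltn_ord i)))) //= etm /= big1 ?addr0.
    by rewrite mulrCA.
  by move=> al; rewrite -val_eqE /= => al0; rewrite etm (negPf al0).
rewrite -emain /sigma /srem /tser -tsumD //; last exact: summ_expi (decays0 (sr n n0)).
apply: eq_tsum => q.
have -> : main q = m q.1 * psi q.2 * (hmain s hc N n q.2 q.1)%:C * expi ((tot q)%:~R * x).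
  rewrite /main /hmain !rmorph_sum mulr_sumr mulr_suml; apply: eq_bigr => j _.
  rewrite rmorph_sum mulr_sumr mulr_suml; apply: eq_bigr => i _.
  rewrite rmorph_sum mulr_sumr mulr_suml; apply: eq_bigr => al _.
  by rewrite /tm !rmorphM; ring.
by rewrite rmorphB; ring.
Qed.

End LocalSymbol.

(** * Homogeneous terms of the symbol *)

Section ScalarSymbol.
Context {R : realType}.
Variable s : R.
Hypothesis s_gt0 : 0 < s.
Local Notation T := (int * int)%type.
Local Notation T3 := ((int * int) * int)%type.
Variables (H : int -> T -> R) (hk : nat -> int -> T -> R) (hc : nat -> nat -> T -> R).
Hypothesis HE : forall n th, n != 0 -> H n th = \sum_(j < 3) `|n|%N%:R `^ (- (2 * s * j%:R)) * hk j n th.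
Hypothesis hkE : forall j N, expn (@rho2 R) N (hk j) (hc j).
Hypothesis H0 : polyb (@rho2 R) (H 0).

(** The only [l] with [dexp s j l = m], if there is one. *)
Definition sidx (j : nat) (m : R) : nat := Num.truncn (- (2 * s * j%:R) - m).
Definition signb (e : bool) (l : nat) : R := if e then 1 else (-1) ^+ l.

(** For special [s] several pairs [(j, l)] have the same degree [- 2 s j - l], so their
    contributions are added. [signb] is the sign of [n^(-l)], which the part of the symbol at
    negative [xi] has to carry. *)
Definition acoef (m : R) (e : bool) (th : T) : R :=
  \sum_(j < 3) if m == dexp s j (sidx j m) then signb e (sidx j m) * hc j (sidx j m) th else 0.

Lemma sidx_dexp j l : sidx j (dexp s j l) = l.
Proof.
rewrite /sidx /dexp (_ : _ - _ = l%:R); first by rewrite natrK.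
by ring.
Qed.

Lemma acoefE M N m e th : M < m -> - M <= N%:R ->
  acoef m e th = \sum_(j < 3) \sum_(l < N) if m == dexp s j l then signb e l * hc j l th else 0.
Proof.
move=> Mm MN; apply: eq_bigr => j _.
have hl (l : 'I_N) : m == dexp s j l -> sidx j m = l by move=> /eqP ->; rewrite sidx_dexp.
case: eqP => [em|nm].
  have lN : (sidx j m < N)%N.
    rewrite -(ltr_nat R); apply: lt_le_trans MN; move: Mm; rewrite {1}em /dexp.
    have : 0 <= 2 * s * j%:R by rewrite !mulr_ge0 // ltW.
    by move: (2 * s * _) => u; lra.
  rewrite (bigD1 (Ordinal lN)) //= -em eqxx big1 ?addr0 // => l lj.
  case: ifP => // /hl e2; move: lj; rewrite -val_eqE /= e2 eqxx //.
rewrite big1 // => l _; case: ifP => // h; have := hl l h => e2.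
by case: nm; rewrite e2; apply/eqP.
Qed.

Lemma acoef_vanish m e th : (forall j l : nat, (j < 3)%N -> m = dexp s j l -> hc j l th = 0) -> acoef m e th = 0.
Proof.
move=> h; rewrite /acoef big1 // => j _; case: eqP => // em.
by rewrite (h j (sidx j m)) ?mulr0.
Qed.

Lemma polyb_acoef m e : polyb (@rho2 R) (acoef m e).
Proof.
apply: polyb_sum; first exact: rho2_ge1.
move=> j; case: (m == _); last exact: polyb_cst.
by apply: polybM; [exact: polyb_cst|exact: polyb_coef hkE _ _].
Qed.

Lemma dtermE j l n : n != 0 -> dterm s j l n = signb (0 < n) l * `|n|%N%:R `^ dexp s j l.
Proof.
move=> n0; rewrite -dterm_exp // /dterm normrM (ger0_norm (powR_ge0 _ _)) normfV normrX.
rewrite mulrCA; congr (_ * _); rewrite -normrX -normfV -exprVn.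
have [np|nn|n1] := ltgtP 0 n; last by rewrite n1 eqxx in n0.
  by rewrite /signb mul1r ger0_norm // exprn_ge0 // invr_ge0 ler0z ltW.
rewrite /signb normrX normfV ltr0_norm ?ltrz0 // -exprMn.
by rewrite invrN mulN1r opprK.
Qed.

(** The candidate degrees. Duplicates are removed because [acoef] has already added the coefficients
    of pairs with equal degree. *)
Definition exps (N : nat) : seq R := undup [seq dexp s j l | j <- iota 0 3, l <- iota 0 N].

Lemma mem_exps N (j : 'I_3) (l : 'I_N) : dexp s j l \in exps N.
Proof.
rewrite mem_undup; apply/allpairsP; exists (val j, val l); split => //; by rewrite mem_iota add0n ltn_ord.
Qed.

Lemma acoef_exps M N m e th : M < m -> - M <= N%:R -> m \notin exps N -> acoef m e th = 0.
Proof.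
move=> Mm MN hm; rewrite (acoefE e th Mm MN) big1 // => j _; rewrite big1 // => l _.
by case: eqP => // em; rewrite em mem_exps in hm.
Qed.

Lemma acoef_sum M N n th : n != 0 -> - M <= N%:R ->
  \sum_(m <- exps N | M < m) `|n|%N%:R `^ m * acoef m (0 < n) th =
  \sum_(j < 3) \sum_(l < N) if M < dexp s j l then dterm s j l n * hc j l th else 0.
Proof.
move=> n0 MN.
under eq_bigr => m Mm do rewrite (acoefE _ th Mm MN) mulr_sumr.
rewrite exchange_big /=; apply: eq_bigr => j _.
under eq_bigr => m Mm do rewrite mulr_sumr.
rewrite exchange_big /=; apply: eq_bigr => l _.
rewrite big_mkcond /= (bigD1_seq (dexp s j l)) ?undup_uniq ?mem_exps //= eqxx big1 ?addr0.
  by rewrite dtermE // mulrCA mulrA.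
by move=> m /negPf ->; rewrite mulr0; case: ifP.
Qed.

Definition arest (M : R) (N : nat) (n : int) (th : T) : R :=
  \sum_(j < 3) \sum_(l < N) if M < dexp s j l then 0 else dterm s j l n * hc j l th.

Lemma acoef_rest M N n th : n != 0 -> - M <= N%:R ->
  \sum_(j < 3) \sum_(i < N) dterm s j i n * hc j i th =
  \sum_(m <- exps N | M < m) `|n|%N%:R `^ m * acoef m (0 < n) th + arest M N n th.
Proof.
move=> n0 MN; rewrite acoef_sum // /arest -big_split; apply: eq_bigr => j _ /=.
by rewrite -big_split; apply: eq_bigr => l _ /=; case: ifP; rewrite ?addr0 ?add0r.
Qed.

Lemma arest_bound M N : exists C, exists2 L : nat, 0 <= C & forall n th, n != 0 ->
  `|arest M N n th| <= `|n|%N%:R `^ M * (C * rho2 th ^+ L).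
Proof.
have : polyb (@rho2 R) (fun th => \sum_(j < 3) \sum_(l < N) `|hc j l th|).
  apply: polyb_sum => [|j]; first exact: rho2_ge1.
  apply: polyb_sum => [|l]; first exact: rho2_ge1.
  by apply: polyb_le (polyb_coef hkE j l) _ => th; rewrite normr_id.
move=> [C [L C0 hC]]; exists C, L => // n th n0.
have n1 : 1 <= (`|n|%N%:R : R) by rewrite natr_absz intr_norm norm_int_ge1.
apply: le_trans (_ : `|n|%N%:R `^ M * \sum_(j < 3) \sum_(l < N) `|hc j l th| <= _); last first.
  by rewrite ler_wpM2l ?powR_ge0 //; apply: le_trans (hC th); exact: ler_norm.
apply: le_trans (ler_norm_sum _ _ _) _; rewrite mulr_sumr; apply: ler_sum => j _.
apply: le_trans (ler_norm_sum _ _ _) _; rewrite mulr_sumr; apply: ler_sum => l _.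
case: ltP => h; first by rewrite normr0 mulr_ge0 ?powR_ge0.
by rewrite normrM dterm_exp // ler_wpM2r // ler_powR.
Qed.

Section OneEntry.
Variable mt : T -> R[i].
Hypothesis m_rapid : rapid2 mt.

Lemma decays_coef (f : T -> R) (C : R) (L : nat) : 0 <= C -> (forall th, `|f th| <= C * rho2 th ^+ L) ->
  decays (fun th => mt th * (f th)%:C) (fun th : T => th.1 + th.2) /\
  forall al, rsum (fun th => normc (mt th * (f th)%:C) * jap (th.1 + th.2) ^+ al) <=
    C * rsum (fun th => normc (mt th) * rho2 th ^+ (L + al)).
Proof.
move=> C0 hf.
have w K : rsumm (fun th => normc (mt th) * rho2 th ^+ K).
  have := rapid2_polyb m_rapid K (polyb_cst (@rho2 R) 1); congr rsumm; apply/funext => th.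
  by rewrite normr1 mulr1.
have key al th : normc (mt th * (f th)%:C) * jap (th.1 + th.2) ^+ al <=
    C * (normc (mt th) * rho2 th ^+ (L + al)).
  rewrite normcM normc_real exprD.
  have -> : C * (normc (mt th) * (rho2 th ^+ L * rho2 th ^+ al)) =
    normc (mt th) * (C * rho2 th ^+ L) * rho2 th ^+ al by ring.
  apply: ler_pM; rewrite ?mulr_ge0 ?normc_ge0 ?exprn_ge0 ?jap_ge0 //; last exact: jap_add_rho2.
  by rewrite ler_wpM2l ?normc_ge0.
have d : decays (fun th => mt th * (f th)%:C) (fun th : T => th.1 + th.2).
  move=> al; apply: rsumm_lew (rsummZ C (w (L + al)%N)) _ => q.
  by rewrite ger0_norm ?mulr_ge0 ?normc_ge0 ?exprn_ge0 ?jap_ge0 // key.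
split => // al; rewrite -rsumZ //.
by apply: le_rsum; [exact: d|exact: rsummZ (w _)|exact: key].
Qed.

Definition aterm (m : R) (e : bool) (x : R) : R[i] :=
  tser (fun th => mt th * (acoef m e th)%:C) (fun th : T => th.1 + th.2) x.

Lemma decays_aterm m e : decays (fun th => mt th * (acoef m e th)%:C) (fun th : T => th.1 + th.2).
Proof. by have [C [L C0 hC]] := polyb_acoef m e; exact: (decays_coef C0 hC).1. Qed.

Lemma aterm_vanish m e x : (forall th, acoef m e th = 0) -> aterm m e x = 0.
Proof.
by move=> h; rewrite /aterm /tser -[RHS](@tsum0 R T); apply: eq_tsum => th; rewrite h mulr0 mul0r.
Qed.

Lemma bterm_rest M N n x : n != 0 -> - M <= N%:R ->
  \sum_(j < 3) \sum_(i < N) (dterm s j i n)%:C * bterm hc mt j i x =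
  \sum_(m <- exps N | M < m) (`|n|%N%:R `^ m)%:C * aterm m (0 < n) x +
  tser (fun th => mt th * (arest M N n th)%:C) (fun th : T => th.1 + th.2) x.
Proof.
move=> n0 MN.
have sb j i : summ (fun th : T => mt th * (hc j i th)%:C * expi ((th.1 + th.2)%:~R * x)).
  exact: summ_expi (decays0 (decays_bterm hkE m_rapid j i)).
have sa m e : summ (fun th : T => mt th * (acoef m e th)%:C * expi ((th.1 + th.2)%:~R * x)).
  exact: summ_expi (decays0 (decays_aterm m e)).
have [C [L C0 hC]] := arest_bound M N.
have sr : summ (fun th : T => mt th * (arest M N n th)%:C * expi ((th.1 + th.2)%:~R * x)).
  have C0' : 0 <= `|n|%N%:R `^ M * C by rewrite mulr_ge0 ?powR_ge0.
  apply: summ_expi; apply: decays0; apply: (decays_coef C0' _).1 => th.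
  by rewrite -mulrA; exact: hC.
pose f j i (th : T) := (dterm s j i n)%:C * (mt th * (hc j i th)%:C * expi ((th.1 + th.2)%:~R * x)).
pose g m (th : T) := (`|n|%N%:R `^ m)%:C * (mt th * (acoef m (0 < n) th)%:C * expi ((th.1 + th.2)%:~R * x)).
have sf j i : summ (f j i) by exact: summZ.
have sg m : summ (g m) by exact: summZ.
transitivity (tsum (fun th => \sum_(j < 3) \sum_(i < N) f j i th)).
  rewrite tsum_sum; last by move=> j; exact: summ_sum.
  apply: eq_bigr => j _; rewrite tsum_sum //; apply: eq_bigr => i _.
  by rewrite /f (tsumZ _ (sb j i)).
transitivity (tsum (fun th => \sum_(m <- exps N | M < m) g m th) +
   tsum (fun th : T => mt th * (arest M N n th)%:C * expi ((th.1 + th.2)%:~R * x))).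
  rewrite -tsumD //; last exact: summ_sum.
  apply: eq_tsum => th.
  transitivity (mt th * (\sum_(j < 3) \sum_(i < N) dterm s j i n * hc j i th)%:C * expi ((th.1 + th.2)%:~R * x)).
    rewrite rmorph_sum mulr_sumr mulr_suml; apply: eq_bigr => j _.
    rewrite rmorph_sum mulr_sumr mulr_suml; apply: eq_bigr => i _.
    by rewrite /f !rmorphM; ring.
  rewrite (acoef_rest _ n0 MN) rmorphD mulrDr mulrDl; congr (_ + _).
  rewrite rmorph_sum mulr_sumr mulr_suml; apply: eq_bigr => m _.
  by rewrite /g !rmorphM; ring.
congr (_ + _); rewrite tsum_sum //; apply: eq_bigr => m _.
by rewrite /g (tsumZ _ (sa m _)).
Qed.

End OneEntry.
End ScalarSymbol.

(** * One matrix entry of a localized operator *)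

Section LocalizedEntry.
Context {R : realType}.
Variable s : R.
Hypothesis s_gt0 : 0 < s.
Local Notation T := (int * int)%type.
Local Notation T3 := ((int * int) * int)%type.
Variables (H : int -> T -> R) (hk : nat -> int -> T -> R) (hc : nat -> nat -> T -> R).
Hypothesis HE : forall n th, n != 0 -> H n th = \sum_(j < 3) `|n|%N%:R `^ (- (2 * s * j%:R)) * hk j n th.
Hypothesis hkE : forall j N, expn (@rho2 R) N (hk j) (hc j).
Hypothesis H0 : polyb (@rho2 R) (H 0).
Variable mt : T -> R[i].
Hypothesis m_rapid : rapid2 mt.

Definition Sop (z : int -> R[i]) (n : int) : R[i] :=
  tsum (fun th : T => mt th * (H (n - (th.1 + th.2)) th)%:C * z (n - (th.1 + th.2))).

Lemma summ_Sop_kernel : exists2 g : T -> R, rsumm g & forall n th, normc (mt th * (H n th)%:C) <= g th.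
Proof.
have [C [L C0 hC]] := H_bounded s_gt0 (@rho2_ge1 R) HE hkE H0.
exists (fun th => C * (normc (mt th) * rho2 th ^+ L)).
  apply: rsummZ; have := rapid2_polyb m_rapid L (polyb_cst (@rho2 R) 1); congr rsumm; apply/funext => th.
  by rewrite normr1 mulr1.
by move=> n th; rewrite normcM normc_real mulrCA ler_wpM2l ?normc_ge0.
Qed.

(** From output frequency, shifts and frequency of [z] to frequency of [z], shifts and frequency of
    [psi]; the output frequency is the sum of the shifts and of the frequencies of [psi] and [z]. *)
Definition Sbij (p : int * (T * int)) : int * T3 := (p.2.2, (p.2.1, p.1 - (p.2.1.1 + p.2.1.2) - p.2.2)).

Lemma bij_Sbij : bijective Sbij.
Proof.
exists (fun p => (p.1 + tot p.2, (p.2.1, p.1))) => [[n [[a b] j]]|[n [[a b] c]]]; rewrite /Sbij /tot /=;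
  by congr (_, _); try (congr (_, _)); lia.
Qed.

(** Fubini along [Sbij]: the terms in which [z] has frequency [n] add up to [sigma] at [n], which is
    thereby the symbol of the composition with [psi]. *)
Lemma Sop_tser (psi z : int -> R[i]) : rapid psi -> rapid z ->
  [/\ forall n, summ (fun th : T => mt th * (H (n - (th.1 + th.2)) th)%:C * conv psi z (n - (th.1 + th.2))),
      summ (Sop (conv psi z)) &
      forall x, summ (fun n => expi (n%:~R * x) * (sigma H mt psi n x * z n)) /\
        tser (Sop (conv psi z)) id x = tsum (fun n => expi (n%:~R * x) * (sigma H mt psi n x * z n))].
Proof.
move=> rpsi rz; have [g sg hg] := summ_Sop_kernel.
have [B hB] : exists B, forall n, normc (conv psi z n) <= B.
  have [C C0 hC] := rapid_conv rpsi rz 0; exists C => n; by have := hC n; rewrite expr0 invr1 mulr1.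
have h1 n : summ (fun th : T => mt th * (H (n - (th.1 + th.2)) th)%:C * conv psi z (n - (th.1 + th.2))).
  apply: summ_le (rsummZ B sg) _ => th; rewrite normcM mulrC.
  by apply: ler_pM; rewrite ?normc_ge0.
pose F x := fun p : int * T3 => expi (p.1%:~R * x) * (mt p.2.1 * psi p.2.2 * (H (p.1 + p.2.2) p.2.1)%:C * expi ((tot p.2)%:~R * x) * z p.1).
have sF x : summ (F x).
  have sq := rsumm_prodM (rapid_summ rz) (rsumm_prodM sg (rapid_summ rpsi)).
  apply: summ_le sq _ => [[n [th c]]] /=.
  rewrite /F /= !normcM !normc_expi mul1r mulr1 mulrC ler_wpM2l ?normc_ge0 //.
  by rewrite [normc (mt _) * _]mulrC -mulrA -normcM mulrC ler_wpM2r ?normc_ge0.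
have sFG x := summ_reindex bij_Sbij (sF x).
have eG x n : tsum (fun r : T * int => F x (Sbij (n, r))) = Sop (conv psi z) n * expi (n%:~R * x).
  have sec := summ_section (sFG x) n.
  rewrite -(tsum_prod sec).2 /Sop -tsumZr //; apply: eq_tsum => th.
  rewrite /conv -tsumZ; last by exact: summ_conv.
  rewrite -tsumZr; last by apply: summZ; exact: summ_conv.
  apply: eq_tsum => j; rewrite /F /Sbij /tot /=.
  rewrite (_ : j + (n - (th.1 + th.2) - j) = n - (th.1 + th.2)); last by lia.
  have -> : expi (n%:~R * x) = expi (j%:~R * x) * expi ((th.1 + th.2 + (n - (th.1 + th.2) - j))%:~R * x).
    by rewrite -expiD -mulrDl -intrD; congr (expi (_%:~R * _)); lia.
  by ring.
have [sS _] := tsum_prod (sFG 0).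
split => //.
  apply: eq_summ sS => n; rewrite /= (eG 0) mulr0 expi0 mulr1 //.
move=> x; have [s1 s2] := tsum_prod (sF x).
have e n : tsum (fun q => F x (n, q)) = expi (n%:~R * x) * (sigma H mt psi n x * z n).
  rewrite /F /sigma /tser /=.
  have sn := summ_expi tot x (decays0 (decays_sigma s_gt0 HE hkE H0 m_rapid rpsi n)).
  rewrite tsumZ; last exact: summZr.
  by rewrite (tsumZr _ sn).
split; first by apply: eq_summ s1 => n; rewrite e.
rewrite -(eq_tsum e) s2 /tser -(tsum_reindex (F x) bij_Sbij).2 -(tsum_prod (sFG x)).2.
by apply: eq_tsum => n; rewrite (eG x).
Qed.

(** The moments are the derivatives of [f] at [x], divided by powers of [i]. *)
Lemma tser_moment (f : R -> R) (a x : R) al : periodic f -> smooth1 setT (f : R -> R^o) ->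
  (\forall y \near x, f y = a) ->
  tser (fun c => fc f c * (c%:~R ^+ al)%:C) id x = if al == 0%N then a%:C else 0.
Proof.
move=> pf sf hf.
have rf := rapid_decays (rapid_fc pf sf).
have := derive1n_fourier al x pf sf; rewrite (nbhs_singleton (derive1n_near_cst al hf)).
have -> : (fun n => fc f n * dcoef n ^+ al) = (fun n => Ic ^+ al * (fc f n * (n%:~R ^+ al)%:C)).
  by apply/funext => n; rewrite /dcoef exprMn rmorphXn; ring.
have sd : summ (fun n : int => fc f n * (n%:~R ^+ al)%:C).
  apply: summ_le (rf al) _ => c.
  rewrite normcM normc_real normrX ler_wpM2l ?normc_ge0 //.
  by rewrite lerXn2r ?nnegrE ?jap_ge0 // jap_norm.
have -> : tser (fun n => Ic ^+ al * (fc f n * (n%:~R ^+ al)%:C)) id x = Ic ^+ al * tser (fun n => fc f n * (n%:~R ^+ al)%:C) id x.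
  by rewrite /tser -(tsumZ (Ic ^+ al) (summ_expi id x sd)); apply: eq_tsum => n; ring.
case: eqP => [->|_]; first by rewrite expr0 mul1r.
move=> /eqP; rewrite mulf_eq0 expf_eq0 => /orP[/andP[_]|/eqP //].
by rewrite eq_complex /= oner_eq0 andbF.
Qed.

Lemma int_powR (n : int) N : n != 0 -> `|n%:~R| ^- N = `|n|%N%:R `^ (- N%:R) :> R.
Proof. by move=> n0; rewrite powR_invn // natr_absz intr_norm. Qed.

Lemma int_powR_le (n : int) (a b : R) : n != 0 -> a <= b -> `|n|%N%:R `^ a <= `|n|%N%:R `^ b.
Proof. by move=> n0 ab; apply: ler_powR; rewrite // natr_absz intr_norm norm_int_ge1. Qed.

Lemma jap_le2 (n : int) : n != 0 -> jap n <= 2 * `|n|%N%:R :> R.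
Proof.
by move=> n0; have := @norm_int_ge1 R n n0; rewrite /jap natr_absz intr_norm; lra.
Qed.

Lemma decays_unit (c : R[i]) (n : int) : decays (fun _ : unit => c) (fun=> n) /\
  forall al, rsum (fun _ : unit => normc c * jap n ^+ al) = normc c * jap n ^+ al.
Proof.
have h (f : unit -> R) : rsumm f /\ rsum f = f tt by apply: rsum_set1 => [[]].
by split=> [L|al]; [exact: (h _).1|exact: (h _).2].
Qed.

Variables chi psi : R -> R.
Hypotheses (pchi : periodic chi) (schi : smooth1 setT (chi : R -> R^o)).
Hypotheses (ppsi : periodic psi) (spsi : smooth1 setT (psi : R -> R^o)).
Hypothesis chi_psi : forall x : R, (\forall y \near x, chi y = 0) \/ (\forall y \near x, psi y = 1).
Variable b : bool.
Hypothesis psi0 : b -> \forall y \near (0 : R), psi y = 0.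

Local Notation sig := (sigma H mt (fc psi)).

Definition pent (n : int) (x : R) : R[i] :=
  (chi x)%:C * (sig n x - (if b then expi (- (n%:~R * x)) * sig n 0 else 0)).

Let rpsi := rapid_fc ppsi spsi.

Lemma pent_periodic n : periodic (pent n).
Proof.
move=> x; rewrite /pent pchi; congr (_ * (_ - _)); first exact: periodic_tser.
case: (b) => //; congr (_ * _).
have := expi_int (- n) (- (n%:~R * x)); rewrite intrN => <-.
by congr expi; ring.
Qed.

Lemma pentE n x : pent n x = (chi x)%:C * sig n x +
  (chi x)%:C * tser (fun _ : unit => (if b then - sig n 0 else 0)) (fun=> - n) x.
Proof.
rewrite /pent mulrBr; congr (_ + _); rewrite /tser.
have -> := (@tsum_set1 R unit (fun _ => (if b then - sig n 0 else 0) * expi ((- n)%:~R * x)) tt _).2; last by case.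
by rewrite -mulrN intrN mulNr; congr (_ * _); case: (b); rewrite ?mul0r ?oppr0 // mulNr mulrC.
Qed.

Lemma pent_smooth n : csmooth1 setT (pent n).
Proof.
have [K K0 hK] := localized_bound 0 pchi schi.
rewrite (_ : pent n = fun x => (chi x)%:C * sig n x +
  (chi x)%:C * tser (fun _ : unit => (if b then - sig n 0 else 0)) (fun=> - n) x); last first.
  by apply/funext => x; exact: pentE.
have d1 := decays_sigma s_gt0 HE hkE H0 m_rapid rpsi n.
have d2 := (decays_unit (if b then - sig n 0 else 0) (- n)).1.
exact: (csmooth1D (hK _ _ _ d1).1 (hK _ _ _ d2).1).1.
Qed.

(** As [psi] vanishes near 0, [sigma_split] with [v = 0] leaves only the remainder, whose order is
    arbitrarily low. *)
Lemma sigma0_bound (M : R) : b -> exists2 C : R, 0 <= C & forall n, n != 0 -> normc (sig n 0) <= C * `|n|%N%:R `^ M.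
Proof.
move=> hb; pose N := (Num.truncn (- M)).+1.
have MN : - M <= N%:R by apply: ltW; exact: truncnS_gt.
have [d hd] := srem_bound s_gt0 HE hkE H0 m_rapid rpsi N.
have [C C0 hC] := hd 0%N.
exists (2 * C); first exact: mulr_ge0.
move=> n n0.
rewrite (sigma_split s_gt0 HE hkE H0 m_rapid rpsi N n0 (v := 0)); last first.
  by move=> al; rewrite (tser_moment al ppsi spsi (psi0 hb)).
rewrite mul0r add0r; apply: le_trans (normc_tser_le tot 0 (decays0 (d n n0)) (fun=> lexx _)) _.
rewrite -mulrA ler_wpM2l //.
have -> : rsum (fun q : T3 => normc (mt q.1 * fc psi q.2 * (H (n + q.2) q.1 - hmain s hc N n q.2 q.1)%:C)) =
  rsum (fun q : T3 => normc (mt q.1 * fc psi q.2 * (H (n + q.2) q.1 - hmain s hc N n q.2 q.1)%:C) * jap (tot q) ^+ 0).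
  by apply: eq_rsum => q; rewrite expr0 mulr1.
apply: le_trans (hC n n0) _; rewrite int_powR // ler_wpM2l //.
by apply: int_powR_le => //; lra.
Qed.

(** Beyond the terms of degree above [M] there are three errors: the homogeneous terms of degree at
    most [M], the remainder [srem], and, if [b] holds, the value at the base point. *)
Lemma pent_asymptotic (M : R) (N al : nat) : - M <= N%:R ->
  exists2 C : R, 0 <= C & forall n x, n != 0 ->
  normc (cderive al (fun y => pent n y - (chi y)%:C *
     \sum_(m <- exps s N | M < m) (`|n|%N%:R `^ m)%:C * aterm s hc mt m (0 < n) y) x) <= C * `|n|%N%:R `^ M.
Proof.
move=> MN.
have [K K0 hK] := localized_bound al pchi schi.
have [d hd] := srem_bound s_gt0 HE hkE H0 m_rapid rpsi N.
have [C2 C20 hC2] := hd al.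
have [C1 [L C10 hC1]] := arest_bound s hkE M N.
pose B1 := rsum (fun th : T => normc (mt th) * rho2 th ^+ (L + al)).
(* Each derivative of [exp(- i n x)] costs a factor [|n|], so the term from the base point is
   estimated with exponent [M - al]. *)
have [C3 C30 hC3] : exists2 C : R, 0 <= C & forall n, n != 0 -> normc (if b then - sig n 0 else 0) <= C * `|n|%N%:R `^ (M - al%:R).
  case: (boolP b) => hb; last by exists 0 => // n _; rewrite (normc_real 0) normr0 mul0r.
  by have [C C0 hC] := sigma0_bound (M - al%:R) hb; exists C => // n n0; rewrite normcN; exact: hC.
have B10 : 0 <= B1.
  apply: rsum_ge0 => th; rewrite mulr_ge0 ?normc_ge0 ?exprn_ge0 //; exact: rho_ge0 (@rho2_ge1 R) _.
exists (K * (C1 * B1) + K * C2 + K * (C3 * 2 ^+ al)).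
  by rewrite !addr_ge0 // !mulr_ge0 // exprn_ge0.
move=> n x n0.
set f := (X in cderive al X).
have C1n : 0 <= `|n|%N%:R `^ M * C1 by rewrite mulr_ge0 ?powR_ge0.
have hr th : `|arest s hc M N n th| <= `|n|%N%:R `^ M * C1 * rho2 th ^+ L by rewrite -mulrA; exact: hC1.
have [dr hr2] := decays_coef m_rapid C1n hr.
have [du hu] := decays_unit (if b then - sig n 0 else 0) (- n).
have [A1s A1b] := hK _ _ _ dr.
have [A2s A2b] := hK _ _ _ (d n n0).
have [A3s A3b] := hK _ _ _ du.
have [A12s A12d] := csmooth1D A1s A2s.
have [A123s A123d] := csmooth1D A12s A3s.
have -> : f = fun y => ((chi y)%:C * tser (fun th => mt th * (arest s hc M N n th)%:C) (fun th : T => th.1 + th.2) y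
   + (chi y)%:C * srem s H hc mt (fc psi) N n y) +
   (chi y)%:C * tser (fun _ : unit => (if b then - sig n 0 else 0)) (fun=> - n) y.
  apply/funext => y; rewrite /f pentE addrAC; congr (_ + _).
  (* Where [chi] vanishes both sides are 0; elsewhere [psi] is 1 near [y] and the expansion applies
     with [v = 1]. *)
  have [c0|c1] := chi_psi y.
    by rewrite (nbhs_singleton c0) rmorph0 !mul0r subrr addr0.
  rewrite (sigma_split s_gt0 HE hkE H0 m_rapid rpsi N n0 (v := 1)); last first.
    by move=> al'; rewrite (tser_moment al' ppsi spsi c1).
  by rewrite mul1r (bterm_rest s_gt0 hkE m_rapid _ n0 MN); ring.
rewrite A123d A12d.
apply: le_trans (normcD _ _) _; rewrite [leRHS]mulrDl; apply: lerD; last first.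
  apply: le_trans (A3b x) _; rewrite -mulrA ler_wpM2l // hu japN.
  apply: le_trans (_ : C3 * `|n|%N%:R `^ (M - al%:R) * (2 * `|n|%N%:R) ^+ al <= _).
    apply: ler_pM; rewrite ?normc_ge0 ?exprn_ge0 ?jap_ge0 //; first exact: hC3.
    by rewrite lerXn2r ?nnegrE ?jap_ge0 ?mulr_ge0 // jap_le2.
  have np : 0 < (`|n|%N%:R : R) by rewrite ltr0n absz_gt0.
  rewrite exprMn -(powR_mulrn al (ltW np)) mulrACA -powRD ?subrK // (gt_eqF np) implybT //.
apply: le_trans (normcD _ _) _; rewrite [leRHS]mulrDl; apply: lerD.
  apply: le_trans (A1b x) _; rewrite -mulrA ler_wpM2l //; apply: le_trans (hr2 al) _.
  by rewrite -/B1 -mulrA mulrC.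
apply: le_trans (A2b x) _; rewrite -mulrA ler_wpM2l //; apply: le_trans (hC2 n n0) _.
by rewrite int_powR // ler_wpM2l //; apply: int_powR_le => //; lra.
Qed.

End LocalizedEntry.

Section Components.
Context {R : realType} (d : nat).

Lemma derive1n_entry (f : R -> 'cV[R]_d) n j : smooth1 setT f ->
  derive1n n (fun x => f x j 0 : R^o) = (fun x => derive1n n f x j 0).
Proof.
move=> sf; elim: n => [//|n IH]; rewrite derive1nS IH; apply/funext => x.
by rewrite derive1nS !derive1E derive_mx ?mxE; [|exact: sf].
Qed.

Lemma smooth1_entry (f : R -> 'cV[R]_d) j : smooth1 setT f -> smooth1 setT (fun x => f x j 0 : R^o).
Proof.
move=> sf n x _; rewrite derive1n_entry //.
by have /derivable_mxP := sf n x I; apply.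
Qed.

Lemma periodic_entry (f : R -> 'cV[R]_d) j : periodic f -> periodic (fun x => f x j 0).
Proof. by move=> pf x; rewrite pf. Qed.

Lemma rapid_fourier (f : R -> 'cV[R]_d) j : periodic f -> smooth1 setT f -> rapid (fun n => fourier f n j 0).
Proof.
move=> pf sf; rewrite (_ : (fun n => _) = fc (fun x => f x j 0)).
  by apply: rapid_fc; [exact: periodic_entry|exact: smooth1_entry].
by apply/funext => n; rewrite mxE.
Qed.

End Components.

(** * The total symbol of an operator given by a matrix of kernels *)

Section MatrixSymbol.
Context {R : realType}.
Variables (k : loops) (s : R).
Hypothesis s_gt0 : 0 < s.
Local Notation T := (int * int)%type.
Variables (H : int -> T -> R) (hk : nat -> int -> T -> R) (hc : nat -> nat -> T -> R).
Hypothesis HE : forall n th, n != 0 -> H n th = \sum_(j < 3) `|n|%N%:R `^ (- (2 * s * j%:R)) * hk j n th.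
Hypothesis hkE : forall j N, expn (@rho2 R) N (hk j) (hc j).
Hypothesis H0 : polyb (@rho2 R) (H 0).
Variables (d : nat) (Mx : T -> 'M[R[i]]_d).
Hypothesis M_rapid : forall i j, rapid2 (fun th => Mx th i j).
Variable P : coeffs R d -> coeffs R d.

Local Notation Sij i j := (Sop H (fun th => Mx th i j)).
Definition based : bool := if k is Based then true else false.

Hypothesis PE : forall Z : coeffs R d, (forall j, rapid (fun n => Z n j 0)) -> forall n i,
  P Z n i 0 = \sum_j Sij i j (fun n => Z n j 0) n -
    (if based && (n == 0) then \sum_j tsum (Sij i j (fun n => Z n j 0)) else 0).

Definition loop_symbol : symbol R d := fun m e x =>
  \matrix_(i, j) aterm s hc (fun th => Mx th i j) m e x.

Lemma loop_symbol_exps M N m : M < m -> - M <= N%:R -> m \notin exps s N -> forall e x, loop_symbol m e x = 0.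
Proof.
move=> Mm MN hm e x; apply/matrixP => i j; rewrite !mxE aterm_vanish // => th.
exact: (acoef_exps s_gt0 hc e th Mm MN hm).
Qed.

Lemma loop_symbol_is_symbol : is_symbol k loop_symbol.
Proof.
split.
- by move=> m e x; apply/matrixP => i j; rewrite !mxE; exact: periodic_tser.
- move=> m e i j; rewrite (_ : (fun x => _) = aterm s hc (fun th => Mx th i j) m e).
    by apply: csmooth1_tser; exact: (decays_aterm s hkE (M_rapid i j) m e).
  by apply/funext => x; rewrite mxE.
- move=> M; pose N := (Num.truncn (- M)).+1.
  have MN : - M <= N%:R by apply: ltW; exact: truncnS_gt.
  apply: (sub_finite_set (B := [set` exps s N])) => [m [Mm nv]|]; last exact: finite_seq.
  apply/negPn/negP => hm; apply: nv => e x _; exact: loop_symbol_exps Mm MN hm e x.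
Qed.

Lemma symbol_sum M N n x : - M <= N%:R ->
  \sum_(m \in [set m | M < m]) symbol_term loop_symbol m x n =
  \sum_(m <- exps s N | M < m) symbol_term loop_symbol m x n.
Proof.
move=> MN; rewrite (fsbigE [seq m <- exps s N | M < m]).
- rewrite big_filter_cond; apply: eq_bigl => m; rewrite andb_idr // => Mm.
  by rewrite inE.
- by rewrite filter_uniq // undup_uniq.
- by move=> m; rewrite /= mem_filter => /andP[].
- move=> m /= Mm; rewrite mem_filter Mm /= => hm.
  by rewrite /symbol_term (loop_symbol_exps Mm MN hm) scaler0.
Qed.

(** The correction in row 0 is a constant function, minus the value at 0 of the uncorrected series;
    the result vanishes at the base point. *)
Lemma tser_P (Z : coeffs R d) i : (forall j, rapid (fun n => Z n j 0)) ->
  (forall j, summ (Sij i j (fun n => Z n j 0))) -> forall x,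
  fseries (P Z) x i 0 = \sum_j tser (Sij i j (fun n => Z n j 0)) id x -
    (if based then \sum_j tser (Sij i j (fun n => Z n j 0)) id 0 else 0).
Proof.
move=> rZ sS x; rewrite /fseries mxE.
pose A n := \sum_j Sij i j (fun n => Z n j 0) n * expi (n%:~R * x).
pose c := if based then \sum_j tser (Sij i j (fun n => Z n j 0)) id 0 else 0.
pose B (n : int) := if n == 0 then c else 0.
have sA : summ A by apply: summ_sum => j; exact: (summ_expi id x (sS j)).
have [sB eB] : summ B /\ tsum B = c.
  have [h1 h2] := @tsum_set1 R int B 0 (fun n n0 => ifN_eq _ _ n0).
  by split => //; rewrite h2 /B eqxx.
have e n : (expi (n%:~R * x) *: P Z n) i 0 = A n - B n.
  rewrite mxE PE // mulrBr; congr (_ - _).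
    by rewrite mulr_sumr; apply: eq_bigr => j _; rewrite mulrC.
  rewrite /B /c; case: eqP => [->|_]; last by rewrite andbF mulr0.
  rewrite andbT mul0r expi0 mul1r; case: based => //.
  apply: eq_bigr => j _; apply: eq_tsum => n'.
  by rewrite mulr0 expi0 mulr1.
have sAB := summB sA sB.
rewrite csumE; last by apply: eq_summ sAB => n; rewrite e.
rewrite (eq_tsum e) tsumB // eB; congr (_ - _).
by rewrite /A tsum_sum // => j; exact: (summ_expi id x (sS j)).
Qed.

Lemma loop_total_symbol : total_symbol k P loop_symbol.
Proof.
split; first exact: loop_symbol_is_symbol.
move=> chi psi [pchi schi _] [ppsi spsi psiU] chi_psi.
(* For based loops 0 is not in [angles], so a cutoff vanishes near it. *)
have psi0 : based -> \forall y \near (0 : R), psi y = 0.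
  rewrite /based => hb; apply: psiU; move: hb; rewrite /angles; case: k => // _ /(_ 0).
  by rewrite mul0r eqxx.
have rpsi := rapid_fc ppsi spsi.
pose pe i j := pent H (fun th => Mx th i j) chi psi based.
exists (fun n x => \matrix_(i, j) pe i j n x); split.
- by move=> n x; apply/matrixP => i j; rewrite !mxE; exact: pent_periodic.
- move=> n i j; rewrite (_ : (fun x => _) = pe i j n); last by apply/funext => x; rewrite mxE.
  exact: (pent_smooth s_gt0 HE hkE H0 (M_rapid i j) pchi schi ppsi spsi).
- move=> f pf sf x.
  have rf j : rapid (fc (fun x => f x j 0)).
    by apply: rapid_fc; [exact: periodic_entry|exact: smooth1_entry].
  pose Z := fourier (fun y => psi y *: f y).
  have eZ j : (fun n => Z n j 0) = conv (fc psi) (fc (fun x => f x j 0)).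
    apply/funext => n.
    have <- := fc_mul n ppsi spsi (periodic_entry j pf) (smooth1_entry sf (j := j)).
    by rewrite /Z mxE /fc; congr (_ -i* _); congr (_ * _); congr per_int; apply/funext => y; rewrite mxE.
  have rZ j : rapid (fun n => Z n j 0) by rewrite eZ; exact: rapid_conv.
  have St i j := Sop_tser s_gt0 HE hkE H0 (M_rapid i j) rpsi (rf j).
  have sS i j : summ (Sij i j (fun n => Z n j 0)) by rewrite eZ; have [] := St i j.
  apply/matrixP => i l; rewrite ord1 mxE tser_P // [RHS]mxE.
  pose zf j n := expi (n%:~R * x) * (sigma H (fun th => Mx th i j) (fc psi) n x * fc (fun x => f x j 0) n).
  pose z0 j n := expi (n%:~R * 0) * (sigma H (fun th => Mx th i j) (fc psi) n 0 * fc (fun x => f x j 0) n).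
  have szf j : summ (zf j) by have [_ _ h] := St i j; exact: (h x).1.
  have sz0 j : summ (z0 j) by have [_ _ h] := St i j; exact: (h 0).1.
  have ez j : tser (Sij i j (fun n => Z n j 0)) id x = tsum (zf j).
    by rewrite eZ; have [_ _ h] := St i j; exact: (h x).2.
  have e0 j : tser (Sij i j (fun n => Z n j 0)) id 0 = tsum (z0 j).
    by rewrite eZ; have [_ _ h] := St i j; exact: (h 0).2.
  pose g n := (chi x)%:C * (\sum_j zf j n - (if based then \sum_j z0 j n else 0)).
  have ssf : summ (fun n => \sum_j zf j n) := summ_sum _ _ szf.
  have ss0 : summ (fun n => if based then \sum_j z0 j n else 0).
    by case: based; [exact: (summ_sum _ _ sz0)|exact: summ0].
  have sg : summ (fun n => \sum_j zf j n - (if based then \sum_j z0 j n else 0)).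
    exact: summB ssf ss0.
  (* The subtracted value at 0, written as a multiple of [exp(i n x)], acquires the factor
     [exp(- i n x)] that occurs in [pent]. *)
  have eg n : (expi (n%:~R * x) *: (\matrix_(i, j) pe i j n x *m fourier f n)) i 0 = g n.
    rewrite mxE mxE mulr_sumr /g.
    have -> : (if based then \sum_j z0 j n else 0) = \sum_j (if based then z0 j n else 0).
      by case: based => //; rewrite big1.
    rewrite -sumrB mulr_sumr; apply: eq_bigr => j _; rewrite mxE /pe /pent /fourier mxE -/(fc (fun x => f x j 0) n) /zf /z0.
    case: based; last by rewrite !subr0; ring.
    rewrite mulr0 expi0.
    have : expi (n%:~R * x) * expi (- (n%:~R * x)) = 1 by rewrite -expiD subrr expi0.
    move: (expi _) (expi _) => u v uv.
    by rewrite -[in RHS]uv; ring.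
  rewrite csumE; last by apply: eq_summ (summZ (chi x)%:C sg) => n; rewrite eg.
  rewrite (eq_tsum eg) /g tsumZ //; congr (_ * _).
  rewrite (tsumB ssf ss0).
  rewrite (tsum_sum _ _ szf); congr (_ - _); first by apply: eq_bigr => j _.
  case: based; last by rewrite tsum0.
  by rewrite (tsum_sum _ _ sz0); apply: eq_bigr.
- move=> M al i j; pose N := (Num.truncn (- M)).+1.
  have MN : - M <= N%:R by apply: ltW; exact: truncnS_gt.
  have [C _ hC] := pent_asymptotic s_gt0 HE hkE H0 (M_rapid i j) pchi schi ppsi spsi chi_psi psi0 al MN.
  exists C => n x n0; have := hC n x n0; congr (normc (cderive al _ x) <= _).
  apply/funext => y; rewrite !mxE (symbol_sum n y MN) summxE /pe; congr (_ - _ * _).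
  by apply: eq_bigr => m _; rewrite /symbol_term !mxE.
Qed.

Lemma order_at_most_loop m : (forall m' e th, m < m' -> acoef s hc m' e th = 0) -> order_at_most k P m.
Proof.
move=> h; exists loop_symbol; first exact: loop_total_symbol.
by move=> m' mm' e x _; apply/matrixP => i j; rewrite !mxE aterm_vanish // => th; exact: h.
Qed.

Lemma order_exactly_loop m : (forall m' e th, m < m' -> acoef s hc m' e th = 0) ->
  ~ vanishes k (loop_symbol m) -> order_exactly k P m.
Proof.
move=> h nv; exists loop_symbol; split=> //; first exact: loop_total_symbol.
by move=> m' mm' e x _; apply/matrixP => i j; rewrite !mxE aterm_vanish // => th; exact: h.
Qed.

Lemma order_minus_infinity_loop : (forall m e th, acoef s hc m e th = 0) -> order_minus_infinity k P.
Proof.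
move=> h; exists loop_symbol; first exact: loop_total_symbol.
by move=> m e x _; apply/matrixP => i j; rewrite !mxE aterm_vanish.
Qed.

End MatrixSymbol.

(** * Kernels acting on decaying sequences *)

Section PSeries.
Context {R : realType}.

(** Bernoulli's inequality [(1 - 1/(y + 1))^(-a) >= 1 + a / (y + 1)], which follows from
    [exp x >= 1 + x] and [ln (1 + x) <= x], multiplied by [(y + 1)^(-a)]. *)
Lemma powR_telescope (a y : R) : 0 < a -> 0 < y ->
  (y + 1) `^ (- (a + 1)) <= a^-1 * (y `^ (- a) - (y + 1) `^ (- a)).
Proof.
move=> a0 y0; have y1 : 0 < y + 1 by rewrite addr_gt0.
have z0 : 0 < y / (y + 1) by rewrite divr_gt0.
have ez : y / (y + 1) = 1 + - (y + 1)^-1 by field; rewrite lt0r_neq0.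
have hz : 1 + a * (y + 1)^-1 <= (y / (y + 1)) `^ (- a).
  rewrite /powR gt_eqF //; apply: le_trans (expR_ge1Dx _) _; rewrite ler_expR mulNr -mulrN ler_wpM2l ?(ltW a0) //.
  rewrite lerNr ez; apply: le_ln1Dx.
  by rewrite ltrN2 invf_lt1 // ltrDr.
have ey : y `^ (- a) = (y + 1) `^ (- a) * (y / (y + 1)) `^ (- a).
  by rewrite -powRM ?(ltW y1) ?(ltW z0) // mulrCA divff ?mulr1 // lt0r_neq0.
rewrite ey (_ : - (a + 1) = - a + - 1); last by ring.
rewrite powRD; last by rewrite (gt_eqF y1) implybT.
rewrite powR_inv1 ?(ltW y1) //.
have p0 : 0 < (y + 1) `^ (- a) by rewrite powR_gt0.
rewrite mulrC ler_pdivlMl //; move: hz; move: ((y + 1) `^ (- a)) p0 ((y + 1)^-1) ((y / (y + 1)) `^ (- a)) => p p0 v u huv.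
have -> : a * (v * p) = p * (a * v) by ring.
have -> : p * u - p = p * (u - 1) by ring.
by rewrite ler_pM2l //; lra.
Qed.

Lemma rsumm_japR (t : R) : 1 < t -> rsumm (fun n => jap n `^ (- t)).
Proof.
move=> t1; pose a := t - 1; have a0 : 0 < a by rewrite subr_gt0.
(* A telescoping majorant; the factor 2 counts the frequencies [N + 1] and [- (N + 1)]. *)
have h N : zpartial (fun n => jap n `^ (- t)) N <= 1 + 2 / a * (1 - N.+1%:R `^ (- a)).
  elim: N => [|N IH].
    rewrite /zpartial big_ord_recl big_ord0 addr0 /jap.
    by rewrite (_ : `|_|%N = 0%N) // addr0 !powR1 subrr mulr0 addr0.
  rewrite zpartialS; apply: le_trans (lerD IH (lexx _)) _.
  have -> : jap (- (N.+1)%:Z) = N.+2%:R :> R by rewrite /jap abszN absz_nat -[RHS]natr1 addrC.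
  have -> : jap (N.+1)%:Z = N.+2%:R :> R by rewrite /jap absz_nat -[RHS]natr1 addrC.
  have y0 : 0 < N.+1%:R :> R by rewrite ltr0n.
  have := powR_telescope a0 y0; rewrite natr1 (_ : a + 1 = t); last by rewrite /a; ring.
  move: (N.+2%:R `^ (- t)) (N.+1%:R `^ (- a)) (N.+2%:R `^ (- a)) => u v w.
  by move: (a^-1) => b; lra.
have [] // := @zpartial_bounded R (fun n => jap n `^ (- t)) (1 + 2 / a).
- by move=> i; rewrite powR_ge0.
- move=> N; apply: le_trans (h N) _; rewrite lerD2l ler_piMr ?divr_ge0 ?(ltW a0) // gerBl powR_ge0.
Qed.

End PSeries.

(** * Sequences with power decay, and kernels concentrated near the diagonal *)

Section Decay.
Context {R : realType}.
Variable t : R.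
Hypothesis t_gt1 : 1 < t.

(** The class contains the rapidly decaying sequences and, for [t = s > 1], the Fourier coefficients
    of H^s fields. The connection preserves it, so iterated covariant derivatives are absolutely
    convergent sums. *)
Definition decay (z : int -> R[i]) : Prop :=
  exists2 C : R, 0 <= C & forall n, normc (z n) <= C * jap n `^ (- t).

Lemma decay_summ z : decay z -> summ z.
Proof. by move=> [C C0 hC]; exact: summ_le (rsummZ C (rsumm_japR t_gt1)) hC. Qed.

Lemma decayD z w : decay z -> decay w -> decay (fun n => z n + w n).
Proof.
move=> [C C0 hC] [D D0 hD]; exists (C + D); first exact: addr_ge0.
by move=> n; apply: le_trans (normcD _ _) _; rewrite mulrDl lerD.
Qed.

Lemma decayZ c z : decay z -> decay (fun n => c * z n).
Proof.
move=> [C C0 hC]; exists (normc c * C); first by rewrite mulr_ge0 ?normc_ge0.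
by move=> n; rewrite normcM -mulrA ler_wpM2l ?normc_ge0.
Qed.

Lemma decay0 : decay (fun=> 0).
Proof. by exists 0 => // n; rewrite normc_real normr0 mul0r. Qed.

Lemma eq_decay z w : z =1 w -> decay z -> decay w.
Proof. by move=> e [C C0 hC]; exists C => // n; rewrite -e. Qed.

Lemma decay_sum (T : Type) (r : seq T) (P : pred T) (f : T -> int -> R[i]) :
  (forall t, decay (f t)) -> decay (fun n => \sum_(t <- r | P t) f t n).
Proof.
move=> h; elim: r => [|x r IH]; first by apply: eq_decay decay0 => n; rewrite big_nil.
case: (boolP (P x)) => Px.
  by apply: eq_decay (decayD (h x) IH) => n; rewrite big_cons Px.
by apply: eq_decay IH => n; rewrite big_cons (negPf Px).
Qed.

(** For the frequency 0 of based loops, where the operators have an exceptional row. *)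
Lemma decay_update z w n0 : decay z -> (forall n, n != n0 -> w n = z n) -> decay w.
Proof.
move=> [C C0 hC] e; have p0 : 0 < jap n0 `^ (- t) by rewrite powR_gt0 ?jap_gt0.
exists (C + normc (w n0) / jap n0 `^ (- t)); first by rewrite addr_ge0 ?divr_ge0 ?normc_ge0 ?(ltW p0).
move=> n; rewrite mulrDl; have [->|nn] := eqVneq n n0.
  by rewrite divfK ?lt0r_neq0 // lerDr mulr_ge0 // ltW.
rewrite e //; apply: le_trans (hC n) _; rewrite lerDl mulr_ge0 ?powR_ge0 //.
by rewrite divr_ge0 ?normc_ge0 ?(ltW p0).
Qed.

Definition tnat : nat := (Num.truncn t).+1.

Lemma japR_le n : jap n ^- tnat <= jap n `^ (- t) :> R.
Proof.
rewrite -powR_invn ?jap_ge0 //; apply: ler_powR; first exact: jap_ge1.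
by rewrite lerN2 ltW // truncnS_gt.
Qed.

Lemma rapid_decay z : rapid z -> decay z.
Proof.
move=> /(_ tnat)[C C0 hC]; exists C => // n; apply: le_trans (hC n) _.
by rewrite ler_wpM2l // japR_le.
Qed.

(** Peetre's inequality: [jap n <= jap (n - q) * jap q], raised to the power [t]; [tnat] is an
    integer above [t]. *)
Lemma peetre n q : jap q `^ (- t) <= jap (n - q) ^+ tnat * jap n `^ (- t) :> R.
Proof.
have t0 : 0 <= t by apply: le_trans (ltW t_gt1); exact: ler01.
have h : jap n `^ t <= jap (n - q) ^+ tnat * jap q `^ t :> R.
  apply: le_trans (_ : (jap (n - q) * jap q) `^ t <= _).
    apply: ge0_ler_powR; rewrite ?nnegrE ?mulr_ge0 ?jap_ge0 //.
    by rewrite -{1}(subrK q n) japD.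
  rewrite powRM ?jap_ge0 // ler_wpM2r ?powR_ge0 //.
  rewrite -powR_mulrn ?jap_ge0 //; apply: ler_powR; first exact: jap_ge1.
  by rewrite ltW // truncnS_gt.
rewrite !powRN -[leLHS]mul1r ler_pdivrMr ?powR_gt0 ?jap_gt0 //.
by rewrite mulrAC ler_pdivlMr ?powR_gt0 ?jap_gt0 // mul1r.
Qed.

Definition kbounded (F : int -> int -> R) : Prop :=
  exists C, exists2 L : nat, 0 <= C & forall n q, `|F n q| <= C * jap (n - q) ^+ L.

Lemma kboundedD F G : kbounded F -> kbounded G -> kbounded (fun n q => F n q + G n q).
Proof.
move=> [C [L C0 hC]] [D [M D0 hD]]; exists (C + D), (L + M)%N; first exact: addr_ge0.
move=> n q; apply: le_trans (ler_normD _ _) _; rewrite mulrDl; apply: lerD.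
  apply: le_trans (hC n q) _; rewrite ler_wpM2l //; apply: ler_weXn2l; [exact: jap_ge1|exact: leq_addr].
apply: le_trans (hD n q) _; rewrite ler_wpM2l //; apply: ler_weXn2l; [exact: jap_ge1|exact: leq_addl].
Qed.

Lemma kboundedN F : kbounded F -> kbounded (fun n q => - F n q).
Proof. by move=> [C [L C0 hC]]; exists C, L => // n q; rewrite normrN. Qed.

Lemma kbounded_cst (c : R) : kbounded (fun _ _ => c).
Proof. by exists `|c|, 0%N => // n q; rewrite mulr1. Qed.

Definition kconv (F : int -> int -> R) (u z : int -> R[i]) (n : int) : R[i] :=
  tsum (fun q => u (n - q) * (F n q)%:C * z q).

Lemma kconv_bound F u z : kbounded F -> rapid u -> decay z ->
  exists2 C : R, 0 <= C & forall n q, normc (u (n - q) * (F n q)%:C * z q) <= C * jap n `^ (- t) * jap (n - q) ^- 2.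
Proof.
move=> [C [L C0 hC]] ru [D D0 hD].
(* Of the decay of [u], [L] powers pay for the growth of [F] and [tnat] for Peetre's inequality; 2
   remain for summability. *)
have [E E0 hE] := ru (L + tnat + 2)%N.
exists (E * C * D); first by rewrite !mulr_ge0.
move=> n q; rewrite !normcM normc_real.
have j0 := @jap_gt0 R (n - q).
apply: le_trans (_ : E * jap (n - q) ^- (L + tnat + 2) * (C * jap (n - q) ^+ L) * (D * (jap (n - q) ^+ tnat * jap n `^ (- t))) <= _).
  apply: ler_pM; rewrite ?mulr_ge0 ?normc_ge0 //.
    by apply: ler_pM; rewrite ?normc_ge0.
  by apply: le_trans (hD q) _; rewrite ler_wpM2l // peetre.
rewrite le_eqVlt; apply/orP; left; apply/eqP.
rewrite !exprD; move: (jap n `^ (- t)) (jap (n - q) : R) j0 => w x x0.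
by field; rewrite ?expf_neq0 ?lt0r_neq0.
Qed.

Lemma summ_kconv F u z n : kbounded F -> rapid u -> decay z -> summ (fun q => u (n - q) * (F n q)%:C * z q).
Proof.
move=> hF ru dz; have [C C0 hC] := kconv_bound hF ru dz.
apply: summ_le (rsummZ (C * jap n `^ (- t)) _) (hC n).
exact: ((rsum_reindex (fun q => jap q ^- 2) (bij_subl n)).1).2 jap_summ.
Qed.

Lemma decay_kconv F u z : kbounded F -> rapid u -> decay z -> decay (kconv F u z).
Proof.
move=> hF ru dz; have [C C0 hC] := kconv_bound hF ru dz.
have S0 : 0 <= rsum (fun q => jap q ^- 2 : R).
  by apply: rsum_ge0 => q; rewrite invr_ge0 exprn_ge0 ?jap_ge0.
exists (2 * C * rsum (fun q => jap q ^- 2)); first by rewrite !mulr_ge0.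
move=> n; have sn : rsumm (fun q => jap (n - q) ^- 2 : R).
  exact: ((rsum_reindex (fun q => jap q ^- 2) (bij_subl n)).1).2 jap_summ.
apply: le_trans (normc_tsum_le (rsummZ (C * jap n `^ (- t)) sn) (hC n)) _.
rewrite rsumZ // (rsum_reindex (fun q => jap q ^- 2) (bij_subl n)).2.
by rewrite le_eqVlt; apply/orP; left; apply/eqP; ring.
Qed.

Lemma kconvD F G u z n : kbounded F -> kbounded G -> rapid u -> decay z ->
  kconv (fun n q => F n q + G n q) u z n = kconv F u z n + kconv G u z n.
Proof.
move=> hF hG ru dz; rewrite -(tsumD (summ_kconv n hF ru dz) (summ_kconv n hG ru dz)).
by apply: eq_tsum => q; rewrite rmorphD; ring.
Qed.

Lemma kconvN F u z n : kconv (fun n q => - F n q) u z n = - kconv F u z n.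
Proof. by rewrite -tsumN; apply: eq_tsum => q; rewrite rmorphN; ring. Qed.

Lemma eq_kconv F G u v z w n : (forall q, F n q = G n q) -> u =1 v -> z =1 w -> kconv F u z n = kconv G v w n.
Proof. by move=> h1 h2 h3; apply: eq_tsum => q; rewrite h1 h2 h3. Qed.

Lemma kconv_sum (T : Type) (r : seq T) F u (z : T -> int -> R[i]) n : kbounded F -> rapid u -> (forall j, decay (z j)) ->
  kconv F u (fun q => \sum_(j <- r) z j q) n = \sum_(j <- r) kconv F u (z j) n.
Proof.
move=> hF ru dz; rewrite -tsum_sum; last by move=> j; exact: summ_kconv.
by apply: eq_tsum => q; rewrite mulr_sumr.
Qed.

(** Summing all Fourier coefficients evaluates a function at 0, so this is the multiplicativity of
    evaluation. *)
Lemma tsum_kconv1 u z : rapid u -> decay z -> tsum (kconv (fun _ _ => 1) u z) = tsum u * tsum z.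
Proof.
move=> ru dz; rewrite -(tsum_mul (rapid_summ ru) (decay_summ dz)).2.
have sp := (tsum_mul (rapid_summ ru) (decay_summ dz)).1.
rewrite -(tsum_reindex _ bij_shear).2.
have sp2 := summ_reindex bij_shear sp.
rewrite -(tsum_prod sp2).2.
by apply: eq_tsum => n; apply: eq_tsum => q; rewrite mulr1.
Qed.

End Decay.

(** * Kernels formed from the eigenvalues *)

Section WeightKernels.
Context {R : realType}.
Variables (k : loops) (s : R).
Hypothesis s_gt0 : 0 < s.

Lemma weight_base (n : int) : (eps k)%:R + n%:~R ^+ 2 = 0 :> R \/ 1 <= (eps k)%:R + n%:~R ^+ 2 :> R.
Proof.
have -> : (eps k)%:R + n%:~R ^+ 2 = ((eps k : nat)%:Z + n ^+ 2)%:~R :> R by rewrite intrD -rmorphXn.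
have [->|h] := eqVneq ((eps k : nat)%:Z + n ^+ 2) 0; [by left|right].
by rewrite -[1]/(1%:~R) ler_int; move: h; have := sqr_ge0 n; case: (eps k) => /=; lia.
Qed.

(** By [q^2 <= 2 p^2 + 2 (p - q)^2], and because a nonzero eigenvalue of [A] is at least 1, the
    eigenvalue at [q] is at most [4 jap (p - q)^2] times the one at [p]. *)
Lemma kbounded_ratio : kbounded (fun p q => weight k s q * weight k (- s) p).
Proof.
pose K := (Num.truncn s).+1.
have sK : s <= K%:R by apply: ltW; exact: truncnS_gt.
exists (4 ^+ K), (2 * K)%N; first by rewrite exprn_ge0.
move=> p q; have J0 := @jap_ge0 R (p - q); have J1 := @jap_ge1 R (p - q).
rewrite ger0_norm ?mulr_ge0 ?weight_ge0 // !weightE.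
have [->|p1] := weight_base p.
  (* For based loops and [p = 0], the convention for powers of 0 makes the ratio 0. *)
  by rewrite powR0 ?oppr_eq0 ?lt0r_neq0 // mulr0 mulr_ge0 ?exprn_ge0.
set Xp := _ + _ in p1 *; have p0 : 0 < Xp by exact: lt_le_trans p1.
have hq : (eps k)%:R + q%:~R ^+ 2 <= (4 * jap (p - q) ^+ 2) * Xp.
  have e0 : 0 <= (eps k)%:R :> R by [].
  have hj : `|(p - q)%:~R| <= jap (p - q) :> R := jap_norm _.
  have : (p - q)%:~R ^+ 2 <= jap (p - q) ^+ 2 :> R.
    by rewrite -(@real_normK _ (p - q)%:~R) ?num_real // lerXn2r ?nnegrE ?normr_ge0.
  have : q%:~R ^+ 2 <= 2 * p%:~R ^+ 2 + 2 * (p - q)%:~R ^+ 2 :> R.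
    by rewrite intrB; move: (p%:~R : R) (q%:~R : R) => x y; have := sqr_ge0 (2 * x - y); nra.
  have J2 : 1 <= jap (p - q) ^+ 2 :> R by rewrite exprn_ege1.
  have : (eps k)%:R + 2 * p%:~R ^+ 2 <= 2 * Xp by rewrite /Xp; lra.
  move: J2 p1; move: Xp p0 (jap (p - q) ^+ 2 : R) (p%:~R ^+ 2 : R) (q%:~R ^+ 2 : R) ((p - q)%:~R ^+ 2 : R) ((eps k)%:R : R).
  by move=> X p0 J P Q D E; nra.
have q0 : 0 <= (eps k)%:R + q%:~R ^+ 2 :> R by rewrite addr_ge0 ?sqr_ge0.
have A0 : 0 <= 4 * jap (p - q) ^+ 2 :> R by rewrite mulr_ge0 ?exprn_ge0.
apply: le_trans (_ : ((4 * jap (p - q) ^+ 2) `^ s * Xp `^ s) * Xp `^ (- s) <= _).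
  rewrite ler_wpM2r ?powR_ge0 // -powRM ?(ltW p0) //.
  by apply: ge0_ler_powR; rewrite ?nnegrE ?mulr_ge0 ?(ltW p0) ?(ltW s_gt0).
rewrite -mulrA powRN divff ?mulr1; last by rewrite lt0r_neq0 // powR_gt0.
have -> : 4 ^+ K * jap (p - q) ^+ (2 * K) = (4 * jap (p - q) ^+ 2) `^ K%:R :> R.
  by rewrite powR_mulrn // exprMn exprM.
apply: ler_powR => //.
by have J2 : 1 <= jap (p - q) ^+ 2 :> R by [rewrite exprn_ege1]; lra.
Qed.

Lemma kbounded_ratio1 : kbounded (fun p q => weight k s (p - q) * weight k (- s) p).
Proof.
have [K hK] := weight_le_jap k s_gt0; exists 1, K => // p q.
rewrite ger0_norm ?mulr_ge0 ?weight_ge0 // mul1r -[leRHS]mulr1.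
by apply: ler_pM; rewrite ?weight_ge0 ?hK //; exact: weightNs_le1.
Qed.

Lemma kbounded_gker : kbounded (gker k s).
Proof.
have := kboundedD (kbounded_cst 1) (kboundedD kbounded_ratio (kboundedN kbounded_ratio1)).
move=> [C [L C0 hC]]; exists C, L => // p q.
by have := hC p q; rewrite /gker mulrBl.
Qed.

(** The terms are of size [|n|^(-2s)] with [2 s > 1]. This makes the subtraction of [F 0] in [Ainv]
    converge for based loops. *)
Lemma summ_weightNs : 2^-1 < s -> rsumm (fun n => weight k (- s) n).
Proof.
move=> s2; have s1 : 1 < 2 * s by lra.
apply: rsumm_lew (rsummZ (4 `^ s) (rsumm_japR s1)) _ => n.
rewrite ger0_norm ?weight_ge0 // weightE.
have [->|n1] := weight_base n.
  by rewrite powR0 ?oppr_eq0 ?lt0r_neq0 // mulr_ge0 ?powR_ge0.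
set X := _ + _ in n1 *; have X0 : 0 < X by exact: lt_le_trans n1.
rewrite powRN [jap n `^ _]powRN -[leLHS]mul1r ler_pdivrMr ?powR_gt0 //.
rewrite mulrAC ler_pdivlMr ?powR_gt0 ?jap_gt0 // mul1r.
rewrite powRrM (powR_mulrn 2) ?jap_ge0 // -powRM ?(ltW X0) //.
apply: ge0_ler_powR; rewrite ?nnegrE ?(ltW s_gt0) ?mulr_ge0 ?exprn_ge0 ?jap_ge0 ?(ltW X0) //.
have : jap n <= 1 + `|n%:~R| :> R by rewrite /jap natr_absz intr_norm.
have : n%:~R ^+ 2 <= X by rewrite /X lerDr.
rewrite -(@real_normK _ n%:~R) ?num_real //.
have := @jap_ge1 R n; have : 0 <= `|n%:~R : R| by [].
move: (jap n : R) (`|n%:~R| : R) X n1 {X0} => J a X X1 a0 J1 aX Ja.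
have : J ^+ 2 <= (1 + a) ^+ 2 by rewrite lerXn2r ?nnegrE //; lra.
by have := sqr_ge0 (a - 1); nra.
Qed.

End WeightKernels.

(** * The curvature in Fourier coefficients *)

Section Bracket.
Context {R : realType} (d : nat).
Variable br : 'cV[R]_d -> 'cV[R]_d -> 'cV[R]_d.
Hypothesis brl : forall a u v w, br (a *: u + v) w = a *: br u w + br v w.
Hypothesis brr : forall a u v w, br u (a *: v + w) = a *: br u v + br u w.

Definition sconst (l j i : 'I_d) : R := br (delta_mx l 0) (delta_mx j 0) i 0.

Lemma cV_basis (v : 'cV[R]_d) : v = \sum_l v l 0 *: delta_mx l 0.
Proof.
apply/matrixP => i j; rewrite ord1 summxE (bigD1 i) //= !mxE eqxx mulr1 big1 ?addr0 // => l li.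
by rewrite !mxE eq_sym (negPf li) mulr0.
Qed.

Lemma br0l w : br 0 w = 0.
Proof. by have := brl (- 1) 0 0 w; rewrite scaler0 addr0 scaleN1r addNr. Qed.
Lemma br0r w : br w 0 = 0.
Proof. by have := brr (- 1) w 0 0; rewrite scaler0 addr0 scaleN1r addNr. Qed.

Lemma br_suml (r : seq 'I_d) (a : 'I_d -> R) (u : 'I_d -> 'cV[R]_d) w :
  br (\sum_(l <- r) a l *: u l) w = \sum_(l <- r) a l *: br (u l) w.
Proof. by elim: r => [|x r IH]; rewrite ?big_nil ?br0l // !big_cons brl IH. Qed.
Lemma br_sumr (r : seq 'I_d) (a : 'I_d -> R) (u : 'I_d -> 'cV[R]_d) w :
  br w (\sum_(l <- r) a l *: u l) = \sum_(l <- r) a l *: br w (u l).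
Proof. by elim: r => [|x r IH]; rewrite ?big_nil ?br0r // !big_cons brr IH. Qed.

Lemma brE u v i : br u v i 0 = \sum_l \sum_j u l 0 * v j 0 * sconst l j i.
Proof.
rewrite {1}(cV_basis u) br_suml summxE; apply: eq_bigr => l _.
rewrite {1}(cV_basis v) br_sumr mxE summxE mulr_sumr; apply: eq_bigr => j _.
by rewrite mxE mulrA.
Qed.

(** The entries of [ad v], extended complex linearly; [sconst] are the structure constants. *)
Definition adc (v : 'cV[R[i]]_d) (i j : 'I_d) : R[i] := \sum_l v l 0 * (sconst l j i)%:C.

Lemma cbracketE v w i : cbracket br v w i 0 = \sum_j adc v i j * w j 0.
Proof.
transitivity (\sum_j \sum_l v l 0 * w j 0 * (sconst l j i)%:C); last first.
  by apply: eq_bigr => j _; rewrite mulr_suml; apply: eq_bigr => l _; rewrite mulrAC.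
rewrite exchange_big /= mxE; apply: complex_ext.
  rewrite !mxE !brE -sumrB (raddf_sum (@complex.Re R)); apply: eq_bigr => l _.
  rewrite -sumrB (raddf_sum (@complex.Re R)); apply: eq_bigr => j _.
  by rewrite /= !creM /= !mxE; ring.
rewrite !mxE !brE -big_split (raddf_sum (@complex.Im R)); apply: eq_bigr => l _.
rewrite /= -big_split (raddf_sum (@complex.Im R)); apply: eq_bigr => j _.
by rewrite /= !cimM !creM /= !mxE; ring.
Qed.

Hypothesis leibniz : forall x y z, br (br x y) z = br x (br y z) - br y (br x z).

Lemma sconst_leibniz l l' j i : \sum_p sconst l l' p * sconst p j i =
  \sum_p (sconst l p i * sconst l' j p - sconst l' p i * sconst l j p).
Proof.
have h (u v : 'cV[R]_d) k : br u (br v (delta_mx k 0)) i 0 = \sum_p br v (delta_mx k 0) p 0 * br u (delta_mx p 0) i 0.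
  by rewrite {1}(cV_basis (br v _)) br_sumr summxE; apply: eq_bigr => p _; rewrite mxE.
have := congr1 (fun m : 'cV[R]_d => m i 0) (leibniz (delta_mx l 0) (delta_mx l' 0) (delta_mx j 0)).
rewrite /= {1}(cV_basis (br (delta_mx l 0) (delta_mx l' 0))) br_suml summxE mxE h mxE h.
rewrite -sumrB => e.
under [RHS]eq_bigr => p _ do rewrite [sconst l p i * _]mulrC [sconst l' p i * _]mulrC.
by rewrite /sconst -e; apply: eq_bigr => p _; rewrite mxE.
Qed.

Lemma exchange_big3 (f : 'I_d -> 'I_d -> 'I_d -> R[i]) :
  \sum_p \sum_l \sum_l' f p l l' = \sum_l \sum_l' \sum_p f p l l'.
Proof. by rewrite exchange_big; apply: eq_bigr => l _; rewrite exchange_big. Qed.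

Lemma exchange_big3' (f : 'I_d -> 'I_d -> 'I_d -> R[i]) :
  \sum_p \sum_l \sum_l' f p l l' = \sum_l \sum_l' \sum_p f p l' l.
Proof. by rewrite exchange_big3 exchange_big. Qed.

Section Fields.
Variables X Y : R -> 'cV[R]_d.
Hypotheses (pX : periodic X) (sX : smooth1 setT X) (pY : periodic Y) (sY : smooth1 setT Y).

Definition adF (X : R -> 'cV[R]_d) (i j : 'I_d) (n : int) : R[i] := adc (fourier X n) i j.

Lemma rapid_adF_of (W : R -> 'cV[R]_d) i j : (forall l, rapid (fun n => fourier W n l 0)) -> rapid (adF W i j).
Proof.
by move=> h; apply: rapid_sum => l; have := rapidZ (sconst l j i)%:C (h l);
  rewrite (_ : (fun n => _) = (fun n => fourier W n l 0 * (sconst l j i)%:C)) //; apply/funext => n; rewrite mulrC.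
Qed.

Lemma fourierE (W : R -> 'cV[R]_d) l : (fun n => fourier W n l 0) = fc (fun x => W x l 0).
Proof. by apply/funext => n; rewrite mxE. Qed.

(** The components of the fields are replaced by their Fourier series, multiplied pointwise, and the
    coefficients are read off by uniqueness. *)
Lemma fourier_bracket p n : fourier (fun x => br (X x) (Y x)) n p 0 =
  \sum_l \sum_l' (sconst l l' p)%:C * conv (fun n => fourier X n l 0) (fun n => fourier Y n l' 0) n.
Proof.
have rX l := rapid_fourier l pX sX; have rY l := rapid_fourier l pY sY.
have rc l l' := rapid_conv (rX l) (rY l').
pose z (l l' : 'I_d) n : R[i] := (sconst l l' p)%:C * conv (fun n => fourier X n l 0) (fun n => fourier Y n l' 0) n.
have rz l l' : rapid (z l l') := rapidZ _ (rc l l').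
have rz2 l : rapid (fun n => \sum_l' z l l' n) := rapid_sum _ _ (rz l).
rewrite (congr1 (fun f => f n) (fourierE (fun x => br (X x) (Y x)) p)).
apply: (@fc_tser R (fun n => \sum_l \sum_l' z l l' n)); first exact: rapid_sum.
move=> x.
have e1 (f : 'I_d -> int -> R[i]) : (forall l, rapid (f l)) -> tser (fun n => \sum_l f l n) id x = \sum_l tser (f l) id x.
  move=> rf; rewrite /tser -tsum_sum; last by move=> l; exact: (summ_expi id x (rapid_summ (rf l))).
  by apply: eq_tsum => m; rewrite mulr_suml.
rewrite e1 // brE rmorph_sum; apply: eq_bigr => l _.
rewrite e1 // rmorph_sum; apply: eq_bigr => l' _.
have -> : tser (z l l') id x = (sconst l l' p)%:C * tser (conv (fun n => fourier X n l 0) (fun n => fourier Y n l' 0)) id x.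
  rewrite /tser -(tsumZ _ (summ_expi id x (rapid_summ (rc l l')))).
  by apply: eq_tsum => m; rewrite /z mulrA.
rewrite tser_conv // !fourierE.
rewrite (fourier_inversion x (periodic_entry l pX) (smooth1_entry sX (j := l))).
rewrite (fourier_inversion x (periodic_entry l' pY) (smooth1_entry sY (j := l'))).
by rewrite !rmorphM mulrC.
Qed.

Lemma rapid_fourier_bracket p : rapid (fun n => fourier (fun x => br (X x) (Y x)) n p 0).
Proof.
have -> : (fun n => fourier (fun x => br (X x) (Y x)) n p 0) = (fun n => \sum_l \sum_l' (sconst l l' p)%:C *
    conv (fun n => fourier X n l 0) (fun n => fourier Y n l' 0) n).
  by apply/funext => n; exact: fourier_bracket.
apply: rapid_sum => l; apply: rapid_sum => l'; apply: rapidZ.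
by apply: rapid_conv; exact: rapid_fourier.
Qed.

(** Pointwise, [ad [X, Y]] is the commutator of [ad X] and [ad Y], which is the Leibniz identity for
    structure constants ([sconst_leibniz]). In Fourier coefficients products become convolutions. *)
Lemma adF_bracket i j n : adF (fun x => br (X x) (Y x)) i j n =
  \sum_l (conv (adF X i l) (adF Y l j) n - conv (adF Y i l) (adF X l j) n).
Proof.
have rX l := rapid_fourier l pX sX; have rY l := rapid_fourier l pY sY.
pose c l l' := conv (fun n => fourier X n l 0) (fun n => fourier Y n l' 0) n.
have cc l l' : conv (fun n => fourier Y n l' 0) (fun n => fourier X n l 0) n = c l l'.
  rewrite /c /conv -(tsum_reindex (fun q => fourier Y (n - q) l' 0 * fourier X q l 0) (bij_subl n)).2.
  by apply: eq_tsum => q; rewrite subKr mulrC.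
have conv_adF (U W : R -> 'cV[R]_d) a b p q : (forall l, rapid (fun n => fourier U n l 0)) -> (forall l, rapid (fun n => fourier W n l 0)) ->
    conv (adF U a b) (adF W p q) n = \sum_l \sum_l' (sconst l b a * sconst l' q p)%:C * conv (fun n => fourier U n l 0) (fun n => fourier W n l' 0) n.
  move=> rU rW; have sp l l' m : summ (fun q : int => fourier U (m - q) l 0 * fourier W q l' 0) := summ_conv m (rU l) (rW l').
  transitivity (tsum (fun r : int => \sum_l \sum_l' (sconst l b a * sconst l' q p)%:C * (fourier U (n - r) l 0 * fourier W r l' 0))).
    apply: eq_tsum => r; rewrite /adF /adc big_distrlr /=; apply: eq_bigr => l _; apply: eq_bigr => l' _.
    by rewrite rmorphM; ring.
  rewrite tsum_sum; last by move=> l; apply: summ_sum => l'; exact: summZ.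
  apply: eq_bigr => l _; rewrite tsum_sum; last by move=> l'; exact: summZ.
  by apply: eq_bigr => l' _; rewrite tsumZ.
under eq_bigr => l _ do rewrite !conv_adF //.
rewrite /adF /adc.
transitivity (\sum_l \sum_l' (\sum_p sconst l l' p * sconst p j i)%:C * c l l').
  under eq_bigr => p _ do rewrite fourier_bracket mulr_suml.
  rewrite exchange_big; apply: eq_bigr => l _ /=.
  under eq_bigr => p _ do rewrite mulr_suml.
  rewrite exchange_big; apply: eq_bigr => l' _ /=.
  by rewrite rmorph_sum mulr_suml; apply: eq_bigr => p _; rewrite rmorphM /c; ring.
transitivity (\sum_l \sum_l' \sum_p (sconst l p i * sconst l' j p)%:C * c l l' -
  \sum_l \sum_l' \sum_p (sconst l' p i * sconst l j p)%:C * c l l'); last first.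
  rewrite sumrB; congr (_ - _); first by rewrite -exchange_big3.
  transitivity (\sum_p \sum_l \sum_l' (sconst l p i * sconst l' j p)%:C * c l' l).
    by rewrite exchange_big3'.
  by apply: eq_bigr => p _; apply: eq_bigr => l _; apply: eq_bigr => l' _; rewrite cc.
rewrite -sumrB; apply: eq_bigr => l _; rewrite -sumrB; apply: eq_bigr => l' _.
rewrite -sumrB sconst_leibniz rmorph_sum mulr_suml; apply: eq_bigr => p _.
by rewrite rmorphB mulrBl.
Qed.

Lemma fourier_sum0 (W : R -> 'cV[R]_d) : periodic W -> smooth1 setT W -> W 0 = 0 -> forall l, tsum (fun n => fourier W n l 0) = 0.
Proof.
move=> pW sW W0 l; have := fourier_inversion 0 (periodic_entry l pW) (smooth1_entry sW (j := l)).
rewrite W0 mxE => e; rewrite fourierE -[RHS]e; apply: eq_tsum => n.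
by rewrite mulr0 expi0 mulr1.
Qed.

End Fields.

Lemma tsum_adF (W : R -> 'cV[R]_d) i j : (forall l, rapid (fun n => fourier W n l 0)) ->
  (forall l, tsum (fun n => fourier W n l 0) = 0) -> tsum (adF W i j) = 0.
Proof.
move=> rW h; rewrite /adF /adc tsum_sum; last first.
  by move=> l; apply: summZr; apply: rapid_summ.
by rewrite big1 // => l _; rewrite tsumZr ?h ?mul0r //; exact: rapid_summ.
Qed.

Lemma fourier_bracket_sum0 (X Y : R -> 'cV[R]_d) : periodic X -> smooth1 setT X -> periodic Y -> smooth1 setT Y ->
  X 0 = 0 -> forall l, tsum (fun n => fourier (fun x => br (X x) (Y x)) n l 0) = 0.
Proof.
move=> pX sX pY sY X0 p.
have rX l := rapid_fourier l pX sX; have rY l := rapid_fourier l pY sY.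
have sc l l' : summ (conv (fun n => fourier X n l 0) (fun n => fourier Y n l' 0)) := rapid_summ (rapid_conv (rX l) (rY l')).
rewrite (eq_tsum (fourier_bracket pX sX pY sY p)) tsum_sum; last by move=> l; apply: summ_sum => l'; exact: summZ.
rewrite big1 // => l _; rewrite tsum_sum; last by move=> l'; exact: summZ.
rewrite big1 // => l' _; rewrite tsumZ //.
have -> : tsum (conv (fun n => fourier X n l 0) (fun n => fourier Y n l' 0)) = tser (conv (fun n => fourier X n l 0) (fun n => fourier Y n l' 0)) id 0.
  by apply: eq_tsum => n; rewrite mulr0 expi0 mulr1.
rewrite tser_conv // (_ : tser _ _ _ = 0) ?mul0r ?mulr0 //.
rewrite -[RHS](fourier_sum0 pX sX X0 l); apply: eq_tsum => n.
by rewrite mulr0 expi0 mulr1.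
Qed.

End Bracket.

(** * Composition of kernels *)

Section KernelComposition.
Context {R : realType}.
Variable t : R.
Hypothesis t_gt1 : 1 < t.
Local Notation T := (int * int)%type.

Lemma decay_bounded z : decay t z -> exists2 C : R, 0 <= C & forall n, normc (z n) <= C.
Proof.
move=> [C C0 hC]; exists C => // n; apply: le_trans (hC n) _.
rewrite ler_piMr // powRN invf_le1 ?powR_gt0 ?jap_gt0 //.
have := ler_powR (@jap_ge1 R n) (ltW (lt_trans ltr01 t_gt1)); by rewrite powRr0.
Qed.

Lemma kconv_alt (F : int -> int -> R) u z n :
  kconv F u z n = tsum (fun a => u a * (F n (n - a))%:C * z (n - a)).
Proof.
rewrite /kconv -(tsum_reindex (fun q => u (n - q) * (F n q)%:C * z q) (bij_subl n)).2.
by apply: eq_tsum => a; rewrite subKr.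
Qed.

(** The iterated sum is indexed by the two shifts [a], [b] on the path from [n - (a + b)] through
    [n - a] to [n], so that it has the same index set as the kernel of a bracket in [kconv_conv]. *)
Lemma kconv_comp F u v z n : kbounded F -> rapid u -> rapid v -> decay t z ->
  let f := fun th : T => u th.1 * v th.2 * (F n (n - th.1) * F (n - th.1) (n - (th.1 + th.2)))%:C * z (n - (th.1 + th.2)) in
  summ f /\ kconv F u (kconv F v z) n = tsum f.
Proof.
move=> hF ru rv dz f.
have [B B0 hB] := decay_bounded dz.
have [C [L C0 hC]] := hF.
have sw (w : int -> R[i]) : rapid w -> rsumm (fun a => C * (normc (w a) * jap a ^+ L)).
  by move=> rw; apply: rsummZ; exact: rapid_decays rw L.
have sf : summ f.
  apply: summ_le (rsummZ B (rsumm_prodM (sw u ru) (sw v rv))) _ => [[a b]].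
  rewrite /f /= !normcM normc_real mulrC; apply: ler_pM; rewrite ?mulr_ge0 ?normc_ge0 //.
  have -> : C * (normc (u a) * jap a ^+ L) * (C * (normc (v b) * jap b ^+ L)) =
    normc (u a) * normc (v b) * ((C * jap a ^+ L) * (C * jap b ^+ L)) by ring.
  rewrite ler_wpM2l ?mulr_ge0 ?normc_ge0 // normrM; apply: ler_pM => //.
    by have := hC n (n - a); rewrite subKr.
  by have := hC (n - a) (n - (a + b)); rewrite (_ : n - a - (n - (a + b)) = b); last by lia.
split => //; rewrite -(tsum_prod sf).2 kconv_alt; apply: eq_tsum => a.
have sv := summ_kconv t_gt1 (n - a) hF rv dz.
rewrite kconv_alt -tsumZ; last first.
  have := summ_reindex (bij_subl (n - a)) sv; apply: eq_summ => b.
  by rewrite subKr.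
apply: eq_tsum => b; rewrite /f /= opprD addrA !rmorphM; ring.
Qed.

Lemma kconv_conv F u v z n : kbounded F -> rapid u -> rapid v -> decay t z ->
  let f := fun th : T => u th.1 * v th.2 * (F n (n - (th.1 + th.2)))%:C * z (n - (th.1 + th.2)) in
  summ f /\ kconv F (conv u v) z n = tsum f.
Proof.
move=> hF ru rv dz f.
have [B B0 hB] := decay_bounded dz.
have [C [L C0 hC]] := hF.
have sf : summ f.
  have := rsumm_prodM (rapid_decays ru L) (rapid_decays rv L) => sp.
  apply: summ_le (rsummZ (C * B) sp) _ => [[a b]].
  rewrite /f /= !normcM normc_real.
  have -> : C * B * (normc (u a) * jap a ^+ L * (normc (v b) * jap b ^+ L)) =
    normc (u a) * normc (v b) * (C * (jap a ^+ L * jap b ^+ L)) * B by ring.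
  apply: ler_pM; rewrite ?mulr_ge0 ?normc_ge0 //.
  rewrite ler_wpM2l ?mulr_ge0 ?normc_ge0 //; apply: le_trans (hC _ _) _.
  by rewrite subKr ler_wpM2l // japX_add.
split => //; rewrite -(tsum_reindex f bij_shear).2.
rewrite -(tsum_prod (summ_reindex bij_shear sf)).2 kconv_alt; apply: eq_tsum => a.
have sc := summ_conv a ru rv.
rewrite /conv -mulrA -(tsumZr _ sc); apply: eq_tsum => b.
by rewrite /f /= subrK !mulrA.
Qed.

End KernelComposition.

(** * The connection in Fourier coefficients *)

Section NablaDef.
Context {R : realType} (d : nat).
Variables (k : loops) (s : R).

Definition badrow (n : int) : bool := based k && (n == 0).

Lemma Ainv0 (F : coeffs R d) i : based k ->
  summ (fun n => (weight k (- s) n)%:C * (F n i 0 - F 0 i 0)) ->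
  Ainv k s F 0 i 0 = - tsum (fun n => (weight k (- s) n)%:C * (F n i 0 - F 0 i 0)).
Proof.
rewrite /based /Ainv; case: k => // _ sF; rewrite eqxx !mxE.
have e n : ((weight Based (- s) n)%:C *: (F n - F 0)) i 0 = (weight Based (- s) n)%:C * (F n i 0 - F 0 i 0) by rewrite !mxE.
rewrite csumE; last by apply: eq_summ sF => n; rewrite e.
by rewrite (eq_tsum e).
Qed.

Lemma AinvN (F : coeffs R d) n i : ~~ badrow n ->
  Ainv k s F n i 0 = (weight k (- s) n)%:C * (F n i 0 - (if based k then F 0 i 0 else 0)).
Proof.
rewrite /badrow /based /Ainv; case: k => /= [_|n0]; first by rewrite /Apow !mxE subr0.
by rewrite (negPf n0) !mxE.
Qed.

Lemma addB_congr (a a' b b' c c' : R[i]) : a = a' -> b = b' -> c = c' -> a - b + c = a' - b' + c'.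
Proof. by move=> -> -> ->. Qed.

Lemma cancel_alg (x y : R[i]) : 2^-1 * (0 - x + y + (x - y)) = 0.
Proof.
have -> : 0 - x + y + (x - y) = 0 by ring.
exact: mulr0.
Qed.

Lemma sum_alg (f g h : 'I_d -> R[i]) (w : R[i]) :
  \sum_j f j - w * \sum_j g j + w * \sum_j h j = \sum_j (f j - w * g j + w * h j).
Proof. by rewrite !mulr_sumr -sumrB -big_split. Qed.

Lemma nabla_alg (a a1 a2 f1 f2 f10 f20 w : R[i]) (b : bool) :
  a1 = w * (f1 - (if b then f10 else 0)) -> a2 = w * (f2 - (if b then f20 else 0)) -> f10 = f20 ->
  2^-1 * (a - a1 + a2) = 2^-1 * (a - w * f1 + w * f2).
Proof. by move=> -> -> ->; congr (_ * _); ring. Qed.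

Lemma nablaE br (X : R -> 'cV[R]_d) Z n i : nabla k br s X Z n i 0 =
  2^-1 * (conv_bracket br (fourier X) Z n i 0
     - Ainv k s (conv_bracket br (Apow k s (fourier X)) Z) n i 0
     + Ainv k s (conv_bracket br (fourier X) (Apow k s Z)) n i 0).
Proof.
rewrite /nabla; move: (conv_bracket _ _ _ n) (Ainv _ _ _ n) (Ainv _ _ _ n) => A B C.
by rewrite !mxE.
Qed.

End NablaDef.

Section Nabla.
Context {R : realType} (d : nat).
Variable br : 'cV[R]_d -> 'cV[R]_d -> 'cV[R]_d.
Hypothesis brl : forall a u v w, br (a *: u + v) w = a *: br u w + br v w.
Hypothesis brr : forall a u v w, br u (a *: v + w) = a *: br u v + br u w.
Variables (k : loops) (s t : R).
Hypotheses (s_gt : 2^-1 < s) (t_gt1 : 1 < t).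

Let s_gt0 : 0 < s. Proof. by apply: lt_trans s_gt; rewrite invr_gt0. Qed.
Let kg := kbounded_gker k s_gt0.

Definition ndecay (Z : coeffs R d) := forall j, decay t (fun n => Z n j 0).

Variable X : R -> 'cV[R]_d.
Hypothesis rX : forall l, rapid (fun n => fourier X n l 0).
Hypothesis X0 : based k -> forall l, tsum (fun n => fourier X n l 0) = 0.

Let rA i j : rapid (adF br X i j) := rapid_adF_of br i j rX.

Definition F1 i j (Z : coeffs R d) n := tsum (fun q => adF br X i j (n - q) * (weight k s (n - q))%:C * Z q j 0).
Definition F2 i j (Z : coeffs R d) n := tsum (fun q => adF br X i j (n - q) * (weight k s q)%:C * Z q j 0).

Lemma kb_weight1 : kbounded (fun n q => weight k s (n - q)).
Proof.
have [K hK] := weight_le_jap k s_gt0; exists 1, K => // n q.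
by rewrite mul1r ger0_norm ?weight_ge0.
Qed.

Lemma summ_F1 i j Z n : ndecay Z -> summ (fun q => adF br X i j (n - q) * (weight k s (n - q))%:C * Z q j 0).
Proof. by move=> dZ; exact: (summ_kconv t_gt1 n kb_weight1 (rA i j) (dZ j)). Qed.

Lemma summ_F2 i j Z n : ndecay Z -> summ (fun q => adF br X i j (n - q) * (weight k s q)%:C * Z q j 0).
Proof.
move=> dZ; have [K hK] := weight_le_jap k s_gt0.
(* The weight at [q] grows, but [n] is fixed: divided by [jap n ^+ K], the kernel is bounded by a
   power of [jap (n - q)]. *)
have kb : kbounded (fun n q => weight k s q / jap n ^+ K).
  exists 1, K => // n' q; have J0 : 0 < jap n' ^+ K :> R by rewrite exprn_gt0 ?jap_gt0.
  rewrite mul1r ger0_norm ?divr_ge0 ?weight_ge0 ?(ltW J0) // ler_pdivrMr //.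
  apply: le_trans (hK q) _; rewrite -exprMn lerXn2r ?nnegrE ?mulr_ge0 ?jap_ge0 //.
  by rewrite -(japN (n' - q)) opprB -{1}(subrK n' q) japD.
have := summZ (jap n ^+ K)%:C (summ_kconv t_gt1 n kb (rA i j) (dZ j)); apply: eq_summ => q.
have J0 : jap n ^+ K != 0 :> R by rewrite expf_neq0 // lt0r_neq0 // jap_gt0.
transitivity (adF br X i j (n - q) * (jap n ^+ K * (weight k s q / jap n ^+ K))%:C * Z q j 0).
  by rewrite rmorphM; ring.
by rewrite [jap n ^+ K * _]mulrC divfK.
Qed.

Lemma conv_bracket_entry (A : int -> R) (B : int -> R) (Z : coeffs R d) n i :
  (forall j, summ (fun q => adF br X i j (n - q) * (A (n - q) * B q)%:C * Z q j 0)) ->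
  conv_bracket br (fun n => (A n)%:C *: fourier X n) (fun n => (B n)%:C *: Z n) n i 0 =
  \sum_j tsum (fun q => adF br X i j (n - q) * (A (n - q) * B q)%:C * Z q j 0).
Proof.
move=> h.
have e q : cbracket br ((A (n - q))%:C *: fourier X (n - q)) ((B q)%:C *: Z q) i 0 =
   \sum_j adF br X i j (n - q) * (A (n - q) * B q)%:C * Z q j 0.
  rewrite cbracketE //; apply: eq_bigr => j _; rewrite mxE /adF /adc rmorphM.
  rewrite !mulr_suml; apply: eq_bigr => l _; rewrite mxE; ring.
rewrite /conv_bracket mxE csumE; last by apply: eq_summ (summ_sum _ _ h) => q; rewrite e.
by rewrite (eq_tsum e) tsum_sum.
Qed.

Lemma cb_entry Z n i : ndecay Z -> conv_bracket br (fourier X) Z n i 0 =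
  \sum_j kconv (fun _ _ => 1) (adF br X i j) (fun q => Z q j 0) n.
Proof.
move=> dZ; have := @conv_bracket_entry (fun=> 1) (fun=> 1) Z n i.
have -> : (fun n => 1%:C *: fourier X n) = fourier X by apply/funext => m; rewrite scale1r.
have -> : (fun n => 1%:C *: Z n) = Z by apply/funext => m; rewrite scale1r.
rewrite mulr1; apply => j.
exact: (summ_kconv t_gt1 n (kbounded_cst 1) (rA i j) (dZ j)).
Qed.

Lemma cb1_entry Z n i : ndecay Z -> conv_bracket br (Apow k s (fourier X)) Z n i 0 = \sum_j F1 i j Z n.
Proof.
move=> dZ; have := @conv_bracket_entry (weight k s) (fun=> 1) Z n i.
have -> : (fun n => 1%:C *: Z n) = Z by apply/funext => m; rewrite scale1r.
have e j : (fun q => adF br X i j (n - q) * (weight k s (n - q) * 1)%:C * Z q j 0) =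
  (fun q => adF br X i j (n - q) * (weight k s (n - q))%:C * Z q j 0) by apply/funext => q; rewrite mulr1.
move=> ->; first by apply: eq_bigr => j _; rewrite e.
by move=> j; rewrite e; exact: summ_F1.
Qed.

Lemma cb2_entry Z n i : ndecay Z -> conv_bracket br (fourier X) (Apow k s Z) n i 0 = \sum_j F2 i j Z n.
Proof.
move=> dZ; have := @conv_bracket_entry (fun=> 1) (weight k s) Z n i.
have -> : (fun n => 1%:C *: fourier X n) = fourier X by apply/funext => m; rewrite scale1r.
have e j : (fun q => adF br X i j (n - q) * (1 * weight k s q)%:C * Z q j 0) =
  (fun q => adF br X i j (n - q) * (weight k s q)%:C * Z q j 0) by apply/funext => q; rewrite mul1r.
move=> ->; first by apply: eq_bigr => j _; rewrite e.
by move=> j; rewrite e; exact: summ_F2.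
Qed.

Let w1 := kbounded_ratio1 k s_gt0.
Let w2 := kbounded_ratio k s_gt0.

Lemma kF1 i j Z n : ndecay Z -> (weight k (- s) n)%:C * F1 i j Z n =
  kconv (fun p q => weight k s (p - q) * weight k (- s) p) (adF br X i j) (fun q => Z q j 0) n.
Proof.
move=> dZ; rewrite -tsumZ; last exact: summ_F1.
by apply: eq_tsum => q; rewrite rmorphM; ring.
Qed.

Lemma kF2 i j Z n : ndecay Z -> (weight k (- s) n)%:C * F2 i j Z n =
  kconv (fun p q => weight k s q * weight k (- s) p) (adF br X i j) (fun q => Z q j 0) n.
Proof.
move=> dZ; rewrite -tsumZ; last exact: summ_F2.
by apply: eq_tsum => q; rewrite rmorphM; ring.
Qed.

(** At output frequency 0 the weights at [n - q = - q] and at [q] agree. Hence the values [F 0]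
    subtracted in the two [Ainv] terms cancel in all rows other than 0, and the kernel [gker] has
    the same form for free and based loops. *)
Lemma F12 i j Z : F1 i j Z 0 = F2 i j Z 0.
Proof. by apply: eq_tsum => q; rewrite !weightE sub0r intrN sqrrN. Qed.

Local Opaque F1 F2 kconv adF conv_bracket Ainv Apow fourier weight.

Lemma kgE i j Z n : ndecay Z ->
  kconv (gker k s) (adF br X i j) (fun q => Z q j 0) n =
  kconv (fun _ _ => 1) (adF br X i j) (fun q => Z q j 0) n
  - (weight k (- s) n)%:C * F1 i j Z n + (weight k (- s) n)%:C * F2 i j Z n.
Proof.
move=> dZ; have e1 := kF1 i j n dZ; have e2 := kF2 i j n dZ.
transitivity (kconv (fun _ _ => 1) (adF br X i j) (fun q => Z q j 0) n
  + kconv (fun p q => - (weight k s (p - q) * weight k (- s) p)) (adF br X i j) (fun q => Z q j 0) n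
  + kconv (fun p q => weight k s q * weight k (- s) p) (adF br X i j) (fun q => Z q j 0) n); last first.
  by congr (_ + _ + _); [apply: etrans (kconvN _ _ _ _) _; congr (- _); exact: esym e1|exact: esym e2].
rewrite -(kconvD t_gt1 n (kbounded_cst 1) (kboundedN w1) (rA i j) (dZ j)).
rewrite -(kconvD t_gt1 n (kboundedD (kbounded_cst 1) (kboundedN w1)) w2 (rA i j) (dZ j)).
by apply: eq_kconv => // q; rewrite /gker; ring.
Qed.

Lemma nabla_entry Z n i : ndecay Z -> ~~ badrow k n ->
  nabla k br s X Z n i 0 = 2^-1 * \sum_j kconv (gker k s) (adF br X i j) (fun q => Z q j 0) n.
Proof.
move=> dZ gn.
have e0 : conv_bracket br (Apow k s (fourier X)) Z 0 i 0 = conv_bracket br (fourier X) (Apow k s Z) 0 i 0.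
  by apply: etrans (cb1_entry 0 i dZ) (etrans _ (esym (cb2_entry 0 i dZ))); apply: eq_bigr => j _; exact: F12.
have a1 := AinvN s (conv_bracket br (Apow k s (fourier X)) Z) i gn.
have a2 := AinvN s (conv_bracket br (fourier X) (Apow k s Z)) i gn.
apply: etrans (nablaE k s br X Z n i) _; apply: etrans (nabla_alg _ a1 a2 e0) _.
congr (_ * _).
transitivity (\sum_j kconv (fun _ _ => 1) (adF br X i j) (fun q => Z q j 0) n -
  (weight k (- s) n)%:C * \sum_j F1 i j Z n + (weight k (- s) n)%:C * \sum_j F2 i j Z n).
  congr (_ - _ * _ + _ * _); [exact: cb_entry|exact: cb1_entry|exact: cb2_entry].
apply: etrans (sum_alg _ _ _ _) _.
by apply: eq_bigr => j _; exact: esym (kgE i j n dZ).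
Qed.

Lemma decay_nabla Z : ndecay Z -> ndecay (nabla k br s X Z).
Proof.
move=> dZ i; pose z n := 2^-1 * \sum_j kconv (gker k s) (adF br X i j) (fun q => Z q j 0) n.
have dz : decay t z.
  apply: decayZ; apply: decay_sum => j; exact: (decay_kconv t_gt1 kg (rA i j) (dZ j)).
apply: (decay_update (n0 := 0) dz) => n n0; apply: nabla_entry => //.
by rewrite /badrow (negPf n0) andbF.
Qed.

(** The bracket vanishes at the base point because [X] does, and the [Ainv] terms do by the choice
    of their coefficient at 0. *)
Lemma nabla_sum0 Z i : based k -> ndecay Z -> tsum (fun n => nabla k br s X Z n i 0) = 0.
Proof.
(* By the convention for powers of 0, sums weighted by [weight (- s)] may run over all
   frequencies. *)
move=> kB dZ; have W0 : weight k (- s) 0 = 0.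
  by rewrite weightE; move: kB; rewrite /eps /based; case: k => // _; rewrite expr0n addr0 powR0 // oppr_eq0 lt0r_neq0.
pose a n : R[i] := conv_bracket br (fourier X) Z n i 0.
pose G1 n : R[i] := conv_bracket br (Apow k s (fourier X)) Z n i 0.
pose G2 n : R[i] := conv_bracket br (fourier X) (Apow k s Z) n i 0.
pose w n : R[i] := (weight k (- s) n)%:C.
have G12 : G1 0 = G2 0.
  by apply: etrans (cb1_entry 0 i dZ) (etrans _ (esym (cb2_entry 0 i dZ))); apply: eq_bigr => j _; exact: F12.
have sa : summ a /\ tsum a = 0.
  have e n : a n = \sum_j kconv (fun _ _ => 1) (adF br X i j) (fun q => Z q j 0) n := cb_entry n i dZ.
  have sj j := decay_summ t_gt1 (decay_kconv t_gt1 (kbounded_cst 1) (rA i j) (dZ j)).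
  split; first by apply: eq_summ (summ_sum _ _ sj) => n; rewrite e.
  rewrite (eq_tsum e) (tsum_sum _ _ sj) big1 // => j _.
  by rewrite (tsum_kconv1 t_gt1 (rA i j) (dZ j)) (tsum_adF br i j rX (X0 kB)) mul0r.
have s1 : summ (fun n => w n * G1 n).
  have sj j := decay_summ t_gt1 (decay_kconv t_gt1 w1 (rA i j) (dZ j)).
  have ss := summ_sum (index_enum _) predT sj.
  apply: (eq_summ _ ss) => n.
  have eG : G1 n = \sum_j F1 i j Z n := cb1_entry n i dZ.
  rewrite eG.
  rewrite mulr_sumr.
  by apply: eq_bigr => j _; have := kF1 i j n dZ.
have s2 : summ (fun n => w n * G2 n).
  have sj j := decay_summ t_gt1 (decay_kconv t_gt1 w2 (rA i j) (dZ j)).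
  have ss := summ_sum (index_enum _) predT sj.
  apply: (eq_summ _ ss) => n.
  have eG : G2 n = \sum_j F2 i j Z n := cb2_entry n i dZ.
  rewrite eG.
  rewrite mulr_sumr.
  by apply: eq_bigr => j _; have := kF2 i j n dZ.
have sw : summ w.
  by apply: summ_le (summ_weightNs k s_gt0 s_gt) _ => n; rewrite normc_real ger0_norm ?weight_ge0.
have sw1 : summ (fun n => w n * (G1 n - G1 0)).
  by apply: eq_summ (summB s1 (summZr (G1 0) sw)) => n; rewrite mulrBr.
have sw2 : summ (fun n => w n * (G2 n - G2 0)).
  by apply: eq_summ (summB s2 (summZr (G2 0) sw)) => n; rewrite mulrBr.
(* [c] is what the two [Ainv] terms put in row 0; as the family [D], supported there, it cancels the
   sums over the other rows. *)
pose c := tsum (fun n => w n * (G1 n - G1 0)) - tsum (fun n => w n * (G2 n - G2 0)).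
pose D (n : int) : R[i] := if n == 0 then c else 0.
have [sD eD] : summ D /\ tsum D = c.
  have [h1 h2] := @tsum_set1 R int D 0 (fun n n0 => ifN_eq _ _ n0).
  by split => //; rewrite h2 /D eqxx.
have e n : nabla k br s X Z n i 0 = 2^-1 * (a n - w n * (G1 n - G1 0) + w n * (G2 n - G2 0) + D n).
  apply: etrans (nablaE k s br X Z n i) _; congr (_ * _); rewrite /D; case: eqP => [->|/eqP n0].
    have a1 := Ainv0 kB sw1; have a2 := Ainv0 kB sw2.
    transitivity (a 0 - - tsum (fun n => w n * (G1 n - G1 0)) + - tsum (fun n => w n * (G2 n - G2 0))).
      exact: addB_congr (erefl _) a1 a2.
    by rewrite /w W0 rmorph0 !mul0r subr0 addr0 opprK /c addrA.
  have gn : ~~ badrow k n by rewrite /badrow (negPf n0) andbF.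
  rewrite addr0.
  have a1 := AinvN s (conv_bracket br (Apow k s (fourier X)) Z) i gn.
  have a2 := AinvN s (conv_bracket br (fourier X) (Apow k s Z)) i gn.
  move: a1 a2; rewrite kB => a1 a2.
  exact: addB_congr (erefl _) a1 a2.
have sA := summB sa.1 sw1; have sB := summD sA sw2; have sC := summD sB sD.
rewrite (eq_tsum e) (tsumZ _ sC) (tsumD sB sD) (tsumD sA sw2) (tsumB sa.1 sw1) eD sa.2 /c.
exact: cancel_alg.
Qed.

End Nabla.

(** * From composed connections to the scalar kernel *)

Section KernelLinear.
Context {R : realType}.
Variable t : R.
Hypothesis t_gt1 : 1 < t.
Implicit Types (F : int -> int -> R) (u v z : int -> R[i]).

Lemma kconvZ F u z c n : kbounded F -> rapid u -> decay t z ->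
  kconv F u (fun q => c * z q) n = c * kconv F u z n.
Proof.
move=> hF ru dz; have sk := summ_kconv t_gt1 n hF ru dz.
rewrite /kconv -(tsumZ c sk); apply: eq_tsum => q.
by rewrite mulrCA.
Qed.

Lemma kconv_suml (T : Type) (r : seq T) F (u v : T -> int -> R[i]) z n : kbounded F ->
  (forall j, rapid (u j)) -> (forall j, rapid (v j)) -> decay t z ->
  kconv F (fun m => \sum_(j <- r) (u j m - v j m)) z n = \sum_(j <- r) (kconv F (u j) z n - kconv F (v j) z n).
Proof.
move=> hF ru rv dz; have su j := summ_kconv t_gt1 n hF (ru j) dz; have sv j := summ_kconv t_gt1 n hF (rv j) dz.
transitivity (tsum (fun q => \sum_(j <- r) (u j (n - q) * (F n q)%:C * z q - v j (n - q) * (F n q)%:C * z q))).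
  apply: eq_tsum => q; rewrite !mulr_suml; apply: eq_bigr => j _.
  by rewrite !mulrBl.
rewrite tsum_sum; last by move=> j; exact: summB (su j) (sv j).
by apply: eq_bigr => j _; rewrite (tsumB (su j) (sv j)).
Qed.

Lemma rapid2_mul u v : rapid u -> rapid v -> rapid2 (fun th : int * int => u th.1 * v th.2).
Proof.
move=> ru rv L; have [C C0 hC] := ru L; have [D D0 hD] := rv L.
exists (C * D); first exact: mulr_ge0.
move=> th; rewrite normcM /rho2 exprMn invfM mulrACA.
by apply: ler_pM; rewrite ?normc_ge0.
Qed.

Lemma rapid2B (a b : int * int -> R[i]) : rapid2 a -> rapid2 b -> rapid2 (fun th => a th - b th).
Proof.
move=> ra rb L; have [C C0 hC] := ra L; have [D D0 hD] := rb L.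
exists (C + D); first exact: addr_ge0.
by move=> th; apply: le_trans (normcB _ _) _; rewrite mulrDl lerD.
Qed.

Lemma rapid2_sum (T : Type) (r : seq T) (a : T -> int * int -> R[i]) : (forall j, rapid2 (a j)) ->
  rapid2 (fun th => \sum_(j <- r) a j th).
Proof.
move=> ra L; elim: r => [|x r [C C0 hC]].
  by exists 0 => // th; rewrite big_nil normc_real normr0 mul0r.
have [D D0 hD] := ra x L; exists (D + C); first exact: addr_ge0.
by move=> th; rewrite big_cons; apply: le_trans (normcD _ _) _; rewrite mulrDl lerD.
Qed.

Variables (k : loops) (s : R).
Hypothesis s_gt0 : 0 < s.

(** The two terms of [hker] are the composition of two kernels [gker / 2] and the kernel [gker / 2]
    belonging to the bracket, for one order of [u] and [v]. *)
Lemma hker_kconv u v z n : rapid u -> rapid v -> decay t z ->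
  let f := fun th : int * int => u th.1 * v th.2 * (hker k s (n - (th.1 + th.2)) th)%:C * z (n - (th.1 + th.2)) in
  summ f /\ tsum f = 4^-1 * kconv (gker k s) u (kconv (gker k s) v z) n - 2^-1 * kconv (gker k s) (conv u v) z n.
Proof.
move=> ru rv dz f; have kg := kbounded_gker k s_gt0.
have [s1 e1] := kconv_comp t_gt1 n kg ru rv dz; have [s2 e2] := kconv_conv t_gt1 n kg ru rv dz.
have e th : f th = 4^-1 * (u th.1 * v th.2 * (gker k s n (n - th.1) * gker k s (n - th.1) (n - (th.1 + th.2)))%:C * z (n - (th.1 + th.2)))
   - 2^-1 * (u th.1 * v th.2 * (gker k s n (n - (th.1 + th.2)))%:C * z (n - (th.1 + th.2))).
  rewrite /f /hker subrK (_ : n - (th.1 + th.2) + th.2 = n - th.1); last by lia.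
  have -> : (4^-1 * (gker k s n (n - th.1) * gker k s (n - th.1) (n - (th.1 + th.2)) - 2 * gker k s n (n - (th.1 + th.2))))%:C =
    4^-1 * (gker k s n (n - th.1) * gker k s (n - th.1) (n - (th.1 + th.2)))%:C - 2^-1 * (gker k s n (n - (th.1 + th.2)))%:C.
    rewrite rmorphM rmorphB rmorphM /= fmorphV !rmorph_nat.
    by field.
  ring.
have ss := summB (summZ 4^-1 s1) (summZ 2^-1 s2).
split; first by apply: eq_summ ss => th; rewrite e.
by rewrite (eq_tsum e) (tsumB (summZ 4^-1 s1) (summZ 2^-1 s2)) (tsumZ _ s1) (tsumZ _ s2) e1 e2.
Qed.

(** The eigenvalue at 0 is 0 and the remaining two terms cancel. Constants are thus annihilated
    outside row 0, so that the exceptional row of an inner factor does not propagate. *)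
Lemma gker_based0 n : based k -> n != 0 -> gker k s n 0 = 0.
Proof.
move=> kB n0; have w0 : weight k s 0 = 0.
  by rewrite weightE; move: kB; rewrite /eps /based; case: k => // _; rewrite expr0n addr0 powR0 // lt0r_neq0.
rewrite /gker w0 subr0 sub0r weightN mulNr divff ?subrr // weightE.
rewrite lt0r_neq0 // powR_gt0 // ltr_wpDl // exprn_even_gt0 //= intr_eq0 //.
Qed.

End KernelLinear.

(** * The kernel of the curvature *)

Section Curvature.
Context {R : realType} (d : nat).
Variable br : 'cV[R]_d -> 'cV[R]_d -> 'cV[R]_d.
Hypothesis brl : forall a u v w, br (a *: u + v) w = a *: br u w + br v w.
Hypothesis brr : forall a u v w, br u (a *: v + w) = a *: br u v + br u w.
Hypothesis leibniz : forall x y z, br (br x y) z = br x (br y z) - br y (br x z).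
Variables (k : loops) (s t : R).
Hypotheses (s_gt : 2^-1 < s) (t_gt1 : 1 < t).
Variables X Y : R -> 'cV[R]_d.
Hypotheses (fX : smooth_field k X) (fY : smooth_field k Y).

Let s_gt0 : 0 < s. Proof. by apply: lt_trans s_gt; rewrite invr_gt0. Qed.
Let kg := kbounded_gker k s_gt0.
Let pX : periodic X. Proof. by case: fX. Qed.
Let pY : periodic Y. Proof. by case: fY. Qed.
Let sX : smooth1 setT X. Proof. by case: fX. Qed.
Let sY : smooth1 setT Y. Proof. by case: fY. Qed.
Let X00 : based k -> X 0 = 0. Proof. by case: fX => _ _ h; rewrite /based => hb; apply: h; move: hb; case: k. Qed.
Let Y00 : based k -> Y 0 = 0. Proof. by case: fY => _ _ h; rewrite /based => hb; apply: h; move: hb; case: k. Qed.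
Let rX l : rapid (fun n => fourier X n l 0) := rapid_fourier l pX sX.
Let rY l : rapid (fun n => fourier Y n l 0) := rapid_fourier l pY sY.
Let rB l : rapid (fun n => fourier (fun x => br (X x) (Y x)) n l 0) := rapid_fourier_bracket brl brr pX sX pY sY l.
Let X0 (h : based k) l := fourier_sum0 pX sX (X00 h) l.
Let Y0 (h : based k) l := fourier_sum0 pY sY (Y00 h) l.
Let B0 (h : based k) l := fourier_bracket_sum0 brl brr pX sX pY sY (X00 h) l.
Let rXA i j := rapid_adF_of br i j rX.
Let rYA i j := rapid_adF_of br i j rY.

(** [n] is the input frequency, so [n + a + b = 0] is the output row 0. For based loops it is set to
    0 here; its true value is restored in [curvature_entry] from the vanishing at the base point. *)
Definition Hcurv (n : int) (th : int * int) : R :=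
  if based k && (n + (th.1 + th.2) == 0) then 0 else hker k s n th.

Definition Mcurv (th : int * int) : 'M[R[i]]_d := \matrix_(i, j)
  \sum_l (adF br X i l th.1 * adF br Y l j th.2 - adF br Y i l th.1 * adF br X l j th.2).

Lemma Mcurv_rapid i j : rapid2 (fun th => Mcurv th i j).
Proof.
have h := rapid2_sum (index_enum _) (fun l => rapid2B (rapid2_mul (rXA i l) (rYA l j)) (rapid2_mul (rYA i l) (rXA l j))).
by move=> L; have [C C0 hC] := h L; exists C => // th; rewrite mxE.
Qed.

Let sop i j (z : int -> R[i]) (n : int) := Sop Hcurv (fun th => Mcurv th i j) z n.

Let kk u v z n : R[i] := 4^-1 * kconv (gker k s) u (kconv (gker k s) v z) n - 2^-1 * kconv (gker k s) (conv u v) z n.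

Lemma sop_good i j z n : decay t z -> ~~ badrow k n ->
  sop i j z n = \sum_l (kk (adF br X i l) (adF br Y l j) z n - kk (adF br Y i l) (adF br X l j) z n).
Proof.
move=> dz gn.
pose f u v := fun th : int * int => u th.1 * v th.2 * (hker k s (n - (th.1 + th.2)) th)%:C * z (n - (th.1 + th.2)).
have h u v (ru : rapid u) (rv : rapid v) : summ (f u v) /\ tsum (f u v) = kk u v z n := hker_kconv t_gt1 k s_gt0 n ru rv dz.
have s1 l := (h _ _ (rXA i l) (rYA l j)).1; have s2 l := (h _ _ (rYA i l) (rXA l j)).1.
transitivity (tsum (fun th => \sum_l (f (adF br X i l) (adF br Y l j) th - f (adF br Y i l) (adF br X l j) th))).
  apply: eq_tsum => th; rewrite mxE !mulr_suml; apply: eq_bigr => l _.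
  have -> : Hcurv (n - (th.1 + th.2)) th = hker k s (n - (th.1 + th.2)) th by rewrite /Hcurv subrK -/(badrow k n) (negPf gn).
  by rewrite !mulrBl.
rewrite tsum_sum; last by move=> l; exact: summB (s1 l) (s2 l).
apply: eq_bigr => l _; rewrite (tsumB (s1 l) (s2 l)).
by rewrite (h _ _ (rXA i l) (rYA l j)).2 (h _ _ (rYA i l) (rXA l j)).2.
Qed.

Lemma sop_bad i j z : based k -> sop i j z 0 = 0.
Proof.
move=> kB; rewrite /sop /Sop -[RHS](@tsum0 R (int * int)%type); apply: eq_tsum => th.
by rewrite /Hcurv kB sub0r addNr eqxx mulr0 mul0r.
Qed.

Lemma decay_sop i j z : decay t z -> decay t (sop i j z).
Proof.
move=> dz.
have dk u v : rapid u -> rapid v -> decay t (kk u v z).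
  move=> ru rv; have d1 := decayZ 4^-1 (decay_kconv t_gt1 kg ru (decay_kconv t_gt1 kg rv dz)).
  have d2 := decayZ (- 2^-1) (decay_kconv t_gt1 kg (rapid_conv ru rv) dz).
  by apply: eq_decay (decayD d1 d2) => n; rewrite mulNr.
have ds l : decay t (fun n => kk (adF br X i l) (adF br Y l j) z n - kk (adF br Y i l) (adF br X l j) z n).
  apply: eq_decay (decayD (dk _ _ (rXA i l) (rYA l j)) (decayZ (- 1) (dk _ _ (rYA i l) (rXA l j)))) => n.
  by rewrite mulN1r.
apply: (decay_update (n0 := 0) (decay_sum (index_enum _) predT ds)) => n n0.
by apply: sop_good => //; rewrite /badrow (negPf n0) andbF.
Qed.

Lemma nabla2_entry (U V : R -> 'cV[R]_d) Z n i :
  (forall l, rapid (fun n => fourier U n l 0)) -> (forall l, rapid (fun n => fourier V n l 0)) ->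
  ndecay t Z -> ~~ badrow k n ->
  nabla k br s U (nabla k br s V Z) n i 0 =
  \sum_l \sum_j 4^-1 * kconv (gker k s) (adF br U i l) (kconv (gker k s) (adF br V l j) (fun q => Z q j 0)) n.
Proof.
move=> rU rV dZ gn; have rUA i' j := rapid_adF_of br i' j rU; have rVA i' j := rapid_adF_of br i' j rV.
apply: etrans (nabla_entry brl brr s_gt t_gt1 rU i (decay_nabla brl brr k s_gt t_gt1 rV dZ) gn) _.
rewrite mulr_sumr; apply: eq_bigr => l _.
have dk j := decay_kconv t_gt1 kg (rVA l j) (dZ j).
transitivity (2^-1 * kconv (gker k s) (adF br U i l) (fun q => 2^-1 * \sum_j kconv (gker k s) (adF br V l j) (fun q => Z q j 0) q) n).
  congr (_ * _); apply: eq_tsum => q.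
  (* The formula for the inner derivative fails in row 0, but there the outer kernel vanishes. *)
  have [bq|gq] := boolP (badrow k q); last by rewrite (nabla_entry brl brr s_gt t_gt1 rV l dZ gq).
  case/andP: bq => kB /eqP ->.
  by rewrite (gker_based0 s_gt0 kB) ?mulr0 ?mul0r //; move: gn; rewrite /badrow kB.
rewrite (kconvZ t_gt1 _ n kg (rUA i l) (decay_sum _ _ dk)) (kconv_sum t_gt1 _ n kg (rUA i l) dk).
rewrite mulrA mulr_sumr; apply: eq_bigr => j _; congr (_ * _).
by rewrite -invfM -natrM.
Qed.

Lemma nabla_bracket_entry Z n i : ndecay t Z -> ~~ badrow k n ->
  nabla k br s (fun x => br (X x) (Y x)) Z n i 0 =
  \sum_l \sum_j 2^-1 * (kconv (gker k s) (conv (adF br X i l) (adF br Y l j)) (fun q => Z q j 0) n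
     - kconv (gker k s) (conv (adF br Y i l) (adF br X l j)) (fun q => Z q j 0) n).
Proof.
move=> dZ gn; apply: etrans (nabla_entry brl brr s_gt t_gt1 rB i dZ gn) _.
rewrite exchange_big mulr_sumr; apply: eq_bigr => j _ /=; rewrite -mulr_sumr; congr (_ * _).
have r1 l := rapid_conv (rXA i l) (rYA l j); have r2 l := rapid_conv (rYA i l) (rXA l j).
rewrite -(kconv_suml t_gt1 _ n kg r1 r2 (dZ j)).
by apply: eq_kconv => // m; exact: (adF_bracket brl brr leibniz).
Qed.

Lemma curvatureE Z n i : curvature k br s X Y Z n i 0 =
  nabla k br s X (nabla k br s Y Z) n i 0 - nabla k br s Y (nabla k br s X Z) n i 0
  - nabla k br s (fun x => br (X x) (Y x)) Z n i 0.
Proof.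
rewrite /curvature; move: (nabla _ _ _ _ _ _) (nabla _ _ _ _ _ _) (nabla _ _ _ _ _ _) => A B C.
by rewrite !mxE.
Qed.

Lemma sub2_congr (a a' b b' c c' : R[i]) : a = a' -> b = b' -> c = c' -> a - b - c = a' - b' - c'.
Proof. by move=> -> -> ->. Qed.

Lemma curv_alg (a b c e : 'I_d -> 'I_d -> R[i]) :
  \sum_l \sum_j 4^-1 * a l j - \sum_l \sum_j 4^-1 * b l j - \sum_l \sum_j 2^-1 * (c l j - e l j) =
  \sum_j \sum_l (4^-1 * a l j - 2^-1 * c l j - (4^-1 * b l j - 2^-1 * e l j)).
Proof.
rewrite -!sumrB exchange_big [RHS]exchange_big /= exchange_big /=; apply: eq_bigr => l _.
rewrite -!sumrB; apply: eq_bigr => j _; ring.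
Qed.

Lemma curvature_good Z n i : ndecay t Z -> ~~ badrow k n ->
  curvature k br s X Y Z n i 0 = \sum_j sop i j (fun q => Z q j 0) n.
Proof.
move=> dZ gn; apply: etrans (curvatureE Z n i) _.
apply: etrans (sub2_congr (nabla2_entry i rX rY dZ gn) (nabla2_entry i rY rX dZ gn) (nabla_bracket_entry i dZ gn)) _.
apply: etrans (curv_alg _ _ _ _) _; apply: eq_bigr => j _.
by rewrite (sop_good i j (dZ j) gn).
Qed.

Lemma curvature_sum0 Z i : based k -> ndecay t Z ->
  summ (fun n => curvature k br s X Y Z n i 0) /\ tsum (fun n => curvature k br s X Y Z n i 0) = 0.
Proof.
move=> kB dZ.
have dX := decay_nabla brl brr k s_gt t_gt1 rX dZ; have dY := decay_nabla brl brr k s_gt t_gt1 rY dZ.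
have dB := decay_nabla brl brr k s_gt t_gt1 rB dZ.
have s1 := decay_summ t_gt1 (decay_nabla brl brr k s_gt t_gt1 rX dY i).
have s2 := decay_summ t_gt1 (decay_nabla brl brr k s_gt t_gt1 rY dX i).
have s3 := decay_summ t_gt1 (dB i).
have ss := summB (summB s1 s2) s3.
split; first by apply: eq_summ ss => n; exact: esym (curvatureE Z n i).
rewrite (eq_tsum (fun n => curvatureE Z n i)) (tsumB (summB s1 s2) s3) (tsumB s1 s2).
apply: etrans (sub2_congr (nabla_sum0 brl brr s_gt t_gt1 rX X0 i kB dY)
  (nabla_sum0 brl brr s_gt t_gt1 rY Y0 i kB dX) (nabla_sum0 brl brr s_gt t_gt1 rB B0 i kB dZ)) _.
by rewrite !subr0.
Qed.

Lemma curvature_entry Z n i : ndecay t Z ->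
  curvature k br s X Y Z n i 0 = \sum_j sop i j (fun q => Z q j 0) n -
    (if based k && (n == 0) then \sum_j tsum (sop i j (fun q => Z q j 0)) else 0).
Proof.
move=> dZ; have [bn|gn] := boolP (badrow k n); last by rewrite -/(badrow k n) (negPf gn) subr0 curvature_good.
rewrite -/(badrow k n) bn; case/andP: bn => kB /eqP ->.
rewrite big1 ?sub0r; last by move=> j _; exact: sop_bad.
have sj j := decay_summ t_gt1 (decay_sop i j (dZ j)).
pose D (n : int) : R[i] := if n == 0 then curvature k br s X Y Z 0 i 0 else 0.
have [sD eD] : summ D /\ tsum D = curvature k br s X Y Z 0 i 0.
  have [h1 h2] := @tsum_set1 R int D 0 (fun n n0 => ifN_eq _ _ n0).
  by split => //; rewrite h2 /D eqxx.
have e m : curvature k br s X Y Z m i 0 = \sum_j sop i j (fun q => Z q j 0) m + D m.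
  rewrite /D; case: eqP => [->|/eqP m0].
    by rewrite big1 ?add0r // => j _; exact: sop_bad.
  by rewrite addr0; apply: curvature_good => //; rewrite /badrow (negPf m0) andbF.
have [_ h0] := curvature_sum0 i kB dZ.
move: h0; rewrite (eq_tsum e) (tsumD (summ_sum _ _ sj) sD) (tsum_sum _ _ sj) eD => /eqP.
by rewrite addrC addr_eq0 => /eqP.
Qed.

End Curvature.

Local Arguments hc : simpl never.
Local Arguments hk : simpl never.

(** * The order of the curvature *)

Section Expansion.
Context {R : realType}.
Variables (k : loops) (s : R).
Hypothesis s_gt0 : 0 < s.
Local Notation T := (int * int)%type.

Definition lastrow (n : int) (th : T) : bool := based k && (n + (th.1 + th.2) == 0).

Lemma lastrow_le n th : lastrow n th -> `|n%:~R| <= rho2 th :> R.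
Proof.
case/andP=> _ /eqP h; have -> : n = - (th.1 + th.2) by lia.
by rewrite intrN normrN; exact: rho2_add.
Qed.

(** The removed frequencies satisfy [n = - (a + b)], hence [|n| <= rho2], so by [expn_discard] the
    coefficients of the expansion remain [hc]. *)
Definition hkD (i : nat) (n : int) (th : T) : R := if lastrow n th then 0 else hk k s i n th.

Lemma HcurvE n th : n != 0 -> Hcurv k s n th = \sum_(j < 3) `|n|%N%:R `^ (- (2 * s * j%:R)) * hkD j n th.
Proof.
move=> n0; rewrite /Hcurv -/(lastrow n th) /hkD; case: lastrow.
  by rewrite big1 // => j _; rewrite mulr0.
rewrite hkerE // !big_ord_recl big_ord0 /= -!hpowE addr0 /bump /=.
by rewrite expr0 mul1r expr1 addrA.
Qed.

Lemma expn_hkD j N : expn (@rho2 R) N (hkD j) (hc k s j).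
Proof. exact: (expn_discard (@rho2_ge1 R) (expn_hk k s_gt0 j N) lastrow_le). Qed.

Lemma polyb_Hcurv0 : polyb (@rho2 R) (Hcurv k s 0).
Proof.
apply: polyb_le (polyb_hker0 k s_gt0) _ => th.
by rewrite /Hcurv; case: ifP; rewrite ?normr0.
Qed.

(** A degree [- 2 s j - l] above [- 2] has [j = 0] and [l <= 1], and these two coefficients
    vanish. *)
Lemma acoef_order2 m e th : 1 < s -> - 2 < m -> acoef s (hc k s) m e th = 0.
Proof.
move=> s1 hm; apply: acoef_vanish => j l _ em; move: hm; rewrite em /dexp.
case: j {em} => [|j]; last first.
  have : 0 <= j%:R :> R by []; have : 0 <= l%:R :> R by [].
  by rewrite -natr1; nra.
case: l => [|[|l]]; rewrite ?hc00 ?hc01 //.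
have : 0 <= l%:R :> R by [].
by rewrite -!natr1; lra.
Qed.

(** As [2 s < 2], a degree above [- 2 s] again has [j = 0] and [l <= 1]. *)
Lemma acoef_order2s m e th : s < 1 -> - (2 * s) < m -> acoef s (hc k s) m e th = 0.
Proof.
move=> s1 hm; apply: acoef_vanish => j l _ em; move: hm; rewrite em /dexp.
case: j {em} => [|j]; last first.
  rewrite -[j.+1%:R]natr1 => h; exfalso; move: h.
  have : 0 <= s * j%:R by rewrite mulr_ge0 // ltW.
  have : 0 <= l%:R :> R by [].
  by lra.
case: l => [|[|l]]; rewrite ?hc00 ?hc01 //.
have : 0 <= l%:R :> R by [].
by rewrite -!natr1; lra.
Qed.

(** For [s > 1] the degree [- 2] occurs only for [j = 0] and [l = 2], within reach of the first
    three terms of each expansion. *)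
Lemma acoef_at2 e th : 1 < s -> acoef s (hc k s) (- 2) e th = - (s ^+ 2 * th.1%:~R * th.2%:~R).
Proof.
move=> s1; have N2 : - (- 3) <= 3%:R :> R by rewrite opprK.
rewrite (acoefE s_gt0 (hc k s) (M := - 3) (N := 3)) //; last by rewrite ltrN2 ltr_nat.
have d0 (l : nat) : dexp s 0 l = - l%:R by rewrite /dexp mulr0 oppr0 sub0r.
rewrite (bigD1 ord0) //= [X in _ + X]big1 ?addr0.
  rewrite (bigD1 (Ordinal (isT : (2 < 3)%N))) //= d0 eqxx big1 ?addr0.
    by rewrite hc02 /signb; case: e; rewrite ?sqrrN ?expr1n mul1r.
  move=> l l2; rewrite d0 eqr_opp eqr_nat; case: eqP => // e2.
  by move: l2; rewrite -val_eqE /= -e2.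
move=> j j0; rewrite big1 // => l _; case: eqP => // e2; exfalso; move: e2; rewrite /dexp.
have : 1 <= j%:R :> R by rewrite (ler_nat R 1) lt0n.
have : 0 <= l%:R :> R by [].
by nra.
Qed.

(** Since [1 < 2 s < 2], [2 s] is not an integer, and the degree [- 2 s] occurs only for [j = 1] and
    [l = 0]. *)
Lemma acoef_at2s e th : 2^-1 < s -> s < 1 -> acoef s (hc k s) (- (2 * s)) e th =
  - 2^-1 * (weight k s th.1 + weight k s th.2 - weight k s (th.1 + th.2)).
Proof.
move=> s2 s1; have N2 : - (- 3) <= 3%:R :> R by rewrite opprK.
rewrite (acoefE s_gt0 (hc k s) (M := - 3) (N := 3)) //; last by rewrite ltrN2; lra.
rewrite (bigD1 (Ordinal (isT : (1 < 3)%N))) //= [X in _ + X]big1 ?addr0.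
  rewrite (bigD1 ord0) //= /dexp mulr1 subr0 eqxx big1 ?addr0.
    by rewrite hc10 /signb; case: e; rewrite ?expr0 mul1r.
  move=> l l0; case: eqP => // e2; exfalso.
  have : 1 <= l%:R :> R by rewrite (ler_nat R 1) lt0n.
  by lra.
move=> j j1; rewrite big1 // => l _; case: eqP => // e2; exfalso; move: e2; rewrite /dexp.
have [j0|j0] := eqVneq (val j) 0%N.
  rewrite j0 mulr0 oppr0 sub0r => /eqP; rewrite eqr_opp => /eqP e2.
  case: (val l) e2 => [|[|l']] e2; [lra|lra|].
  have : 0 <= l'%:R :> R by []; move: e2; rewrite -!natr1; lra.
have j2 : (2 <= val j)%N by move: j1 j0; rewrite -val_eqE /=; lia.
have : 2 <= j%:R :> R by rewrite (ler_nat R 2).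
have : 0 <= l%:R :> R by [].
by nra.
Qed.

End Expansion.

(** * The expansion for based loops and s = 1 *)

Section Expansion1.
Context {R : realType}.
Local Notation T := (int * int)%type.

(** For [s = 1] the degrees belonging to different [j] overlap and their coefficients would have to
    be compared. Instead the whole kernel is taken as the part [j = 0]: it vanishes for
    [|n| > rho2], so all its coefficients are 0. *)
Definition hk1 (i : nat) (n : int) (th : T) : R := if i is 0%N then Hcurv Based 1 n th else 0.

Lemma Hcurv1E n th : n != 0 -> Hcurv Based (1 : R) n th = \sum_(j < 3) `|n|%N%:R `^ (- (2 * 1 * j%:R)) * hk1 j n th.
Proof.
move=> n0; rewrite big_ord_recl big1 ?addr0; last by move=> j _; rewrite /hk1 mulr0.
by rewrite /hk1 /= mulr0 oppr0 powRr0 mul1r.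
Qed.

Lemma expn_hk1 j N : expn (@rho2 R) N (hk1 j) (fun _ _ => 0).
Proof.
have r1 := @rho2_ge1 R.
case: j => [|j]; apply: expn_supp => //.
- have [C [L C0 hC]] := bounded_hker Based (@ltr01 R).
  exists C, L => // n th n0; apply: le_trans (hC n th n0).
  by rewrite /hk1 /Hcurv; case: ifP; rewrite ?normr0.
- move=> n th n0; rewrite /hk1 /Hcurv /=; case: (eqVneq (n + (th.1 + th.2)) 0) => [_|h2]; first by rewrite eqxx.
  have [e|h1] := eqVneq (n + th.2) 0; last by rewrite hker_based1 ?eqxx.
  move=> _; have -> : n = - th.2 by lia.
  by rewrite intrN normrN; exact: rho2_snd.
- by exists 0, 0%N => // n th n0; rewrite /hk1 normr0 mul0r.
- by move=> n th n0; rewrite /hk1 eqxx.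
Qed.

End Expansion1.

(** * Upper bounds and criteria for exactness *)

Section CurvatureOrder.
Context {R : realType} (d : nat).
Variable br : 'cV[R]_d -> 'cV[R]_d -> 'cV[R]_d.
Hypothesis brl : forall a u v w, br (a *: u + v) w = a *: br u w + br v w.
Hypothesis brr : forall a u v w, br u (a *: v + w) = a *: br u v + br u w.
Hypothesis leibniz : forall x y z, br (br x y) z = br x (br y z) - br y (br x z).
Variables X Y : R -> 'cV[R]_d.

Let two1 : 1 < 2 :> R. Proof. by rewrite ltr1n. Qed.

Lemma curvature_rapid k s : 2^-1 < s -> smooth_field k X -> smooth_field k Y ->
  forall Z : coeffs R d, (forall j, rapid (fun n => Z n j 0)) -> forall n i,
  curvature k br s X Y Z n i 0 = \sum_j Sop (Hcurv k s) (fun th => Mcurv br X Y th i j) (fun n => Z n j 0) n -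
    (if based k && (n == 0) then \sum_j tsum (Sop (Hcurv k s) (fun th => Mcurv br X Y th i j) (fun n => Z n j 0)) else 0).
Proof.
move=> s2 fX fY Z rZ n i.
by apply: (curvature_entry brl brr leibniz s2 two1 fX fY n i) => j; exact: rapid_decay.
Qed.

Lemma curvature_order2 k s : 1 < s -> smooth_field k X -> smooth_field k Y ->
  order_at_most k (curvature k br s X Y) (- 2).
Proof.
move=> s1 fX fY; have s2 : 2^-1 < s by lra. have s0 : 0 < s by lra.
apply: (order_at_most_loop s0 (HcurvE k s0) (expn_hkD k s0) (polyb_Hcurv0 k s0) (Mcurv_rapid br fX fY) (curvature_rapid s2 fX fY)).
by move=> m e th; exact: acoef_order2.
Qed.

Lemma curvature_order2s k s : 2^-1 < s -> s < 1 -> smooth_field k X -> smooth_field k Y ->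
  order_at_most k (curvature k br s X Y) (- (2 * s)).
Proof.
move=> s2 s1 fX fY; have s0 : 0 < s by lra.
apply: (order_at_most_loop s0 (HcurvE k s0) (expn_hkD k s0) (polyb_Hcurv0 k s0) (Mcurv_rapid br fX fY) (curvature_rapid s2 fX fY)).
by move=> m e th; exact: acoef_order2s.
Qed.

Lemma curvature_smoothing : smooth_field Based X -> smooth_field Based Y ->
  order_minus_infinity Based (curvature Based br 1 X Y).
Proof.
move=> fX fY; have s2 : 2^-1 < 1 :> R by lra. have s0 : 0 < 1 :> R by lra.
apply: (order_minus_infinity_loop s0 Hcurv1E expn_hk1 (polyb_Hcurv0 Based s0) (Mcurv_rapid br fX fY) (curvature_rapid s2 fX fY)).
by move=> m e th; exact: acoef_vanish.
Qed.

Lemma curvature_exactly2 k s x i j : 1 < s -> smooth_field k X -> smooth_field k Y -> angles k x ->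
  tser (fun th => Mcurv br X Y th i j * (- (s ^+ 2 * th.1%:~R * th.2%:~R))%:C) (fun th : int * int => th.1 + th.2) x != 0 ->
  order_exactly k (curvature k br s X Y) (- 2).
Proof.
move=> s1 fX fY ax nz; have s2 : 2^-1 < s by lra. have s0 : 0 < s by lra.
apply: (order_exactly_loop s0 (HcurvE k s0) (expn_hkD k s0) (polyb_Hcurv0 k s0) (Mcurv_rapid br fX fY) (curvature_rapid s2 fX fY)).
  by move=> m e th; exact: acoef_order2.
move=> /(_ true x ax)/matrixP/(_ i j); rewrite !mxE => h; move/eqP: nz; apply; rewrite -[RHS]h.
by apply: eq_tsum => th; rewrite acoef_at2.
Qed.

Lemma curvature_exactly2s k s x i j : 2^-1 < s -> s < 1 -> smooth_field k X -> smooth_field k Y -> angles k x ->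
  tser (fun th => Mcurv br X Y th i j * (- 2^-1 * (weight k s th.1 + weight k s th.2 - weight k s (th.1 + th.2)))%:C)
    (fun th : int * int => th.1 + th.2) x != 0 ->
  order_exactly k (curvature k br s X Y) (- (2 * s)).
Proof.
move=> s2 s1 fX fY ax nz; have s0 : 0 < s by lra.
apply: (order_exactly_loop s0 (HcurvE k s0) (expn_hkD k s0) (polyb_Hcurv0 k s0) (Mcurv_rapid br fX fY) (curvature_rapid s2 fX fY)).
  by move=> m e th; exact: acoef_order2s.
move=> /(_ true x ax)/matrixP/(_ i j); rewrite !mxE => h; move/eqP: nz; apply; rewrite -[RHS]h.
by apply: eq_tsum => th; rewrite acoef_at2s.
Qed.

End CurvatureOrder.

(** * Trace class *)

Section KernelDecay.
Context {R : realType}.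
Variables (k : loops) (s : R).
Hypothesis s_gt1 : 1 < s.
Local Notation T := (int * int)%type.

Let s_gt0 : 0 < s. Proof. exact: lt_trans s_gt1. Qed.

Lemma hkD0_bound : exists C, exists2 L : nat, 0 <= C &
  forall n th, n != 0 -> `|hkD k s 0 n th| <= C * rho2 th ^+ L * `|n%:~R| ^- 2.
Proof.
have [_ [_ [C [L C0 hC]]]] := @expn_hkD R k s s_gt0 0%N 2%N.
exists C, L => // n th n0; have n1 := @norm_int_ge1 R n n0.
have -> : hkD k s 0 n th = n%:~R ^- 2 * (n%:~R * (n%:~R * (hkD k s 0 n th - hc k s 0 0 th) - hc k s 0 1 th)).
  by rewrite hc00 hc01 !subr0 [n%:~R * (_ * _)]mulrA -expr2 mulKf // expf_neq0 // intr_eq0.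
by rewrite normrM mulrC normfV normrX ler_wpM2r ?invr_ge0 ?exprn_ge0 ?hC.
Qed.

Lemma sum3_le (C0 C1 C2 C3 p u v : R) : 0 <= C0 -> 0 <= C1 -> 0 <= C2 -> 0 <= C3 -> 0 <= p -> 0 <= v -> u <= 4 * v ->
  C0 * p * u + (C1 * p * u + C2 * p * u) <= (4 * (C0 + C1 + C2) + C3) * p * v.
Proof.
move=> h0 h1 h2 h3 p0 v0 uv; apply: le_trans (_ : (C0 + C1 + C2) * p * (4 * v) <= _).
  rewrite -!mulrDl addrA; apply: ler_wpM2l => //; by rewrite mulr_ge0 ?addr_ge0.
have : 0 <= C3 * p * v by rewrite !mulr_ge0.
by lra.
Qed.

(** The part [j = 0] gains [n^(-2)] because its first two coefficients vanish, the others because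
    [2 s > 2]. The factor 4 in [C] compares [|n|^(-2)] with [jap n ^- 2]. *)
Lemma Hcurv_bound : exists C, exists2 L : nat, 0 <= C &
  forall n th, `|Hcurv k s n th| <= C * rho2 th ^+ L * jap n ^- 2.
Proof.
have [C0 [L0 C0p h0]] := hkD0_bound.
have [C1 [L1 C1p h1]] := expn_bounded (@rho2_ge1 R) (expn_hkD k s_gt0 1 0).
have [C2 [L2 C2p h2]] := expn_bounded (@rho2_ge1 R) (expn_hkD k s_gt0 2 0).
have [C3 [L3 C3p h3]] := polyb_Hcurv0 k s_gt0.
have [L [l0 l1 l2 l3]] : exists L, [/\ (L0 <= L)%N, (L1 <= L)%N, (L2 <= L)%N & (L3 <= L)%N].
  by exists (L0 + L1 + L2 + L3)%N; split; lia.
pose C := 4 * (C0 + C1 + C2) + C3.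
have r1 th := @rho2_ge1 R th; have r0 th : 0 <= rho2 th :> R by exact: le_trans (r1 th).
have rL th j : (j <= L)%N -> rho2 th ^+ j <= rho2 th ^+ L :> R by move=> jL; apply: ler_weXn2l.
exists C, L; first by rewrite /C addr_ge0 ?mulr_ge0 ?addr_ge0.
move=> n th; have [->|n0] := eqVneq n 0.
  rewrite /jap absz0 addr0 expr1n invr1 mulr1; apply: le_trans (h3 th) _.
  apply: ler_pM; rewrite ?exprn_ge0 //; first by rewrite /C lerDr mulr_ge0 ?addr_ge0.
  exact: rL.
have n1 := @norm_int_ge1 R n n0; have np : 0 < `|n%:~R| :> R by exact: lt_le_trans n1.
have jn : `|n%:~R| ^- 2 <= 4 * jap n ^- 2 :> R.
  rewrite ler_pdivlMr ?exprn_gt0 ?jap_gt0 // mulrC ler_pdivrMr ?exprn_gt0 //.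
  have -> : 4 * `|n%:~R| ^+ 2 = (2 * `|n%:~R|) ^+ 2 :> R by rewrite exprMn -natrX.
  by rewrite lerXn2r ?nnegrE ?jap_ge0 ?mulr_ge0 // -intr_norm -natr_absz; exact: jap_le2.
have hp (j : nat) : (0 < j)%N -> `|n|%N%:R `^ (- (2 * s * j%:R)) <= `|n%:~R| ^- 2 :> R.
  move=> j0; rewrite natr_absz intr_norm -powR_invn //; apply: ler_powR => //; rewrite lerN2.
  have j1 : 1 <= j%:R :> R by rewrite (ler_nat R 1).
  have : 1 <= s * j%:R by rewrite mulr_ege1 // ltW.
  by rewrite -mulrA; lra.
rewrite (HcurvE k s_gt0) // !big_ord_recl big_ord0 addr0 /= mulr0 oppr0 powRr0 mul1r -[bump 0 (bump 0 0)]/2%N -[bump 0 0]/1%N.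
have b0 : `|hkD k s 0 n th| <= C0 * rho2 th ^+ L * `|n%:~R| ^- 2.
  by apply: le_trans (h0 n th n0) _; rewrite ler_wpM2r ?invr_ge0 ?exprn_ge0 // ler_wpM2l // rL.
have bj (j : nat) Cj Lj : (0 < j)%N -> 0 <= Cj -> (Lj <= L)%N -> `|hkD k s j n th| <= Cj * rho2 th ^+ Lj ->
    `| `|n|%N%:R `^ (- (2 * s * j%:R)) * hkD k s j n th| <= Cj * rho2 th ^+ L * `|n%:~R| ^- 2.
  move=> j0 Cj0 jL hj; rewrite normrM mulrC; apply: ler_pM => //.
    by apply: le_trans hj _; rewrite ler_wpM2l // rL.
  by rewrite ger0_norm ?powR_ge0 // hp.
have b1 := bj 1%N C1 L1 isT C1p l1 (h1 n th n0); have b2 := bj 2%N C2 L2 isT C2p l2 (h2 n th n0).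
apply: le_trans (le_trans (ler_normD _ _) (lerD b0 (le_trans (ler_normD _ _) (lerD b1 b2)))) _.
apply: sum3_le => //.
- by rewrite exprn_ge0.
- by rewrite invr_ge0 exprn_ge0 // jap_ge0.
Qed.

(** All weights are even. Together with the Hermitian symmetry of [Mcurv], this shows that the
    curvature maps real fields to real fields. *)
Lemma Hcurv_even n th : Hcurv k s (- n) (- th.1, - th.2) = Hcurv k s n th.
Proof.
have we t m : weight k t (- m) = weight k t m by rewrite !weightE intrN sqrrN.
have ge p q : gker k s (- p) (- q) = gker k s p q by rewrite /gker -opprD !we.
rewrite /Hcurv /hker /= -!opprD oppr_eq0 !ge.
by [].
Qed.

End KernelDecay.

(** * Peetre's inequality for exponents of either sign *)

Section PowerPeetre.
Context {R : realType}.

Lemma peetreR (t : R) : exists L : nat, forall n q, jap q `^ (- t) <= jap (n - q) ^+ L * jap n `^ (- t) :> R.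
Proof.
pose L := (Num.truncn `|t|).+1; exists L => n q.
have tL : `|t| <= L%:R by apply: ltW; exact: truncnS_gt.
have p (a b : int) u : 0 <= u -> u <= L%:R -> jap a `^ u <= jap (b - a) ^+ L * jap b `^ u :> R.
  move=> u0 uL; apply: le_trans (_ : (jap (b - a) * jap b) `^ u <= _).
    apply: ge0_ler_powR; rewrite ?nnegrE ?mulr_ge0 ?jap_ge0 //.
    by rewrite -{1}(subKr b a) addrC; apply: le_trans (japD _ _) _; rewrite japN.
  rewrite powRM ?jap_ge0 // ler_wpM2r ?powR_ge0 // -powR_mulrn ?jap_ge0 //.
  by apply: ler_powR => //; exact: jap_ge1.
have [t0|t0] := leP 0 t; last first.
  by apply: p; [lra|rewrite (le_trans _ tL) // ler0_norm // ltW].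
have h := p n q t t0 (le_trans (ler_norm _) tL).
rewrite -opprB japN in h.
rewrite !powRN -[leLHS]mul1r ler_pdivrMr ?powR_gt0 ?jap_gt0 //.
by rewrite mulrAC ler_pdivlMr ?powR_gt0 ?jap_gt0 // mul1r.
Qed.

End PowerPeetre.

Section Conjugation.
Context {R : realType}.
Implicit Types x y : R[i].

Lemma conjcB x y : (x - y)^*%C = x^*%C - y^*%C. Proof. exact: (rmorphB (@conjc R)). Qed.
Lemma conjcM x y : (x * y)^*%C = x^*%C * y^*%C. Proof. exact: (rmorphM (@conjc R)). Qed.
Lemma conjc_sum (I : Type) (r : seq I) (f : I -> R[i]) :
  (\sum_(i <- r) f i)^*%C = \sum_(i <- r) (f i)^*%C.
Proof. exact: (rmorph_sum (@conjc R)). Qed.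

Lemma tsum_conjc (I : choiceType) (f : I -> R[i]) : tsum (fun i => (f i)^*%C) = (tsum f)^*%C.
Proof.
apply: complex_ext; rewrite ?cre_tsum ?cim_tsum.
  transitivity (rsum (fun i => cre (f i))); first by apply: eq_rsum => i; case: (f i).
  by rewrite -cre_tsum; case: (tsum f).
transitivity (rsum (fun i => - cim (f i))); first by apply: eq_rsum => i; case: (f i).
by rewrite rsumN -cim_tsum; case: (tsum f).
Qed.

Lemma tsumV (I : zmodType) (f : I -> R[i]) : tsum (fun i => f (- i)) = tsum f.
Proof. by apply: (tsum_reindex f _).2; exact: (inv_bij (@opprK I)). Qed.

End Conjugation.

(** * Hermitian symmetry of the Fourier coefficients of real fields *)

Section CurvatureReal.
Context {R : realType} (d : nat).
Variable br : 'cV[R]_d -> 'cV[R]_d -> 'cV[R]_d.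

Definition hermitian (z : int -> R[i]) := forall n, z (- n) = (z n)^*%C.

Lemma fc_hermitian f : continuous f -> hermitian (@fc R f).
Proof.
move=> cf n; rewrite /fc.
have -> : (fun x => f x * cos ((- n)%:~R * x)) = (fun x => f x * cos (n%:~R * x)).
  by apply/funext => x; rewrite intrN mulNr cosN.
have -> : (fun x => f x * sin ((- n)%:~R * x)) = (fun x => - (f x * sin (n%:~R * x))).
  by apply/funext => x; rewrite intrN mulNr sinN mulrN.
rewrite per_intN; first by rewrite mulrN.
by apply: cont_mul => //; exact: cont_sinn.
Qed.

Lemma fourier_hermitian (W : R -> 'cV[R]_d) l : smooth1 setT W -> hermitian (fun n => fourier W n l 0).
Proof.
move=> sW n; rewrite !(congr1 (fun f => f _) (fourierE W l)); apply: fc_hermitian.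
have := @derive1n_continuous R (fun x => W x l 0) 0%N; apply; exact: smooth1_entry.
Qed.

Lemma adF_hermitian (W : R -> 'cV[R]_d) i j : smooth1 setT W -> hermitian (adF br W i j).
Proof.
move=> sW n; rewrite /adF /adc conjc_sum; apply: eq_bigr => l _.
by rewrite conjcM (fourier_hermitian l sW) conjc_real.
Qed.

Lemma Mcurv_hermitian X Y i j (th : int * int) : smooth1 setT X -> smooth1 setT Y ->
  Mcurv br X Y (- th) i j = (Mcurv br X Y th i j)^*%C.
Proof.
move=> sX sY; rewrite !mxE conjc_sum; apply: eq_bigr => l _.
by rewrite conjcB !conjcM !adF_hermitian.
Qed.

Lemma Sop_hermitian k s X Y i j z : smooth1 setT X -> smooth1 setT Y -> hermitian z ->
  hermitian (Sop (Hcurv k s) (fun th => Mcurv br X Y th i j) z).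
Proof.
move=> sX sY hz n; rewrite /Sop -tsum_conjc -tsumV; apply: eq_tsum => th.
have e : - n - ((- th).1 + (- th).2) = - (n - (th.1 + th.2)) by rewrite /=; lia.
rewrite e hz Mcurv_hermitian // !conjcM conjc_real; congr (_ * _%:C * _).
exact: Hcurv_even.
Qed.

End CurvatureReal.

(** * The curvature gains two powers of the frequency *)

Section CurvatureBound.
Context {R : realType} (d : nat).
Variable br : 'cV[R]_d -> 'cV[R]_d -> 'cV[R]_d.
Hypothesis brl : forall a u v w, br (a *: u + v) w = a *: br u w + br v w.
Hypothesis brr : forall a u v w, br u (a *: v + w) = a *: br u v + br u w.
Hypothesis leibniz : forall x y z, br (br x y) z = br x (br y z) - br y (br x z).
Variables (k : loops) (s : R).
Hypothesis s_gt1 : 1 < s.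
Variables X Y : R -> 'cV[R]_d.
Hypotheses (fX : smooth_field k X) (fY : smooth_field k Y).
Local Notation T := (int * int)%type.

Let s_gt0 : 0 < s. Proof. exact: lt_trans s_gt1. Qed.
Let s_gt : 2^-1 < s. Proof. by apply: lt_trans s_gt1; lra. Qed.
Let sX : smooth1 setT X. Proof. by case: fX. Qed.
Let sY : smooth1 setT Y. Proof. by case: fY. Qed.
Let P (Z : coeffs R d) := curvature k br s X Y Z.
Let M i j (th : T) := Mcurv br X Y th i j.

(** An input of frequency 0 is annihilated, as in [gker_based0]. The curvature thus sees a sequence
    only outside the bad row, as the metric does. *)
Lemma Hcurv_bad n th : badrow k n -> Hcurv k s n th = 0.
Proof.
case/andP=> kB /eqP ->; rewrite /Hcurv kB /= !add0r; case: eqVneq => // ab0.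
rewrite /hker !add0r (gker_based0 s_gt0 kB ab0) mulr0 subr0.
have [b0|b0] := eqVneq th.2 0; last by rewrite (gker_based0 s_gt0 kB b0) !mulr0.
have := gker_based0 s_gt0 kB ab0; rewrite b0 => ->; by rewrite mul0r mulr0.
Qed.

(** Decay with an explicit constant, leaving out the frequency 0 of based loops, where the weight of
    the metric is 0. *)
Definition qdecay (t C : R) (Z : coeffs R d) := forall j i, ~~ badrow k j -> normc (Z j i 0) <= C * jap j `^ (- t).

Lemma sop_term_bound t i j : exists2 g : T -> R, rsumm g & forall C z, 0 <= C ->
  (forall q, ~~ badrow k q -> normc (z q) <= C * jap q `^ (- t)) -> forall n th,
  normc (M i j th * (Hcurv k s (n - (th.1 + th.2)) th)%:C * z (n - (th.1 + th.2))) <= C * jap n `^ (- (t + 2)) * g th.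
Proof.
have [D [L D0 hD]] := Hcurv_bound k s_gt1; have [K hK] := @peetreR R (t + 2).
have rM : rapid2 (M i j) := Mcurv_rapid br fX fY i j.
exists (fun th => D * (normc (M i j th) * rho2 th ^+ (L + K))).
  apply: rsummZ; have := rapid2_polyb rM (L + K) (polyb_cst (@rho2 R) 1).
  by congr rsumm; apply/funext => th; rewrite normr1 mulr1.
move=> C z C0 hz n th; set q := n - (th.1 + th.2).
have r0 : 0 <= rho2 th :> R by apply: le_trans (rho2_ge1 th).
have [bq|gq] := boolP (badrow k q).
  rewrite (Hcurv_bad th bq) rmorph0 mulr0 mul0r normc0.
  by rewrite !mulr_ge0 ?powR_ge0 ?normc_ge0 ?exprn_ge0.
rewrite !normcM normc_real.
apply: le_trans (_ : normc (M i j th) * (D * rho2 th ^+ L * jap q ^- 2) * (C * jap q `^ (- t)) <= _).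
  by apply: ler_pM; rewrite ?mulr_ge0 ?normc_ge0 ?hz // ler_wpM2l ?normc_ge0.
have e : jap q ^- 2 * jap q `^ (- t) = jap q `^ (- (t + 2)) :> R.
  rewrite -powR_invn ?jap_ge0 // -powRD; last by rewrite (gt_eqF (jap_gt0 q)) implybT.
  by rewrite [- (t + 2)]opprD [- t + _]addrC.
have h : jap q `^ (- (t + 2)) <= rho2 th ^+ K * jap n `^ (- (t + 2)) :> R.
  apply: le_trans (hK n q) _; rewrite ler_wpM2r ?powR_ge0 //.
  have -> : n - q = th.1 + th.2 by rewrite /q; lia.
  exact: jap_add_rho2.
have -> : normc (M i j th) * (D * rho2 th ^+ L * jap q ^- 2) * (C * jap q `^ (- t)) =
   (normc (M i j th) * D * rho2 th ^+ L * C) * jap q `^ (- (t + 2)) by rewrite -e; ring.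
have -> : C * jap n `^ (- (t + 2)) * (D * (normc (M i j th) * rho2 th ^+ (L + K))) =
   (normc (M i j th) * D * rho2 th ^+ L * C) * (rho2 th ^+ K * jap n `^ (- (t + 2))) by rewrite exprD; ring.
by apply: ler_wpM2l => //; rewrite !mulr_ge0 ?normc_ge0 ?exprn_ge0.
Qed.

(** The factor [jap ^- 2] of [Hcurv_bound] at the input frequency is carried to the output by
    Peetre's inequality. Decay of order [t0] gives the curvature its kernel formula, while [t] is
    the exponent of the quantitative bound and may have either sign. *)
Lemma curvature_bound t0 t : 1 < t0 -> exists2 C : R, 0 <= C & forall D Z, 0 <= D -> ndecay t0 Z ->
  qdecay t D Z -> qdecay (t + 2) (C * D) (P Z).
Proof.
move=> t1; have h i j := cid2 (sop_term_bound t i j).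
pose g i j := s2val (h i j); have sg i j : rsumm (g i j) := s2valP (h i j).
have hg i j C z : 0 <= C ->
  (forall q, ~~ badrow k q -> normc (z q) <= C * jap q `^ (- t)) -> forall n th,
  normc (M i j th * (Hcurv k s (n - (th.1 + th.2)) th)%:C * z (n - (th.1 + th.2))) <= C * jap n `^ (- (t + 2)) * g i j th.
  exact: (s2valP' (h i j)).
exists (\sum_i \sum_j 2 * `|rsum (g i j)|).
  by rewrite sumr_ge0 // => i _; rewrite sumr_ge0 // => j _; rewrite mulr_ge0.
move=> D Z D0 dZ qZ n i gn; rewrite /P (curvature_good brl brr leibniz s_gt t1 fX fY i dZ gn).
apply: le_trans (normc_sum _ _ _) _.
apply: le_trans (_ : \sum_j (2 * `|rsum (g i j)|) * D * jap n `^ (- (t + 2)) <= _); last first.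
  rewrite -mulr_suml ler_wpM2r ?powR_ge0 // -mulr_suml ler_wpM2r //.
  by rewrite [leRHS](bigD1 i) //= lerDl sumr_ge0 // => l _; rewrite sumr_ge0 // => j _; rewrite mulr_ge0.
apply: ler_sum => j _; set b := D * jap n `^ (- (t + 2)).
have b0 : 0 <= b by rewrite mulr_ge0 ?powR_ge0.
apply: le_trans (normc_tsum_le (rsummZ b (sg i j)) (hg i j D (fun q => Z q j 0) D0 (fun q => qZ q j) n)) _.
rewrite rsumZ // -mulrA -/b -mulrA ler_wpM2l // mulrC ler_wpM2r //; exact: ler_norm.
Qed.

Lemma summ_sop t0 i j z n : 1 < t0 -> decay t0 z ->
  summ (fun th : T => M i j th * (Hcurv k s (n - (th.1 + th.2)) th)%:C * z (n - (th.1 + th.2))).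
Proof.
move=> t1 [C C0 hC]; have [g sg hg] := sop_term_bound t0 i j.
by apply: summ_le (rsummZ (C * jap n `^ (- (t0 + 2))) sg) _ => th; apply: hg.
Qed.

Lemma mulBC (m z w c : R[i]) : m * (z - c * w) = m * z - c * (m * w).
Proof. by rewrite mulrBr [c * (_ * _)]mulrCA. Qed.

Lemma subc_congr (c a a' b b' : R[i]) : a = a' -> b = b' -> a - c * b = a' - c * b'.
Proof. by move=> -> ->. Qed.

Lemma curvature_linear t0 (Z W : coeffs R d) (c : R[i]) n i : 1 < t0 -> ndecay t0 Z -> ndecay t0 W -> ~~ badrow k n ->
  P (fun m => Z m - c *: W m) n i 0 = P Z n i 0 - c * P W n i 0.
Proof.
move=> t1 dZ dW gn.
have dZW : ndecay t0 (fun m => Z m - c *: W m).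
  move=> j; apply: eq_decay (decayD (dZ j) (decayZ (- c) (dW j))) => m.
  by rewrite !mxE mulNr.
have cg V (dV : ndecay t0 V) := curvature_good brl brr leibniz s_gt t1 fX fY i dV gn.
apply: etrans (cg _ dZW) _; apply: esym; apply: etrans (subc_congr c (cg _ dZ) (cg _ dW)) _.
rewrite mulr_sumr -sumrB; apply: eq_bigr => j _; apply: esym.
have s1 := summ_sop i j n t1 (dZ j); have s2 := summ_sop i j n t1 (dW j).
have e := tsumB s1 (summZ c s2); rewrite (tsumZ c s2) in e; apply: etrans _ e; apply: eq_tsum => th.
have -> : (Z (n - (th.1 + th.2)) - c *: W (n - (th.1 + th.2))) j 0 = Z (n - (th.1 + th.2)) j 0 - c * W (n - (th.1 + th.2)) j 0 by rewrite !mxE.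
exact: mulBC.
Qed.

Lemma curvature_hermitian t0 Z : 1 < t0 -> ndecay t0 Z -> (forall i, hermitian (fun n => Z n i 0)) ->
  forall i, hermitian (fun n => P Z n i 0).
Proof.
move=> t1 dZ hZ i n; have ce m := curvature_entry brl brr leibniz s_gt t1 fX fY m i dZ.
apply: etrans (ce _) _; apply: esym; apply: etrans (congr1 _ (ce _)) _; apply: esym; rewrite conjcB conjc_sum.
have hs j := @Sop_hermitian R d br k s X Y i j _ sX sY (hZ j).
congr (_ - _); first by apply: eq_bigr => j _; exact: hs.
rewrite oppr_eq0; case: ifP => _; last by rewrite conjc0.
rewrite conjc_sum; apply: eq_bigr => j _.
by rewrite -tsum_conjc -[LHS]tsumV; apply: eq_tsum => m; exact: hs.
Qed.

End CurvatureBound.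

(** * Dual bases for the inner product *)

Section DualBasis.
Context {R : realType} (d : nat).
Variable ip : 'cV[R]_d -> 'cV[R]_d -> R.
Hypothesis ipC : forall v w, ip v w = ip w v.
Hypothesis ipL : forall a u v w, ip (a *: u + v) w = a * ip u w + ip v w.
Hypothesis ipP : forall v, v != 0 -> 0 < ip v v.

Lemma ipD u v w : ip (u + v) w = ip u w + ip v w.
Proof. by rewrite -{1}[u]scale1r ipL mul1r. Qed.

Lemma ip0 w : ip 0 w = 0.
Proof. by have := ipL 1 0 0 w; rewrite scale1r addr0 mul1r => /eqP; rewrite -subr_eq0 opprD addNKr oppr_eq0 => /eqP. Qed.

Lemma ipZ a u w : ip (a *: u) w = a * ip u w.
Proof. by rewrite -[a *: u]addr0 ipL ip0 addr0. Qed.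

Lemma ipZr a u w : ip u (a *: w) = a * ip u w.
Proof. by rewrite ipC ipZ ipC. Qed.

Lemma ip_sum (r : seq 'I_d) (f : 'I_d -> 'cV[R]_d) w : ip (\sum_(i <- r) f i) w = \sum_(i <- r) ip (f i) w.
Proof. by elim: r => [|i r IH]; rewrite ?big_nil ?ip0 // !big_cons ipD IH. Qed.

Lemma ip_ge0 v : 0 <= ip v v.
Proof. by have [->|/ipP/ltW //] := eqVneq v 0; rewrite ip0. Qed.

Definition gram : 'M[R]_d := \matrix_(i, j) ip (delta_mx i 0) (delta_mx j 0).

Lemma ipE u v : ip u v = \sum_i \sum_j u i 0 * v j 0 * gram i j.
Proof.
rewrite {1}(cV_basis u) ip_sum; apply: eq_bigr => i _.
rewrite ipZ {1}(cV_basis v) ipC ip_sum mulr_sumr; apply: eq_bigr => j _.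
by rewrite ipZ ipC mxE mulrA.
Qed.

Lemma gram_unit : gram \in unitmx.
Proof.
rewrite -row_free_unit; apply/inj_row_free => v v0; apply/eqP/negP => /negP v1.
have : 0 < ip v^T v^T by apply: ipP; rewrite -(inj_eq trmx_inj) trmxK trmx0.
have -> : ip v^T v^T = ((v *m gram) *m v^T) 0 0.
  rewrite ipE mxE exchange_big; apply: eq_bigr => j _ /=.
  by rewrite [(v *m gram) _ _]mxE mulr_suml; apply: eq_bigr => i _; rewrite !mxE mulrAC.
by rewrite v0 mul0mx mxE ltxx.
Qed.

Lemma dual_basis : exists f : 'I_d -> 'cV[R]_d, forall w i, ip w (f i) = w i 0.
Proof.
exists (fun i => col i (invmx gram)) => w i.
have -> : w i 0 = ((w^T *m gram) *m invmx gram) 0 i by rewrite mulmxK ?gram_unit // mxE.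
rewrite ipE mxE exchange_big; apply: eq_bigr => j _ /=.
by rewrite [(w^T *m gram) _ _]mxE mulr_suml; apply: eq_bigr => l _; rewrite !mxE mulrAC.
Qed.

Definition gram_norm : R := \sum_i \sum_j `|gram i j|.

Lemma gram_norm_ge0 : 0 <= gram_norm.
Proof. by rewrite sumr_ge0 // => i _; rewrite sumr_ge0. Qed.

Lemma ip_le (v : 'cV[R]_d) (c : R) : (forall i, `|v i 0| <= c) -> ip v v <= gram_norm * c ^+ 2.
Proof.
move=> h; rewrite ipE /gram_norm mulr_suml; apply: ler_sum => i _.
rewrite mulr_suml; apply: ler_sum => j _; apply: le_trans (ler_norm _) _.
rewrite !normrM mulrC ler_wpM2l // expr2.
by apply: ler_pM.
Qed.

End DualBasis.

(** * Sobolev spaces and power decay *)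

Section SobolevNorm.
Context {R : realType} (k : loops).

Lemma weight_le_japR (t : R) n : 0 <= t -> weight k t n <= jap n `^ (2 * t).
Proof.
move=> t0; rewrite weightE powRrM; apply: ge0_ler_powR; rewrite ?nnegrE ?addr_ge0 ?sqr_ge0 ?powR_ge0 //.
rewrite powR_mulrn ?jap_ge0 // -(@real_normK _ n%:~R) ?num_real // -intr_norm -natr_absz /jap.
have : (eps k)%:R <= 1 :> R by case: (eps k).
have : 0 <= `|n|%N%:R :> R by [].
by rewrite sqrrD; lra.
Qed.

Lemma japR_le_weight (t : R) n : 0 <= t -> ~~ badrow k n -> jap n `^ (2 * t) <= 4 `^ t * weight k t n.
Proof.
move=> t0 gn; rewrite weightE powRrM -powRM ?addr_ge0 ?sqr_ge0 //.
apply: ge0_ler_powR; rewrite ?nnegrE ?mulr_ge0 ?addr_ge0 ?sqr_ge0 ?powR_ge0 //.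
rewrite powR_mulrn ?jap_ge0 // -(@real_normK _ n%:~R) ?num_real // -intr_norm -natr_absz /jap.
have [n0|n0] := eqVneq n 0.
  move: gn; rewrite /badrow n0 eqxx andbT; rewrite /based /eps; case: k => // _.
  by rewrite absz0 addr0 expr1n expr0n addr0 mulr1 ler1n.
have : 1 <= `|n|%N%:R :> R by rewrite (ler_nat R 1) absz_gt0.
have : 0 <= (eps k)%:R :> R by [].
by nra.
Qed.

Lemma weight_bad (t : R) n : t != 0 -> badrow k n -> weight k t n = 0.
Proof.
by move=> t0 /andP[kB /eqP ->]; rewrite weightE; move: kB; rewrite /based /eps; case: k => // _; rewrite expr0n addr0 powR0.
Qed.

End SobolevNorm.

Section SobolevSpace.
Context {R : realType} (d : nat) (k : loops) (s : R).
Hypothesis s_gt1 : 1 < s.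
Implicit Types Z W : coeffs R d.

Let s_ge0 : 0 <= s. Proof. by apply: ltW; apply: lt_trans s_gt1. Qed.

(** Each term of the series in the definition of [Hs] is at most its sum. That series has the weight
    [(1 + n^2)^s] for both kinds of loops, hence [Free]. *)
Lemma Hs_decay Z : Hs k s Z -> ndecay s Z.
Proof.
move=> [_ cZ _] i; set f := fun n : int => weight Free s n * normc (Z n i 0) ^+ 2.
have f0 n : 0 <= f n by rewrite mulr_ge0 ?weight_ge0 ?sqr_ge0.
have nd : nondecreasing_seq (zpartial f).
  by apply/nondecreasing_seqP => n; rewrite zpartialS lerDl addr_ge0.
have hB n : f n <= limn (zpartial f).
  apply: le_trans (nondecreasing_cvgn_le nd (cZ i) `|n|%N).
  rewrite zpartialE (bigD1_seq n) ?zseq_uniq //=.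
    by rewrite lerDl sumr_ge0.
  apply/mapP; exists (absz (n + (absz n)%:Z)); last by lia.
  by rewrite mem_iota; lia.
have B0 : 0 <= limn (zpartial f) by exact: le_trans (f0 0) (hB 0).
exists (Num.sqrt (4 `^ s * limn (zpartial f))); first exact: sqrtr_ge0.
move=> n; rewrite powRN ler_pdivlMr ?powR_gt0 ?jap_gt0 //.
rewrite -[leLHS]ger0_norm ?mulr_ge0 ?normc_ge0 ?powR_ge0 // -sqrtr_sqr ler_sqrt ?mulr_ge0 ?powR_ge0 //.
rewrite exprMn mulrC -powR_mulrn ?powR_ge0 // -powRrM [s * _]mulrC.
apply: le_trans (ler_wpM2r (sqr_ge0 _) (japR_le_weight s_ge0 (isT : ~~ badrow Free n))) _.
by rewrite -mulrA ler_wpM2l ?powR_ge0 ?hB.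
Qed.

Lemma Hs_hermitian Z : Hs k s Z -> forall i, hermitian (fun n => Z n i 0).
Proof. by move=> [h _ _] i n; exact: h. Qed.

Lemma fseries0 Z i : summ (fun n => Z n i 0) -> fseries Z 0 i 0 = tsum (fun n => Z n i 0).
Proof.
move=> sZ; rewrite mxE -csumE //; congr csum; apply/funext => n.
by rewrite mulr0 expi0 scale1r.
Qed.

(** The margin [1/2] makes [jap n] to the power [2 s - 2 t] summable. *)
Lemma HsI Z (t : R) : s + 2^-1 < t -> (forall i, hermitian (fun n => Z n i 0)) -> ndecay t Z ->
  (based k -> forall i, tsum (fun n => Z n i 0) = 0) -> Hs k s Z.
Proof.
move=> st hZ dZ Z0; have t1 : 1 < t by move: s_gt1 st; lra.
split.
- by move=> n i; exact: hZ.
- move=> i; have [C C0 hC] := dZ i; apply: (@cvgP _ _ (rsum (fun n : int => weight Free s n * normc (Z n i 0) ^+ 2))).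
  apply: cvg_zpartial.
  have st2 : 1 < 2 * t - 2 * s by lra.
  apply: rsumm_lew (rsummZ (C ^+ 2) (rsumm_japR st2)) _ => n.
  rewrite ger0_norm; last by rewrite mulr_ge0 ?powR_ge0 ?sqr_ge0.
  have -> : jap n `^ (- (2 * t - 2 * s)) = jap n `^ (2 * s) * (jap n `^ (- t)) ^+ 2 :> R.
    rewrite -powR_mulrn ?powR_ge0 // -powRrM -powRD; last by rewrite (gt_eqF (jap_gt0 n)) implybT.
    by congr (_ `^ _); ring.
  rewrite [leRHS]mulrCA -[in leRHS]exprMn; apply: ler_pM; [exact: powR_ge0|exact: sqr_ge0|exact: (weight_le_japR Free n s_ge0)|].
  by rewrite lerXn2r ?nnegrE ?normc_ge0 ?mulr_ge0 ?powR_ge0.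
- move=> kB; have {}kB : based k by rewrite kB.
  apply/matrixP => i j; rewrite ord1 [RHS]mxE.
  by rewrite (fseries0 (decay_summ t1 (dZ i))) Z0.
Qed.

Variable ip : 'cV[R]_d -> 'cV[R]_d -> R.
Hypothesis ipC : forall v w, ip v w = ip w v.
Hypothesis ipL : forall a u v w, ip (a *: u + v) w = a * ip u w + ip v w.
Hypothesis ipP : forall v, v != 0 -> 0 < ip v v.

(** The same margin as in [HsI]. In the bad row the weight is 0, so the bound of [qdecay] outside it
    suffices. *)
Lemma snorm_le t : s + 2^-1 < t -> exists2 C : R, 0 <= C &
  forall D W, 0 <= D -> qdecay k t D W -> snorm k ip s W <= C * D.
Proof.
move=> st; have st2 : 1 < 2 * t - 2 * s by lra.
set S := rsum (fun n : int => jap n `^ (- (2 * t - 2 * s)) : R).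
exists (Num.sqrt (2 * gram_norm ip * S)); first exact: sqrtr_ge0.
move=> D W D0 qW; have gn0 := gram_norm_ge0 ip.
have S0 : 0 <= S by apply: rsum_ge0 => n; exact: powR_ge0.
rewrite /snorm -[D in leRHS]ger0_norm // -sqrtr_sqr -sqrtrM ?mulr_ge0 //.
apply: ler_wsqrtr; rewrite /sip; set f := fun n => _.
have h n : `|f n| <= 2 * gram_norm ip * D ^+ 2 * jap n `^ (- (2 * t - 2 * s)).
  rewrite ger0_norm; last by rewrite mulr_ge0 ?weight_ge0 ?addr_ge0 ?ip_ge0.
  have [bn|gn] := boolP (badrow k n).
    by rewrite /f weight_bad ?mul0r ?mulr_ge0 ?powR_ge0 ?sqr_ge0 // gt_eqF // (lt_trans ltr01).
  have hre : ip (remx (W n)) (remx (W n)) <= gram_norm ip * (D * jap n `^ (- t)) ^+ 2.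
    by apply: ip_le => // i; rewrite mxE; apply: le_trans (normc_re _) (qW n i gn).
  have him : ip (immx (W n)) (immx (W n)) <= gram_norm ip * (D * jap n `^ (- t)) ^+ 2.
    by apply: ip_le => // i; rewrite mxE; apply: le_trans (normc_im _) (qW n i gn).
  have e : jap n `^ (- (2 * t - 2 * s)) = jap n `^ (2 * s) * (jap n `^ (- t)) ^+ 2 :> R.
    rewrite -powR_mulrn ?powR_ge0 // -powRrM -powRD; last by rewrite (gt_eqF (jap_gt0 n)) implybT.
    by congr (_ `^ _); ring.
  apply: le_trans (_ : jap n `^ (2 * s) * (2 * (gram_norm ip * (D * jap n `^ (- t)) ^+ 2)) <= _).
    apply: ler_pM; rewrite ?weight_ge0 ?weight_le_japR ?addr_ge0 ?ip_ge0 //.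
    by rewrite mulr2n mulrDl mul1r lerD.
  by rewrite e exprMn; lra.
have sf := rsumm_lew (rsummZ (2 * gram_norm ip * D ^+ 2) (rsumm_japR st2)) h.
rewrite (zsumE sf) mulrAC -rsumZ; last exact: rsumm_japR.
apply: le_rsum => //; first exact: rsummZ (rsumm_japR st2).
by move=> n; exact: le_trans (ler_norm _) (h n).
Qed.

End SobolevSpace.

(** * Enumeration of countable families *)

Section PickleSums.
Context {R : realType}.

Lemma rsumm_fin (I : finType) (f : I -> R) : rsumm f.
Proof.
have h (s : seq I) : uniq s -> \sum_(i <- s) `|f i| <= \sum_i `|f i|.
  by move=> us; rewrite big_uniq // [leRHS](bigID (mem s)) /= lerDl sumr_ge0.
exact: (rsumm_norm f).1 (rsum_bounded (fun i => normr_ge0 (f i)) h).1.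
Qed.

(** The enumeration meets [q] exactly once, at the index [pickle q]. *)
Lemma sum_pickle_inv (T : countType) (V : nmodType) (q : T) (A : V) N :
  \sum_(j < N) oapp (fun p => if p == q then A else 0) 0 (pickle_inv j) = if (pickle q < N)%N then A else 0.
Proof.
have -> : (if (pickle q < N)%N then A else 0) = \sum_(j < N | j == pickle q :> nat) A by rewrite big_ord1_eq.
rewrite [RHS]big_mkcond; apply: eq_bigr => j _ /=.
have := @pickle_invK T j; case e : (pickle_inv _) => [p|] /= h.
  by rewrite -h (inj_eq (pcan_inj pickleK)).
by case: eqP => // jq; move: e; rewrite jq pickleK_inv.
Qed.

Lemma sum_pickle_inv_le (T : countType) (F : T -> R) N : (forall p, 0 <= F p) -> rsumm F ->
  \sum_(j < N) oapp F 0 (pickle_inv j) <= rsum F.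
Proof.
move=> F0 sF; rewrite -(big_mkord xpredT (fun j => oapp F 0 (pickle_inv j))) /index_iota subn0.
have -> : \sum_(i <- iota 0 N) oapp F 0 (pickle_inv i) = \sum_(p <- pmap pickle_inv (iota 0 N)) F p.
  elim: (iota 0 N) => [|j r IH]; rewrite ?big_nil // big_cons IH /=.
  by case: (pickle_inv j) => [p|] /=; rewrite ?big_cons ?add0r.
apply: sum_seq_rsum_le => //; apply: (@pmap_uniq _ _ (@pickle_inv T) pickle); [exact: pickle_invK|exact: iota_uniq].
Qed.

End PickleSums.

(** * A real basis of cosines and sines *)

Section RealBasis.
Context {R : realType} (d : nat) (k : loops).

Definition part (b : bool) (z : 'cV[R[i]]_d) : 'cV[R]_d := if b then remx z else immx z.

(* The Fourier coefficients of cos (m x) if b, and of - sin (m x) otherwise; for based loops the cosines are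
   corrected by a constant, which the metric does not see. *)
Definition bas (m : int) (b : bool) (n : int) : R[i] :=
  (if b then 2^-1 * ((n == m)%:R + (n == - m)%:R) - (badrow k n)%:R else 0) +i*
  (if b then 0 else 2^-1 * ((n == m)%:R - (n == - m)%:R)).

Definition atom (m : int) (b : bool) (v : 'cV[R]_d) : coeffs R d :=
  fun n => bas m b n *: map_mx (real_complex R) v.

Lemma atomE m b v n i : atom m b v n i 0 = bas m b n * (v i 0)%:C.
Proof. by rewrite !mxE. Qed.

Lemma bas_hermitian m b : hermitian (bas m b).
Proof.
move=> n; rewrite /bas /badrow oppr_eq0 eqr_opp (eqr_oppLR n m).
by case: b; rewrite /= ?oppr0 -?mulrN ?opprB // [(n == - m)%:R + _]addrC.
Qed.

Lemma atom_hermitian m b v i : hermitian (fun n => atom m b v n i 0).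
Proof. by move=> n; rewrite !atomE bas_hermitian conjcM conjc_real. Qed.

(** As a sum of families supported at a single frequency, the basis sequence can be summed and
    estimated term by term. *)
Lemma basE m b n : bas m b n =
  (if n == m then (if b then 2^-1 else 2^-1 * Ic) else 0) +
  ((if n == - m then (if b then 2^-1 else - (2^-1 * Ic)) else 0) +
   (if n == 0 then - (based k && b)%:R else 0)).
Proof.
have [h1 h2] : cre (2^-1 : R[i]) = 2^-1 /\ cim (2^-1 : R[i]) = 0.
  have -> : 2^-1 = (2^-1 : R)%:C :> R[i] by rewrite fmorphV rmorph_nat.
  by [].
rewrite /bas /badrow; apply: complex_ext; rewrite ?creD ?cimD;
  case: (n == m); case: (n == - m); case: (n == 0); case: b; case: (based k);
  rewrite /= ?h1 ?h2 ?creM ?cimM /= ?h1 ?h2 ?andbT ?andbF /=; by field.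
Qed.

Lemma decay_set1 (t : R) (m : int) (c : R[i]) : decay t (fun n => if n == m then c else 0).
Proof. by apply: (decay_update (n0 := m) (decay0 t)) => n nm; rewrite (negPf nm). Qed.

Lemma decay_bas t m b : decay t (bas m b).
Proof.
apply: eq_decay (decayD (decay_set1 t m _) (decayD (decay_set1 t (- m) _) (decay_set1 t 0 _))) => n.
by rewrite basE.
Qed.

Lemma tsum_bas m b : based k -> tsum (bas m b) = 0.
Proof.
move=> kB; rewrite (eq_tsum (basE m b)).
have s1 (p : int) (c : R[i]) : summ (fun n => if n == p then c else 0) /\ tsum (fun n => if n == p then c else 0) = c.
  by have [a e] := @tsum_set1 R int (fun n => if n == p then c else 0) p (fun n np => ifN_eq _ _ np); rewrite e eqxx.
rewrite (tsumD (s1 _ _).1 (summD (s1 _ _).1 (s1 _ _).1)) (tsumD (s1 _ _).1 (s1 _ _).1) !(s1 _ _).2 kB.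
by case: b => /=; [rewrite addrA -[2^-1]mul1r -splitr subrr|rewrite oppr0 addr0 subrr].
Qed.

Lemma bas_off m b n : ~~ badrow k n -> n != m -> n != - m -> bas m b n = 0.
Proof. by rewrite /bas => /negPf -> /negPf -> /negPf ->; case: b; rewrite /= ?addr0 ?subr0 mulr0. Qed.

Lemma normc_bas m b n : ~~ badrow k n -> normc (bas m b n) <= 1.
Proof.
move=> /negPf h; apply: le_trans (normc_le _) _; rewrite /bas h /= subr0.
case: b; rewrite normr0 ?addr0 ?add0r ler_norml; apply/andP; split;
  by case: (n == m); case: (n == - m) => /=; lra.
Qed.

(** Outside the bad row the sequence lives at the frequencies [m] and [- m], so a power of [jap n]
    can be exchanged for the same power of [jap m]. *)
Lemma qdecay_bas t m b (c : R) n : 0 <= c -> ~~ badrow k n -> normc (bas m b n * c%:C) <= c * jap m `^ t * jap n `^ (- t).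
Proof.
move=> c0 gn; rewrite normcM normc_real ger0_norm // mulrC.
have [e|nm] := boolP ((n == m) || (n == - m)); last first.
  move: nm; rewrite negb_or => /andP[h1 h2].
  by rewrite (bas_off b gn h1 h2) normc0 mulr0 !mulr_ge0 ?powR_ge0.
have -> : jap n = jap m :> R by case/orP: e => /eqP ->; rewrite ?japN.
rewrite -mulrA powRN divff ?gt_eqF ?powR_gt0 ?jap_gt0 // ler_wpM2l //.
exact: normc_bas.
Qed.

End RealBasis.

(** * Nuclearity of operators that gain two powers of the frequency *)

Section Nuclear.
Context {R : realType} (d : nat) (k : loops) (s : R).
Hypothesis s_gt1 : 1 < s.
Variable ip : 'cV[R]_d -> 'cV[R]_d -> R.
Hypothesis ipC : forall v w, ip v w = ip w v.
Hypothesis ipL : forall a u v w, ip (a *: u + v) w = a * ip u w + ip v w.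
Hypothesis ipP : forall v, v != 0 -> 0 < ip v v.
Implicit Types Z W : coeffs R d.
Local Notation T := (int * 'I_d * bool)%type.

Let s_gt0 : 0 < s. Proof. exact: lt_trans s_gt1. Qed.
Let s_neq0 : s != 0. Proof. by rewrite gt_eqF. Qed.
Let s_ge0 : 0 <= s. Proof. exact: ltW. Qed.

(** The frequencies [m] and [- m] contribute equally by Hermitian symmetry, each with a factor
    [1/2]. For [m = 0] they coincide, and the imaginary part of [Z 0] vanishes. *)
Lemma sip_atom Z m b v : (forall i, hermitian (fun n => Z n i 0)) ->
  sip k ip s Z (atom k m b v) = weight k s m * ip (part b (Z m)) v.
Proof.
move=> hZ.
have reN n : remx (Z (- n)) = remx (Z n) by apply/colP => i; rewrite !mxE hZ; case: (Z n i 0).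
have imN n : immx (Z (- n)) = - immx (Z n) by apply/colP => i; rewrite !mxE hZ; case: (Z n i 0).
have wN n : weight k s (- n) = weight k s n by rewrite !weightE intrN sqrrN.
have ra n : remx (atom k m b v n) = cre (bas k m b n) *: v.
  by apply/colP => i; rewrite [LHS]mxE [RHS]mxE atomE creM /= mulr0 subr0.
have ia n : immx (atom k m b v n) = cim (bas k m b n) *: v.
  by apply/colP => i; rewrite [LHS]mxE [RHS]mxE atomE cimM /= mulr0 add0r.
have ipN u : ip (- u) v = - ip u v by rewrite -scaleN1r (ipZ ipL) mulN1r.
pose A := 2^-1 * (weight k s m * ip (part b (Z m)) v).
have e n : weight k s n * (ip (remx (Z n)) (remx (atom k m b v n)) + ip (immx (Z n)) (immx (atom k m b v n))) =
    (if n == m then A else 0) + (if n == - m then A else 0).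
  rewrite ra ia !(ipZr ipC ipL) /bas /=.
  have [bn|gn] := boolP (badrow k n).
    rewrite (weight_bad s_neq0 bn) mul0r.
    have [em|nm] := eqVneq n m; have [em'|nm'] := eqVneq n (- m); rewrite ?addr0 //.
    - by rewrite /A -em (weight_bad s_neq0 bn) mul0r mulr0 addr0.
    - by rewrite /A -em (weight_bad s_neq0 bn) mul0r mulr0.
    - by rewrite /A -[m]opprK -em' wN (weight_bad s_neq0 bn) mul0r mulr0 addr0.
  rewrite subr0 /A /part; clear A ra ia.
  have [->|nm] := eqVneq n m.
    have [em|nm] := eqVneq m (- m); case: b; rewrite /= ?(mul0r, addr0, add0r, subr0, subrr, mulr0, mulr1); try by ring.
    have -> : immx (Z m) = 0.
      have m0 : m = 0 by lia.
      apply/eqP; have := imN 0; rewrite oppr0 -m0 => /eqP; rewrite -subr_eq0 opprK -mulr2n -scaler_nat scaler_eq0.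
      by rewrite pnatr_eq0.
    by rewrite (ip0 ipL) !mulr0 addr0.
  have [->|nm'] := eqVneq n (- m); last by case: b; rewrite /= ?(addr0, subrr, mulr0, mul0r).
  by rewrite reN imN wN; case: b; rewrite /= ?ipN; ring.
have r (p : int) : rsumm (fun n => if n == p then A else 0) /\ rsum (fun n => if n == p then A else 0) = A.
  by have [a h] := @rsum_set1 R int (fun n => if n == p then A else 0) p (fun n np => ifN_eq _ _ np); rewrite h eqxx.
rewrite /sip (_ : (fun n => _) = (fun n => (if n == m then A else 0) + (if n == - m then A else 0))); last by apply/funext.
rewrite (zsumE (rsummD (r m).1 (r (- m)).1)) (rsumD (r m).1 (r (- m)).1) !(r _).2 /A.
lra.
Qed.

Lemma atom_Hs m b (v : 'cV[R]_d) : Hs k s (atom k m b v).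
Proof.
apply: (@HsI R d k s s_gt1 _ (s + 1)); first by rewrite ltrD2l; lra.
- by move=> i; exact: atom_hermitian.
- move=> i; apply: eq_decay (decayZ (v i 0)%:C (decay_bas k (s + 1) m b)) => n.
  by rewrite atomE mulrC.
- move=> kB i; rewrite (eq_tsum (fun n => atomE k m b v n i)).
  have t1 : 1 < s + 1 by move: s_gt1; lra.
  by rewrite (tsumZr _ (decay_summ t1 (decay_bas k (s + 1) m b))) (tsum_bas m b kB) mul0r.
Qed.

Variable f : 'I_d -> 'cV[R]_d.
Hypothesis ip_f : forall w i, ip w (f i) = w i 0.

(** [uvec] and [evec] resolve the identity: the weight and the dual basis are chosen so that,
    outside the bad row, the product of [Z] with [uvec p] is one real coordinate of one Fourier
    coefficient of [Z]. *)
Definition uvec (p : T) : coeffs R d := atom k p.1.1 p.2 (weight k (- s) p.1.1 *: f p.1.2).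
Definition evec (p : T) : coeffs R d := atom k p.1.1 p.2 (delta_mx p.1.2 0).

Lemma sip_uvec Z p : (forall i, hermitian (fun n => Z n i 0)) ->
  sip k ip s Z (uvec p) = weight k s p.1.1 * weight k (- s) p.1.1 * part p.2 (Z p.1.1) p.1.2 0.
Proof. by move=> hZ; rewrite sip_atom // (ipZr ipC ipL) ip_f mulrA. Qed.

Lemma weightVK n : ~~ badrow k n -> weight k s n * weight k (- s) n = 1.
Proof.
move=> gn; rewrite weightN divff // gt_eqF //.
have := japR_le_weight s_ge0 gn; have := @powR_gt0 R (jap n) (2 * s) (jap_gt0 n).
by have := @powR_gt0 R 4 s ltac:(by []); move: (weight k s n) => w h1 h2 h3; nra.
Qed.

(** By [sip_uvec] the squared norm is a coordinate of [uvec p] at its own frequency, and this is of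
    the size of [weight (- s)]. *)
Lemma snorm_uvec : exists2 C : R, 0 <= C & forall p, snorm k ip s (uvec p) <= C * jap p.1.1 `^ (- s).
Proof.
pose B := \sum_i ip (f i) (f i); have B0 : 0 <= B by rewrite sumr_ge0 // => i _; exact: (ip_ge0 ipL ipP).
exists (Num.sqrt (4 `^ s * B)); first exact: sqrtr_ge0.
move=> [[m i] b] /=; rewrite /snorm sip_uvec; last by move=> l; exact: atom_hermitian.
rewrite -[jap m `^ (- s)]ger0_norm ?powR_ge0 // -sqrtr_sqr -sqrtrM ?mulr_ge0 ?powR_ge0 //.
apply: ler_wsqrtr; rewrite -powR_mulrn ?powR_ge0 // -powRrM /=.
have [bm|gm] := boolP (badrow k m).
  by rewrite (weight_bad s_neq0 bm) !mul0r !mulr_ge0 ?powR_ge0.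
rewrite weightVK // mul1r.
have fB : f i i 0 <= B.
  rewrite -ip_f /B (bigD1 i) //= lerDl sumr_ge0 // => l _; exact: (ip_ge0 ipL ipP).
have f0 : 0 <= f i i 0 by rewrite -ip_f; exact: (ip_ge0 ipL ipP).
have w0 := weight_ge0 k (- s) m.
have e : part b (uvec (m, i, b) m) i 0 <= weight k (- s) m * f i i 0.
  have h := @normc_bas R k m b m gm.
  have cr (z : R[i]) (a : R) : cre (z * a%:C) = cre z * a by rewrite creM /= mulr0 subr0.
  have ci (z : R[i]) (a : R) : cim (z * a%:C) = cim z * a by rewrite cimM /= mulr0 add0r.
  have -> : weight k (- s) m * f i i 0 = 1 * (weight k (- s) m * f i i 0) by rewrite mul1r.
  rewrite /part; case: b h => h; rewrite mxE atomE ?cr ?ci mxE ler_wpM2r ?mulr_ge0 //.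
    by apply: le_trans h; apply: le_trans (normc_re _); exact: ler_norm.
  by apply: le_trans h; apply: le_trans (normc_im _); exact: ler_norm.
apply: le_trans e _; rewrite mulrAC; apply: ler_pM => //.
have := japR_le_weight s_ge0 gm; rewrite weightN.
have -> : - s * 2 = - (2 * s) by ring.
rewrite powRN => h; have wp : 0 < weight k s m.
  have := @powR_gt0 R (jap m) (2 * s) (jap_gt0 m); have := @powR_gt0 R 4 s ltac:(by []).
  by move: h; move: (weight k s m) => w h1 h2 h3; nra.
by rewrite -[leLHS]mul1r ler_pdivrMr // mulrAC ler_pdivlMr ?powR_gt0 ?jap_gt0 // mul1r.
Qed.

(** The index set contains [m] and [- m], which give equal cosines and opposite sines. Each real
    coordinate at [n] is therefore delivered by two of the [atoms4], each contributing half. *)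
Definition Acoef Z n i (b : bool) : R[i] :=
  if b then (2^-1 * cre (Z n i 0))%:C else (2^-1 * cim (Z n i 0))%:C * Ic.

Definition atoms4 n i : seq T := [:: (n, i, true); (- n, i, true); (n, i, false); (- n, i, false)].

Lemma uvec_coef Z n i p : (forall i, hermitian (fun n => Z n i 0)) -> ~~ badrow k n ->
  (sip k ip s Z (uvec p))%:C * evec p n i 0 = \sum_(q <- atoms4 n i) (if p == q then Acoef Z n i q.2 else 0).
Proof.
Proof.
move=> hZ gn; case: p => [[m i'] b]; rewrite sip_uvec // /evec atomE !big_cons big_nil addr0 /=.
rewrite !xpair_eqE; have [->|ii] := eqVneq i' i; last first.
  by rewrite !andbF /= !addr0 mxE [i == i']eq_sym (negPf ii) /= rmorph0 !mulr0.
rewrite !andbT [delta_mx _ _ _ _]mxE !eqxx rmorph1 mulr1.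
have hNi : cre (Z (- n) i 0) = cre (Z n i 0) by rewrite hZ; case: (Z n i 0).
have hNs : cim (Z (- n) i 0) = - cim (Z n i 0) by rewrite hZ; case: (Z n i 0).
have gN : ~~ badrow k (- n) by move: gn; rewrite /badrow oppr_eq0.
have [mn|mn] := eqVneq m n; last first.
  have [mn'|mn'] := eqVneq m (- n); last first.
    rewrite bas_off ?mulr0 ?addr0 //; first by rewrite eq_sym.
    by rewrite -eqr_oppLR eq_sym.
  rewrite mn' weightVK // mul1r /part /bas (negPf gn) opprK eqxx.
  have -> : (n == - n) = false by apply/negP => /eqP h; move: mn; rewrite mn' -h eqxx.
  by case: b; rewrite /= mxE ?hNi ?hNs /Acoef /=; apply: complex_ext; rewrite ?creD ?cimD ?creM ?cimM /=; ring.
rewrite mn weightVK // mul1r /part /bas (negPf gn) eqxx.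
have [nn|nn] := eqVneq n (- n); last first.
  by case: b; rewrite /= mxE /Acoef /=; apply: complex_ext; rewrite ?creD ?cimD ?creM ?cimM /=; ring.
have z0 : cim (Z n i 0) = 0 by move: hNs; rewrite -nn; lra.
by case: b; rewrite /= mxE /Acoef /= ?z0; apply: complex_ext; rewrite ?creD ?cimD ?creM ?cimM /=; field.
Qed.

Lemma Acoef_sum Z n i : \sum_(q <- atoms4 n i) Acoef Z n i q.2 = Z n i 0.
Proof.
rewrite !big_cons big_nil addr0 /Acoef /=.
by apply: complex_ext; rewrite ?creD ?cimD ?creM ?cimM /=; field.
Qed.

Lemma normc_Acoef Z n i b : normc (Acoef Z n i b) <= normc (Z n i 0).
Proof.
have h (x y : R) : `|x| <= y -> `|2^-1 * x| <= y.
  by move=> hx; rewrite normrM ger0_norm ?invr_ge0 //; apply: le_trans hx; rewrite ler_piMl //; lra.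
rewrite /Acoef; case: b.
  by rewrite normc_real; apply: h; exact: normc_re.
rewrite normcM normc_real (_ : normc Ic = 1) ?mulr1; last by rewrite /= expr0n expr1n add0r sqrtr1.
by apply: h; exact: normc_im.
Qed.

Definition useq (j : nat) : coeffs R d := oapp uvec (fun=> 0) (pickle_inv j).
Definition eseq (j : nat) : coeffs R d := oapp evec (fun=> 0) (pickle_inv j).

Lemma Hs0 : Hs k s (fun=> 0 : 'cV[R[i]]_d).
Proof.
apply: (@HsI R d k s s_gt1 _ (s + 1)); first by rewrite ltrD2l; lra.
- by move=> i n; rewrite !mxE conjc0.
- by move=> i; apply: eq_decay (decay0 _) => n; rewrite mxE.
- by move=> _ i; rewrite -[RHS](@tsum0 R int); apply: eq_tsum => n; rewrite mxE.
Qed.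

Lemma useq_Hs j : Hs k s (useq j).
Proof. by rewrite /useq; case: (pickle_inv j) => [p|] /=; [exact: atom_Hs|exact: Hs0]. Qed.

Lemma eseq_Hs j : Hs k s (eseq j).
Proof. by rewrite /eseq; case: (pickle_inv j) => [p|] /=; [exact: atom_Hs|exact: Hs0]. Qed.

Definition remainder Z (N : nat) : coeffs R d :=
  fun n => Z n - \sum_(j < N) (sip k ip s Z (useq j))%:C *: eseq j n.

Lemma remainderS Z N : remainder Z N.+1 = (fun n => remainder Z N n - (sip k ip s Z (useq N))%:C *: eseq N n).
Proof. by apply/funext => n; rewrite /remainder big_ord_recr /= opprD addrA. Qed.

Lemma remainder_entry Z N n i : Hs k s Z -> ~~ badrow k n ->
  remainder Z N n i 0 = \sum_(q <- atoms4 n i) (if (pickle q < N)%N then 0 else Acoef Z n i q.2).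
Proof.
move=> HZ gn; have hZ := Hs_hermitian HZ.
transitivity (Z n i 0 - \sum_(j < N) \sum_(q <- atoms4 n i) oapp (fun p => if p == q then Acoef Z n i q.2 else 0) 0 (pickle_inv j)).
  rewrite [LHS]mxE [(- _ : 'cV[R[i]]_d) i 0]mxE summxE; congr (_ - _); apply: eq_bigr => j _.
  rewrite mxE /useq /eseq; case: (pickle_inv j) => [p|] /=; first exact: uvec_coef.
  by rewrite mxE mulr0 big1_seq.
rewrite exchange_big /= -{1}(Acoef_sum Z n i) -sumrB; apply: eq_bigr => q _.
by rewrite (sum_pickle_inv q (Acoef Z n i q.2) N); case: ifP => _; rewrite ?subrr ?subr0.
Qed.

Lemma normc_remainder Z N n i : Hs k s Z -> ~~ badrow k n -> normc (remainder Z N n i 0) <= 4 * normc (Z n i 0).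
Proof.
move=> HZ gn; rewrite remainder_entry //; apply: le_trans (normc_sum _ _ _) _.
apply: le_trans (_ : \sum_(q <- atoms4 n i) normc (Z n i 0) <= _).
  apply: ler_sum => q _; case: ifP => _; last exact: normc_Acoef.
  by rewrite normc0 normc_ge0.
by rewrite !big_cons big_nil addr0 !addrA -!mulr2n; lra.
Qed.

(** Only finitely many indices have frequency at most [J]; [N0] exceeds their positions in the
    enumeration. *)
Lemma remainder_eq0 (J : nat) : exists N0, forall N Z n i, (N0 <= N)%N -> (`|n| <= J)%N -> Hs k s Z -> ~~ badrow k n ->
  remainder Z N n i 0 = 0.
Proof.
pose g (x : 'I_J.*2.+1 * 'I_d * bool) : T := ((x.1.1 : nat)%:Z - J%:Z, x.1.2, x.2).
exists (\max_x pickle (g x)).+1 => N Z n i hN hn HZ gn; rewrite remainder_entry // big1_seq // => q /= hq.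
suff -> : (pickle q < N)%N by [].
have [x ->] : exists x, q = g x.
  have hr (m : int) : (`|m| <= J)%N -> exists y : 'I_J.*2.+1, m = (y : nat)%:Z - J%:Z.
    move=> hm; have hy : (absz (m + J%:Z)%R < J.*2.+1)%N by lia.
    by exists (Ordinal hy) => /=; lia.
  have [y1 e1] := hr n hn; have [y2 e2] : exists y : 'I_J.*2.+1, - n = (y : nat)%:Z - J%:Z by apply: hr; rewrite abszN.
  move: hq; rewrite !inE => /or4P[] /eqP ->; [exists (y1, i, true)|exists (y2, i, true)|exists (y1, i, false)|exists (y2, i, false)];
    by rewrite /g /= -?e1 -?e2.
by apply: leq_trans hN; rewrite ltnS; exact: (@leq_bigmax _ (fun x => pickle (g x))).
Qed.

Variable P : coeffs R d -> coeffs R d.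
Hypothesis P_bound : forall t : R, exists2 C : R, 0 <= C & forall D Z, 0 <= D -> ndecay s Z ->
  qdecay k t D Z -> qdecay k (t + 2) (C * D) (P Z).
Hypothesis P_linear : forall Z W (c : R[i]) n i, ndecay s Z -> ndecay s W -> ~~ badrow k n ->
  P (fun m => Z m - c *: W m) n i 0 = P Z n i 0 - c * P W n i 0.
Hypothesis P_hermitian : forall Z, ndecay s Z -> (forall i, hermitian (fun n => Z n i 0)) ->
  forall i, hermitian (fun n => P Z n i 0).
Hypothesis P_sum0 : forall Z i, based k -> ndecay s Z -> tsum (fun n => P Z n i 0) = 0.

Lemma qdecay_ndecay (t C : R) Z : 0 <= C -> qdecay k t C Z -> ndecay t Z.
Proof.
move=> C0 q i; exists (C + normc (Z 0 i 0)); first by rewrite addr_ge0 ?normc_ge0.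
move=> n; have [->|n0] := eqVneq n 0.
  by rewrite /jap absz0 addr0 powR1 mulr1 lerDr.
have gn : ~~ badrow k n by rewrite /badrow (negPf n0) andbF.
by apply: le_trans (q n i gn) _; rewrite ler_wpM2r ?powR_ge0 // lerDl normc_ge0.
Qed.

Lemma Hs_qdecay Z : Hs k s Z -> exists2 M : R, 0 <= M & qdecay k s M Z.
Proof.
move=> HZ; have h i := cid2 (Hs_decay s_gt1 HZ i).
exists (\sum_i s2val (h i)); first by rewrite sumr_ge0 // => i _; exact: (s2valP (h i)).
move=> n i _; apply: le_trans (s2valP' (h i) n) _; rewrite ler_wpM2r ?powR_ge0 //.
by rewrite (bigD1 i) //= lerDl sumr_ge0 // => l _; exact: (s2valP (h l)).
Qed.

Lemma P_Hs Z : Hs k s Z -> Hs k s (P Z).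
Proof.
move=> HZ; have dZ := Hs_decay s_gt1 HZ; have [M M0 qM] := Hs_qdecay HZ; have [C C0 hC] := P_bound s.
apply: (@HsI R d k s s_gt1 _ (s + 2)); first by rewrite ltrD2l; lra.
- exact: P_hermitian dZ (Hs_hermitian HZ).
- by apply: qdecay_ndecay (hC M Z M0 dZ qM); rewrite mulr_ge0.
- by move=> kB i; exact: P_sum0.
Qed.

Definition vseq (j : nat) : coeffs R d := P (eseq j).

(** An atom at frequency [m] obeys a decay bound of exponent [s - 5/4] with constant [jap m] to that
    power. [P] raises the exponent to [s + 3/4], above the [s + 1/2] that the norm requires. Any
    number strictly between 1 and 3/2 could replace [5/4]. *)
Lemma snorm_vseq : exists2 C : R, 0 <= C &
  forall p, snorm k ip s (P (evec p)) <= C * jap p.1.1 `^ (s - 5 / 4).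
Proof.
have [C1 C10 h1] := P_bound (s - 5 / 4).
have [|C2 C20 h2] := @snorm_le R d k s s_gt1 ip ipC ipL ipP (s - 5 / 4 + 2); first by lra.
exists (C2 * C1); first exact: mulr_ge0.
move=> p; rewrite -mulrA; apply: h2; first by rewrite mulr_ge0 ?powR_ge0.
apply: h1; [exact: powR_ge0|exact: Hs_decay (atom_Hs _ _ _)|].
move=> n i gn; rewrite atomE; have := qdecay_bas (s - 5 / 4) p.1.1 p.2 (@ler01 R) gn.
rewrite mul1r; apply: le_trans; rewrite !normcM ler_wpM2l ?normc_ge0 // !normc_real normr1 mxE.
by case: (_ && _); rewrite ?normr1 ?normr0.
Qed.

Lemma snorm_ge0 Z : 0 <= snorm k ip s Z.
Proof. exact: sqrtr_ge0. Qed.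

Lemma nuclear_series : cvgn (series (fun j => snorm k ip s (useq j) * snorm k ip s (vseq j))).
Proof.
have [C1 C10 h1] := snorm_uvec; have [C2 C20 h2] := snorm_vseq.
(* The exponents [- s] of [uvec] and [s - 5/4] of its image add up to [- 5/4], which is summable. *)
pose F (p : T) := C1 * C2 * jap p.1.1 `^ (- (5 / 4)).
have F0 p : 0 <= F p by rewrite !mulr_ge0 ?powR_ge0.
have u0 : snorm k ip s (fun=> 0 : 'cV[R[i]]_d) = 0.
  have [|C C0 h] := @snorm_le R d k s s_gt1 ip ipC ipL ipP (s + 1); first by lra.
  apply/eqP; rewrite eq_le snorm_ge0 andbT -(mulr0 C); apply: h => // n i _.
  by rewrite mxE normc0 mul0r.
have hF j : snorm k ip s (useq j) * snorm k ip s (vseq j) <= oapp F 0 (pickle_inv j).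
  rewrite /vseq /useq /eseq; case: (pickle_inv j) => [p|] /=; last by rewrite u0 mul0r.
  apply: le_trans (ler_pM (snorm_ge0 _) (snorm_ge0 _) (h1 p) (h2 p)) _.
  rewrite /F mulrACA ler_wpM2l ?mulr_ge0 // -powRD; last by rewrite (gt_eqF (jap_gt0 _)) implybT.
  by rewrite addrA addNr add0r.
have sF : rsumm F.
  have t1 : 1 < 5 / 4 :> R by lra.
  have := rsumm_prodM (rsumm_prodM (rsummZ (C1 * C2) (rsumm_japR t1)) (@rsumm_fin R 'I_d (fun=> 1))) (@rsumm_fin R bool (fun=> 1)).
  by congr rsumm; apply/funext => p; rewrite !mulr1.
apply: nondecreasing_is_cvgn.
  apply/nondecreasing_seqP => N; rewrite seriesSr lerDl mulr_ge0 ?snorm_ge0 //.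
exists (rsum F) => _ [N _ <-]; rewrite /series /= big_mkord.
apply: le_trans (sum_pickle_inv_le N F0 sF); apply: ler_sum => j _; exact: hF.
Qed.

Lemma remainder_Hs Z N : Hs k s Z -> ndecay s (remainder Z N).
Proof.
move=> HZ i; elim: N => [|N IH].
  by apply: eq_decay (Hs_decay s_gt1 HZ i) => n; rewrite /remainder big_ord0 subr0.
rewrite remainderS; apply: eq_decay (decayD IH (decayZ (- (sip k ip s Z (useq N))%:C) (Hs_decay s_gt1 (eseq_Hs N) i))) => n.
by rewrite [RHS]mxE [(- _ : 'cV[R[i]]_d) i 0]mxE [(_ *: _ : 'cV[R[i]]_d) i 0]mxE mulNr.
Qed.

Definition premainder Z (N : nat) : coeffs R d :=
  fun n => P Z n - \sum_(j < N) (sip k ip s Z (useq j))%:C *: vseq j n.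

(** [P_linear] speaks of the rows outside the bad one, the same rows that [qdecay] looks at. *)
Lemma P_remainder Z N n i : Hs k s Z -> ~~ badrow k n -> premainder Z N n i 0 = P (remainder Z N) n i 0.
Proof.
move=> HZ gn; elim: N => [|N IH].
  rewrite /premainder big_ord0 subr0; congr (P _ _ _ _); apply/funext => m.
  by rewrite /remainder big_ord0 subr0.
rewrite remainderS P_linear //; [|exact: remainder_Hs|exact: Hs_decay (eseq_Hs N)].
rewrite -IH /premainder big_ord_recr /= opprD addrA.
by rewrite [LHS]mxE [(- _ : 'cV[R[i]]_d) i 0]mxE [(_ *: _ : 'cV[R[i]]_d) i 0]mxE.
Qed.

(** Finitely many terms remove all frequencies up to [J]. Beyond, lowering the exponent from [s] to
    [s - 5/4] leaves a spare factor [1 / jap n], at most [1 / (J + 1)]. *)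
Lemma qdecay_remainder Z : Hs k s Z -> exists2 M : R, 0 <= M & forall J : nat, exists N0, forall N, (N0 <= N)%N ->
  qdecay k (s - 5 / 4) (M / J.+1%:R) (remainder Z N).
Proof.
move=> HZ; have [M M0 hM] := Hs_qdecay HZ; exists (4 * M); first by rewrite mulr_ge0.
move=> J; have [N0 h0] := remainder_eq0 J; exists N0 => N hN n i gn.
have J0 : 0 < J.+1%:R :> R by [].
have [hn|hn] := leqP `|n|%N J.
  by rewrite (h0 N Z n i hN hn HZ gn) normc0 !mulr_ge0 ?powR_ge0 ?invr_ge0.
apply: le_trans (normc_remainder N i HZ gn) _.
have -> : 4 * M / J.+1%:R * jap n `^ (- (s - 5 / 4)) = 4 * (M * (J.+1%:R^-1 * jap n `^ (- (s - 5 / 4)))) by rewrite !mulrA.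
rewrite ler_wpM2l //; apply: le_trans (hM n i gn) _; rewrite ler_wpM2l //.
have jJ : J.+1%:R <= jap n :> R by apply: le_trans (_ : `|n|%N%:R <= _); [rewrite ler_nat|rewrite /jap lerDr].
apply: le_trans (_ : (jap n)^-1 * jap n `^ (- (s - 5 / 4)) <= _); last first.
  by rewrite ler_wpM2r ?powR_ge0 // lef_pV2 ?posrE ?jap_gt0.
rewrite -powR_inv1 ?jap_ge0 // -powRD; last by rewrite (gt_eqF (jap_gt0 _)) implybT.
by apply: ler_powR; [exact: jap_ge1|lra].
Qed.

Lemma cvg_premainder Z : Hs k s Z -> (fun N => snorm k ip s (premainder Z N)) @ \oo --> (0 : R).
Proof.
move=> HZ; have [M M0 hM] := qdecay_remainder HZ.
have [C1 C10 h1] := P_bound (s - 5 / 4).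
have [|C2 C20 h2] := @snorm_le R d k s s_gt1 ip ipC ipL ipP (s - 5 / 4 + 2); first by lra.
have K0 : 0 <= C2 * (C1 * M) by rewrite !mulr_ge0.
(* [J + 1] exceeds [C2 C1 M / e], so that the norm of the remainder falls below [e]. *)
apply/cvgrPdist_lt => e e0; pose J := Num.truncn (C2 * (C1 * M) / e).
have [N0 hN0] := hM J; exists N0 => // N /= hN.
rewrite sub0r normrN ger0_norm ?snorm_ge0 //.
have q : qdecay k (s - 5 / 4 + 2) (C1 * (M / J.+1%:R)) (premainder Z N).
  move=> n i gn; rewrite P_remainder //; apply: h1 => //; last exact: hN0.
    by rewrite divr_ge0.
  exact: remainder_Hs.
apply: le_lt_trans (h2 _ _ _ q) _; first by rewrite mulr_ge0 ?divr_ge0.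
rewrite !mulrA ltr_pdivrMr // -!mulrA -ltr_pdivrMl //.
by rewrite mulrC; exact: truncnS_gt.
Qed.

Lemma nuclear_trace_class : trace_class k ip s P.
Proof.
split; first exact: P_Hs.
exists useq, vseq; split.
- by move=> j; split; [exact: useq_Hs|exact: P_Hs (eseq_Hs j)].
- exact: nuclear_series.
- exact: cvg_premainder.
Qed.

End Nuclear.

Section CurvatureTraceClass.
Context {R : realType} (d : nat).
Variable br : 'cV[R]_d -> 'cV[R]_d -> 'cV[R]_d.
Hypothesis brl : forall a u v w, br (a *: u + v) w = a *: br u w + br v w.
Hypothesis brr : forall a u v w, br u (a *: v + w) = a *: br u v + br u w.
Hypothesis leibniz : forall x y z, br (br x y) z = br x (br y z) - br y (br x z).
Variable ip : 'cV[R]_d -> 'cV[R]_d -> R.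
Hypothesis ipC : forall v w, ip v w = ip w v.
Hypothesis ipL : forall a u v w, ip (a *: u + v) w = a * ip u w + ip v w.
Hypothesis ipP : forall v, v != 0 -> 0 < ip v v.

Lemma curvature_trace_class k s X Y : 1 < s -> smooth_field k X -> smooth_field k Y ->
  trace_class k ip s (curvature k br s X Y).
Proof.
move=> s1 fX fY; have [f hf] := dual_basis ipC ipL ipP.
have s2 : 2^-1 < s by lra.
apply: (nuclear_trace_class s1 ipC ipL ipP hf).
- by move=> t; exact: curvature_bound.
- by move=> Z W c n i dZ dW gn; exact: (curvature_linear brl brr leibniz s1 fX fY c i s1 dZ dW gn).
- by move=> Z dZ hZ; exact: (curvature_hermitian brl brr leibniz s1 fX fY s1 dZ hZ).
- by move=> Z i kB dZ; exact: (curvature_sum0 brl brr s2 s1 fX fY i kB dZ).2.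
Qed.

End CurvatureTraceClass.

Local Notation coord := (@Defs.coord _ _ _).

(** * The Lie bracket of a Lie group *)

Section NearDifferentiable.
Context {R : realType} (V W : normedModType R).

Lemma near_differentiable (f g : V -> W) a :
  (\forall x \near a, f x = g x) -> differentiable f a -> differentiable g a.
Proof.
move=> fg df; have fga := nbhs_singleton fg.
have dc : continuous ('d f a) by exact: diff_continuous.
have /diff_locallyP [_ /eqaddoP hf] := df.
have hg : g \o shift a = cst (g a) + 'd f a +o_ 0 id.
  apply/eqaddoP => e e0; have he := hf e e0.
  have sh : \forall h \near (0 : V), f (h + a) = g (h + a).
    by move: fg; rewrite (near_shift 0 a) /= ; apply: filterS => h /=; rewrite subr0.
  near=> h.
  have -> : (g \o shift a - (cst (g a) + 'd f a)) h = (f \o shift a - (cst (f a) + 'd f a)) h.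
    rewrite !fctE /= /cst -fga; congr (_ - _); apply/esym.
    by near: h.
  by near: h.
have eg : 'd g a = 'd f a :> (V -> W) := diff_unique dc hg.
by apply/diff_locallyP; rewrite eg.
Unshelve. all: by end_near. Qed.

Lemma derive_linear (f : V -> W) a (c : R) u v : differentiable f a ->
  'D_(c *: u + v) f a = c *: 'D_u f a + 'D_v f a.
Proof. by move=> df; rewrite !deriveE // linearP. Qed.

Lemma derive_pair (V' : normedModType R) (f : V -> W) (g : V -> V') a v :
  differentiable f a -> differentiable g a -> 'D_v (fun y => (f y, g y)) a = ('D_v f a, 'D_v g a).
Proof. by move=> df dg; rewrite deriveE ?(diff_pair df dg) ?deriveE //; exact: differentiable_pair. Qed.

Lemma derive_comp (V' : normedModType R) (f : V -> W) (g : W -> V') a v :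
  differentiable f a -> differentiable g (f a) -> 'D_v (fun x => g (f x)) a = 'D_('D_v f a) g (f a).
Proof.
move=> df dg; have dc := differentiable_comp df dg.
rewrite -[fun x => g (f x)]/(g \o f) deriveE // diff_comp //= deriveE // deriveE //.
Qed.

End NearDifferentiable.

Section Coordinates.
Context {R : realType} (V : normedModType R) (d : nat).

Lemma differentiable_cV (f : V -> 'cV[R]_d) a : (forall j, differentiable (fun u => f u j 0 : R^o) a) -> differentiable f a.
Proof.
move=> df; have -> : f = \sum_(j < d) (fun u => f u j 0 *: delta_mx j 0).
  by apply/funext => u; rewrite fct_sumE {1}(cV_basis (f u)).
by apply: differentiable_sum => j; exact: differentiableZl.
Qed.

Lemma differentiable_entry m (f : V -> 'cV[R]_m) a j : differentiable f a -> differentiable (fun u => f u j 0 : R^o) a.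
Proof. by move=> df; apply: (@differentiable_comp _ _ _ _ f (fun N : 'cV[R]_m => N j 0 : R^o)) => //; exact: differentiable_coord. Qed.

Lemma derive_entry (f : V -> 'cV[R]_d) a v j : differentiable f a -> 'D_v f a j 0 = 'D_v (fun u => f u j 0 : R^o) a.
Proof. by move=> df; rewrite derive_mx ?mxE //; exact: diff_derivable. Qed.

Lemma differentiable_scale_sum n (xi : V -> 'cV[R]_n) (Q : 'I_n -> V -> 'cV[R]_d) a :
  differentiable xi a -> (forall i, differentiable (Q i) a) ->
  differentiable (fun u => \sum_i xi u i 0 *: Q i u) a.
Proof.
move=> dxi dQ; apply: differentiable_cV => j.
have -> : (fun u => (\sum_i xi u i 0 *: Q i u) j 0 : R^o) = \sum_(i < n) ((fun u => xi u i 0 : R^o) * (fun u => Q i u j 0 : R^o)).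
  by apply/funext => u; rewrite summxE fct_sumE; apply: eq_bigr => i _; rewrite mxE.
by apply: differentiable_sum => i; apply: differentiableM; exact: differentiable_entry.
Qed.

Lemma bilinear_alg (a b c f g : R) : a * f * g + c * b * g = g * (c * b + f * a).
Proof. ring. Qed.

(** In structure constants this is the product rule for scalar functions. *)
Lemma derive_bilinear (br : 'cV[R]_d -> 'cV[R]_d -> 'cV[R]_d) (f g : V -> 'cV[R]_d) a v :
  (forall a u v w, br (a *: u + v) w = a *: br u w + br v w) ->
  (forall a u v w, br u (a *: v + w) = a *: br u v + br u w) ->
  differentiable f a -> differentiable g a ->
  'D_v (fun u => br (f u) (g u)) a = br ('D_v f a) (g a) + br (f a) ('D_v g a).
Proof.
move=> brl brr df dg.
have D (h : V -> 'cV[R]_d) l : differentiable h a -> is_derive a v (fun u => h u l 0 : R^o) ('D_v h a l 0).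
  move=> dh; split; first by apply: diff_derivable; exact: differentiable_entry.
  by rewrite derive_entry.
have e r : (fun u => br (f u) (g u) r 0 : R^o) =
    \sum_(l < d) \sum_(j < d) (sconst br l j r *: ((fun u => f u l 0 : R^o) * (fun u => g u j 0 : R^o))).
  apply/funext => u; rewrite (brE brl brr) fct_sumE.
  by apply: eq_bigr => l _; rewrite fct_sumE; apply: eq_bigr => j _; rewrite mulrC.
have Dr r := is_derive_sum (fun l => is_derive_sum (fun j => is_deriveZ (sconst br l j r) (is_deriveM (D f l df) (D g j dg)))).
have db : derivable (fun u => br (f u) (g u)) a v.
  by apply/derivable_mxP => r z; rewrite ord1 e; exact: (@ex_derive _ _ _ _ _ _ _ (Dr r)).
apply/matrixP => r z; rewrite ord1 {z} (derive_mx db) mxE e.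
apply: etrans (@derive_val _ _ _ _ _ _ _ (Dr r)) _.
have e1 := brE brl brr ('D_v f a) (g a) r.
have e2 := brE brl brr (f a) ('D_v g a) r.
rewrite mxE; apply/esym; apply: etrans (f_equal2 +%R e1 e2) _.
rewrite -big_split; apply: eq_bigr => l _; rewrite -big_split; apply: eq_bigr => j _.
exact: bilinear_alg.
Qed.

End Coordinates.

(** * The adjoint representation and the Leibniz identity *)

Section LieGroup.
Context {R : realType} (G : lieGroup R).
Local Notation d := (lg_dim G).
Local Notation V := 'cV[R]_d.
Local Notation c1 := (lg_chart1 G).
Local Notation phi := (coord c1).
Local Notation phiV := (par c1).
Local Notation mul := (@lg_mul R G).
Local Notation inv := (@lg_inv R G).
Local Notation e := (lg_one G).
Local Notation u0 := (phi e).
Local Notation adj := (@Ad R G).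
Local Notation br := (@lie_bracket R G).

Lemma lg_mulIV (x : G) : mul x (inv x) = e.
Proof.
rewrite -(lg_mul1 (mul x (inv x))) -(lg_mulV (inv x)) -lg_mulA; congr (mul _ _).
by rewrite (lg_mulA (inv x) x) lg_mulV lg_mul1.
Qed.

Lemma lg_mulr1 (x : G) : mul x e = x.
Proof. by rewrite -(lg_mulV x) lg_mulA lg_mulIV lg_mul1. Qed.

Lemma lg_invM (x y : G) : inv (mul x y) = mul (inv y) (inv x).
Proof.
have h : mul (mul x y) (mul (inv y) (inv x)) = e.
  by rewrite -lg_mulA (lg_mulA y) lg_mulIV lg_mul1 lg_mulIV.
by rewrite -[LHS]lg_mulr1 -h lg_mulA lg_mulV lg_mul1.
Qed.

Lemma lg_inv1 : inv e = e.
Proof. by rewrite -{2}(lg_mulV e) lg_mulr1. Qed.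

Section Charts.
Variable c : chart R d G.
Hypothesis ac : lg_atlas c.

Lemma chart_parK x : dom c x -> par c (coord c x) = x.
Proof. by have [_ _ h _ _] := lg_charts ac; exact: h. Qed.

Lemma chart_coordK u : (coord c @` dom c) u -> coord c (par c u) = u /\ dom c (par c u).
Proof. by move=> [x dx <-]; rewrite chart_parK. Qed.

Lemma chart_par_cont u : (coord c @` dom c) u -> {for u, continuous (par c)}.
Proof. by have [_ _ _ _ h] := lg_charts ac; exact: h. Qed.

Lemma chart_near_dom (V' : topologicalType) (f : V' -> G) a : {for a, continuous f} -> dom c (f a) ->
  \forall x \near a, dom c (f x).
Proof.
move=> cf da; have [od _ _ _ _] := lg_charts ac.
by apply: cf; exact: open_nbhs_nbhs.
Qed.

Lemma chart_near_image u : (coord c @` dom c) u -> \forall v \near u, (coord c @` dom c) v.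
Proof. by move=> iu; have [_ oi _ _ _] := lg_charts ac; exact: open_nbhs_nbhs. Qed.

End Charts.

Let a1 := lg_chart1_atlas G.
Let d1 := lg_chart1_one G.

Lemma image_u0 : (coord c1 @` dom c1) u0.
Proof. by exists e. Qed.
Let i1 := image_u0.

Lemma phiV_u0 : phiV u0 = e.
Proof. exact: chart_parK. Qed.

Lemma phiV_cont : {for u0, continuous phiV}.
Proof. exact: chart_par_cont. Qed.

Lemma mul_cont_at (V' : topologicalType) (f g : V' -> G) a : {for a, continuous f} -> {for a, continuous g} ->
  {for a, continuous (fun x => mul (f x) (g x))}.
Proof.
move=> cf cg; apply: (@continuous_comp _ _ _ (fun x => (f x, g x)) (fun z => mul z.1 z.2)).
  exact: cvg_pair.
exact: lg_mul_cont.
Qed.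

Lemma inv_cont_at (V' : topologicalType) (f : V' -> G) a : {for a, continuous f} -> {for a, continuous (fun x => inv (f x))}.
Proof. by move=> cf; apply: (continuous_comp cf); exact: lg_inv_cont. Qed.

Lemma cst_cont_at (V' : topologicalType) (g : G) (a : V') : {for a, continuous (fun _ : V' => g)}.
Proof. exact: cst_continuous. Qed.

Definition mulc (ca cb cc : chart R d G) (z : V * V) : V := coord cc (mul (par ca z.1) (par cb z.2)).

Lemma mulc_diff ca cb cc (z : V * V) : lg_atlas ca -> lg_atlas cb -> lg_atlas cc ->
  (coord ca @` dom ca) z.1 -> (coord cb @` dom cb) z.2 -> dom cc (mul (par ca z.1) (par cb z.2)) ->
  differentiable (mulc ca cb cc) z /\ forall w, differentiable ('D_w (mulc ca cb cc)) z.
Proof.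
move=> Aa Ab Ac h1 h2 h3; have [D H] := @lg_mul_smooth R G ca cb cc Aa Ab Ac 2%N.
by split; [exact: D|move=> w; have [D' _] := H w; exact: D'].
Qed.

Definition cj (g : G) (u : V) : V := phi (mul (mul g (phiV u)) (inv g)).

Lemma cj_u0 g : cj g u0 = u0.
Proof. by rewrite /cj phiV_u0 lg_mulr1 lg_mulIV. Qed.

Lemma cj_cont g : {for u0, continuous (fun u => mul (mul g (phiV u)) (inv g))}.
Proof.
apply: mul_cont_at; last exact: cst_cont_at.
by apply: mul_cont_at; [exact: cst_cont_at|exact: phiV_cont].
Qed.

Lemma cj_near g : \forall u \near u0, phiV (cj g u) = mul (mul g (phiV u)) (inv g).
Proof.
have h0 : dom c1 (mul (mul g (phiV u0)) (inv g)) by rewrite phiV_u0 lg_mulr1 lg_mulIV.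
have := @chart_near_dom _ a1 _ _ _ (@cj_cont g) h0.
by apply: filterS => u; exact: chart_parK.
Qed.

(** The product of [g] with a point near the identity lies near [g], possibly outside the chart at
    the identity. Conjugation is therefore factored through charts around [g] and [inv g], in which
    multiplication is smooth. *)
Lemma cj_diff g : differentiable (cj g) u0.
Proof.
have [cg ag dg] := lg_cover g; have [ci ai di] := lg_cover (inv g).
pose m1 u := mulc cg c1 cg (coord cg g, u).
have igg : (coord cg @` dom cg) (coord cg g) by exists g.
have iig : (coord ci @` dom ci) (coord ci (inv g)) by exists (inv g).
have dm1 : differentiable m1 u0.
  have h3 : dom cg (mul (par cg (coord cg g)) (phiV u0)) by rewrite chart_parK // phiV_u0 lg_mulr1.
  have [D _] := @mulc_diff cg c1 cg (coord cg g, u0) ag a1 ag igg i1 h3.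
  apply: (@differentiable_comp _ _ _ _ (fun u => (coord cg g, u)) (mulc cg c1 cg)); last exact: D.
  by apply: differentiable_pair; [exact: differentiable_cst|exact: ex_diff].
have em1 : m1 u0 = coord cg g by rewrite /m1 /mulc /= phiV_u0 chart_parK // lg_mulr1.
have dm2 : differentiable (fun u => mulc cg ci c1 (m1 u, coord ci (inv g))) u0.
  have h3 : dom c1 (mul (par cg (coord cg g)) (par ci (coord ci (inv g)))).
    by rewrite !chart_parK // lg_mulIV.
  have [D _] := @mulc_diff cg ci c1 (coord cg g, coord ci (inv g)) ag ai a1 igg iig h3.
  apply: (@differentiable_comp _ _ _ _ (fun u => (m1 u, coord ci (inv g))) (mulc cg ci c1)); last by rewrite em1.
  by apply: differentiable_pair => //; exact: differentiable_cst.
apply: near_differentiable dm2.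
have h0 : dom cg (mul g (phiV u0)) by rewrite phiV_u0 lg_mulr1.
have cm : {for u0, continuous (fun u => mul g (phiV u))}.
  by apply: mul_cont_at; [exact: cst_cont_at|exact: phiV_cont].
have := @chart_near_dom _ ag _ _ _ cm h0.
apply: filterS => u du.
by rewrite /cj /mulc /m1 /mulc /= !(chart_parK ag) // (chart_parK ai).
Qed.

Lemma Ad_linear g a v w : adj g (a *: v + w) = a *: adj g v + adj g w.
Proof. exact: derive_linear (cj_diff g). Qed.

Lemma Ad1 v : adj e v = v.
Proof.
rewrite -[RHS](derive_id u0 v); apply: near_eq_derive.
have := chart_near_image a1 i1; apply: filterS => u /(chart_coordK a1)[h _].
by rewrite lg_inv1 lg_mulr1 lg_mul1.
Qed.

Lemma Ad_mul g h v : adj (mul g h) v = adj g (Ad h v).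
Proof.
have dg : differentiable (cj g) (cj h u0) by rewrite cj_u0; exact: cj_diff.
transitivity ('D_v (fun u => cj g (cj h u)) u0); last first.
  by rewrite (derive_comp v (cj_diff h) dg) cj_u0.
apply: near_eq_derive; have := cj_near h; apply: filterS => u eu.
by rewrite /cj -/(cj h u) eu lg_invM !lg_mulA.
Qed.

Definition AdF (w u : V) : V := adj (phiV u) w.

(** In the chart, [u v u^-1] is [P (P (u, v), I u)]; its derivative in [v] along [w] is that of [P]
    along [(xi, 0)], with [xi] depending on [u]. Second derivatives of [P] are controlled along
    fixed directions, so [xi] is expanded in the standard basis, which yields the functions
    [Q i]. *)
Lemma AdF_near w : exists (xi : V -> V) (Q : 'I_d -> V -> V),
  [/\ differentiable xi u0, forall i, differentiable (Q i) u0 &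
      \forall u \near u0, AdF w u = \sum_i xi u i 0 *: Q i u].
Proof.
pose P := mulc c1 c1 c1; pose I u := phi (inv (phiV u)).
have dI : dom c1 (inv (phiV u0)) by rewrite phiV_u0 lg_inv1.
have I0 : I u0 = u0 by rewrite /I phiV_u0 lg_inv1.
have dIf : differentiable I u0.
  by have [D _] := @lg_inv_smooth R G c1 c1 a1 a1 1%N; apply: D.
have [P0 DP0] : differentiable P (u0, u0) /\ forall w, differentiable ('D_w P) (u0, u0).
  by apply: mulc_diff => //=; rewrite phiV_u0 lg_mul1.
exists (fun u => 'D_((0, w) : V * V) P (u, u0)).
exists (fun i u => 'D_((delta_mx i 0, 0) : V * V) P (u, I u)); split.
- apply: (@differentiable_comp _ _ _ _ (fun u => (u, u0)) ('D_((0, w) : V * V) P)); last exact: DP0.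
  by apply: differentiable_pair; [exact: ex_diff|exact: differentiable_cst].
- move=> i; apply: (@differentiable_comp _ _ _ _ (fun u => (u, I u)) ('D_((delta_mx i 0, 0) : V * V) P)); last by rewrite I0; exact: DP0.
  by apply: differentiable_pair; [exact: ex_diff|exact: dIf].
have n1 := chart_near_image a1 i1.
have n2 : \forall u \near u0, dom c1 (inv (phiV u)).
  have cI : {for u0, continuous (fun u => inv (phiV u))} by apply: inv_cont_at; exact: phiV_cont.
  exact: (@chart_near_dom _ a1 _ _ _ cI dI).
near=> u.
have iu : (coord c1 @` dom c1) u by near: u.
have diu : dom c1 (inv (phiV u)) by near: u.
have [uK du] := chart_coordK a1 iu.
have PuE : P (u, u0) = u by rewrite /P /mulc /= phiV_u0 lg_mulr1.
have dPu : differentiable P (u, u0).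
  by apply: (mulc_diff a1 a1 a1 _ _ _).1 => //=; rewrite phiV_u0 lg_mulr1.
have dPI : differentiable P (u, I u).
  apply: (mulc_diff a1 a1 a1 _ _ _).1 => //=; first by exists (inv (phiV u)).
  by rewrite (chart_parK a1 diu) lg_mulIV.
have dq : differentiable (fun v : V => P (u, v)) u0.
  apply: (@differentiable_comp _ _ _ _ (fun v : V => (u, v)) P); last exact: dPu.
  by apply: differentiable_pair; [exact: differentiable_cst|exact: ex_diff].
transitivity ('D_w (fun v => P (P (u, v), I u)) u0).
  apply: near_eq_derive; have h0 : dom c1 (mul (phiV u) (phiV u0)) by rewrite phiV_u0 lg_mulr1.
  have cm : {for u0, continuous (fun v => mul (phiV u) (phiV v))}.
    by apply: mul_cont_at; [exact: cst_cont_at|exact: phiV_cont].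
  have := @chart_near_dom _ a1 _ _ _ cm h0.
  apply: filterS => v dv; rewrite /P /mulc /=.
  by rewrite (chart_parK a1 dv) (chart_parK a1 diu).
pose q v := (P (u, v), I u).
have dqq : differentiable q u0 by apply: differentiable_pair => //; exact: differentiable_cst.
have eq0 : q u0 = (u, I u) by rewrite /q PuE.
rewrite (derive_comp (f := q) (g := P) w dqq); last by rewrite eq0.
pose xi := 'D_((0, w) : V * V) P (u, u0).
have dc (a b : V) : differentiable (fun _ : V => a) b by exact: differentiable_cst.
have did : differentiable (fun v : V => v) u0 by exact: ex_diff.
have dpr : differentiable (fun v : V => (u, v)) u0 by exact: differentiable_pair.
have exi : 'D_w (fun v => P (u, v)) u0 = xi.
  rewrite (derive_comp (f := fun v : V => (u, v)) (g := P) w dpr dPu).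
  by rewrite (derive_pair w (dc u u0) did) derive_cst derive_id.
have eDq : 'D_w q u0 = (xi, 0).
  by rewrite (derive_pair w dq (dc (I u) u0)) derive_cst exi.
rewrite eq0 eDq.
have -> : (xi, 0) = \sum_i xi i 0 *: ((delta_mx i 0, 0) : V * V) :> V * V.
  rewrite {1}(cV_basis xi); elim/big_ind2: _ => //.
    by move=> x1 x2 y1 y2 <- <-; congr (_, _); rewrite addr0.
  by move=> i _; congr (_, _); rewrite scaler0.
rewrite deriveE // linear_sum; apply: eq_bigr => i _.
by rewrite [X in _ = _ *: X](deriveE _ dPI); exact: linearZ.
Unshelve. all: by end_near. Qed.

Lemma AdF_diff w : differentiable (AdF w) u0.
Proof.
have [xi [Q [dxi dQ h]]] := AdF_near w.
apply: near_differentiable (differentiable_scale_sum dxi dQ).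
by apply: filterS h => u ->.
Qed.

Lemma lie_bracketE v w : lie_bracket v w = 'D_v (AdF w) u0.
Proof. by []. Qed.

Lemma lie_bracket_linearl a u v w : br (a *: u + v) w = a *: br u w + br v w.
Proof. exact: derive_linear (AdF_diff w). Qed.

Lemma lie_bracket_linearr a u v w : br u (a *: v + w) = a *: br u v + br u w.
Proof.
have dv := diff_derivable (v := u) (AdF_diff v); have dw := diff_derivable (v := u) (AdF_diff w).
transitivity ('D_u (a *: AdF v + AdF w) u0).
  by congr ('D_u _ u0); apply/funext => x; exact: Ad_linear.
by rewrite (deriveD (derivableZ (k := a) dv) dw) (deriveZ a dv).
Qed.

(** [Ad (g u g^-1) (Ad g w) = Ad g (Ad u w)], differentiated in [u] at the identity along [v]. *)
Lemma lie_bracket_Ad g v w : br (adj g v) (adj g w) = adj g (br v w).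
Proof.
have dF : differentiable (AdF (adj g w)) (cj g u0) by rewrite cj_u0; exact: AdF_diff.
transitivity ('D_v (fun u => AdF (adj g w) (cj g u)) u0).
  by rewrite (derive_comp v (cj_diff g) dF) cj_u0.
transitivity ('D_v (fun u => 'd (cj g) u0 (AdF w u)) u0).
  apply: near_eq_derive; have := cj_near g; apply: filterS => u eu.
  rewrite /AdF eu -Ad_mul -(deriveE _ (cj_diff g)) -/(adj g _) -Ad_mul; congr (Ad _ w).
  by rewrite -lg_mulA lg_mulV lg_mulr1.
have dc : continuous ('d (cj g) u0) by apply: diff_continuous; exact: cj_diff.
have dl x : differentiable ('d (cj g) u0) x by exact: linear_differentiable.
rewrite (derive_comp (f := AdF w) (g := 'd (cj g) u0) v (AdF_diff w) (dl _)).
by rewrite deriveE // diff_lin // -(deriveE _ (cj_diff g)).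
Qed.

(** The identity [lie_bracket_Ad], differentiated in [g] at the identity by the product rule for the
    bilinear bracket. *)
Lemma lie_bracket_derivation (x v w : V) : br x (br v w) = br (br x v) w + br v (br x w).
Proof.
have A0 y : AdF y u0 = y by rewrite /AdF phiV_u0 Ad1.
have := derive_bilinear x lie_bracket_linearl lie_bracket_linearr (AdF_diff v) (AdF_diff w).
rewrite !A0 => <-; congr ('D_x _ u0); apply/funext => u.
by rewrite /AdF lie_bracket_Ad.
Qed.

Lemma lie_bracket_leibniz (x v w : V) : br (br x v) w = br x (br v w) - br v (br x w).
Proof. by rewrite lie_bracket_derivation addrK. Qed.

End LieGroup.

(** * The multiplicative group of the quaternions *)

Section CkCalculus.
Context {R : realType} (V : normedModType R) (O : set V).
Hypothesis oO : open O.

Lemma open_near x : O x -> \forall y \near x, O y.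
Proof. by move=> Ox; exact: open_nbhs_nbhs. Qed.

(** On an open set equality of functions is equality near each point, so derivatives agree. Closure
    of [Ck] under an operation is proved by replacing the derivative with its formula through this
    lemma. *)
Lemma eq_Ck k (W : normedModType R) (f g : V -> W) : (forall x, O x -> f x = g x) -> Ck k O f -> Ck k O g.
Proof.
have near_eq (f' g' : V -> W) x : (forall x, O x -> f' x = g' x) -> O x -> \forall y \near x, f' y = g' y.
  by move=> h /open_near; apply: filterS => y; exact: h.
elim: k f g => [|k IH] f g fg /=.
  move=> h x Ox; rewrite /prop_for /continuous_at -fg //; apply: cvg_trans (h x Ox).
  by apply: near_eq_cvg; exact: near_eq.
move=> [df Df]; split=> [x Ox|v].
  exact: near_differentiable (near_eq f g x fg Ox) (df x Ox).
apply: IH (Df v) => x Ox; apply: near_eq_derive; exact: near_eq.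
Qed.

Lemma CkS k (W : normedModType R) (f : V -> W) : Ck k.+1 O f -> Ck k O f.
Proof.
elim: k f => [|k IH] f [df Df].
  by move=> x Ox; exact: differentiable_continuous (df x Ox).
by split => // v; apply: IH; exact: Df.
Qed.

Lemma Ck_cst k (W : normedModType R) (a : W) : Ck k O (fun=> a).
Proof.
elim: k a => [|k IH] a; first by move=> x Ox; exact: cst_continuous.
split=> [x Ox|v]; first exact: differentiable_cst.
by apply: eq_Ck (IH 0) => x Ox; rewrite derive_cst.
Qed.

Lemma CkD k (W : normedModType R) (f g : V -> W) : Ck k O f -> Ck k O g -> Ck k O (fun x => f x + g x).
Proof.
elim: k f g => [|k IH] f g; first by move=> hf hg x Ox; apply: cvgD; [exact: hf|exact: hg].
move=> [df Df] [dg Dg]; split=> [x Ox|v].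
  by apply: (@differentiableD _ _ _ f g); [exact: df|exact: dg].
apply: eq_Ck (IH _ _ (Df v) (Dg v)) => x Ox.
by rewrite (@deriveD _ _ _ f g) //; apply: diff_derivable; [exact: df|exact: dg].
Qed.

Lemma Ck_sum k (W : normedModType R) n (f : 'I_n -> V -> W) : (forall i, Ck k O (f i)) -> Ck k O (fun x => \sum_i f i x).
Proof.
move=> h; suff: forall r : seq 'I_n, Ck k O (fun x => \sum_(i <- r) f i x) by apply.
elim=> [|i r IH]; first by apply: eq_Ck (Ck_cst k 0) => x _; rewrite big_nil.
by apply: eq_Ck (CkD (h i) IH) => x _; rewrite big_cons.
Qed.

Lemma CkM k (f g : V -> R^o) : Ck k O f -> Ck k O g -> Ck k O (fun x => f x * g x : R^o).
Proof.
elim: k f g => [|k IH] f g; first by move=> hf hg x Ox; apply: cvgM; [exact: hf|exact: hg].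
move=> hf hg; have hf' := CkS hf; have hg' := CkS hg; case: hf hg => df Df [dg Dg]; split=> [x Ox|v].
  by apply: (@differentiableM _ _ f g); [exact: df|exact: dg].
apply: eq_Ck (CkD (IH _ _ hf' (Dg v)) (IH _ _ hg' (Df v))) => x Ox.
by rewrite (@deriveM _ _ f g) //; apply: diff_derivable; [exact: df|exact: dg].
Qed.

Lemma CkV k (f : V -> R^o) : (forall x, O x -> f x != 0) -> Ck k O f -> Ck k O (fun x => (f x)^-1 : R^o).
Proof.
move=> f0; elim: k => [|k IH]; first by move=> hf x Ox; apply: cvgV; [exact: f0|exact: hf].
move=> hf; have hf' := CkS hf; case: hf => df Df; split=> [x Ox|v].
  by apply: (@differentiableV _ _ f); [exact: df|exact: f0].
apply: eq_Ck (CkM (Ck_cst k (-1 : R^o)) (CkM (CkM (IH hf') (IH hf')) (Df v))) => x Ox.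
rewrite (@deriveV _ _ f); [|exact: f0|by apply: diff_derivable; exact: df].
by rewrite /GRing.scale /= mulN1r mulNr -invfM -expr2.
Qed.

Lemma Ck_linear k (W : normedModType R) (f : V -> W) : (forall a u v, f (a *: u + v) = a *: f u + f v) ->
  continuous f -> Ck k O f.
Proof.
move=> lf cf; pose fM := GRing.isLinear.Build _ _ _ _ f lf; pose L : {linear V -> W} := HB.pack f fM.
have dL x : differentiable L x by exact: linear_differentiable.
case: k => [|k]; first by move=> x Ox; exact: cf.
split=> [x Ox|v]; first exact: dL.
apply: eq_Ck (Ck_cst k (f v)) => x Ox.
by rewrite (@deriveE _ _ _ L) // (@diff_lin _ _ _ L).
Qed.

Lemma CkZl k (W : normedModType R) (g : V -> R^o) (w : W) : Ck k O g -> Ck k O (fun x => (g x : R) *: w).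
Proof.
elim: k g => [|k IH] g hg; first by move=> x Ox; apply: cvgZr_tmp; exact: hg.
case: hg => dg Dg; split=> [x Ox|v]; first by apply: differentiableZl; exact: dg.
apply: eq_Ck (IH _ (Dg v)) => x Ox.
rewrite [RHS]deriveE; last by apply: differentiableZl; exact: dg.
by rewrite diffZl ?deriveE //; exact: dg.
Qed.

Lemma Ck_cV k d (f : V -> 'cV[R]_d) : (forall j, Ck k O (fun x => f x j 0 : R^o)) -> Ck k O f.
Proof.
move=> h; have ck j := CkZl (delta_mx j 0 : 'cV[R]_d) (h j).
by apply: eq_Ck (Ck_sum ck) => x _; rewrite {2}(cV_basis (f x)).
Qed.

End CkCalculus.

(** * Quaternion algebra *)

Section Quaternions.
Context {R : realType}.
Local Notation H := 'cV[R]_4.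

Definition i0 : 'I_4 := Ordinal (isT : 0 < 4)%N.
Definition i1 : 'I_4 := Ordinal (isT : 1 < 4)%N.
Definition i2 : 'I_4 := Ordinal (isT : 2 < 4)%N.
Definition i3 : 'I_4 := Ordinal (isT : 3 < 4)%N.

Lemma ord4P (P : 'I_4 -> Prop) : P i0 -> P i1 -> P i2 -> P i3 -> forall i, P i.
Proof.
move=> h0 h1 h2 h3 [[|[|[|[|m]]]] hm] //.
- by rewrite (_ : Ordinal hm = i0) //; exact: val_inj.
- by rewrite (_ : Ordinal hm = i1) //; exact: val_inj.
- by rewrite (_ : Ordinal hm = i2) //; exact: val_inj.
- by rewrite (_ : Ordinal hm = i3) //; exact: val_inj.
Qed.

Lemma qext (x y : H) : x i0 0 = y i0 0 -> x i1 0 = y i1 0 -> x i2 0 = y i2 0 -> x i3 0 = y i3 0 -> x = y.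
Proof. by move=> h0 h1 h2 h3; apply/matrixP => i j; rewrite ord1; move: i; apply: ord4P. Qed.

Lemma sum4 (f : 'I_4 -> R) : \sum_i f i = f i0 + f i1 + f i2 + f i3.
Proof.
by rewrite !big_ord_recl big_ord0 addr0 !addrA; congr (f _ + f _ + f _ + f _); exact: val_inj.
Qed.

Definition quat (a b c d : R) : H := \col_i nth 0 [:: a; b; c; d] i.

Definition qmul (x y : H) : H := quat
  (x i0 0 * y i0 0 - x i1 0 * y i1 0 - x i2 0 * y i2 0 - x i3 0 * y i3 0)
  (x i0 0 * y i1 0 + x i1 0 * y i0 0 + x i2 0 * y i3 0 - x i3 0 * y i2 0)
  (x i0 0 * y i2 0 - x i1 0 * y i3 0 + x i2 0 * y i0 0 + x i3 0 * y i1 0)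
  (x i0 0 * y i3 0 + x i1 0 * y i2 0 - x i2 0 * y i1 0 + x i3 0 * y i0 0).
Definition qconj (x : H) : H := quat (x i0 0) (- x i1 0) (- x i2 0) (- x i3 0).
Definition qip (x y : H) : R := \sum_i x i 0 * y i 0.
Definition qnorm (x : H) : R := qip x x.
Definition qone : H := quat 1 0 0 0.
Definition qinv (x : H) : H := (qnorm x)^-1 *: qconj x.

Lemma quatE a b c d : (quat a b c d i0 0 = a) * (quat a b c d i1 0 = b) * (quat a b c d i2 0 = c) * (quat a b c d i3 0 = d).
Proof. by rewrite !mxE. Qed.

Lemma qmulA x y z : qmul x (qmul y z) = qmul (qmul x y) z.
Proof. by apply: qext; rewrite !quatE; ring. Qed.

Lemma qmul1 x : qmul qone x = x.
Proof. by apply: qext; rewrite !quatE; ring. Qed.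

Lemma qmulr1 x : qmul x qone = x.
Proof. by apply: qext; rewrite !quatE; ring. Qed.

Lemma qnorm_gt0 x : x != 0 -> 0 < qnorm x.
Proof.
move=> x0; rewrite lt0r; apply/andP; split; last by apply: sumr_ge0 => i _; rewrite -expr2 sqr_ge0.
apply: contraNneq x0 => /eqP; rewrite psumr_eq0; last by move=> i _; rewrite -expr2 sqr_ge0.
move=> /allP h; apply/eqP/matrixP => i j; rewrite ord1 mxE.
by have := h i (mem_index_enum i); rewrite mulf_eq0 orbb => /eqP.
Qed.

Lemma qmulVx x : x != 0 -> qmul (qinv x) x = qone.
Proof.
move=> x0; have n0 := lt0r_neq0 (qnorm_gt0 x0).
have e : qmul (qinv x) x = (qnorm x)^-1 *: qmul (qconj x) x.
  by apply: qext; rewrite !quatE !mxE /=; ring.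
rewrite e; have -> : qmul (qconj x) x = qnorm x *: qone.
  by apply: qext; rewrite !quatE !mxE /qnorm /qip sum4 /=; ring.
by rewrite scalerA mulVf // scale1r.
Qed.

Lemma qnormM x y : qnorm (qmul x y) = qnorm x * qnorm y.
Proof. by rewrite /qnorm /qip !sum4 !quatE; ring. Qed.

Lemma qnorm0 : qnorm 0 = 0.
Proof. by rewrite /qnorm /qip sum4 !mxE; ring. Qed.

Lemma qmul_neq0 x y : x != 0 -> y != 0 -> qmul x y != 0.
Proof.
move=> x0 y0; apply/eqP => h; have := mulr_gt0 (qnorm_gt0 x0) (qnorm_gt0 y0).
by rewrite -qnormM h qnorm0 ltxx.
Qed.

Lemma qinv_neq0 x : x != 0 -> qinv x != 0.
Proof.
move=> x0; rewrite scaler_eq0 negb_or invr_eq0 lt0r_neq0 ?qnorm_gt0 //=.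
apply: contraNneq x0 => /matrixP h; apply/eqP/qext; rewrite !mxE.
- by have := h i0 0; rewrite !mxE.
- by have /eqP := h i1 0; rewrite !mxE oppr_eq0 => /eqP.
- by have /eqP := h i2 0; rewrite !mxE oppr_eq0 => /eqP.
- by have /eqP := h i3 0; rewrite !mxE oppr_eq0 => /eqP.
Qed.

Lemma qone_neq0 : qone != 0.
Proof. by apply/eqP => /matrixP/(_ i0 0); rewrite !mxE /= => /eqP; rewrite oner_eq0. Qed.

Lemma qip_mull g v w : qip (qmul g v) (qmul g w) = qnorm g * qip v w.
Proof. by rewrite /qnorm /qip !sum4 !quatE; ring. Qed.
Lemma qip_mulr g v w : qip (qmul v g) (qmul w g) = qnorm g * qip v w.
Proof. by rewrite /qnorm /qip !sum4 !quatE; ring. Qed.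

Lemma qmul_linearl a u v w : qmul (a *: u + v) w = a *: qmul u w + qmul v w.
Proof. by apply: qext; rewrite !quatE !mxE /=; ring. Qed.
Lemma qmul_linearr a w u v : qmul w (a *: u + v) = a *: qmul w u + qmul w v.
Proof. by apply: qext; rewrite !quatE !mxE /=; ring. Qed.

End Quaternions.

(** * The Lie group of nonzero quaternions *)

Section QuaternionGroup.
Context {R : realType}.
Local Notation H := 'cV[R]_4.

(** The nonzero quaternions form an open subset of [R^4], so a single chart covers the group. It is
    connected and not commutative, and the Euclidean inner product is [Ad]-invariant because the
    norm is multiplicative. *)
Definition qgroup : topologicalType := initial_topology (val : {x : H | x != 0} -> H).
Definition qval (x : qgroup) : H := val (x : {x : H | x != 0}).
Definition qpar (x : H) : qgroup := insubd (exist _ qone (@qone_neq0 R) : {x : H | x != 0}) x.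

Lemma qval_neq0 (x : qgroup) : qval x != 0.
Proof. exact: (valP (x : {x : H | x != 0})). Qed.

Lemma qval_inj (x y : qgroup) : qval x = qval y -> x = y.
Proof. exact: val_inj. Qed.

Lemma qparK (x : H) : x != 0 -> qval (qpar x) = x.
Proof. by move=> x0; rewrite /qval /qpar val_insubd x0. Qed.

Lemma qvalK (x : qgroup) : qpar (qval x) = x.
Proof. by apply: qval_inj; rewrite qparK // qval_neq0. Qed.

Lemma qval_continuous : continuous qval.
Proof. exact: initial_continuous. Qed.

Lemma qgroup_continuous (T : topologicalType) (f : T -> qgroup) a :
  {for a, continuous (fun x => qval (f x))} -> {for a, continuous f}.
Proof.
move=> cf A [_ [[C oC <-] Ca CA]].
have nC : nbhs (qval (f a)) C by exact: open_nbhs_nbhs.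
have := cf _ nC; rewrite /nbhs /=; apply: filterS => x; exact: CA.
Qed.

Lemma open_neq0 : open [set x : H | x != 0].
Proof.
have c0 : closed [set (0 : H)] by apply: accessible_closed_set1; apply: hausdorff_accessible; exact: norm_hausdorff.
rewrite (_ : [set x | _] = ~` [set (0 : H)]); first exact: closed_openC.
by apply/seteqP; split => x /= /eqP.
Qed.

Lemma qpar_continuous (x : H) : x != 0 -> {for x, continuous qpar}.
Proof.
move=> x0; apply: qgroup_continuous.
have near0 : \forall y \near x, y = qval (qpar y).
  by have := open_nbhs_nbhs (conj open_neq0 x0); apply: filterS => y y0; rewrite qparK.
rewrite /prop_for /continuous_at qparK //; exact: cvg_trans (near_eq_cvg near0) _.
Qed.

Definition qgmul (x y : qgroup) : qgroup := qpar (qmul (qval x) (qval y)).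
Definition qginv (x : qgroup) : qgroup := qpar (qinv (qval x)).
Definition qgone : qgroup := qpar qone.

Lemma qval_mul x y : qval (qgmul x y) = qmul (qval x) (qval y).
Proof. by rewrite qparK // qmul_neq0 // qval_neq0. Qed.
Lemma qval_inv x : qval (qginv x) = qinv (qval x).
Proof. by rewrite qparK // qinv_neq0 // qval_neq0. Qed.
Lemma qval_one : qval qgone = qone.
Proof. by rewrite qparK // qone_neq0. Qed.

Lemma qgmulA x y z : qgmul x (qgmul y z) = qgmul (qgmul x y) z.
Proof. by apply: qval_inj; rewrite !qval_mul qmulA. Qed.
Lemma qgmul1 x : qgmul qgone x = x.
Proof. by apply: qval_inj; rewrite qval_mul qval_one qmul1. Qed.
Lemma qgmulV x : qgmul (qginv x) x = qgone.
Proof. by apply: qval_inj; rewrite qval_mul qval_inv qval_one qmulVx // qval_neq0. Qed.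

Lemma qgroup_hausdorff : hausdorff_space qgroup.
Proof.
have := @norm_hausdorff R H; rewrite !open_hausdorff => h x y xy.
have xy' : qval x != qval y by apply: contraNneq xy => /qval_inj ->.
have [[A B] /= [xA yB] [oA oB AB]] := h _ _ xy'.
exists (qval @^-1` A, qval @^-1` B) => /=; first by move: xA yB; rewrite !inE.
split; [by apply: open_comp => // z _; exact: qval_continuous|by apply: open_comp => // z _; exact: qval_continuous|].
by rewrite -preimage_setI (eqP AB) preimage_set0.
Qed.

Definition qchart : chart R 4 qgroup := Chart setT qval qpar.

Lemma qchart_image : coord qchart @` dom qchart = [set x : H | x != 0].
Proof.
apply/seteqP; split => [_ [x _ <-]|x x0] /=; first exact: qval_neq0.
by exists (qpar x) => //=; rewrite qparK.
Qed.

Lemma qchart_is_chart : is_chart qchart.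
Proof.
split; rewrite ?qchart_image.
- exact: openT.
- exact: open_neq0.
- by move=> x _; exact: qvalK.
- by move=> x _; exact: qval_continuous.
- by move=> x x0; exact: qpar_continuous.
Qed.

Lemma Ck_coord (V : normedModType R) (O : set V) k m (f : V -> 'cV[R]_m) i : open O ->
  (forall a u v, f (a *: u + v) = a *: f u + f v) -> continuous f -> Ck k O (fun x => f x i 0 : R^o).
Proof.
move=> oO lf cf; apply: (Ck_linear oO); first by move=> a u v; rewrite lf !mxE.
move=> x; apply: (@continuous_comp _ _ _ f (fun M : 'cV[R]_m => M i 0 : R^o)); first exact: cf.
exact: coord_continuous.
Qed.

Lemma Ck_qmul (O : set (H * H)) k : open O -> Ck k O (fun z => qmul z.1 z.2).
Proof.
move=> oO; apply: (Ck_cV oO) => j.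
have c1 i : Ck k O (fun z => z.1 i 0 : R^o).
  by apply: (@Ck_coord _ _ _ _ (fun z : H * H => z.1)) => // z; exact: cvg_fst.
have c2 i : Ck k O (fun z => z.2 i 0 : R^o).
  by apply: (@Ck_coord _ _ _ _ (fun z : H * H => z.2)) => // z; exact: cvg_snd.
have c l i := CkM oO (CkM oO (c1 l) (c2 i)) (Ck_cst oO k (sconst qmul l i j : R^o)).
apply: (eq_Ck oO) (Ck_sum oO (fun l => Ck_sum oO (c l))) => z _.
by rewrite [RHS](brE (@qmul_linearl R) (@qmul_linearr R)).
Qed.

Lemma Ck_qinv k : Ck k [set x : H | x != 0] (@qinv R).
Proof.
have oO := open_neq0; apply: (Ck_cV oO) => j.
have c i : Ck k [set x : H | x != 0] (fun x => x i 0 : R^o).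
  by apply: (@Ck_coord _ _ _ _ (fun x : H => x)) => // z; exact: cvg_id.
have cn : Ck k [set x : H | x != 0] (fun x => qnorm x : R^o).
  exact: (Ck_sum oO (fun i => CkM oO (c i) (c i))).
have cv := CkV oO (fun x x0 => lt0r_neq0 (qnorm_gt0 x0)) cn.
have cc (s : R) := CkM oO cv (CkM oO (Ck_cst oO k (s : R^o)) (c j)).
by move: j {c} cc; apply: ord4P => cc; [apply: (eq_Ck oO) (cc 1)|apply: (eq_Ck oO) (cc (-1))
   |apply: (eq_Ck oO) (cc (-1))|apply: (eq_Ck oO) (cc (-1))] => x _; rewrite !mxE /= ?mul1r ?mulN1r.
Qed.

Lemma qgmul_continuous : continuous (fun z : qgroup * qgroup => qgmul z.1 z.2).
Proof.
move=> z; apply: qgroup_continuous.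
rewrite (_ : (fun x => _) = (fun w : H * H => qmul w.1 w.2) \o (fun x : qgroup * qgroup => (qval x.1, qval x.2))); last first.
  by apply/funext => x; rewrite qval_mul.
apply: continuous_comp; last exact: (@Ck_qmul setT 0%N openT).
have c1 : {for z, continuous (fun x : qgroup * qgroup => qval x.1)}.
  by apply: continuous_comp; [exact: cvg_fst|exact: qval_continuous].
have c2 : {for z, continuous (fun x : qgroup * qgroup => qval x.2)}.
  by apply: continuous_comp; [exact: cvg_snd|exact: qval_continuous].
exact: (cvg_pair c1 c2).
Qed.

Lemma qginv_continuous : continuous qginv.
Proof.
move=> x; apply: qgroup_continuous.
rewrite (_ : (fun x => _) = (@qinv R) \o qval); last by apply/funext => y; rewrite /= qval_inv.
apply: continuous_comp; first exact: qval_continuous.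
by have := @Ck_qinv 0%N; apply; exact: qval_neq0.
Qed.

Lemma qcompat c c' : [set qchart] c -> [set qchart] c' ->
  smooth_on (coord c @` (dom c `&` dom c')) (coord c' \o par c).
Proof.
move=> -> -> k; rewrite /= setTI -[_ @` _]/(coord qchart @` dom qchart) qchart_image.
apply: (eq_Ck open_neq0) (_ : Ck k _ (fun x : H => x)); first by move=> x x0; rewrite /= qparK.
apply: (Ck_linear open_neq0) => // x; exact: cvg_id.
Qed.

Lemma qgmul_smooth c1 c2 c3 : [set qchart] c1 -> [set qchart] c2 -> [set qchart] c3 ->
  smooth_on [set z : H * H | [/\ (coord c1 @` dom c1) z.1, (coord c2 @` dom c2) z.2 &
      dom c3 (qgmul (par c1 z.1) (par c2 z.2))]]
    (fun z => coord c3 (qgmul (par c1 z.1) (par c2 z.2))).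
Proof.
move=> -> -> -> k; rewrite qchart_image.
have -> : [set z : H * H | [/\ [set x : H | x != 0] z.1, [set x : H | x != 0] z.2 &
    dom qchart (qgmul (par qchart z.1) (par qchart z.2))]] =
   (fst @^-1` [set x : H | x != 0]) `&` (snd @^-1` [set x : H | x != 0]).
  by apply/seteqP; split => z /= [].
have oO : open ((@fst H H @^-1` [set x : H | x != 0]) `&` (@snd H H @^-1` [set x : H | x != 0])).
  apply: openI; apply: open_comp open_neq0 => z _; [exact: cvg_fst|exact: cvg_snd].
apply: (eq_Ck oO) (Ck_qmul k oO) => z [z1 z2].
by rewrite /= qval_mul !qparK.
Qed.

Lemma qginv_smooth c c' : [set qchart] c -> [set qchart] c' ->
  smooth_on [set u | (coord c @` dom c) u /\ dom c' (qginv (par c u))]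
    (fun u => coord c' (qginv (par c u))).
Proof.
move=> -> -> k; rewrite qchart_image.
have -> : [set u : H | [set x : H | x != 0] u /\ dom qchart (qginv (par qchart u))] = [set x : H | x != 0].
  by apply/seteqP; split => z /=; [case|split].
by apply: (eq_Ck open_neq0) (Ck_qinv k) => x x0; rewrite /= qval_inv qparK.
Qed.

Lemma qcharts c : [set qchart] c -> is_chart c.
Proof. by move=> ->; exact: qchart_is_chart. Qed.
Lemma qcover (x : qgroup) : exists2 c, [set qchart] c & dom c x.
Proof. by exists qchart. Qed.

Definition quaternions : lieGroup R := @LieGroup R qgroup 4 qgmul qginv qgone qgmulA qgmul1 qgmulV
  qgroup_hausdorff [set qchart] qcharts qcover qcompat qgmul_continuous qginv_continuous
  qgmul_smooth qginv_smooth qchart erefl I.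

Lemma segment_connected_quat (a b : H) : (forall t : R, 0 <= t <= 1 -> (1 - t) *: a + t *: b != 0) ->
  connected [set qpar ((1 - t) *: a + t *: b) | t in `[(0 : R), 1]].
Proof.
move=> h; apply: connected_continuous_connected; first exact: segment_connected.
apply: continuous_in_subspaceT => t; rewrite inE /= in_itv /= => t01.
apply: (@continuous_comp _ _ _ (fun t : R => (1 - t) *: a + t *: b) qpar); last exact: qpar_continuous (h t t01).
have d : differentiable (fun t : R => (1 - t) *: a + t *: b) t.
  by apply: differentiableD; apply: differentiableZl.
exact: differentiable_continuous.
Qed.

(** A quaternion that is not real is joined to 1 by a segment avoiding 0; a real one is reached from
    1 through the imaginary unit [j]. *)
Lemma quaternions_connected : connected [set: quaternions].
Proof.
pose j : H := quat 0 1 0 0.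
pose seg (a b : H) := [set qpar ((1 - t) *: a + t *: b) | t in `[(0 : R), 1]].
have seg0 a b : seg a b (qpar a) by exists 0 => /=; rewrite ?in_itv /= ?lexx ?ler01 // subr0 scale1r scale0r addr0.
have seg1 a b : seg a b (qpar b) by exists 1 => /=; rewrite ?in_itv /= ?lexx ?ler01 // subrr scale1r scale0r add0r.
have s1j : connected (seg qone j).
  apply: segment_connected_quat => t t01; apply/eqP => /matrixP e.
  have := e i0 0; have := e i1 0; rewrite !mxE /=; lra.
have ex (x : qgroup) : exists A : set qgroup, [/\ connected A, A qgone & A x].
  have [e|ne] := boolP [forall i : 'I_4, (i == i0) || (qval x i 0 == 0)].
    have z i : i != i0 -> qval x i 0 = 0.
      by move=> ii; have /forallP/(_ i) := e; rewrite (negPf ii) /= => /eqP.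
    have x0 : qval x i0 0 != 0.
      apply: contraNneq (qval_neq0 x) => h; apply/eqP/qext; rewrite ?h ?z //; by rewrite mxE.
    exists (seg qone j `|` seg j (qval x)); split.
    - apply: connectedU => //; first by exists (qpar j); split; [exact: seg1|exact: seg0].
      apply: segment_connected_quat => t t01; apply/eqP => /matrixP h.
      have := h i0 0; have := h i1 0; rewrite !mxE /= (z i1) // => h1 h0.
      have t1 : t = 1 by move: h1; lra.
      by move: h0; rewrite t1 mulr0 add0r mul1r => /eqP; rewrite (negPf x0).
    - by left; exact: seg0.
    - by right; have := seg1 j (qval x); rewrite qvalK.
  exists (seg qone (qval x)); split; last 2 first.
  - exact: seg0.
  - by have := seg1 qone (qval x); rewrite qvalK.
  apply: segment_connected_quat => t t01; apply/eqP => /matrixP h.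
  move: ne; rewrite negb_forall => /existsP; case=> i; rewrite negb_or => /andP[ii xi].
  have q1 : qone i 0 = 0 :> R by move: i ii {xi}; apply: ord4P; rewrite ?eqxx // => _; rewrite !mxE.
  have := h i 0; rewrite [LHS]mxE [X in X + _]mxE [X in _ + X]mxE q1 mulr0 add0r mxE => /eqP.
  rewrite mulf_eq0 (negPf xi) orbF => /eqP t0.
  by have := h i0 0; rewrite t0 subr0 scale1r scale0r addr0 !mxE /= => /eqP; rewrite oner_eq0.
rewrite (_ : [set: quaternions] = \bigcup_(x in [set: qgroup]) (projT1 (cid (ex x)))).
  apply: bigcup_connected; first by exists qgone => x _; case: (projT2 (cid (ex x))).
  by move=> x _; case: (projT2 (cid (ex x))).
apply/seteqP; split => // x _; exists x => //; by case: (projT2 (cid (ex x))).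
Qed.

End QuaternionGroup.

(** * The adjoint action and the bracket of the quaternions *)

Section QuaternionBracket.
Context {R : realType}.
Local Notation H := 'cV[R]_4.
Local Notation G := (@quaternions R).

Lemma derive_lin (V W : normedModType R) (f : V -> W) a v : (forall a u v, f (a *: u + v) = a *: f u + f v) ->
  continuous f -> 'D_v f a = f v.
Proof.
move=> lf cf; pose fM := GRing.isLinear.Build _ _ _ _ f lf; pose L : {linear V -> W} := HB.pack f fM.
have dL x : differentiable L x by exact: linear_differentiable.
by rewrite (@deriveE _ _ _ L) // (@diff_lin _ _ _ L).
Qed.

Lemma near_qone : \forall u \near (@qone R), u != 0.
Proof. by have := open_nbhs_nbhs (conj (@open_neq0 R) (@qone_neq0 R)). Qed.

Lemma quat_phi1 : Defs.coord (lg_chart1 G) (lg_one G) = qone.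
Proof. exact: qval_one. Qed.

Lemma qmul_sandwich_continuous (a b : H) : continuous (fun u => qmul (qmul a u) b).
Proof.
have cm (T : topologicalType) (f g : T -> H) : continuous f -> continuous g -> continuous (fun x => qmul (f x) (g x)).
  move=> cf cg x; apply: (@continuous_comp _ _ _ (fun x => (f x, g x)) (fun z => qmul z.1 z.2)).
    exact: (cvg_pair (cf x) (cg x)).
  exact: (@Ck_qmul R setT 0%N openT).
apply: (cm _ (fun u => qmul a u) (fun=> b)); last exact: cst_continuous.
by apply: (cm _ (fun=> a) id) => x; [exact: cst_continuous|exact: cvg_id].
Qed.

Lemma quat_Ad (g : G) (v : H) : @Ad R G g v = qmul (qmul (qval g) v) (qinv (qval g)).
Proof.
rewrite /Ad quat_phi1.
transitivity ('D_v (fun u => qmul (qmul (qval g) u) (qinv (qval g))) (@qone R)).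
  apply: near_eq_derive; apply: filterS near_qone => u u0.
  by rewrite /= !qval_mul qval_inv qparK.
apply: (@derive_lin _ _ (fun u => qmul (qmul (qval g) u) (qinv (qval g)))); last exact: qmul_sandwich_continuous.
by move=> a u w; rewrite qmul_linearr qmul_linearl.
Qed.

(** The identity [Ad u w * u = u * w], differentiated at [u = 1] along [v] by the product rule,
    reads [[v, w] + w v = v w]. *)
Lemma quat_bracket (v w : H) : @lie_bracket R G v w = qmul v w - qmul w v.
Proof.
have dF : differentiable (@AdF R G w) (@qone R) by have := @AdF_diff R G w; rewrite quat_phi1.
have did : differentiable (fun u : H => u) (@qone R) by exact: ex_diff.
have dc : differentiable (fun _ : H => w) (@qone R) by exact: differentiable_cst.
have F0 : @AdF R G w (@qone R) = w by rewrite -quat_phi1 /AdF phiV_u0 Ad1.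
have e1 := derive_bilinear v (@qmul_linearl R) (@qmul_linearr R) dF did.
have e2 := derive_bilinear v (@qmul_linearl R) (@qmul_linearr R) did dc.
have e : 'D_v (fun u => qmul (@AdF R G w u) u) (@qone R) = 'D_v (fun u => qmul u w) (@qone R).
  apply: near_eq_derive; apply: filterS near_qone => u u0.
  by rewrite /AdF quat_Ad /= qparK // -qmulA qmulVx // qmulr1.
move: e; rewrite e1 e2 F0 derive_id derive_cst qmulr1.
have -> : qmul (@qone R) 0 = 0 by rewrite qmul1.
rewrite addr0 => <-.
by rewrite addrK lie_bracketE quat_phi1.
Qed.

Lemma quat_inner_product : @inner_product R G (@qip R).
Proof.
split.
- by move=> v w; apply: eq_bigr => i _; rewrite mulrC.
- move=> a u v w; rewrite /qip mulr_sumr -big_split; apply: eq_bigr => i _.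
  by rewrite !mxE /=; ring.
- exact: qnorm_gt0.
Qed.

(** Left and right multiplication scale [qip] by the squared norms of [g] and of its inverse, whose
    product is 1. *)
Lemma quat_Ad_invariant : @Ad_invariant R G (@qip R).
Proof.
move=> g v w; rewrite !quat_Ad qip_mulr qip_mull mulrA -qnormM qmulVx ?qval_neq0 //.
by rewrite {1}/qnorm /qip sum4 !quatE; ring.
Qed.

End QuaternionBracket.

(** * Fields for which the orders are attained *)

Section Example.
Context {R : realType}.
Local Notation G := (@quaternions R).
Local Notation br := (@lie_bracket R G).

Definition wave (p : 'I_4) (x : R) : 'cV[R]_4 := sin x *: delta_mx p 0.

Lemma derive1n_wave p n : exists a b : R, derive1n n (wave p) = fun x => (a * cos x + b * sin x) *: delta_mx p 0.
Proof.
elim: n => [|n [a [b IH]]]; first by exists 0, 1; apply/funext => x; rewrite mul0r add0r mul1r.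
exists b, (- a); apply/funext => x; rewrite derive1nS IH derive1E.
have ds : is_derive x 1 (fun x : R => a * cos x + b * sin x : R^o) (b * cos x + - a * sin x).
  by apply: is_derive_eq; rewrite /GRing.scale /=; ring.
have dd : differentiable (fun x : R => a * cos x + b * sin x : R^o) x.
  by apply/derivable1_diffP; exact: ex_derive.
rewrite deriveE; last exact: differentiableZl.
rewrite diffZl // -deriveE // (@derive_val _ _ _ _ _ _ _ ds) //.
Qed.

Lemma wave_smooth k p : smooth_field k (wave p).
Proof.
split.
- by move=> x; rewrite /wave mulr2n addrA sinDpi sinDpi opprK.
- move=> n x _; have [a [b ->]] := derive1n_wave p n.
  apply: diff_derivable; apply: differentiableZl.
  apply/derivable1_diffP; exact: ex_derive.
- by rewrite /wave sin0 scale0r.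
Qed.

Lemma tsum_seq (I : choiceType) (s : seq I) (f : I -> R[i]) : uniq s -> (forall i, i \notin s -> f i = 0) ->
  summ f /\ tsum f = \sum_(i <- s) f i.
Proof.
move=> us hs; pose g p i := if i == p then f p else 0.
have hg p : summ (g p) /\ tsum (g p) = f p.
  have [h1 h2] := @tsum_set1 R I (g p) p (fun i ip => ifN_eq _ _ ip).
  by split => //; rewrite h2 /g eqxx.
have e i : f i = \sum_(p <- s) g p i.
  have [si|si] := boolP (i \in s).
    rewrite (bigD1_seq i) //= {1}/g eqxx big1 ?addr0 // => p pi.
    by rewrite /g eq_sym (negPf pi).
  rewrite hs // big_seq big1 // => p ps; rewrite /g; case: eqP => // ip.
  by rewrite ip ps in si.
have sg p := (hg p).1.
split; first by apply: eq_summ (summ_sum s predT sg) => i; rewrite e.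
by rewrite (eq_tsum e) tsum_sum //; apply: eq_bigr => p _; exact: (hg p).2.
Qed.

(** The Fourier coefficients of the sine, not the cardinal sine. *)
Definition sinc (n : int) : R[i] := if n == 1 then - 2^-1 * Ic else if n == -1 then 2^-1 * Ic else 0.

Lemma sinc_supp n : n \notin [:: 1; -1 : int] -> sinc n = 0.
Proof. by rewrite !inE negb_or /sinc => /andP[/negPf -> /negPf ->]. Qed.

Lemma rapid_sinc : rapid sinc.
Proof.
move=> L; exists (2 ^+ L * (normc (sinc 1) + normc (sinc (-1)))).
  by rewrite mulr_ge0 ?exprn_ge0 ?addr_ge0 ?normc_ge0.
move=> n; have [ns|ns] := boolP (n \in [:: 1; -1 : int]); last first.
  rewrite sinc_supp // normc_real normr0 mulr_ge0 ?invr_ge0 ?exprn_ge0 ?jap_ge0 //.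
  by rewrite mulr_ge0 ?exprn_ge0 ?addr_ge0 ?normc_ge0.
have j2 : jap n = 2 :> R by move: ns; rewrite !inE => /orP[] /eqP ->; rewrite /jap.
rewrite j2 mulrAC divff ?mul1r; last by rewrite expf_neq0 // pnatr_eq0.
by move: ns; rewrite !inE => /orP[] /eqP ->; rewrite ?lerDl ?lerDr normc_ge0.
Qed.

Lemma fc_sin n : fc (sin : R -> R) n = sinc n.
Proof.
apply: fc_tser; first exact: rapid_sinc.
move=> x; have [|_ e] := @tsum_seq int [:: 1; -1] (fun i => sinc i * expi (i%:~R * x)) isT.
  by move=> i /sinc_supp ->; rewrite mul0r.
rewrite /tser e.
rewrite !big_cons big_nil addr0 /sinc /=.
rewrite mul1r mulN1r /expi cosN sinN.
by apply: complex_ext; rewrite ?creD ?cimD ?creM ?cimM /=; field.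
Qed.

Lemma fourier_wave p l n : fourier (wave p) n l 0 = if l == p then sinc n else 0.
Proof.
rewrite (congr1 (fun f => f n) (fourierE (wave p) l)).
case: eqP => [->|/eqP lp].
  rewrite -fc_sin; congr fc; apply/funext => x.
  by rewrite /wave !mxE !eqxx mulr1.
rewrite (_ : (fun x => _) = fun=> 0); last by apply/funext => x; rewrite /wave !mxE (negPf lp) mulr0.
apply: (@fc_tser R (fun=> 0)); first exact: rapid0.
move=> x; rewrite /tser (_ : (fun i => _) = fun=> 0) ?tsum0 //.
by apply/funext => i; rewrite mul0r.
Qed.

Lemma adF_wave p i j n : adF br (wave p) i j n = sinc n * (sconst br p j i)%:C.
Proof.
rewrite /adF /adc (bigD1 p) //= fourier_wave eqxx big1 ?addr0 // => l lp.
by rewrite fourier_wave (negPf lp) mul0r.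
Qed.

Lemma wave_alg (a b : R[i]) (p q p' q' : R) :
  a * p%:C * (b * q%:C) - a * p'%:C * (b * q'%:C) = a * b * (p * q - p' * q')%:C.
Proof. by rewrite rmorphB !rmorphM; ring. Qed.

(** The commutator of [ad i1] and [ad i2] sends the unit [i1] to 4 times [i2]; this is the
    corresponding matrix entry. *)
Lemma sconst_wave : \sum_l (sconst br i1 l i2 * sconst br i2 i1 l - sconst br i2 l i2 * sconst br i1 i1 l) = 4 :> R.
Proof. by rewrite sum4 /sconst !quat_bracket !mxE /=; ring. Qed.

Lemma Mcurv_wave th : Mcurv br (wave i1) (wave i2) th i2 i1 = sinc th.1 * sinc th.2 * 4.
Proof.
rewrite mxE.
have e l : adF br (wave i1) i2 l th.1 * adF br (wave i2) l i1 th.2 - adF br (wave i2) i2 l th.1 * adF br (wave i1) l i1 th.2 =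
   sinc th.1 * sinc th.2 * (sconst br i1 l i2 * sconst br i2 i1 l - sconst br i2 l i2 * sconst br i1 i1 l)%:C.
  by rewrite !adF_wave; exact: wave_alg.
rewrite (eq_bigr _ (fun l _ => e l)) -mulr_sumr -rmorph_sum sconst_wave.
by rewrite (rmorph_nat (real_complex R) 4).
Qed.

Lemma sinc1 : sinc 1 = - 2^-1 * Ic. Proof. by []. Qed.

Lemma sincN1 : sinc (-1) = 2^-1 * Ic. Proof. by []. Qed.

Lemma sinc_mul a b : a \in [:: 1; -1 : int] -> b \in [:: 1; -1 : int] -> sinc a * sinc b * 4 = (- (a * b)%:~R)%:C.
Proof.
by rewrite !inE => /orP[] /eqP -> /orP[] /eqP ->; rewrite ?sinc1 ?sincN1; apply: complex_ext; rewrite ?creM ?cimM /=; field.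
Qed.

(** The sum of two odd frequencies is even, so at [x = pi] all exponentials are 1 and only signs
    remain. *)
Lemma expi_sum_pi a b : a \in [:: 1; -1 : int] -> b \in [:: 1; -1 : int] -> expi ((a + b)%:~R * pi : R) = 1.
Proof.
move=> ha hb; have [m ->] : exists m : int, a + b = m + m.
  by move: ha hb; rewrite !inE => /orP[] /eqP -> /orP[] /eqP ->; [exists 1|exists 0|exists 0|exists (-1)].
have e : (m + m)%:~R * pi = m%:~R * (pi *+ 2) + 0 :> R by rewrite intrD addr0 mulr2n; ring.
rewrite e; by rewrite expi_int expi0.
Qed.

Lemma wave_tser (c : int * int -> R) :
  tser (fun th => Mcurv br (wave i1) (wave i2) th i2 i1 * (c th)%:C) (fun th : int * int => th.1 + th.2) pi =
  (- c (1, 1) + c (1, -1) + c (-1, 1) - c (-1, -1))%:C.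
Proof.
pose f th := Mcurv br (wave i1) (wave i2) th i2 i1 * (c th)%:C * expi ((th.1 + th.2)%:~R * pi).
have hf th : f th = if (th.1 \in [:: 1; -1 : int]) && (th.2 \in [:: 1; -1 : int]) then (- (th.1 * th.2)%:~R * c th)%:C else 0.
  rewrite /f Mcurv_wave; case: ifPn => [/andP[h1 h2]|].
    by apply: etrans (congr1 _ (expi_sum_pi h1 h2)) _; rewrite mulr1 (sinc_mul h1 h2) (rmorphM (real_complex R)).
  by rewrite negb_and => /orP[] /sinc_supp ->; rewrite ?mulr0 !mul0r.
have [|_ e] := @tsum_seq (int * int)%type [:: (1, 1); (1, -1); (-1, 1); (-1, -1)] f isT.
  move=> [a b] h; rewrite hf; case: ifP => //= /andP[ha hb]; exfalso; move: h.
  by move: ha hb; rewrite !inE => /orP[] /eqP -> /orP[] /eqP ->.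
apply: etrans e _; rewrite !big_cons big_nil !hf /= addr0 -!(rmorphD (real_complex R)); congr (_%:C).
by ring.
Qed.

Lemma angles_pi k : angles k (pi : R).
Proof.
case: k => //= n; apply/eqP => h; have pi0 : pi != 0 :> R by rewrite gt_eqF ?pi_gt0.
have : (1 : R) = (n * 2)%:~R by apply: (mulIf pi0); rewrite mul1r intrM {1}h -mulrA mulr_natl.
by move/eqP; rewrite -[1]/(1%:~R) eqr_int => /eqP; lia.
Qed.

(** The four pairs of frequencies contribute with equal signs and add up to [4 s^2]. *)
Lemma wave_exactly2 k s : 1 < s -> order_exactly k (loop_curvature G k s (wave i1) (wave i2)) (- 2).
Proof.
move=> s1; apply: (@curvature_exactly2 R 4 br (@lie_bracket_linearl R G) (@lie_bracket_linearr R G) (@lie_bracket_leibniz R G) _ _ k s pi i2 i1) => //.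
- exact: wave_smooth.
- exact: wave_smooth.
- exact: angles_pi.
rewrite wave_tser /=; apply/eqP => /complexI h.
have : 0 < s ^+ 2 by rewrite exprn_gt0 //; lra.
by move: h; rewrite !intrN; lra.
Qed.

(** The weights at the frequencies 1 and -1 cancel, and what remains is the weight at 0 minus the
    weight at 2, which is negative because the weight increases with [|n|]. *)
Lemma wave_exactly2s k s : 2^-1 < s -> s < 1 -> order_exactly k (loop_curvature G k s (wave i1) (wave i2)) (- (2 * s)).
Proof.
move=> s2 s1; apply: (@curvature_exactly2s R 4 br (@lie_bracket_linearl R G) (@lie_bracket_linearr R G) (@lie_bracket_leibniz R G) _ _ k s pi i2 i1) => //.
- exact: wave_smooth.
- exact: wave_smooth.
- exact: angles_pi.
rewrite wave_tser /=; apply/eqP => /complexI.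
have e1 : weight k s (-1) = weight k s 1 by rewrite !weightE intrN sqrrN.
have e2 : weight k s (-1 - 1) = weight k s (1 + 1) by rewrite !weightE -opprD intrN sqrrN.
have l : weight k s 0 < weight k s (1 + 1).
  rewrite !weightE; apply: gt0_ltr_powR; rewrite ?nnegrE ?addr_ge0 ?sqr_ge0 ?ler0n //; first lra.
  by rewrite ltrD2l expr0n exprn_gt0.
rewrite e1 e2 subrr addNr; lra.
Qed.

End Example.

Theorem theorem1 (R : realType) :
  [/\ (* (1) *)
      forall (G : lieGroup R) (ip : 'cV[R]_(lg_dim G) -> 'cV[R]_(lg_dim G) -> R)
        (k : loops) (s : R) (X Y : R -> 'cV[R]_(lg_dim G)),
        connected [set: G] -> inner_product ip -> Ad_invariant ip -> 1 < s ->
        smooth_field k X -> smooth_field k Y ->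
        order_at_most k (loop_curvature G k s X Y) (- 2),
      (* (2) *)
      forall (G : lieGroup R) (ip : 'cV[R]_(lg_dim G) -> 'cV[R]_(lg_dim G) -> R)
        (k : loops) (s : R) (X Y : R -> 'cV[R]_(lg_dim G)),
        connected [set: G] -> inner_product ip -> Ad_invariant ip ->
        2^-1 < s -> s < 1 ->
        smooth_field k X -> smooth_field k Y ->
        order_at_most k (loop_curvature G k s X Y) (- (2 * s)),
      (* (3) *)
      forall k : loops,
        (forall s : R, 1 < s ->
          exists (G : lieGroup R)
            (ip : 'cV[R]_(lg_dim G) -> 'cV[R]_(lg_dim G) -> R)
            (X Y : R -> 'cV[R]_(lg_dim G)),
            [/\ connected [set: G], inner_product ip /\ Ad_invariant ip,
                smooth_field k X, smooth_field k Y &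
                order_exactly k (loop_curvature G k s X Y) (- 2)]) /\
        (forall s : R, 2^-1 < s -> s < 1 ->
          exists (G : lieGroup R)
            (ip : 'cV[R]_(lg_dim G) -> 'cV[R]_(lg_dim G) -> R)
            (X Y : R -> 'cV[R]_(lg_dim G)),
            [/\ connected [set: G], inner_product ip /\ Ad_invariant ip,
                smooth_field k X, smooth_field k Y &
                order_exactly k (loop_curvature G k s X Y) (- (2 * s))]),
      (* (4) *)
      forall (G : lieGroup R) (ip : 'cV[R]_(lg_dim G) -> 'cV[R]_(lg_dim G) -> R)
        (X Y : R -> 'cV[R]_(lg_dim G)),
        connected [set: G] -> inner_product ip -> Ad_invariant ip ->
        smooth_field Based X -> smooth_field Based Y ->
        order_minus_infinity Based (loop_curvature G Based 1 X Y) &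
      (* (5) *)
      forall (G : lieGroup R) (ip : 'cV[R]_(lg_dim G) -> 'cV[R]_(lg_dim G) -> R)
        (k : loops) (s : R) (X Y : R -> 'cV[R]_(lg_dim G)),
        connected [set: G] -> inner_product ip -> Ad_invariant ip -> 1 < s ->
        smooth_field k X -> smooth_field k Y ->
        trace_class k ip s (loop_curvature G k s X Y)].
Proof.
split.
- move=> G ip k s X Y _ _ _ s1 fX fY.
  have h := curvature_order2 (@lie_bracket_linearl R G) (@lie_bracket_linearr R G) (@lie_bracket_leibniz R G) s1 fX fY; exact: h.
- move=> G ip k s X Y _ _ _ s2 s1 fX fY.
  have h := curvature_order2s (@lie_bracket_linearl R G) (@lie_bracket_linearr R G) (@lie_bracket_leibniz R G) s2 s1 fX fY; exact: h.
- move=> k; split=> [s s1|s s2 s1]; exists (@quaternions R), (@qip R), (wave i1), (wave i2);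
    (split; [exact: quaternions_connected|exact: (conj quat_inner_product quat_Ad_invariant)|
             exact: wave_smooth|exact: wave_smooth|]).
  + exact: wave_exactly2.
  + exact: wave_exactly2s.
- move=> G ip X Y _ _ _ fX fY.
  have h := curvature_smoothing (@lie_bracket_linearl R G) (@lie_bracket_linearr R G) (@lie_bracket_leibniz R G) fX fY; exact: h.
- move=> G ip k s X Y _ [ipC ipL ipP] _ s1 fX fY.
  have h := curvature_trace_class (@lie_bracket_linearl R G) (@lie_bracket_linearr R G) (@lie_bracket_leibniz R G) ipC ipL ipP s1 fX fY; exact: h.
Qed.
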